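(* Let $m>2$ be an integer, $n\ge 2$, let $\Omega\subset\mathbb{R}^n$ be a bounded domain with Lipschitz boundary, let $1<p<n$, $p^*=\frac{np}{n-p}$, and let $\nu,q,\kappa_1,\dots,\kappa_m$ be real numbers with $0<\nu<1<p<q<\kappa_i+1<p^*$ ($i=1,\dots,m$) and $\sum_{i=1}^m\kappa_i+m<p^*$. Let $\eta:\overline{\Omega}\to[0,\infty)$ with $\eta\in L^\infty(\Omega)$, and let $a_1,\dots,a_m\in L^\infty(\Omega)$ with $a_i(z)>0$ for a.e. $z\in\Omega$. Then there exists a constant $\lambda^{**}>0$ such that for all $\lambda\in(0,\lambda^{**})$ the system $$\begin{cases}-\Delta_p y_i-\mathrm{div}(\eta|\nabla y_i|^{q-2}\nabla y_i)=a_i(z)|y_i|^{-1-\nu}y_i+\lambda(\kappa_i+1)|y_i|^{\kappa_i-1}y_i\prod_{j\ne i}|y_j|^{\kappa_j+1}, & z\in\Omega,\ i=1,\dots,m,\\ y_1=y_2=\cdots=y_m=0, & z\in\partial\Omega,\end{cases}$$ has at least two positive weak solutions $(y_1^*,\dots,y_m^* ),(y_{1*},\dots,y_{m*})\in Y=[W_0^{1,\mathcal H}(\Omega)]^m$ such that $$J(y_1^*,\dots,y_m^* )<0<J(y_{1*},\dots,y_{m*}).$$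
   Context: $|\cdot|$ is the Euclidean norm on $\mathbb{R}^n$ and $\Delta_p y=\mathrm{div}(|\nabla y|^{p-2}\nabla y)$. Put $\mathcal H(z,t)=t^p+\eta(z)t^q$ and $\rho_{\mathcal H}(u)=\int_\Omega(|u|^p+\eta|u|^q)\,dz$. $L^{\mathcal H}(\Omega)$ is the Musielak-Orlicz space of measurable $u$ with $\rho_{\mathcal H}(u)<\infty$, with Luxemburg norm $\|u\|_{\mathcal H}=\inf\{\tau>0:\rho_{\mathcal H}(u/\tau)\le1\}$. $W^{1,\mathcal H}(\Omega)=\{y\in L^{\mathcal H}(\Omega):|\nabla y|\in L^{\mathcal H}(\Omega)\}$ has norm $\|\nabla y\|_{\mathcal H}+\|y\|_{\mathcal H}$ (where $\|\nabla y\|_{\mathcal H}=\||\nabla y|\|_{\mathcal H}$), and $W_0^{1,\mathcal H}(\Omega)$ is the completion of $C_0^\infty(\Omega)$ in it. The energy functional $J:Y\to\mathbb{R}$ is $$J(y_1,\dots,y_m)=\sum_{i=1}^m\int_\Omega\Big(\tfrac1p|\nabla y_i|^p+\tfrac{\eta}{q}|\nabla y_i|^q\Big)dz-\tfrac{1}{1-\nu}\sum_{i=1}^m\int_\Omega a_i|y_i|^{1-\nu}dz-\lambda\int_\Omega\prod_{i=1}^m|y_i|^{\kappa_i+1}dz.$$ A positive weak solution is $(y_1,\dots,y_m)\in Y$ with every $y_i>0$ a.e. in $\Omega$ such that for every $(h_1,\dots,h_m)\in Y$ one has $a_iy_i^{-\nu}h_i\in L^1(\Omega)$ for all $i$ and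 $$\sum_{i=1}^m\Big[\int_\Omega(|\nabla y_i|^{p-2}+\eta|\nabla y_i|^{q-2})\nabla y_i\cdot\nabla h_i\,dz-\int_\Omega a_iy_i^{-\nu}h_i\,dz-\lambda(\kappa_i+1)\int_\Omega|y_i|^{\kappa_i}\prod_{j\ne i}|y_j|^{\kappa_j+1}h_i\,dz\Big]=0.$$ *)

(* Defs.v *)
From HB Require Import structures.
From mathcomp Require Import all_boot all_order all_algebra.
From mathcomp Require Import all_classical all_reals all_analysis.

Set Implicit Arguments.
Unset Strict Implicit.
Unset Printing Implicit Defensive.
Import Order.TTheory GRing.Theory Num.Theory.
Import numFieldNormedType.Exports.
Local Open Scope classical_set_scope.
Local Open Scope ring_scope.

(** * Lebesgue measure on R^n

   ['rV[R]_n] carries the product sigma-algebra; [borel_lebesgue n] is the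
   n-fold product of the one-dimensional Lebesgue measure, and [lebesgue_rV n]
   is its completion, so that "measurable" means Lebesgue measurable. *)

Definition measure_rV_display : measure_display.
Proof. exact: default_measure_display. Qed.

Section measurable_rV.
Context {R : realType} (n : nat).

Let coord (i : 'I_n) (x : 'rV[R]_n) : measurableTypeR R := x ord0 i.

Let rV_set0 : g_sigma_preimage coord set0.
Proof. exact: sigma_algebra0. Qed.

Let rV_setC A : g_sigma_preimage coord A -> g_sigma_preimage coord (~` A).
Proof. exact: sigma_algebraC. Qed.

Let rV_bigcup (F : (set 'rV[R]_n)^nat) :
  (forall i, g_sigma_preimage coord (F i)) ->
  g_sigma_preimage coord (\bigcup_i (F i)).
Proof. exact: sigma_algebra_bigcup. Qed.

HB.instance Definition _ := @isMeasurable.Build measure_rV_display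
  'rV[R]_n (g_sigma_preimage coord) rV_set0 rV_setC rV_bigcup.

Lemma measurable_coord (i : 'I_n) :
  measurable_fun [set: 'rV[R]_n] (fun x => x ord0 i : measurableTypeR R).
Proof.
move=> _ Y mY; rewrite setTI; apply: sub_sigma_algebra => /=.
rewrite -bigcup_seq/=; exists i => /=; first by rewrite mem_index_enum.
by exists Y => //; rewrite setTI.
Qed.

Lemma measurable_fun_coordP d (T : measurableType d) (f : T -> 'rV[R]_n) :
  (forall i, measurable_fun [set: T]
     (fun x => f x ord0 i : measurableTypeR R)) ->
  measurable_fun [set: T] f.
Proof.
move=> mf _ A mA; rewrite setTI.
have sA : sigma_algebra setT (fun B : set 'rV[R]_n => measurable (f @^-1` B)).
  split; first by rewrite preimage_set0.
    by move=> B mB; rewrite setTD preimage_setC; exact: measurableC.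
  by move=> F mF; rewrite preimage_bigcup; exact: bigcup_measurable.
apply: (smallest_sub sA _ mA) => B /=.
rewrite -bigcup_seq/= => -[i _ [C mC <-]].
by rewrite setTI -comp_preimage -[X in measurable X]setTI; exact: mf.
Qed.

End measurable_rV.

Section lebesgue_rV.
Context {R : realType}.

Definition rV_cons n (x : measurableTypeR R * 'rV[R]_n) : 'rV[R]_n.+1 :=
  \row_(i < n.+1) (if unlift ord0 i is Some j then x.2 ord0 j else x.1).

Definition rV_uncons n (x : 'rV[R]_n.+1) : measurableTypeR R * 'rV[R]_n :=
  (x ord0 ord0, \row_(j < n) x ord0 (lift ord0 j)).

Lemma rV_consK n : cancel (@rV_cons n) (@rV_uncons n).
Proof.
move=> [t x]; rewrite /rV_uncons /rV_cons mxE unlift_none; congr pair.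
by apply/rowP => j; rewrite !mxE liftK.
Qed.

Lemma measurable_rV_cons n : measurable_fun [set: _] (@rV_cons n).
Proof.
apply: measurable_fun_coordP => i.
have [j|] := unliftP ord0 i => ->.
- under eq_fun do rewrite mxE liftK.
  exact: (measurableT_comp (@measurable_coord R n j) measurable_snd).
- under eq_fun do rewrite mxE unlift_none.
  exact: measurable_fst.
Qed.

Lemma measurable_rV_uncons n : measurable_fun [set: _] (@rV_uncons n).
Proof.
apply: measurable_fun_pair => /=; first exact: measurable_coord.
apply: measurable_fun_coordP => i.
under eq_fun do rewrite mxE.
exact: measurable_coord.
Qed.

HB.instance Definition _ n :=
  isMeasurableFun.Build _ _ _ _ (@rV_cons n) (@measurable_rV_cons n).

Section lebesgue_step.
Variables (n : nat) (mu : {sigma_finite_measure set 'rV[R]_n -> \bar R}).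

Definition lebesgue_step : set 'rV[R]_n.+1 -> \bar R :=
  pushforward (@lebesgue_measure R \x mu)%E (@rV_cons n).

Let lebesgue_step0 : lebesgue_step set0 = 0%E.
Proof. exact: measure0. Qed.

Let lebesgue_step_ge0 A : (0 <= lebesgue_step A)%E.
Proof. exact: measure_ge0. Qed.

Let lebesgue_step_sigma_additive : semi_sigma_additive lebesgue_step.
Proof. exact: measure_semi_sigma_additive. Qed.

HB.instance Definition _ := isMeasure.Build _ _ _ lebesgue_step
  lebesgue_step0 lebesgue_step_ge0 lebesgue_step_sigma_additive.

Let lebesgue_step_sigma_finite : sigma_finite setT lebesgue_step.
Proof.
have /sigma_finiteP[F [TF ndF Foo]] := sigma_finiteT (@lebesgue_measure R).
have /sigma_finiteP[G [TG ndG Goo]] := sigma_finiteT mu.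
exists (fun k => @rV_uncons n @^-1` (F k `*` G k)).
  apply/esym; rewrite -subTset => x _.
  have [i _ Fi] : (\bigcup_i F i) (rV_uncons x).1 by rewrite -TF.
  have [j _ Gj] : (\bigcup_i G i) (rV_uncons x).2 by rewrite -TG.
  exists (maxn i j) => //; split.
    by move: Fi; exact/subsetPset/ndF/leq_maxl.
  by move: Gj; exact/subsetPset/ndG/leq_maxr.
move=> k; have [mF Fkoo] := Foo k; have [mG Gkoo] := Goo k; split.
  rewrite -[X in measurable X]setTI; apply: measurable_rV_uncons => //.
  exact: measurableX.
rewrite /lebesgue_step /pushforward -comp_preimage.
rewrite (_ : _ \o _ = id); last by apply/funext => x /=; rewrite rV_consK.
rewrite preimage_id product_measure1E// lte_mul_pinfty//.
by rewrite ge0_fin_numE.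
Qed.

HB.instance Definition _ := Measure_isSigmaFinite.Build _ _ _ lebesgue_step
  lebesgue_step_sigma_finite.

End lebesgue_step.

Fixpoint borel_lebesgue n : {sigma_finite_measure set 'rV[R]_n -> \bar R} :=
  if n is k.+1 then lebesgue_step (borel_lebesgue k) else dirac (0 : 'rV[R]_0).

Definition lebesgue_rV n :=
  @completed_measure_extension _ _ _ (borel_lebesgue n).

HB.instance Definition _ n := Measure.on (@lebesgue_rV n).

End lebesgue_rV.
Arguments lebesgue_rV {R} n.

Section euclidean.
Context {R : realType} {n : nat}.
Implicit Types u v : 'rV[R]_n.

Definition dotv u v : R := \sum_(i < n) u ord0 i * v ord0 i.

(* The library norm on ['rV[R]_n] is the sup norm. *)
Definition enorm u : R := Num.sqrt (dotv u u).

Definition ebase (i : 'I_n) : 'rV[R]_n := delta_mx ord0 i.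

End euclidean.

Section domains.
Context {R : realType} {n : nat}.
Implicit Types Omega : set 'rV[R]_n.

Definition bounded_domain Omega : Prop :=
  [/\ Omega !=set0, open Omega, connected Omega &
      exists M : R, forall x, Omega x -> enorm x <= M].

Definition boundary Omega : set 'rV[R]_n := closure Omega `\` interior Omega.

(* Near every boundary point, after an orthogonal change of coordinates [Q],
   Omega is the part lying above the graph of a Lipschitz function [gamma] of
   the coordinates other than the [j]-th ([col' j] deletes coordinate [j]). *)
Definition lipschitz_boundary Omega : Prop :=
  forall x0, boundary Omega x0 ->
  exists (Q : 'M[R]_n) (j : 'I_n) (gamma : 'rV[R]_n.-1 -> R) (L r : R),
    [/\ Q *m Q^T = 1%:M, 0 < r,
        forall u v, `|gamma u - gamma v| <= L * enorm (u - v) &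
        forall x, enorm (x - x0) < r ->
          (Omega x <-> gamma (col' j (x *m Q)) < (x *m Q) ord0 j)].

Fixpoint Ck (k : nat) (f : 'rV[R]_n -> R) : Prop :=
  continuous f /\
  if k is k'.+1 then
    forall i : 'I_n, (forall x, derivable f x (ebase i)) /\
                     Ck k' (fun x => 'D_(ebase i) f x)
  else True.

Definition test_function Omega : set ('rV[R]_n -> R) :=
  [set phi | [/\ forall k, Ck k phi,
                 compact (closure [set x | phi x != 0]) &
                 closure [set x | phi x != 0] `<=` Omega]].

End domains.

Section lebesgue_spaces.
Context {R : realType} {n : nat}.
Implicit Types (Omega : set 'rV[R]_n) (f y : 'rV[R]_n -> R).

Local Notation mu := (@lebesgue_rV R n).

(* [measurable_fun Omega f] without the type annotation would mean Borel
   measurable. *)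
Definition lebesgue_measurable Omega f : Prop :=
  let T := caratheodory_type ((@borel_lebesgue R n)^*)%mu in
  measurable_fun (Omega : set T) (f : T -> R).

Definition Linfty Omega f : Prop :=
  lebesgue_measurable Omega f /\
  exists M : R, {ae mu, forall z, Omega z -> `|f z| <= M}.

Definition L1loc Omega f : Prop :=
  lebesgue_measurable Omega f /\
  forall K, K `<=` Omega -> compact K -> mu.-integrable K (EFin \o f).

Definition is_weak_gradient Omega y (g : 'rV[R]_n -> 'rV[R]_n) : Prop :=
  [/\ L1loc Omega y,
      forall i : 'I_n, L1loc Omega (fun z => g z ord0 i) &
      forall phi, test_function Omega phi -> forall i : 'I_n,
        \int[mu]_(z in Omega) (y z * 'D_(ebase i) phi z) =
        - \int[mu]_(z in Omega) (g z ord0 i * phi z)].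

(* The weak gradient is only determined a.e. in Omega; [weak_gradient] selects
   one representative (and is [0] if there is none). *)
Definition weak_gradient Omega y : 'rV[R]_n -> 'rV[R]_n :=
  xget (fun=> 0) [set g | is_weak_gradient Omega y g].

End lebesgue_spaces.

(** Elements of the function spaces are total functions on ['rV[R]_n], of which
    only the values a.e. in Omega matter. *)
Section musielak_orlicz.
Context {R : realType} {n : nat}.
Variables (Omega : set 'rV[R]_n) (eta : 'rV[R]_n -> R) (p q : R).
Implicit Types u : 'rV[R]_n -> R.

Local Notation mu := (@lebesgue_rV R n).

Definition rhoH u : \bar R :=
  (\int[mu]_(z in Omega) (`|u z| `^ p + eta z * `|u z| `^ q)%:E)%E.

Definition LH : set ('rV[R]_n -> R) :=
  [set u | lebesgue_measurable Omega u /\ (rhoH u < +oo)%E].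

Definition normH u : \bar R :=
  ereal_inf [set tau%:E | tau in
    [set tau : R | 0 < tau /\ (rhoH (fun z => u z / tau)%R <= 1)%E]].

Definition norm_grad (y : 'rV[R]_n -> R) : 'rV[R]_n -> R :=
  fun z => enorm (weak_gradient Omega y z).

Definition W1H : set ('rV[R]_n -> R) :=
  [set y | [/\ LH y, exists g, is_weak_gradient Omega y g & LH (norm_grad y)]].

Definition norm1H (y : 'rV[R]_n -> R) : \bar R := (normH (norm_grad y) + normH y)%E.

(* The completion of the test functions, realized as their closure in [W1H]. *)
Definition W01H : set ('rV[R]_n -> R) :=
  [set y | W1H y /\ exists phi : nat -> 'rV[R]_n -> R,
    (forall k, test_function Omega (phi k)) /\
    norm1H (y \- phi k) @[k --> \oo] --> 0%E].

Section system.
Context {m : nat}.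
Variables (nu lambda : R) (kappa : 'I_m -> R) (a : 'I_m -> 'rV[R]_n -> R).
Implicit Types y h : 'I_m -> 'rV[R]_n -> R.

Definition Y : set ('I_m -> 'rV[R]_n -> R) := [set y | forall i, W01H (y i)].

Definition J y : R :=
  \sum_(i < m) \int[mu]_(z in Omega)
     (p^-1 * norm_grad (y i) z `^ p + eta z / q * norm_grad (y i) z `^ q)
  - (1 - nu)^-1 *
    \sum_(i < m) \int[mu]_(z in Omega) (a i z * `|y i z| `^ (1 - nu))
  - lambda *
    \int[mu]_(z in Omega) \prod_(i < m) `|y i z| `^ (kappa i + 1).

(* Weak form of the system
     - div(|grad y_i|^(p-2) grad y_i) - div(eta |grad y_i|^(q-2) grad y_i)
       = a_i |y_i|^(-1-nu) y_i
         + lambda (kappa_i + 1) |y_i|^(kappa_i - 1) y_i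
             prod_(j != i) |y_j|^(kappa_j + 1)   in Omega,
     y_i = 0                                     on the boundary,
   for positive y; the boundary condition is encoded in [Y]. *)
Definition positive_weak_solution y : Prop :=
  [/\ Y y,
      forall i, {ae mu, forall z, Omega z -> 0 < y i z} &
      forall h, Y h ->
        (forall i, mu.-integrable Omega
           (EFin \o (fun z => a i z * y i z `^ (- nu) * h i z))) /\
        \sum_(i < m)
          (\int[mu]_(z in Omega)
             ((norm_grad (y i) z `^ (p - 2) +
               eta z * norm_grad (y i) z `^ (q - 2)) *
              dotv (weak_gradient Omega (y i) z) (weak_gradient Omega (h i) z))
           - \int[mu]_(z in Omega) (a i z * y i z `^ (- nu) * h i z)
           - lambda * (kappa i + 1) *
             \int[mu]_(z in Omega)
               (`|y i z| `^ kappa i *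
                (\prod_(j < m | j != i) `|y j z| `^ (kappa j + 1)) * h i z))
        = 0].

End system.
End musielak_orlicz.

(* Main.v *)
(* Write d = sum_i (kappa_i + 1), so that q < d < p^*.  Along a ray t |-> t y the energy is
   t^p A/p + t^q B/q - t^(1-nu) S/(1-nu) - lambda t^d C, where A, B are the gradient terms, S the
   singular and C the coupling term.  By Sobolev's inequality there is a radius rho such that, for
   small lambda, J >= 1 on the sphere A = rho.  The first solution minimizes J on the ball A <= rho,
   where J takes negative values; it is therefore interior.  The second one minimizes max_t J(t y)
   over all y with C(y) > 0; this maximum is at least 1, and it is attained at only one t, since
   t^(1-d) d/dt J(t y) is strictly concave as a function of t^(p-d).  The minima exist because
   W_0^(1,H) embeds compactly in L^d (telescoping dyadic averages and the Poincare inequality on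
   cubes) and because the modulars are weakly lower semicontinuous (uniform convexity), and they may
   be taken nonnegative by passing to |y|.

   J is not differentiable, but both minimizers satisfy J(t_e (y + e h)) >= J(t_e y) for rescalings
   t_e -> 1.  For h >= 0, Fatou's lemma then gives y > 0 a.e. and the integrability of a y^(-nu) h;
   after that, dominated convergence gives the weak equation in every direction h. *)

Require Import Defs.
From mathcomp Require Import all_boot all_order all_algebra.
From mathcomp Require Import all_classical all_reals all_analysis measurable_realfun.
From mathcomp Require Import ring lra.

Set Implicit Arguments.
Unset Strict Implicit.
Unset Printing Implicit Defensive.
Import Order.TTheory GRing.Theory Num.Theory.
Import numFieldNormedType.Exports.
Local Open Scope classical_set_scope.
Local Open Scope ring_scope.

(** * Real-valued integrals *)

(** The second minimizer lives on the set of ray maximizers, and without differentiability no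
    multiplier rule is at hand there. Uniqueness of the maximal t replaces it: it forces the
    rescalings t_e to tend to 1, so that both minimizers satisfy the same one-sided condition
    [path_minimal]. The weight may vanish, so only A controls the other terms; hence the sphere is
    taken in A alone, and B is bounded afterwards from the energy. The variational part never sees
    W_0^(1,H). It works with a relation [X u g] between a function and its gradient, whose
    properties are listed in the record [energy_space]. The relation is instantiated by
    [approximable], the limits of test functions in L^d and in the modular; the Sobolev inequality
    identifies them with the closure in the Luxemburg norm. Weak compactness is obtained without
    dual spaces: almost minimizers of a uniformly convex functional on midpoint-stable sets of test
    functions converge strongly. *)

Section real_integrals.
Context d (T : measurableType d) (R : realType).
Variables (mu : {measure set T -> \bar R}) (D : set T).
Hypothesis mD : measurable D.
Implicit Types f g : T -> R.

Lemma integrable_fun_measurable f :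
  mu.-integrable D (EFin \o f) -> measurable_fun D f.
Proof. by move=> /integrableP[/measurable_EFinP]. Qed.

Lemma integrable_dominated f g : measurable_fun D f ->
  mu.-integrable D (EFin \o g) -> (forall x, D x -> `|f x| <= g x) ->
  mu.-integrable D (EFin \o f).
Proof.
move=> mf ig fg; apply: (le_integrable mD _ _ ig); first exact/measurable_EFinP.
by move=> x Dx; rewrite /= lee_fin (le_trans (fg _ Dx))// ler_norm.
Qed.

Lemma integrable_dominated_ae f g : measurable_fun D f ->
  mu.-integrable D (EFin \o g) -> {ae mu, forall x, D x -> `|f x| <= g x} ->
  mu.-integrable D (EFin \o f).
Proof.
move=> mf ig fg; apply/integrableP; split; first exact/measurable_EFinP.
have mg := integrable_fun_measurable ig.
case/integrableP: ig => _; apply: le_lt_trans.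
apply: ae_ge0_le_integral => //.
- by apply: measurableT_comp => //; exact/measurable_EFinP.
- by apply: measurableT_comp => //; exact/measurable_EFinP.
- apply: filterS fg => x h Dx /=; rewrite lee_fin (le_trans (h Dx))//.
  exact: ler_norm.
Qed.

Lemma integrable_ge0P f : measurable_fun D f -> (forall x, D x -> 0 <= f x) ->
  (\int[mu]_(x in D) (f x)%:E < +oo)%E -> mu.-integrable D (EFin \o f).
Proof.
move=> mf f0 h; apply/integrableP; split; first exact/measurable_EFinP.
rewrite (_ : integral _ _ _ = \int[mu]_(x in D) (f x)%:E)%E//.
by apply: eq_integral => x /set_mem Dx /=; rewrite ger0_norm ?f0.
Qed.

Lemma EFin_Rintegral f : mu.-integrable D (EFin \o f) ->
  (\int[mu]_(x in D) f x)%:E = (\int[mu]_(x in D) (f x)%:E)%E.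
Proof. by move=> fi; rewrite /Rintegral fineK//; exact: integrable_fin_num. Qed.

Lemma integrable_cst_mul (k : R) f : mu.-integrable D (EFin \o f) ->
  mu.-integrable D (EFin \o (fun x => k * f x)).
Proof. by move=> h; have := integrableZl mD k h. Qed.

Lemma integrable_add f g : mu.-integrable D (EFin \o f) ->
  mu.-integrable D (EFin \o g) -> mu.-integrable D (EFin \o (fun x => f x + g x)).
Proof. by move=> hf hg; have := integrableD mD hf hg. Qed.

Lemma integrable_sub f g : mu.-integrable D (EFin \o f) ->
  mu.-integrable D (EFin \o g) -> mu.-integrable D (EFin \o (fun x => f x - g x)).
Proof. by move=> hf hg; have := integrableB mD hf hg. Qed.

Lemma integrable_sum_fun (I : Type) (s : seq I) (F : I -> T -> R) :
  (forall i, mu.-integrable D (EFin \o F i)) ->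
  mu.-integrable D (EFin \o (fun x => \sum_(i <- s) F i x)).
Proof.
move=> h; elim: s => [|i s ih].
  rewrite (_ : _ \o _ = cst 0%E); first exact: integrable0.
  by apply/funext => x /=; rewrite big_nil.
rewrite (_ : _ \o _ = EFin \o (fun x => F i x + \sum_(i <- s) F i x)).
  exact: integrable_add.
by apply/funext => x /=; rewrite big_cons.
Qed.

Lemma Rintegral_sum (I : Type) (s : seq I) (F : I -> T -> R) :
  (forall i, mu.-integrable D (EFin \o F i)) ->
  \int[mu]_(x in D) (\sum_(i <- s) F i x) = \sum_(i <- s) \int[mu]_(x in D) F i x.
Proof.
move=> h; elim: s => [|i s ih].
  rewrite big_nil (_ : (fun x => \sum_(i <- [::]) F i x) = cst 0).
    by rewrite Rintegral_cst// mul0r.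
  by apply/funext => x /=; rewrite big_nil.
rewrite big_cons -ih -RintegralD//; last exact: integrable_sum_fun.
by apply: eq_Rintegral => x _; rewrite big_cons.
Qed.

Lemma le_Rintegral_ae f g : mu.-integrable D (EFin \o f) ->
  mu.-integrable D (EFin \o g) -> {ae mu, forall x, D x -> f x <= g x} ->
  \int[mu]_(x in D) f x <= \int[mu]_(x in D) g x.
Proof.
move=> fi gi fg.
rewrite -subr_ge0 -RintegralB//.
have gfi := integrable_sub gi fi.
have mgf := integrable_fun_measurable gfi.
(* [g - f] has a sign only almost everywhere; [h] agrees with it a.e. and is nonnegative
   everywhere. *)
pose h x := `|g x - f x|.
suff -> : \int[mu]_(x in D) (g x - f x) = \int[mu]_(x in D) h x.
  by apply: Rintegral_ge0 => x _; rewrite normr_ge0.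
congr fine; apply: ae_eq_integral => //; first exact/measurable_EFinP.
  by apply/measurable_EFinP; exact: measurableT_comp.
apply: filterS fg => x hx Dx; rewrite /h ger0_norm// subr_ge0.
exact: hx.
Qed.

Lemma eq_Rintegral_ae f g : measurable_fun D f -> measurable_fun D g ->
  {ae mu, forall x, D x -> f x = g x} ->
  \int[mu]_(x in D) f x = \int[mu]_(x in D) g x.
Proof.
move=> mf mg fg; congr fine; apply: ae_eq_integral => //;
  [exact/measurable_EFinP|exact/measurable_EFinP|].
by apply: filterS fg => x h Dx; rewrite h.
Qed.

Lemma eq_integrable_ae f g : measurable_fun D g ->
  {ae mu, forall x, D x -> f x = g x} ->
  mu.-integrable D (EFin \o f) -> mu.-integrable D (EFin \o g).
Proof.
move=> mg fg fi; apply: (@integrable_dominated_ae _ (Num.norm \o f)) => //.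
  exact: integrable_norm.
by apply: filterS fg => x h Dx; rewrite /= h.
Qed.

Lemma dominated_Rintegral (F : nat -> T -> R) f g :
  (forall k, measurable_fun D (F k)) -> measurable_fun D f ->
  {ae mu, forall x, D x -> F k x @[k --> \oo] --> f x} ->
  mu.-integrable D (EFin \o g) ->
  {ae mu, forall x, D x -> forall k, `|F k x| <= g x} ->
  [/\ forall k, mu.-integrable D (EFin \o F k), mu.-integrable D (EFin \o f) &
      \int[mu]_(x in D) F k x @[k --> \oo] --> \int[mu]_(x in D) f x].
Proof.
move=> mF mf Ff gi Fg.
have Fi k : mu.-integrable D (EFin \o F k).
  apply: (integrable_dominated_ae _ gi) => //.
  by apply: filterS Fg => x h Dx; exact: h.
have [] := @dominated_convergence _ _ _ mu D mD (fun k => EFin \o F k)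
  (EFin \o f) (EFin \o g).
- by move=> k; exact/measurable_EFinP.
- exact/measurable_EFinP.
- by apply: filterS Ff => x h Dx; apply: cvg_EFin; [exact: nearW|exact: h].
- exact: gi.
- by apply: filterS Fg => x h k Dx; rewrite /= lee_fin; exact: h.
move=> fi _ h; split => //.
by apply: fine_cvg; rewrite EFin_Rintegral.
Qed.

Lemma fatou_Rintegral (F : nat -> T -> R) f (C : R) :
  (forall k, mu.-integrable D (EFin \o F k)) -> measurable_fun D f ->
  (forall k x, D x -> 0 <= F k x) -> (forall x, D x -> 0 <= f x) ->
  {ae mu, forall x, D x -> F k x @[k --> \oo] --> f x} ->
  (forall k, \int[mu]_(x in D) F k x <= C) ->
  mu.-integrable D (EFin \o f) /\ \int[mu]_(x in D) f x <= C.
Proof.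
move=> Fi mf F0 f0 Ff FC.
have mF k := integrable_fun_measurable (Fi k).
have h : (\int[mu]_(x in D) (f x)%:E <= C%:E)%E.
  have := @fatou _ _ _ mu D mD (fun k => EFin \o F k).
  move=> /(_ (fun k => iffRL (measurable_EFinP _ _) (mF k))).
  move=> /(_ (fun k x Dx => F0 k x Dx)) fat.
  (* The pointwise lower limit equals [f] only a.e., so the two integrals are identified through an
     a.e. equality; measurability of the lower limit is derived from that of upper limits by a
     change of sign. *)
  have <- : (\int[mu]_(x in D) limn_einf (fun k => (F k x)%:E) =
    \int[mu]_(x in D) (f x)%:E)%E.
    have ml : measurable_fun D (fun x => limn_einf (fun k => (F k x)%:E)).
      rewrite (_ : (fun _ => _) =
        (fun x => - limn_esup (fun k => (- (F k x)%:E)%E))%E).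
        apply: measurableT_comp => //; apply: measurable_fun_limn_esup => k.
        by apply: measurableT_comp => //; exact/measurable_EFinP.
      apply/funext => x; rewrite -limn_einfN; congr limn_einf.
      by apply/funext => k; rewrite /comp oppeK.
    apply: ae_eq_integral => //; first exact/measurable_EFinP.
    apply: filterS Ff => x h Dx.
    by apply cvg_limn_einf_sup; apply: cvg_EFin; [exact: nearW|exact: h].
  apply: (le_trans fat).
  apply: (le_trans (limn_einf_sup _)).
  rewrite limn_esup_lim; apply: lime_le; first exact: is_cvg_esups.
  apply: nearW => n; apply: ge_ereal_sup => _ [k _ <-].
  by rewrite -EFin_Rintegral// lee_fin.
have fi : mu.-integrable D (EFin \o f).
  by apply: integrable_ge0P => //; rewrite (le_lt_trans h)// ltry.
by split => //; rewrite -lee_fin EFin_Rintegral.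
Qed.

End real_integrals.

(** * Almost everywhere limits of fast Cauchy sequences *)

Section fast_cauchy.
Context (R : realType).

(** The increments are dominated by a geometric series of sum [2 * K], and [u k - u 0] is the
    telescoping sum of the increments. *)
Lemma geometric_cauchy (u : nat -> R) (K : R) : 0 <= K ->
  (forall k, `|u k.+1 - u k| <= K * 2^-1 ^+ k) ->
  cvgn u /\ forall k, `|u k| <= `|u 0%N| + 2 * K.
Proof.
move=> K0 h.
have h2 : `|2^-1 : R| < 1 by rewrite ger0_norm ?invr_ge0// invf_lt1 ?ltr1n.
have sumle n : \sum_(0 <= i < n) 2^-1 ^+ i <= 2 :> R.
  have -> : \sum_(0 <= i < n) 2^-1 ^+ i = 2 - 2 * 2^-1 ^+ n :> R.
    elim: n => [|n ih]; first by rewrite big_geq// expr0; lra.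
    by rewrite big_nat_recr//= ih exprS; field.
  by have : 0 <= 2^-1 ^+ n :> R by []; lra.
split.
  have : cvgn (series (telescope u)).
    apply: normed_cvg; apply: (series_le_cvg _ _ _ (is_cvg_geometric_series (a := K) h2)).
    - by move=> n; exact: normr_ge0.
    - by move=> n; rewrite /= mulr_ge0.
    - by move=> n; rewrite /telescope /=; exact: h.
  move=> /cvg_ex[l hl]; apply/cvg_ex; exists (u 0%N + l).
  pose v n := u 0%N + series (telescope u) n.
  have uv : u = v by apply/funext => n; exact: eq_sum_telescope.
  by rewrite {1}uv; apply: cvgD hl; exact: cvg_cst.
move=> k; rewrite (eq_sum_telescope u k) (le_trans (ler_normD _ _))// lerD2l.
rewrite (le_trans (ler_norm_sum _ _ _))//.
rewrite (@le_trans _ _ (\sum_(0 <= i < k) K * 2^-1 ^+ i))//.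
  by apply: ler_sum => i _; exact: h.
by rewrite -mulr_sumr mulrC ler_wpM2r.
Qed.

(** Valid for every exponent [r >= 0], since [a + b] is at most twice the larger of the two
    numbers. *)
Lemma powR_addr_le (a b r : R) : 0 <= a -> 0 <= b -> 0 <= r ->
  (a + b) `^ r <= 2 `^ r * (a `^ r + b `^ r).
Proof.
move=> a0 b0 r0.
wlog ab : a b a0 b0 / a <= b.
  by move=> h; have [/h|/ltW/h] := leP a b; [exact|rewrite addrC (addrC (b `^ r)); exact].
apply: (@le_trans _ _ ((2 * b) `^ r)).
  by apply: ge0_ler_powR; rewrite ?nnegrE//; [exact: addr_ge0|exact: mulr_ge0|lra].
by rewrite powRM// ler_wpM2l ?powR_ge0// lerDr powR_ge0.
Qed.

Context d (T : measurableType d).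
Variables (mu : {measure set T -> \bar R}) (D : set T).
Hypothesis mD : measurable D.

Lemma powR_integrable_add (f g : T -> R) (r : R) : 0 <= r ->
  measurable_fun D f -> measurable_fun D g ->
  (forall x, D x -> 0 <= f x) -> (forall x, D x -> 0 <= g x) ->
  mu.-integrable D (EFin \o (fun x => f x `^ r)) ->
  mu.-integrable D (EFin \o (fun x => g x `^ r)) ->
  mu.-integrable D (EFin \o (fun x => (f x + g x) `^ r)).
Proof.
move=> r0 mf mg f0 g0 fi gi.
apply: (integrable_dominated mD _ (integrable_cst_mul mD (2 `^ r) (integrable_add mD fi gi))).
  by apply: (measurableT_comp (measurable_powR r)); exact: measurable_funD.
move=> x Dx; rewrite ger0_norm ?powR_ge0//; apply: powR_addr_le => //; [exact: f0|exact: g0].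
Qed.

(* The dominating function is [|f 0| + 2 W^(1/r)], where
   [W = sum_k (2^k |f (k+1) - f k|)^r] has a finite integral. *)
Lemma fast_cauchy_ae (f : nat -> T -> R) (r : R) : 0 < r ->
  (forall k, measurable_fun D (f k)) ->
  mu.-integrable D (EFin \o (fun x => `|f 0%N x| `^ r)) ->
  (forall k, mu.-integrable D (EFin \o (fun x => `|f k.+1 x - f k x| `^ r))) ->
  (forall k, (2 ^+ k) `^ r * \int[mu]_(x in D) (`|f k.+1 x - f k x| `^ r) <= 2^-1 ^+ k) ->
  exists g G : T -> R, [/\ measurable_fun D g, measurable_fun D G, (forall x, D x -> 0 <= G x),
    mu.-integrable D (EFin \o (fun x => G x `^ r)) &
    {ae mu, forall x, D x -> f k x @[k --> \oo] --> g x /\ forall k, `|f k x| <= G x}].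
Proof.
move=> r0 mf f0i fi fle.
pose w k x := (2 ^+ k * `|f k.+1 x - f k x|) `^ r.
have mw k : measurable_fun D (w k).
  apply: (measurableT_comp (measurable_powR r)).
  apply: measurable_funM => //; apply: measurableT_comp => //.
  exact: measurable_funB.
have w0 k x : 0 <= w k x by exact: powR_ge0.
pose W x := (\sum_(0 <= k <oo) (w k x)%:E)%E.
have W0 x : (0 <= W x)%E by apply: nneseries_ge0 => k _ _; rewrite lee_fin.
have mW : measurable_fun D W.
  apply: ge0_emeasurable_sum; first by move=> k x _ _; rewrite lee_fin.
  by move=> k _; exact/measurable_EFinP.
have intW : (\int[mu]_(x in D) W x <= 2%:E)%E.
  rewrite /W integral_nneseries//; last 2 first.
    by move=> k; exact/measurable_EFinP.
    by move=> k x _; rewrite lee_fin.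
  apply: (@le_trans _ _ (\sum_(0 <= k <oo) (geometric 1 2^-1 k)%:E)%E).
    apply: lee_nneseries => [k _ _|k _]; first by apply: integral_ge0 => x _; rewrite lee_fin.
    rewrite (_ : w k = fun x => (2 ^+ k) `^ r * `|f k.+1 x - f k x| `^ r); last first.
      by apply/funext => x; rewrite /w powRM.
    rewrite -EFin_Rintegral//; last exact: integrable_cst_mul.
    by rewrite lee_fin RintegralZl// /geometric/= mul1r.
  have h2 : `|2^-1 : R| < 1 by rewrite ger0_norm ?invr_ge0// invf_lt1 ?ltr1n.
  have := cvg_geometric_series (a := 1) h2.
  rewrite (_ : 1 / (1 - 2^-1) = 2 :> R); last by field.
  move=> h; rewrite (_ : limn _ = 2%:E)//; apply/cvg_lim => //.
  rewrite (_ : (fun n : nat => _) = EFin \o series (geometric 1 2^-1)).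
    by apply: cvg_EFin; [exact: nearW|exact: h].
  by apply/funext => n /=; rewrite /series/= sumEFin.
have Wi : mu.-integrable D W.
  apply/integrableP; split => //.
  rewrite (_ : integral _ _ _ = \int[mu]_(x in D) W x)%E.
    by rewrite (le_lt_trans intW)// ltry.
  by apply: eq_integral => x _; rewrite gee0_abs.
have Wfin := integrable_ae mD Wi.
pose c x : R := (fine (W x)) `^ r^-1.
have c0 x : 0 <= c x by exact: powR_ge0.
have wle x k : W x \is a fin_num -> `|f k.+1 x - f k x| <= c x * 2^-1 ^+ k.
  move=> Wx.
  have : w k x <= fine (W x).
    rewrite -lee_fin fineK//.
    apply: (le_trans _ (nneseries_lim_ge k.+1 _)); last by move=> *; rewrite lee_fin.
    rewrite big_nat_recr//= leeDr// sume_ge0// => *; exact: w0.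
  move=> /(ge0_ler_powR (r := r^-1)) -/(_ (ltW _)).
  rewrite !nnegrE invr_gt0 => /(_ r0 (w0 _ _)).
  have Wx0 : 0 <= fine (W x) by exact: fine_ge0.
  move=> /(_ Wx0); rewrite /w -powRrM divff ?gt_eqF// powRr1 ?mulr_ge0// -/(c x).
  by rewrite exprVn ler_pdivlMr ?exprn_gt0// mulrC.
pose E := D `&` [set x | W x \is a fin_num].
have mE : measurable E by exact: emeasurable_fin_num.
(* Multiplication by the indicator of [E] makes the sequence converge at every point, so that its
   limit is measurable. *)
pose h k x := f k x * \1_E x.
have mh k : measurable_fun D (h k).
  by apply: measurable_funM => //; apply: measurable_funTS; exact: measurable_indic.
have hcvg x : cvgn (h ^~ x).
  rewrite /h indicE; case: (boolP (x \in E)) => [/set_mem[Dx /= Wx]|_].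
    rewrite /= (_ : (fun _ => _) = f ^~ x); last by apply/funext => k; rewrite mulr1.
    by have [] := geometric_cauchy (c0 x) (fun k => wle x k Wx).
  rewrite /= (_ : (fun _ => _) = cst 0); first exact: is_cvg_cst.
  by apply/funext => k; rewrite mulr0.
exists (fun x => limn (h ^~ x)), (fun x => `|f 0%N x| + 2 * c x).
have mc : measurable_fun D c.
  apply: (measurableT_comp (measurable_powR _)).
  exact: (measurableT_comp (@fine_measurable _ _ measurableT) mW).
split.
- by apply: (measurable_fun_cvg mh) => x _; exact: hcvg.
- by apply: measurable_funD; [exact: measurableT_comp|exact: measurable_funM].
- by move=> x _; rewrite addr_ge0// mulr_ge0.
- apply: powR_integrable_add => //.
  + exact: ltW.
  + exact: measurableT_comp.
  + exact: measurable_funM.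
  + by move=> x _; rewrite mulr_ge0.
  rewrite (_ : (fun x => _) = (fun x => 2 `^ r * fine (W x))); last first.
    apply/funext => x; rewrite powRM// /c -powRrM mulVf ?gt_eqF// powRr1//.
    exact: fine_ge0.
  apply: integrable_cst_mul => //; apply: integrable_ge0P => //.
  + exact: (measurableT_comp (@fine_measurable _ _ measurableT) mW).
  + by move=> x _; exact: fine_ge0.
  + apply: (@le_lt_trans _ _ 2%:E); last by rewrite ltry.
    apply: le_trans intW.
    apply: ge0_le_integral => //; first by move=> x _; rewrite lee_fin fine_ge0.
    * apply/measurable_EFinP.
      exact: (measurableT_comp (@fine_measurable _ _ measurableT) mW).
    * by move=> x _; case: (W x) (W0 x) => //= z z0; rewrite leey.
- apply: filterS Wfin => x /[swap] Dx /(_ Dx) Wx; split.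
    have := hcvg x; rewrite /h indicE mem_set//=.
    rewrite (_ : (fun k => f k x * 1) = f ^~ x)//; by apply/funext => k; rewrite mulr1.
  by move=> k; have [_] := geometric_cauchy (c0 x) (fun k => wle x k Wx); exact.
Qed.

End fast_cauchy.

(** * Lebesgue measure on boxes *)

Section euclidean_measure.
Context {R : realType}.
Local Notation bl := (@borel_lebesgue R).

Definition obox n (a b : 'rV[R]_n) : set 'rV[R]_n :=
  [set x | forall i, a ord0 i < x ord0 i < b ord0 i].

Definition hbox n (a b : 'rV[R]_n) : set 'rV[R]_n :=
  [set x | forall i, a ord0 i <= x ord0 i < b ord0 i].

Lemma measurable_coord_box n (P : 'I_n -> set (measurableTypeR R)) : (forall i, measurable (P i)) ->
  measurable [set x : 'rV[R]_n | forall i, P i (x ord0 i)].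
Proof.
move=> mP; rewrite (_ : mkset _ =
  \bigcap_(i in [set: 'I_n]) ((fun x : 'rV[R]_n => x ord0 i) @^-1` P i)).
  apply: fin_bigcap_measurable => // i _.
  by rewrite -[X in measurable X]setTI; exact: (@measurable_coord R n i measurableT).
by apply/seteqP; split => x /= h i => [_|]; exact: h.
Qed.

Lemma measurable_obox n (a b : 'rV[R]_n) : measurable (obox a b).
Proof.
have := @measurable_coord_box n (fun i => `]a ord0 i, b ord0 i[%classic).
move=> /(_ (fun i => measurable_itv _)).
by rewrite (_ : mkset _ = obox a b)//; apply/seteqP; split => x h i; have := h i; rewrite /= in_itv.
Qed.

Lemma measurable_hbox n (a b : 'rV[R]_n) : measurable (hbox a b).
Proof.
have := @measurable_coord_box n (fun i => `[a ord0 i, b ord0 i[%classic).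
move=> /(_ (fun i => measurable_itv _)).
by rewrite (_ : mkset _ = hbox a b)//; apply/seteqP; split => x h i; have := h i; rewrite /= in_itv.
Qed.

(** The open box of half-width [2^-j] around the lattice point [2^-j c]. Neighbouring boxes overlap,
    so that countably many open boxes cover the space at each scale. *)
Definition dyadic_box n (jc : nat * 'rV[int]_n) : set 'rV[R]_n :=
  obox (\row_i (2^-1 ^+ jc.1 * (jc.2 ord0 i - 1)%:~R)) (\row_i (2^-1 ^+ jc.1 * (jc.2 ord0 i + 1)%:~R)).

(** The centre is [x] rounded down to the lattice. That the closed box stays in [U] is what later
    allows bumps over it to be test functions. *)
Lemma dyadic_box_ball n (U : set 'rV[R]_n) (x : 'rV[R]_n) : open U -> U x ->
  exists jc, dyadic_box jc x /\
    forall y : 'rV[R]_n, (forall i, 2^-1 ^+ jc.1 * (jc.2 ord0 i - 1)%:~R <= y ord0 i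
      <= 2^-1 ^+ jc.1 * (jc.2 ord0 i + 1)%:~R) -> U y.
Proof.
move=> oU Ux; have /nbhs_ballP[e /= e0 eU] : nbhs x U by exact: open_nbhs_nbhs.
(* The closed box has sides [2 * 2^-j], so all its points are within [e] of [x] in the sup norm. *)
have [j je] : exists j, 2^-1 ^+ j < e / 2.
  have h2 : `|2^-1 : R| < 1 by rewrite ger0_norm ?invr_ge0// invf_lt1 ?ltr1n.
  have := @cvg_expr R 2^-1 h2; move=> /cvgrPdist_lt/(_ (e / 2))[|N _ /(_ N (leqnn N))].
    by rewrite divr_gt0.
  by rewrite sub0r normrN ger0_norm// => h; exists N.
have p0 : 0 < 2^-1 ^+ j :> R by rewrite exprn_gt0// invr_gt0.
exists (j, \row_i Num.floor (2 ^+ j * x ord0 i)).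
have pK : 2^-1 ^+ j * 2 ^+ j = 1 :> R by rewrite -exprMn mulVf// expr1n.
have fl i : 2^-1 ^+ j * (Num.floor (2 ^+ j * x ord0 i))%:~R <= x ord0 i <
    2^-1 ^+ j * (Num.floor (2 ^+ j * x ord0 i) + 1)%:~R.
  have /andP[h1 h2] := floor_itv (2 ^+ j * x ord0 i).
  have xE : x ord0 i = 2^-1 ^+ j * (2 ^+ j * x ord0 i) by rewrite mulrA pK mul1r.
  by rewrite [leRHS]xE [ltLHS]xE ler_pM2l// ltr_pM2l// h1.
split => /=.
  move=> i; rewrite !mxE; have /andP[h1 h2] := fl i; rewrite h2 andbT.
  by apply: lt_le_trans h1; rewrite ltr_pM2l// ltr_int ltrBlDr ltrDl.
move=> y hy; apply: eU; split => // i j'.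
rewrite (ord1 i); have := hy j'; rewrite !mxE /= => /andP[y1 y2].
have /andP[x1 x2] := fl j'.
rewrite /ball/= ltr_distl.
move: x1 x2 y1 y2; rewrite !intrD !intrN !mulrDr !mulr1 => x1 x2 y1 y2.
by apply/andP; split; lra.
Qed.

(** The sigma-algebra is the product one, so an open set is written as a countable union of dyadic
    boxes. *)
Lemma open_measurable_rV n (U : set 'rV[R]_n) : open U -> measurable U.
Proof.
move=> oU.
pose P jc := dyadic_box jc `<=` U.
rewrite (_ : U = \bigcup_(jc : nat * 'rV[int]_n) (if `[< P jc >] then dyadic_box jc else set0)).
  apply: countable_bigcupT_measurable => [|jc]; first exact: countableP.
  by case: ifP => // _; exact: measurable_obox.
apply/seteqP; split => [x Ux|x [jc _]]; last by case: asboolP => // h; exact: h.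
have [jc [jcx h]] := dyadic_box_ball oU Ux.
exists jc => //; rewrite asboolT// => y hy; apply: h => i; have /andP[h1 h2] := hy i.
by move: h1 h2; rewrite !mxE => /ltW -> /ltW ->.
Qed.

Lemma continuous_measurable_rV n (f : 'rV[R]_n -> R) : continuous f ->
  measurable_fun [set: 'rV[R]_n] f.
Proof.
move=> cf; apply: (measurability _ (RGenOInfty.measurableE R)) => // _ [_ [x ->] <-].
rewrite setTI; apply: open_measurable_rV.
by apply: open_comp; [move=> y _; exact: cf|exact: interval_open].
Qed.

Lemma borel_lebesgueS n A : bl n.+1 A =
  pushforward (@lebesgue_measure R \x bl n)%E (@rV_cons R n) A.
Proof. by []. Qed.

Lemma lebesgue_measure_co (a h : R) : 0 <= h ->
  lebesgue_measure (`[a, a + h[%classic : set R) = h%:E.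
Proof.
move=> h0; rewrite lebesgue_measure_itv/= lte_fin; case: ltP => [_|].
  by rewrite -EFinB addrAC subrr add0r.
by rewrite gerDl => hle; have -> : h = 0 by apply/le_anti/andP.
Qed.

Lemma borel_lebesgue_hbox n (a : 'rV[R]_n) (h : R) : 0 <= h ->
  bl n (hbox a (\row_i (a ord0 i + h))) = (h ^+ n)%:E.
Proof.
move=> h0; elim: n a => [|n ih] a.
  rewrite expr0 /= diracE mem_set// => -[]//.
rewrite borel_lebesgueS /pushforward.
pose a' : 'rV[R]_n := \row_j a ord0 (lift ord0 j).
rewrite (_ : _ @^-1` _ = `[a ord0 ord0, a ord0 ord0 + h[%classic `*`
  hbox a' (\row_i (a' ord0 i + h))).
  rewrite product_measure1E//; last exact: measurable_hbox.
  transitivity (h%:E * (h ^+ n)%:E)%E; last by rewrite -EFinM exprS.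
  by congr (_ * _)%E; [exact: lebesgue_measure_co|exact: ih].
apply/seteqP; split => [[s x] /= H|[s x] /= [H1 H2] i].
  split => [|i].
    by have := H ord0; rewrite in_itv/= /rV_cons !mxE unlift_none.
  by have := H (lift ord0 i); rewrite /rV_cons !mxE liftK.
rewrite /rV_cons !mxE; case: unliftP => [j ->|->].
  by have := H2 j; rewrite !mxE.
by move: H1; rewrite in_itv.
Qed.

Lemma ge0_integral_borelS n (f : 'rV[R]_n.+1 -> \bar R) :
  measurable_fun setT f -> (forall x, 0 <= f x)%E ->
  (\int[bl n.+1]_x f x = \int[@lebesgue_measure R]_s \int[bl n]_x f (rV_cons (s, x)))%E.
Proof.
move=> mf f0.
have -> : (\int[bl n.+1]_x f x = \int[pushforward (@lebesgue_measure R \x bl n)%E (@rV_cons R n)]_x f x)%E.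
  by apply: eq_measure_integral.
rewrite (ge0_integral_pushforward (@measurable_rV_cons R n))//.
rewrite preimage_setT fubini_tonelli1; [by []| |by move=> x; exact: f0].
by apply: measurableT_comp => //; exact: measurable_rV_cons.
Qed.

Local Notation cT n := (caratheodory_type ((bl n)^*)%mu).

Lemma borel_cara n (A : set 'rV[R]_n) : measurable A -> measurable (A : set (cT n)).
Proof. by move=> mA; apply: caratheodory_measurable_mu_ext. Qed.

(** The identity from the Lebesgue sigma-algebra to the Borel one. Pushing [lebesgue_rV] forward
    along it gives back [borel_lebesgue], which transfers integrals of Borel functions between the
    two measures. *)
Definition cara_id n (x : cT n) : 'rV[R]_n := x.

Lemma measurable_cara_id n : measurable_fun setT (@cara_id n).
Proof. by move=> _ A mA; rewrite setTI; exact: borel_cara. Qed.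

Lemma borel_measurable_cara n (D : set 'rV[R]_n) (f : 'rV[R]_n -> R) :
  measurable_fun D f -> measurable D -> measurable_fun (D : set (cT n)) (f : cT n -> R).
Proof. by move=> mf mD _ B mB; apply: borel_cara; exact: mf. Qed.

Lemma lebesgue_rV_borel n (A : set 'rV[R]_n) : measurable A ->
  @lebesgue_rV R n A = bl n A.
Proof. by move=> mA; exact: measurable_mu_extE. Qed.

Lemma ge0_integral_lebesgue_rV n (D : set 'rV[R]_n) (f : 'rV[R]_n -> \bar R) :
  measurable D -> measurable_fun D f -> (forall x, D x -> 0 <= f x)%E ->
  (\int[@lebesgue_rV R n]_(x in D) f x = \int[bl n]_(x in D) f x)%E.
Proof.
move=> mD mf f0.
have <- : (\int[pushforward (@lebesgue_rV R n) (@cara_id n)]_(x in D) f x =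
   \int[bl n]_(x in D) f x)%E.
  apply: (@eq_measure_integral measure_rV_display 'rV[R]_n R D (bl n)
    (pushforward (@lebesgue_rV R n) (@cara_id n)) f) => [|mid A mA _]; first exact: measurable_cara_id.
  exact: lebesgue_rV_borel.
rewrite (ge0_integral_pushforward (@measurable_cara_id n))//.
by move=> x /set_mem; exact: f0.
Qed.

Lemma integrable_lebesgue_rV n (D : set 'rV[R]_n) (f : 'rV[R]_n -> R) :
  measurable D -> (bl n).-integrable D (EFin \o f) ->
  (@lebesgue_rV R n).-integrable (D : set (cT n)) (EFin \o (f : cT n -> R)).
Proof.
move=> mD fi; have mf := integrable_fun_measurable fi.
case/integrableP: fi => _ h; apply/integrableP; split.
  by apply/measurable_EFinP; exact: borel_measurable_cara.
rewrite ge0_integral_lebesgue_rV//.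
by apply: measurableT_comp => //; exact/measurable_EFinP.
Qed.

Lemma Rintegral_lebesgue_rV n (D : set 'rV[R]_n) (f : 'rV[R]_n -> R) :
  measurable D -> measurable_fun D f ->
  \int[@lebesgue_rV R n]_(x in D) f x = \int[bl n]_(x in D) f x.
Proof.
move=> mD mf; congr fine.
rewrite [LHS]integralE [RHS]integralE.
by congr (_ - _)%E; apply: ge0_integral_lebesgue_rV => //;
  [apply: measurable_funepos|apply: measurable_funeneg]; exact/measurable_EFinP.
Qed.

End euclidean_measure.

(** * Calculus of smooth functions *)

Section directional_derivatives.
Context {R : realType} {V : normedModType R}.
Implicit Types (f g : V -> R) (x v : V).

(** Reduces directional derivatives to derivatives in one real variable, where the chain rule
    applies. *)
Lemma is_derive_line f x v (df : R) :
  is_derive x v f df <-> is_derive (0 : R) (1 : R) (fun h : R => f (h *: v + x)) df.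
Proof.
have E : (fun h : R => h^-1 *: ((f \o shift x) (h *: v) - f x)) =
    (fun h : R => h^-1 *: (((fun h : R => f (h *: v + x)) \o shift 0) (h *: (1 : R)) -
       (fun h : R => f (h *: v + x)) 0)).
  apply/funext => h /=; rewrite addr0 scale0r add0r.
  by rewrite (_ : h *: (1 : R) = h)//; rewrite /GRing.scale/= mulr1.
split=> -[] d1 d2; split.
- by move: d1; rewrite /derivable E.
- by rewrite -d2 /derive E.
- by rewrite /derivable E.
- by rewrite -d2 /derive E.
Qed.

Lemma is_derive_comp_real (h : R -> R) f x v (dh df : R) :
  is_derive (f x) 1 h dh -> is_derive x v f df ->
  is_derive x v (h \o f) (dh * df).
Proof.
move=> H /is_derive_line F; apply/is_derive_line.
apply: (@is_derive1_comp _ h (fun t : R => f (t *: v + x)) 0 dh df) => //.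
by rewrite scale0r add0r.
Qed.

End directional_derivatives.

(** * Stability properties of C^k functions *)

Section Ck_theory.
Context {R : realType} {n : nat}.
Implicit Types (f g : 'rV[R]_n -> R).

Lemma Ck_continuous k f : Ck k f -> continuous f.
Proof. by case: k => [|k] []. Qed.

Lemma CkS k f : Ck k.+1 f -> Ck k f.
Proof.
elim: k f => [|k ih] f [cf df]; first by split.
by split => // i; have [d1 d2] := df i; split => //; exact: ih.
Qed.

Lemma Ck_cst k (c : R) : Ck k (fun _ : 'rV[R]_n => c).
Proof.
elim: k c => [|k ih] c; split=> //; try exact: cst_continuous.
move=> i; split; first by move=> x; exact: derivable_cst.
rewrite (_ : derive _ ^~ _ = (fun _ => 0)); first exact: ih.
by apply/funext => x; rewrite derive_cst.
Qed.

Lemma CkD k f g : Ck k f -> Ck k g -> Ck k (fun x => f x + g x).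
Proof.
elim: k f g => [|k ih] f g [cf df] [cg dg].
  by split => // x; apply: continuousD; [exact: cf|exact: cg].
split; first by move=> x; apply: continuousD; [exact: cf|exact: cg].
move=> i; have [df1 df2] := df i; have [dg1 dg2] := dg i; split.
  by move=> x; exact: (derivableD (df1 x) (dg1 x)).
rewrite (_ : (fun x => _) = (fun x => 'D_(ebase i) f x + 'D_(ebase i) g x)).
  exact: ih.
by apply/funext => x; exact: (deriveD (df1 x) (dg1 x)).
Qed.

Lemma CkM k f g : Ck k f -> Ck k g -> Ck k (fun x => f x * g x).
Proof.
elim: k f g => [|k ih] f g Cf Cg.
  case: Cf Cg => cf _ [cg _].
  by split => // x; apply: continuousM; [exact: cf|exact: cg].
have := Cf; have := Cg; case=> cg dg [cf df].
split; first by move=> x; apply: continuousM; [exact: cf|exact: cg].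
move=> i; have [df1 df2] := df i; have [dg1 dg2] := dg i; split.
  by move=> x; exact: (derivableM (df1 x) (dg1 x)).
rewrite (_ : (fun x => _) =
  (fun x => f x * 'D_(ebase i) g x + g x * 'D_(ebase i) f x)).
  by apply: CkD; apply: ih => //; exact: CkS.
by apply/funext => x; rewrite (deriveM (df1 x) (dg1 x)).
Qed.

Lemma CkZ k (c : R) f : Ck k f -> Ck k (fun x => c * f x).
Proof. by move=> Cf; apply: CkM => //; exact: Ck_cst. Qed.

Lemma CkB k f g : Ck k f -> Ck k g -> Ck k (fun x => f x - g x).
Proof.
move=> Cf Cg; rewrite (_ : (fun x => _) = (fun x => f x + (-1) * g x)).
  by apply: CkD => //; exact: CkZ.
by apply/funext => x; rewrite mulN1r.
Qed.

Lemma Ck_prod k (I : Type) (s : seq I) (F : I -> 'rV[R]_n -> R) :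
  (forall i, Ck k (F i)) -> Ck k (fun x => \prod_(i <- s) F i x).
Proof.
move=> CF; elim: s => [|i s ih].
  rewrite (_ : (fun x => _) = (fun _ => 1)); first exact: Ck_cst.
  by apply/funext => x; rewrite big_nil.
rewrite (_ : (fun x => _) = (fun x => F i x * \prod_(i <- s) F i x)).
  exact: CkM.
by apply/funext => x; rewrite big_cons.
Qed.

Lemma is_derive_coord (i j : 'I_n) (x : 'rV[R]_n) :
  is_derive x (ebase i) (fun x : 'rV[R]_n => x ord0 j) (i == j)%:R.
Proof.
apply/is_derive_line.
rewrite (_ : (fun h => _) = (fun h : R => h *: ((i == j)%:R : R) + x ord0 j)); last first.
  by apply/funext => h; rewrite !mxE /= eq_sym.
apply: is_derive_eq.
by rewrite scaler0 add0r addr0 /GRing.scale/= mulr1.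
Qed.

Lemma Ck_coord k (j : 'I_n) : Ck k (fun x : 'rV[R]_n => x ord0 j).
Proof.
have cc : continuous (fun x : 'rV[R]_n => x ord0 j) by exact: coord_continuous.
case: k => [|k]; split => // i; split.
  by move=> x; have [] := is_derive_coord i j x.
rewrite (_ : (fun x => _) = (fun _ => (i == j)%:R)); first exact: Ck_cst.
by apply/funext => x; have [_ ->] := is_derive_coord i j x.
Qed.

(** The outer derivative is required to be C^k only after composition with [f]. This suits families
    of outer functions that are closed under derivation, by induction on [k]. *)
Lemma Ck_comp_step k (h dh : R -> R) f : continuous h ->
  (forall s : R, is_derive s (1 : R) h (dh s)) -> Ck k.+1 f -> Ck k (fun x => dh (f x)) ->
  Ck k.+1 (fun x => h (f x)).
Proof.
move=> ch hd Cf Cdh; have [cf df] := Cf.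
split; first by move=> x; apply: continuous_comp; [exact: cf|exact: ch].
move=> i; have [df1 df2] := df i.
have H x := is_derive_comp_real (hd (f x)) (DeriveDef (df1 x) erefl).
split; first by move=> x; have [] := H x.
rewrite (_ : (fun x => _) = (fun x => dh (f x) * 'D_(ebase i) f x)).
  by apply: CkM.
by apply/funext => x; have [] := H x.
Qed.

End Ck_theory.

(** * Flat functions and the smoothed absolute value *)

Section smooth_functions.
Context {R : realType}.

(** The classical function exp(-1/x), extended by 0, times a power of 1/x. The power makes the
    family closed under derivation up to linear combinations. *)
Definition flat (m : nat) (x : R) : R :=
  if 0 < x then x^-1 ^+ m * expR (- x^-1) else 0.

Lemma flat_ge0 m x : 0 <= flat m x.
Proof.
by rewrite /flat; case: ifP => // x0; rewrite mulr_ge0 ?expR_ge0// exprn_ge0// invr_ge0 ltW.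
Qed.

(** The term of order m + 1 of the exponential series at y = 1/x gives y^(m+1) / (m+1)! <= exp y.
    The linear bound yields the derivative 0 at the origin. *)
Lemma flat_le m x : flat m x <= (m.+1)`!%:R * `|x|.
Proof.
rewrite /flat; case: ifPn => [x0|_]; last by rewrite mulr_ge0.
have y0 : 0 < x^-1 by rewrite invr_gt0.
have h : x^-1 ^+ m.+1 / (m.+1)`!%:R <= expR x^-1.
  by apply: le_trans (expR_ge1Dxn m (ltW y0)); rewrite lerDr.
have f0 : 0 < (m.+1)`!%:R :> R by rewrite ltr0n fact_gt0.
rewrite ler_pdivrMr// in h.
rewrite expRN ler_pdivrMr ?expR_gt0// gtr0_norm//.
move: h; rewrite exprSr => h.
have -> : x^-1 ^+ m = x * (x^-1 ^+ m * x^-1).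
  by rewrite mulrCA divff ?mulr1// gt_eqF.
apply: (le_trans (ler_wpM2l (ltW x0) h)).
by rewrite le_eqVlt; apply/orP; left; apply/eqP; ring.
Qed.

Lemma is_derive_pow m (f : R -> R) (x df : R) : is_derive x (1 : R) f df ->
  is_derive x (1 : R) (fun y => f y ^+ m) (m%:R * f x ^+ m.-1 * df).
Proof.
move=> fd; elim: m => [|m ih].
  rewrite !mul0r (_ : (fun y => _) = cst 1); first exact: is_derive_cst.
  by apply/funext => y; rewrite expr0.
rewrite (_ : (fun y => _) = f * (fun y => f y ^+ m)); last first.
  by apply/funext => y; rewrite exprS.
apply: (is_derive_eq (is_deriveM fd ih)); rewrite /GRing.scale/=.
case: m {ih} => [|m] /=; first by rewrite !expr0 !mul0r mulr0 add0r !mul1r.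
by rewrite exprS -[m.+2]addn1 natrD; ring.
Qed.

Lemma is_derive_flat m (x : R) : is_derive x (1 : R) (flat m) (flat m.+2 x - m%:R * flat m.+1 x).
Proof.
have [x0|x0|->] := ltgtP x 0.
- apply: (@near_eq_is_derive _ _ _ (cst 0)).
    near=> y; rewrite /flat ifF//; apply/negbTE; rewrite -leNgt ltW//.
    by near: y; exact: lt_nbhsl.
  rewrite {1 2}/flat !ltNge ltW//= mulr0 subr0; exact: is_derive_cst.
- apply: (@near_eq_is_derive _ _ _ (fun y : R => y^-1 ^+ m * expR (- y^-1))).
    near=> y; rewrite /flat ifT//.
    by near: y; exact: lt_nbhsr.
  have xn0 : x != 0 by rewrite gt_eqF.
  have dinv : is_derive x 1 (fun y : R => y^-1) (- x ^- 2).
    by apply: (is_derive_eq (is_deriveV xn0 (is_derive_id _ _))); rewrite /GRing.scale/= mulr1.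
  have dexp : is_derive x 1 (expR \o (fun y : R => - y^-1)) (expR (- x^-1) * x ^- 2).
    apply: is_derive1_comp.
    by apply: (is_derive_eq (is_deriveN dinv)); rewrite opprK.
  have dpow : is_derive x 1 ((fun y : R => y ^+ m) \o (fun y : R => y^-1))
      (m%:R * x^-1 ^+ m.-1 * (- x ^- 2)).
    exact: is_derive_pow.
  apply: (is_derive_eq (is_deriveM dpow dexp)).
  rewrite /flat x0 /GRing.scale/=.
  case: m dpow => [|m] dpow /=.
    by rewrite !expr0 !mul0r subr0 mulr0 addr0 mul1r exprVn mulrC.
  have -> : x ^- 2 = x^-1 ^+ 2 by rewrite exprVn.
  by set a := x^-1; rewrite !exprS; ring.
(* At the origin the difference quotient of [flat m] is [flat m.+1], which is squeezed to 0 by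
   [flat_le]. *)
have H : (fun h : R => h^-1 *: ((flat m \o shift 0) (h *: (1 : R)) - flat m 0)) @ 0^' --> (0 : R).
  rewrite (_ : (fun h => _) = flat m.+1); last first.
    apply/funext => h /=; rewrite addr0 (_ : h *: (1 : R) = h); last by rewrite /GRing.scale/= mulr1.
    rewrite /flat ltxx subr0 /GRing.scale/=; case: ifP; last by rewrite mulr0.
    by rewrite exprS mulrA.
  apply: cvg_within_filter.
  apply: (@squeeze_cvgr _ _ _ _ (fun=> 0) (fun h : R => (m.+2)`!%:R * `|h|)).
  - by apply: nearW => h; rewrite flat_ge0 flat_le.
  - exact: cvg_cst.
  - rewrite -[X in _ --> X](mulr0 ((m.+2)`!%:R : R)); apply: cvgMr.
    by rewrite -[X in _ --> X](@normr0 R R); exact: norm_continuous.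
rewrite (_ : _ - _ = 0); last by rewrite /flat ltxx mulr0 subr0.
by apply: DeriveDef; [exact: cvgP H|exact: cvg_lim H].
Unshelve. all: by end_near. Qed.

Lemma continuous_flat m : continuous (flat m).
Proof.
move=> x; apply: differentiable_continuous; apply/derivable1_diffP.
by have [] := is_derive_flat m x.
Qed.

Lemma Ck_flat n k m (f : 'rV[R]_n -> R) : (forall k, Ck k f) -> Ck k (fun x => flat m (f x)).
Proof.
move=> Cf; elim: k m => [|k ih] m.
  split => // x; apply: continuous_comp; last exact: continuous_flat.
  exact: (Ck_continuous (Cf 0%N)).
apply: (Ck_comp_step (@continuous_flat m) (is_derive_flat m) (Cf k.+1)).
by apply: CkB => //; apply: CkZ.
Qed.

(** The subtracted [e] makes the function vanish at 0, so that composition with it preserves test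
    functions. *)
Definition smooth_abs (e s : R) : R := Num.sqrt (s ^+ 2 + e ^+ 2) - e.

Lemma is_derive_invsqrt (e s : R) : 0 < e ->
  is_derive s 1 (fun s => (Num.sqrt (s ^+ 2 + e ^+ 2))^-1)
    (- s * (Num.sqrt (s ^+ 2 + e ^+ 2))^-1 ^+ 3).
Proof.
move=> e0.
have p0 : 0 < s ^+ 2 + e ^+ 2 by rewrite ltr_wpDl ?sqr_ge0// exprn_gt0.
have d2 : is_derive s 1 (fun s : R => s ^+ 2 + e ^+ 2) (2 * s).
  rewrite (_ : (fun s => _) = (fun s : R => s * s) + cst (e ^+ 2)); last first.
    by apply/funext => x; rewrite /= expr2.
  apply: (is_derive_eq (is_deriveD (is_deriveM (is_derive_id _ _) (is_derive_id _ _)) (is_derive_cst _ _ _))).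
  by rewrite /GRing.scale/= mulr1 addr0 mulr2n mulrDl mul1r.
have dsq := @is_derive1_comp _ Num.sqrt (fun s : R => s ^+ 2 + e ^+ 2) s _ _ (is_derive1_sqrt p0) d2.
have q0 : 0 < Num.sqrt (s ^+ 2 + e ^+ 2) by rewrite sqrtr_gt0.
have /= := is_deriveV _ dsq; move=> /(_ (lt0r_neq0 q0)) h.
apply: (is_derive_eq h); rewrite /GRing.scale/=.
by field; rewrite gt_eqF.
Qed.

Lemma Ck_smooth_abs n k (e : R) (f : 'rV[R]_n -> R) : 0 < e ->
  (forall k, Ck k f) -> Ck k (fun x => smooth_abs e (f x)).
Proof.
move=> e0 Cf.
have p0 s : 0 < s ^+ 2 + e ^+ 2 by rewrite ltr_wpDl ?sqr_ge0// exprn_gt0.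
pose r s := (Num.sqrt (s ^+ 2 + e ^+ 2))^-1.
have cr : continuous r.
  move=> x; apply: differentiable_continuous; apply/derivable1_diffP.
  by have [] := is_derive_invsqrt x e0.
have Cr j : Ck j (fun x => r (f x)).
  elim: j => [|j ih].
    by split => // x; apply: continuous_comp; [exact: (Ck_continuous (Cf 0%N))|exact: cr].
  apply: (@Ck_comp_step _ _ _ r (fun s => - s * r s ^+ 3)) => //.
    by move=> s; exact: is_derive_invsqrt.
  rewrite (_ : (fun x => _) = (fun x => (-1 * f x) * (r (f x) * (r (f x) * r (f x))))).
    by do !apply: CkM => //; exact: Ck_cst.
  by apply/funext => x; rewrite mulN1r !exprS mulr1.
(* The root is written as its square times the inverse root [r]. As the derivative of [r] is
   [- s r^3], smoothness of [r] follows by induction without any other function. *)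
rewrite (_ : (fun x => _) = (fun x => (f x * f x + e ^+ 2) * r (f x) - e)).
  apply: CkB; last exact: Ck_cst.
  by apply: CkM => //; apply: CkD; [exact: CkM|exact: Ck_cst].
apply/funext => x; rewrite /smooth_abs -expr2 /r; congr (_ - _).
set z := f x ^+ 2 + e ^+ 2; have z0 : 0 < z by exact: p0.
by rewrite -[X in X / _](sqr_sqrtr (ltW z0)) expr2 mulfK// gt_eqF// sqrtr_gt0.
Qed.

Lemma derive_smooth_abs n (e : R) (f : 'rV[R]_n -> R) (x v : 'rV[R]_n) : 0 < e ->
  derivable f x v ->
  'D_v (fun x => smooth_abs e (f x)) x = f x / Num.sqrt (f x ^+ 2 + e ^+ 2) * 'D_v f x.
Proof.
move=> e0 df.
have p0 : 0 < f x ^+ 2 + e ^+ 2 by rewrite ltr_wpDl ?sqr_ge0// exprn_gt0.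
have d2 : is_derive (f x) 1 (fun s : R => s ^+ 2 + e ^+ 2) (2 * f x).
  rewrite (_ : (fun s => _) = (fun s : R => s * s) + cst (e ^+ 2)); last first.
    by apply/funext => y; rewrite /= expr2.
  apply: (is_derive_eq (is_deriveD (is_deriveM (is_derive_id _ _) (is_derive_id _ _)) (is_derive_cst _ _ _))).
  by rewrite /GRing.scale/= mulr1 addr0 mulr2n mulrDl mul1r.
have dsq := is_deriveB (@is_derive1_comp _ Num.sqrt (fun s : R => s ^+ 2 + e ^+ 2) (f x) _ _ (is_derive1_sqrt p0) d2) (is_derive_cst e (f x) 1).
have [_] := is_derive_comp_real dsq (DeriveDef df erefl).
rewrite /comp /= => h; rewrite [LHS]h subr0.
have q0 : 0 < Num.sqrt (f x ^+ 2 + e ^+ 2) by rewrite sqrtr_gt0.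
by field; rewrite gt_eqF.
Qed.

End smooth_functions.

(** * Poincare inequality on cubes *)

Section nonneg_iterated_integrals.
Context d1 d2 (X : measurableType d1) (Y : measurableType d2) (R : realType).
Variables (m1 : {sigma_finite_measure set X -> \bar R}) (m2 : {sigma_finite_measure set Y -> \bar R}).
Variables (A : set X) (B : set Y).
Hypotheses (mA : measurable A) (mB : measurable B).
Variable K : X * Y -> \bar R.
Hypotheses (mK : measurable_fun setT K) (K0 : forall z, (0 <= K z)%E).

Lemma measurable_fun_inner_integral :
  measurable_fun setT (fun x => \int[m2]_(y in B) K (x, y))%E.
Proof.
pose K' : X * Y -> \bar R := K \_ (setT `*` B).
have mK' : measurable_fun setT K'.
  by apply/(measurable_restrictT K (measurableX measurableT mB)); exact: measurable_funTS.
have K'0 z : (0 <= K' z)%E by rewrite /K' patchE; case: ifP.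
have := @measurable_fun_fubini_tonelli_F _ _ X Y R m2 K' mK' K'0.
rewrite /fubini_F (_ : (fun x => _) = (fun x => \int[m2]_(y in B) K (x, y))%E)//.
apply/funext => x; rewrite [RHS]integral_mkcond; apply: eq_integral => y _.
by rewrite /K' !patchE in_setX in_setT.
Qed.

Lemma tonelli_restrict :
  (\int[m1]_(x in A) \int[m2]_(y in B) K (x, y) =
   \int[m2]_(y in B) \int[m1]_(x in A) K (x, y))%E.
Proof.
pose K' : X * Y -> \bar R := K \_ (A `*` B).
have mK' : measurable_fun setT K'.
  by apply/(measurable_restrictT K (measurableX mA mB)); exact: measurable_funTS.
have K'0 z : (0 <= K' z)%E by rewrite /K' patchE; case: ifP.
have := fubini_tonelli1 (m1 := m1) (m2 := m2) K' mK' K'0.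
rewrite (fubini_tonelli2 (m1 := m1) (m2 := m2) K' mK' K'0) /fubini_F /fubini_G => h.
transitivity (\int[m1]_x \int[m2]_y K' (x, y))%E; last rewrite -h.
  rewrite integral_mkcond; apply: eq_integral => x _; rewrite patchE.
  case: ifPn => xA; last by rewrite integral0_eq// => y _; rewrite /K' patchE in_setX (negbTE xA).
  rewrite integral_mkcond; apply: eq_integral => y _.
  by rewrite /K' !patchE in_setX xA.
rewrite [RHS]integral_mkcond; apply: eq_integral => y _; rewrite patchE.
case: ifPn => yB; last by rewrite integral0_eq// => x _; rewrite /K' patchE in_setX (negbTE yB) andbF.
rewrite [RHS]integral_mkcond; apply: eq_integral => x _.
by rewrite /K' !patchE in_setX yB andbT.
Qed.

End nonneg_iterated_integrals.

(** * Slicing along the first coordinate *)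

Section slices.
Context {R : realType}.
Local Notation bl := (@borel_lebesgue R).
Local Notation leb := (@lebesgue_measure R).

Lemma rV_cons_ebase0 n (s t : R) (x : 'rV[R]_n) :
  rV_cons (t + s, x) = t *: ebase ord0 + rV_cons (s, x).
Proof.
apply/rowP => i; rewrite /rV_cons /ebase !mxE eqxx/=.
by case: unliftP => [j ->|->] /=; rewrite ?mulr0 ?mulr1 ?add0r.
Qed.

Lemma rV_cons_ebaseS n (s t : R) (x : 'rV[R]_n) (j : 'I_n) :
  rV_cons (s, t *: ebase j + x) = t *: ebase (lift ord0 j) + rV_cons (s, x).
Proof.
apply/rowP => i; rewrite /rV_cons /ebase !mxE eqxx/=.
case: unliftP => [k ->|->] /=; rewrite ?mulr0 ?add0r//.
by rewrite !mxE (inj_eq lift_inj) eqxx.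
Qed.

Lemma continuous_rV_cons_l n (x : 'rV[R]_n) : continuous (fun s : R => rV_cons (s, x)).
Proof.
move=> s; apply/cvg_ballP => e e0.
have h : nbhs s (ball s e) by apply/nbhs_ballP; exists e.
apply: filterS h => t st; split => // i j.
by rewrite /rV_cons !mxE; case: unliftP => [k _|_] //=; exact: ballxx.
Qed.

Lemma continuous_rV_cons_r n (s : R) : continuous (fun x : 'rV[R]_n => rV_cons (s, x)).
Proof.
move=> x A /nbhs_ballP[e e0 eA]; apply/nbhs_ballP; exists e => // y [_ xy].
apply: eA; split => // i j.
by rewrite /rV_cons !mxE; case: unliftP => [k _|_] /=; [exact: xy|exact: ballxx].
Qed.

Lemma is_derive_slice0 n (f : 'rV[R]_n.+1 -> R) (s : R) (x : 'rV[R]_n) (df : R) :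
  is_derive (rV_cons (s, x)) (ebase ord0) f df ->
  is_derive s (1 : R) (fun s => f (rV_cons (s, x))) df.
Proof.
move=> /is_derive_line h; apply/is_derive_line.
rewrite (_ : (fun t : R => _) = (fun t : R => f (t *: ebase ord0 + rV_cons (s, x))))//.
by apply/funext => t; rewrite -rV_cons_ebase0 (_ : t *: (1 : R) = t)// /GRing.scale/= mulr1.
Qed.

Lemma is_derive_sliceS n (f : 'rV[R]_n.+1 -> R) (s : R) (x : 'rV[R]_n) (j : 'I_n) (df : R) :
  is_derive (rV_cons (s, x)) (ebase (lift ord0 j)) f df ->
  is_derive x (ebase j) (fun x => f (rV_cons (s, x))) df.
Proof.
move=> /is_derive_line h; apply/is_derive_line.
rewrite (_ : (fun t : R => _) = (fun t : R => f (t *: ebase (lift ord0 j) + rV_cons (s, x))))//.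
by apply/funext => t; rewrite -rV_cons_ebaseS.
Qed.

Lemma derive_sliceS n (f : 'rV[R]_n.+1 -> R) (s : R) (j : 'I_n) : Ck 1 f ->
  'D_(ebase j) (fun x => f (rV_cons (s, x))) =
  (fun x => 'D_(ebase (lift ord0 j)) f (rV_cons (s, x))).
Proof.
move=> [_ Cf]; apply/funext => x.
by have [] := is_derive_sliceS (DeriveDef ((Cf (lift ord0 j)).1 (rV_cons (s, x))) erefl).
Qed.

Lemma Ck1_slice n (f : 'rV[R]_n.+1 -> R) (s : R) : Ck 1 f ->
  Ck 1 (fun x => f (rV_cons (s, x))).
Proof.
move=> Cf; split.
  move=> x; apply: (@continuous_comp _ _ _ (fun x => rV_cons (s, x)) f).
    exact: continuous_rV_cons_r.
  exact: (Ck_continuous Cf).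
move=> j; split.
  move=> x; case: Cf => _ Cf.
  by have [] := is_derive_sliceS (DeriveDef ((Cf (lift ord0 j)).1 (rV_cons (s, x))) erefl).
rewrite derive_sliceS//; split => // x.
apply: (@continuous_comp _ _ _ (fun x => rV_cons (s, x)) ('D_(ebase (lift ord0 j)) f)).
  exact: continuous_rV_cons_r.
by case: Cf => _ /(_ (lift ord0 j))[_ [cf _]]; exact: cf.
Qed.

Lemma FTC_derive (h dh : R -> R) (a b : R) : a < b ->
  (forall s : R, is_derive s (1 : R) h (dh s)) -> continuous dh ->
  (\int[leb]_(x in `[a, b]) (dh x)%:E = (h b)%:E - (h a)%:E)%E.
Proof.
move=> ab hd cdh.
have ch : continuous h.
  move=> x; apply: differentiable_continuous; apply/derivable1_diffP.
  by have [] := hd x.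
apply: continuous_FTC2 => //.
- by apply: continuous_subspaceT => x; exact: cdh.
- split; first by move=> x _; have [] := hd x.
    by apply: cvg_at_right_filter; exact: ch.
  by apply: cvg_at_left_filter; exact: ch.
- by move=> x _; rewrite derive1E; have [] := hd x.
Qed.

Lemma FTC_bound (h dh : R -> R) (a b s t : R) :
  (forall s : R, is_derive s (1 : R) h (dh s)) -> continuous dh ->
  a <= s < b -> a <= t < b ->
  ((`|h s - h t|)%:E <= \int[leb]_(x in `[a, b[) (`|dh x|)%:E)%E.
Proof.
move=> hd cdh.
have mdh D : measurable_fun D (fun x : R => (`|dh x|)%:E).
  apply/measurable_EFinP; apply: measurable_funTS; apply: measurableT_comp => //.
  exact: continuous_measurable_fun.
wlog st : s t / s <= t.
  by move=> H sab tab; have [/H|/ltW /H] := leP s t; [exact|rewrite distrC; exact].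
move=> sab tab; move: st; rewrite le_eqVlt => /predU1P[->|st].
  by rewrite subrr normr0; apply: integral_ge0 => x _; rewrite lee_fin.
have FT := FTC_derive st hd cdh.
rewrite distrC -[(`|h t - h s|)%:E]/(`|(h t)%:E - (h s)%:E|)%E -FT.
apply: (@le_trans _ _ (\int[leb]_(x in `[s, t]) (`|dh x|)%:E)%E).
  apply: le_abse_integral => //; apply/measurable_EFinP; apply: measurable_funTS.
  exact: continuous_measurable_fun.
apply: ge0_subset_integral => //; first exact: mdh.
move=> x /=; rewrite !in_itv/= => /andP[sx xt].
case/andP: sab => as_ _; case/andP: tab => _ tb.
by rewrite (le_trans as_ sx) (le_lt_trans xt tb).
Qed.

Lemma hbox_cons n (a : 'rV[R]_n.+1) (h : R) :
  @rV_cons R n @^-1` hbox a (\row_i (a ord0 i + h)) =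
  `[a ord0 ord0, a ord0 ord0 + h[%classic `*`
  hbox (\row_j a ord0 (lift ord0 j)) (\row_i ((\row_j a ord0 (lift ord0 j) : 'rV[R]_n) ord0 i + h)).
Proof.
apply/seteqP; split => [[s x] /= H|[s x] /= [H1 H2] i].
  split => [|i].
    by have := H ord0; rewrite in_itv/= /rV_cons !mxE unlift_none.
  by have := H (lift ord0 i); rewrite /rV_cons !mxE liftK.
rewrite /rV_cons !mxE; case: unliftP => [j ->|->].
  by have := H2 j; rewrite !mxE.
by move: H1; rewrite in_itv.
Qed.

Definition cube n (a : 'rV[R]_n) (h : R) : set 'rV[R]_n := hbox a (\row_i (a ord0 i + h)).

Lemma measurable_cube n (a : 'rV[R]_n) h : measurable (cube a h).
Proof. exact: measurable_hbox. Qed.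

Definition row_tail n (a : 'rV[R]_n.+1) : 'rV[R]_n := \row_j a ord0 (lift ord0 j).

Lemma integral_cubeS n (a : 'rV[R]_n.+1) (h : R) (f : 'rV[R]_n.+1 -> \bar R) :
  measurable_fun setT f -> (forall x, 0 <= f x)%E ->
  (\int[bl n.+1]_(x in cube a h) f x =
   \int[leb]_(s in `[a ord0 ord0, (a ord0 ord0 + h)%R[) \int[bl n]_(x in cube (row_tail a) h) f (rV_cons (s, x)))%E.
Proof.
move=> mf f0; rewrite integral_mkcond ge0_integral_borelS; last 2 first.
  by apply/(measurable_restrictT f (measurable_cube _ _)); exact: measurable_funTS.
  by move=> x; rewrite patchE; case: ifP.
have E s x : ((rV_cons (s, x) \in cube a h) =
   (s \in `[a ord0 ord0, a ord0 ord0 + h[%classic) && (x \in cube (row_tail a) h)).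
  have E0 : cube a h (rV_cons (s, x)) = (`[a ord0 ord0, a ord0 ord0 + h[%classic `*`
      cube (row_tail a) h) (s, x) by rewrite /cube /row_tail -hbox_cons.
  apply/idP/andP => [/set_mem|[/set_mem H1 /set_mem H2]].
    by rewrite E0 => -[H1 H2]; split; exact/mem_set.
  by apply/mem_set; rewrite E0.
rewrite [RHS]integral_mkcond; apply: eq_integral => s _; rewrite patchE.
case: ifPn => sI; last by rewrite integral0_eq// => y _; rewrite patchE E (negbTE sI).
rewrite [RHS]integral_mkcond; apply: eq_integral => x _.
by rewrite !patchE E sI.
Qed.

Lemma measurable_cons_fun n (f : 'rV[R]_n.+1 -> \bar R) : measurable_fun setT f ->
  measurable_fun setT (fun z : measurableTypeR R * 'rV[R]_n => f (rV_cons z)).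
Proof. by move=> mf; apply: measurableT_comp => //; exact: measurable_rV_cons. Qed.

Lemma integral_cubeS_swap n (a : 'rV[R]_n.+1) (h : R) (f : 'rV[R]_n.+1 -> \bar R) :
  measurable_fun setT f -> (forall x, 0 <= f x)%E ->
  (\int[bl n.+1]_(x in cube a h) f x =
   \int[bl n]_(x in cube (row_tail a) h) \int[leb]_(s in `[a ord0 ord0, (a ord0 ord0 + h)%R[) f (rV_cons (s, x)))%E.
Proof.
move=> mf f0; rewrite integral_cubeS//.
apply: (@tonelli_restrict _ _ (measurableTypeR R) 'rV[R]_n R leb (bl n) _ _ _ _
  (fun z => f (rV_cons z))) => //; first exact: measurable_cube.
exact: measurable_cons_fun.
Qed.

End slices.

Section poincare.
Context {R : realType}.
Local Notation bl := (@borel_lebesgue R).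
Local Notation leb := (@lebesgue_measure R).

Lemma measurable_continuousE n (f : 'rV[R]_n -> R) : continuous f ->
  measurable_fun setT (fun x => (f x)%:E).
Proof. by move=> cf; apply/measurable_EFinP; exact: continuous_measurable_rV. Qed.

Lemma continuous_abs_derive n (f : 'rV[R]_n -> R) i : Ck 1 f ->
  continuous (fun x => `|'D_(ebase i) f x|).
Proof.
move=> [_ /(_ i)[_ [cf _]]] x.
by apply: (@continuous_comp _ _ _ ('D_(ebase i) f) Num.norm); [exact: cf|exact: norm_continuous].
Qed.

(** Induction on the dimension: the first coordinate is changed by the fundamental theorem of
    calculus, the others by the induction hypothesis in a slice. Both steps are L^1 estimates on a
    product and contribute the same constant, so [h^(n+1)] is reproduced. *)
Lemma poincare_cube n (f : 'rV[R]_n -> R) (a : 'rV[R]_n) (h : R) : 0 <= h -> Ck 1 f ->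
  (\int[bl n]_(y in cube a h) \int[bl n]_(z in cube a h) (`|f y - f z|)%:E <=
   (h ^+ n.+1)%:E * \sum_(i < n) \int[bl n]_(y in cube a h) (`|'D_(ebase i) f y|)%:E)%E.
Proof.
move=> h0; elim: n f a => [|n ih] f a Cf.
  rewrite big_ord0 mule0 integral0_eq// => y _; rewrite integral0_eq// => z _.
  by rewrite (_ : y = z) ?subrr ?normr0//; apply/rowP => -[].
pose I := `[a ord0 ord0, a ord0 ord0 + h[%classic : set (measurableTypeR R).
pose Q := cube (row_tail a) h.
have mI : measurable I by exact: measurable_itv.
have mQ : measurable Q by exact: measurable_cube.
have mf : measurable_fun setT f by exact: continuous_measurable_rV (Ck_continuous Cf).
have mfc : measurable_fun setT (fun z : measurableTypeR R * 'rV[R]_n => f (rV_cons z)).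
  by apply: measurableT_comp => //; exact: measurable_rV_cons.
have muQ : bl n Q = (h ^+ n)%:E by exact: borel_lebesgue_hbox.
have muI : leb I = h%:E by exact: lebesgue_measure_co.
have md i := measurable_continuousE (@continuous_abs_derive _ f i Cf).
(* [G y] bounds every variation along the first coordinate above [y], and [H y] collects the
   differences within one slice. The triangle inequality through the point (t, y) gives the bound
   [inner]. *)
pose G (y : 'rV[R]_n) := (\int[leb]_(s in I) (`|'D_(ebase ord0) f (rV_cons (s, y))|)%:E)%E.
pose H (y : 'rV[R]_n) := (\int[leb]_(t in I) \int[bl n]_(z in Q)
  (`|f (rV_cons (t, y)) - f (rV_cons (t, z))|)%:E)%E.
have mG : measurable_fun setT G.
  have := @measurable_fun_inner_integral _ _ 'rV[R]_n (measurableTypeR R) R leb I mI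
    (fun z => (`|'D_(ebase ord0) f (rV_cons (z.2, z.1))|)%:E).
  apply => //; apply: (measurableT_comp (measurable_cons_fun (md ord0))).
  exact: measurable_swap.
have mHK : measurable_fun setT (fun w : ('rV[R]_n * measurableTypeR R) * 'rV[R]_n =>
    (`|f (rV_cons (w.1.2, w.1.1)) - f (rV_cons (w.1.2, w.2))|)%:E).
  apply/measurable_EFinP; apply: measurableT_comp => //; apply: measurable_funB.
    apply: (measurableT_comp mfc); apply: measurable_fun_pair.
      by apply: (measurableT_comp measurable_snd); exact: measurable_fst.
    by apply: (measurableT_comp measurable_fst); exact: measurable_fst.
  apply: (measurableT_comp mfc); apply: measurable_fun_pair; last exact: measurable_snd.
  by apply: (measurableT_comp measurable_snd); exact: measurable_fst.
have mHi : measurable_fun setT (fun z : 'rV[R]_n * measurableTypeR R =>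
    \int[bl n]_(y in Q) (`|f (rV_cons (z.2, z.1)) - f (rV_cons (z.2, y))|)%:E)%E.
  exact: (measurable_fun_inner_integral (bl n) mQ mHK).
have mHK' : measurable_fun setT (fun w : (measurableTypeR R * 'rV[R]_n) * 'rV[R]_n =>
    (`|f (rV_cons (w.1.1, w.1.2)) - f (rV_cons (w.1.1, w.2))|)%:E).
  apply/measurable_EFinP; apply: measurableT_comp => //; apply: measurable_funB.
    apply: (measurableT_comp mfc); apply: measurable_fun_pair.
      by apply: (measurableT_comp measurable_fst); exact: measurable_fst.
    by apply: (measurableT_comp measurable_snd); exact: measurable_fst.
  apply: (measurableT_comp mfc); apply: measurable_fun_pair; last exact: measurable_snd.
  by apply: (measurableT_comp measurable_fst); exact: measurable_fst.
have mHi' : measurable_fun setT (fun z : measurableTypeR R * 'rV[R]_n =>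
    \int[bl n]_(y in Q) (`|f (rV_cons (z.1, z.2)) - f (rV_cons (z.1, y))|)%:E)%E.
  exact: (measurable_fun_inner_integral (bl n) mQ mHK').
have mH : measurable_fun setT H.
  apply: (@measurable_fun_inner_integral _ _ 'rV[R]_n (measurableTypeR R) R leb I mI
    (fun z => \int[bl n]_(y in Q) (`|f (rV_cons (z.2, z.1)) - f (rV_cons (z.2, y))|)%:E)%E) => //.
  by move=> z; apply: integral_ge0 => y _; rewrite lee_fin.
have G0 y : (0 <= G y)%E by apply: integral_ge0 => s _; rewrite lee_fin.
have H0 y : (0 <= H y)%E.
  by apply: integral_ge0 => s _; apply: integral_ge0 => z _; rewrite lee_fin.
have mK1 (c : R) : measurable_fun setT (fun w : measurableTypeR R * 'rV[R]_n =>
    (`|c - f (rV_cons w)|)%:E).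
  apply/measurable_EFinP; apply: measurableT_comp => //.
  by apply: measurable_funB => //; exact: measurable_cst.
have mK2 (y : 'rV[R]_n) : measurable_fun setT (fun w : measurableTypeR R * 'rV[R]_n =>
    (`|f (rV_cons (w.1, y)) - f (rV_cons w)|)%:E).
  apply/measurable_EFinP; apply: measurableT_comp => //.
  apply: measurable_funB => //; apply: (measurableT_comp mfc).
  by apply: measurable_fun_pair; [exact: measurable_fst|exact: measurable_cst].
have mI1 c : measurable_fun I (fun t => \int[bl n]_(z in Q) (`|c - f (rV_cons (t, z))|)%:E)%E.
  by apply: measurable_funTS; exact: (measurable_fun_inner_integral (bl n) mQ (mK1 c)).
have mI2 y : measurable_fun I (fun t => \int[bl n]_(z in Q)
    (`|f (rV_cons (t, y)) - f (rV_cons (t, z))|)%:E)%E.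
  by apply: measurable_funTS; exact: (measurable_fun_inner_integral (bl n) mQ (mK2 y)).
have mK3 c t : measurable_fun Q (fun z => (`|c - f (rV_cons (t, z))|)%:E).
  by apply: measurable_funTS; exact: (measurableT_comp (mK1 c) (pair1_measurable t)).
have hn0 k : (0 <= (h ^+ k)%:E)%E by rewrite lee_fin exprn_ge0.
have inner s y : I s -> ((\int[bl n.+1]_(z in cube a h) (`|f (rV_cons (s, y)) - f z|)%:E) <=
    (h ^+ n.+1)%:E * G y + H y)%E.
  move=> Is; rewrite integral_cubeS//; last first.
    apply/measurable_EFinP; apply: measurableT_comp => //.
    by apply: measurable_funB => //; exact: measurable_cst.
  rewrite -/I -/Q.
  apply: (@le_trans _ _ (\int[leb]_(t in I) (cst ((h ^+ n)%:E * G y) t +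
     \int[bl n]_(z in Q) (`|f (rV_cons (t, y)) - f (rV_cons (t, z))|)%:E))%E).
    apply: ge0_le_integral => //.
    - by move=> t _; apply: integral_ge0 => z _; rewrite lee_fin.
    - by apply: emeasurable_funD => //; exact: mI2.
    - move=> t It /=.
      apply: (@le_trans _ _ (\int[bl n]_(z in Q) (cst (G y) z +
         (`|f (rV_cons (t, y)) - f (rV_cons (t, z))|)%:E))%E).
        apply: ge0_le_integral => //.
        + by apply: emeasurable_funD; [exact: measurable_cst|exact: mK3].
        + move=> z _ /=.
          apply: (@le_trans _ _ ((`|f (rV_cons (s, y)) - f (rV_cons (t, y))|)%:E +
             (`|f (rV_cons (t, y)) - f (rV_cons (t, z))|)%:E)%E).
            by rewrite -EFinD lee_fin ler_distD.
          apply: leeD => //; move: Is It; rewrite /I /= !in_itv/= => Is It.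
          apply: (@FTC_bound R (fun s => f (rV_cons (s, y)))
            (fun s => 'D_(ebase ord0) f (rV_cons (s, y))) (a ord0 ord0) (a ord0 ord0 + h)) => //.
            move=> r; apply: is_derive_slice0; apply: DeriveDef => //.
            by case: Cf => _ /(_ ord0)[].
          move=> r; apply: (@continuous_comp _ _ _ (fun s => rV_cons (s, y)) ('D_(ebase ord0) f)).
            exact: continuous_rV_cons_l.
          by case: Cf => _ /(_ ord0)[_ [cf _]]; exact: cf.
      rewrite (@ge0_integralD _ _ _ (bl n) Q mQ (cst (G y)) _ (fun _ _ => G0 y)
        (@measurable_cst _ _ _ _ Q (G y)) _ (mK3 (f (rV_cons (t, y))) t)); last first.
        by move=> z _; rewrite lee_fin.
      by rewrite (integral_cst (bl n) mQ) [X in (_ * X)%E]muQ muleC.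
  rewrite (@ge0_integralD _ _ _ leb I mI (cst ((h ^+ n)%:E * G y)%E) _
    (fun _ _ => mule_ge0 (hn0 n) (G0 y)) (@measurable_cst _ _ _ _ I _) _ (mI2 y)); last first.
    by move=> t _; apply: integral_ge0 => z _; rewrite lee_fin.
  rewrite (integral_cst leb mI) [X in (_ * X)%E]muI leeD2r//.
  by rewrite muleAC -EFinM -exprSr.
have mIn : measurable_fun setT (fun y => \int[bl n.+1]_(z in cube a h) (`|f y - f z|)%:E)%E.
  apply: (@measurable_fun_inner_integral _ _ 'rV[R]_n.+1 'rV[R]_n.+1 R (bl n.+1) (cube a h)
    (measurable_cube _ _) (fun z => (`|f z.1 - f z.2|)%:E)) => //.
  apply/measurable_EFinP; apply: measurableT_comp => //; apply: measurable_funB.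
    by apply: (measurableT_comp mf); exact: measurable_fst.
  by apply: (measurableT_comp mf); exact: measurable_snd.
have mGH : measurable_fun Q (fun y => (h ^+ n.+1)%:E * G y + H y)%E.
  apply: measurable_funTS; apply: emeasurable_funD => //.
  exact: measurable_funeM.
rewrite integral_cubeS//; last by move=> y; apply: integral_ge0 => z _; rewrite lee_fin.
rewrite -/I -/Q.
apply: (@le_trans _ _ (\int[leb]_(s in I) cst (\int[bl n]_(y in Q) ((h ^+ n.+1)%:E * G y + H y)) s)%E).
  apply: ge0_le_integral => //.
  - by move=> s _; apply: integral_ge0 => y _; apply: integral_ge0 => z _; rewrite lee_fin.
  - apply: measurable_funTS.
    apply: (@measurable_fun_inner_integral _ _ (measurableTypeR R) 'rV[R]_n R (bl n) Q mQ
      (fun z => \int[bl n.+1]_(w in cube a h) (`|f (rV_cons z) - f w|)%:E)%E) => //.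
      exact: (measurable_cons_fun mIn).
    by move=> z; apply: integral_ge0 => w _; rewrite lee_fin.
  - move=> s Is /=; apply: ge0_le_integral => //.
    + by move=> y _; apply: integral_ge0 => z _; rewrite lee_fin.
    + apply: measurable_funTS; apply: (measurableT_comp mIn).
      exact: (measurableT_comp (@measurable_rV_cons R n) (pair1_measurable s)).
    + by move=> y _; exact: inner.
rewrite (integral_cst leb mI) [X in (_ * X)%E]muI.
rewrite (@ge0_integralD _ _ _ (bl n) Q mQ _ H (fun y _ => mule_ge0 (hn0 n.+1) (G0 y))
  (measurable_funTS (measurable_funeM _ mG)) (fun y _ => H0 y) (measurable_funTS mH)).
rewrite (ge0_integralZl (bl n) mQ (measurable_funTS mG) (fun y _ => G0 y) (hn0 n.+1)).
have -> : (\int[bl n]_(y in Q) G y = \int[bl n.+1]_(y in cube a h) (`|'D_(ebase ord0) f y|)%:E)%E.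
  by rewrite integral_cubeS_swap.
(* After exchanging the integrals, the induction hypothesis applies in each slice. *)
have HB : (\int[bl n]_(y in Q) H y <= (h ^+ n.+1)%:E *
    \sum_(j < n) \int[bl n.+1]_(y in cube a h) (`|'D_(ebase (lift ord0 j)) f y|)%:E)%E.
  have -> : (\int[bl n]_(y in Q) H y = \int[leb]_(t in I) \int[bl n]_(y in Q)
      \int[bl n]_(z in Q) (`|f (rV_cons (t, y)) - f (rV_cons (t, z))|)%:E)%E.
    apply: (@tonelli_restrict _ _ 'rV[R]_n (measurableTypeR R) R (bl n) leb Q I mQ mI
      (fun z => \int[bl n]_(y in Q) (`|f (rV_cons (z.2, z.1)) - f (rV_cons (z.2, y))|)%:E)%E) => //.
    by move=> z; apply: integral_ge0 => y _; rewrite lee_fin.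
  have mdj j : measurable_fun I (fun t => \int[bl n]_(y in Q)
      (`|'D_(ebase (lift ord0 j)) f (rV_cons (t, y))|)%:E)%E.
    apply: measurable_funTS.
    apply: (@measurable_fun_inner_integral _ _ (measurableTypeR R) 'rV[R]_n R (bl n) Q mQ
      (fun z => (`|'D_(ebase (lift ord0 j)) f (rV_cons z)|)%:E)) => //.
    exact: (measurable_cons_fun (md (lift ord0 j))).
  apply: (@le_trans _ _ (\int[leb]_(t in I) ((h ^+ n.+1)%:E * \sum_(j < n)
      \int[bl n]_(y in Q) (`|'D_(ebase (lift ord0 j)) f (rV_cons (t, y))|)%:E))%E).
    apply: ge0_le_integral => //.
    - by move=> t _; apply: integral_ge0 => y _; apply: integral_ge0 => z _; rewrite lee_fin.
    - apply: measurable_funTS.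
      apply: (@measurable_fun_inner_integral _ _ (measurableTypeR R) 'rV[R]_n R (bl n) Q mQ
        (fun z => \int[bl n]_(y in Q) (`|f (rV_cons (z.1, z.2)) - f (rV_cons (z.1, y))|)%:E)%E) => //.
      by move=> z; apply: integral_ge0 => y _; rewrite lee_fin.
    - by apply: measurable_funeM; apply: emeasurable_sum => j; exact: mdj.
    - move=> t It /=; apply: (le_trans (ih _ (row_tail a) (Ck1_slice t Cf))).
      apply: lee_wpmul2l; first exact: hn0.
      apply: lee_sum => j _; rewrite le_eqVlt; apply/orP; left; apply/eqP; apply: eq_integral => y _.
      by have /(congr1 (@^~ y)) /= -> := derive_sliceS t j Cf.
  have d0 j t : (0 <= \int[bl n]_(y in Q) (`|'D_(ebase (lift ord0 j)) f (rV_cons (t, y))|)%:E)%E.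
    by apply: integral_ge0 => y _; rewrite lee_fin.
  have ds0 (t : measurableTypeR R) : I t -> (0 <= \sum_(j < n)
      \int[bl n]_(y in Q) (`|'D_(ebase (lift ord0 j)) f (rV_cons (t, y))|)%:E)%E.
    by move=> _; apply: sume_ge0 => j _; exact: d0.
  rewrite (ge0_integralZl leb mI (emeasurable_sum _ mdj) ds0 (hn0 n.+1)).
  apply: lee_wpmul2l; first exact: hn0.
  rewrite (ge0_integral_sum leb mI mdj (fun j t _ => d0 j t)).
  by apply: lee_sum => j _; rewrite (integral_cubeS _ _ (md _)).
have D00 : (0 <= \int[bl n.+1]_(y in cube a h) (`|'D_(ebase ord0) f y|)%:E)%E.
  by apply: integral_ge0 => y _; rewrite lee_fin.
have DS0 : (0 <= \sum_(j < n) \int[bl n.+1]_(y in cube a h) (`|'D_(ebase (lift ord0 j)) f y|)%:E)%E.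
  by apply: sume_ge0 => j _; apply: integral_ge0 => y _; rewrite lee_fin.
have HQ0 : (0 <= \int[bl n]_(y in Q) H y)%E by apply: integral_ge0 => y _; exact: H0.
rewrite big_ord_recl; move: D00 DS0 HQ0 HB.
move: (integral _ _ _) (\sum_(j < n) _)%R (integral _ _ _) => u v w u0 v0 w0 wv.
rewrite muleC (ge0_muleDr _ (mule_ge0 (hn0 n.+1) u0) w0) (ge0_muleDr _ u0 v0).
rewrite !muleA -!EFinM -exprS; apply: leeD2l.
apply: (@le_trans _ _ (h%:E * ((h ^+ n.+1)%:E * v))%E).
  by apply: lee_wpmul2l wv; rewrite lee_fin.
by rewrite muleA -EFinM -exprS.
Qed.

End poincare.

(** * Dyadic averages *)

Section power_inequalities.
Context {R : realType}.
Implicit Types a b t p r : R.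

(** Young's inequality for [t] and [a^(p-1)] with conjugate exponents p and p/(p-1). It says that
    [t^p] lies above its tangent at [a]; integrated, it serves as Jensen's and as Hoelder's
    inequality. *)
Lemma powR_tangent a t p : 1 < p -> 0 <= a -> 0 <= t ->
  p * a `^ (p - 1) * t <= t `^ p + (p - 1) * a `^ p.
Proof.
move=> p1 a0 t0; have p0 : 0 < p by apply: lt_trans p1.
have p10 : 0 < p - 1 by rewrite subr_gt0.
have q0 : 0 < p / (p - 1) by rewrite divr_gt0.
have pq : p^-1 + (p / (p - 1))^-1 = 1 by field; rewrite !gt_eqF.
have := conjugate_powR t0 (powR_ge0 a (p - 1)) p0 q0 pq.
rewrite -powRrM (_ : (p - 1) * (p / (p - 1)) = p); last by field; rewrite gt_eqF.
move=> /(ler_wpM2l (ltW p0)).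
rewrite (_ : p * (t `^ p / p + _) = t `^ p + (p - 1) * a `^ p); last by field; rewrite !gt_eqF.
by rewrite (mulrC t) mulrA.
Qed.

Lemma powR_homo r a b : 0 <= r -> 0 <= a -> a <= b -> a `^ r <= b `^ r.
Proof. by move=> r0 a0 ab; apply: ge0_ler_powR => //; rewrite nnegrE// (le_trans a0). Qed.

Lemma powR_exprn a n : 0 <= a -> (a ^+ n) = a `^ n%:R.
Proof. by move=> a0; rewrite powR_mulrn. Qed.

Lemma powRXn a r n : 0 <= a -> (a ^+ n) `^ r = (a `^ r) ^+ n.
Proof.
by move=> a0; rewrite (powR_exprn _ a0) -powRrM mulrC powRrM powR_mulrn// powR_ge0.
Qed.

End power_inequalities.

Section subset_integrals.
Context d (T : measurableType d) (R : realType) (mu : {measure set T -> \bar R}).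

Lemma le_Rintegral_subset (A B : set T) (f : T -> R) : measurable A -> measurable B ->
  A `<=` B -> mu.-integrable B (EFin \o f) -> (forall x, B x -> 0 <= f x) ->
  \int[mu]_(x in A) f x <= \int[mu]_(x in B) f x.
Proof.
move=> mA mB AB fi f0; rewrite -lee_fin !EFin_Rintegral//; last exact: integrableS fi.
apply: ge0_subset_integral => //; apply/measurable_EFinP.
exact: integrable_fun_measurable fi.
Qed.

End subset_integrals.

Section dyadic_cells.
Context {R : realType} {n : nat}.
Local Notation bl := (@borel_lebesgue R n).
Implicit Types x y : 'rV[R]_n.

Definition mesh (j : nat) : R := 2^-1 ^+ j.

Lemma mesh_gt0 j : 0 < mesh j. Proof. by rewrite exprn_gt0// invr_gt0. Qed.

Lemma meshK j : mesh j * 2 ^+ j = 1. Proof. by rewrite -exprMn mulVf// expr1n. Qed.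

(** The lower corner of the half-open dyadic cube of side [2^-j] that contains [x]. Equality of
    anchors is an equivalence relation whose classes are the cells. *)
Definition anchor j x : 'rV[R]_n := \row_i (mesh j * (Num.floor (2 ^+ j * x ord0 i))%:~R).

Definition cell j x : set 'rV[R]_n := cube (anchor j x) (mesh j).

Lemma anchor_eqP j x y : anchor j y = anchor j x <->
  forall i, Num.floor (2 ^+ j * y ord0 i) = Num.floor (2 ^+ j * x ord0 i).
Proof.
split => [/rowP h i|h].
  have := h i; rewrite !mxE => /(mulfI (lt0r_neq0 (mesh_gt0 j)))/eqP.
  by rewrite eqr_int => /eqP.
by apply/rowP => i; rewrite !mxE h.
Qed.

Lemma cellP j x y : cell j x y <-> anchor j y = anchor j x.
Proof.
rewrite anchor_eqP.
have E i : ((anchor j x ord0 i <= y ord0 i < anchor j x ord0 i + mesh j) =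
    (Num.floor (2 ^+ j * y ord0 i) == Num.floor (2 ^+ j * x ord0 i))).
  rewrite floor_eq !mxE.
  set z := (Num.floor (2 ^+ j * x ord0 i)).
  have -> : mesh j * z%:~R + mesh j = mesh j * (z + 1)%:~R by rewrite intrD mulrDr mulr1.
  have yE : y ord0 i = mesh j * (2 ^+ j * y ord0 i) by rewrite mulrA meshK mul1r.
  by rewrite {1 2}yE ler_pM2l ?mesh_gt0// ltr_pM2l ?mesh_gt0.
split => h i; have := h i; rewrite !mxE.
  by move=> hh; apply/eqP; rewrite -E !mxE.
by move=> hh; move/eqP: hh; rewrite -E !mxE.
Qed.

Lemma cell_self j x : cell j x x. Proof. exact/cellP. Qed.

Lemma cellS j x : cell j.+1 x `<=` cell j x.
Proof.
move=> y /cellP/anchor_eqP h; apply/cellP/anchor_eqP => i.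
(* The integer part at scale [j] is determined by the one at scale [j + 1], through the integers
   below it. *)
have E (z : R) (m : int) : (m <= Num.floor (2 ^+ j * z)) = (m *+ 2 <= Num.floor (2 ^+ j.+1 * z)) :> bool.
  rewrite !floor_ge_int exprS -mulrA (_ : (m *+ 2)%:~R = 2 * m%:~R :> R).
    by rewrite ler_pM2l.
  by rewrite mulr2n intrD mulr2n mulrDl mul1r.
by apply/eqP; rewrite eq_le E -h -E lexx/= E h -E lexx.
Qed.

Lemma measurable_anchor_eq j (a : 'rV[R]_n) : measurable [set x | anchor j x = a].
Proof.
pose P (i : 'I_n) : set (measurableTypeR R) :=
  (fun s : R => mesh j * (Num.floor (2 ^+ j * s))%:~R) @^-1` [set a ord0 i].
have -> : [set x : 'rV[R]_n | anchor j x = a] = [set x | forall i, P i (x ord0 i)].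
  apply/seteqP; split => x /= h; first by move=> i; rewrite /P /= -h mxE.
  by apply/rowP => i; have := h i; rewrite /P /= mxE.
apply: measurable_coord_box => i; rewrite -[P i]setTI.
apply: (nondecreasing_measurable (f := fun s : R => mesh j * (Num.floor (2 ^+ j * s))%:~R)) => //.
move=> s t st; rewrite ler_pM2l ?mesh_gt0// ler_int le_floor//.
by rewrite ler_pM2l// exprn_gt0.
Qed.

Definition lattice_point j (c : 'rV[int]_n) : 'rV[R]_n := \row_i (mesh j * (c ord0 i)%:~R).

Lemma anchor_lattice j x : anchor j x = lattice_point j (\row_i Num.floor (2 ^+ j * x ord0 i)).
Proof. by apply/rowP => i; rewrite !mxE. Qed.

(** [F] is arbitrary: [anchor j] takes countably many values, each on a measurable set. *)
Lemma measurable_comp_anchor d (T : measurableType d) j (F : 'rV[R]_n -> T) :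
  measurable_fun setT (F \o anchor j).
Proof.
move=> _ A mA; rewrite setTI.
rewrite (_ : _ @^-1` _ = \bigcup_(c : 'rV[int]_n)
  (if `[< A (F (lattice_point j c)) >] then [set x | anchor j x = lattice_point j c] else set0)).
  apply: countable_bigcupT_measurable => [|c]; first exact: countableP.
  by case: ifP => // _; exact: measurable_anchor_eq.
apply/seteqP; split => [x /= Ax|x [c _]]; last by case: asboolP => //= h ->.
exists (\row_i Num.floor (2 ^+ j * x ord0 i)) => //.
by rewrite asboolT -?anchor_lattice.
Qed.

Lemma measurable_same_cell j : measurable [set z : 'rV[R]_n * 'rV[R]_n | anchor j z.1 = anchor j z.2].
Proof.
rewrite (_ : mkset _ = \bigcup_(c : 'rV[int]_n)
  ([set x | anchor j x = lattice_point j c] `*` [set x | anchor j x = lattice_point j c])).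
  apply: countable_bigcupT_measurable => [|c]; first exact: countableP.
  by apply: measurableX; exact: measurable_anchor_eq.
apply/seteqP; split => [[x y] /= xy|[x y] [c _ /= [-> ->]]]//.
by exists (\row_i Num.floor (2 ^+ j * x ord0 i)) => //=; rewrite -xy -anchor_lattice.
Qed.

Lemma measurable_cell j x : measurable (cell j x).
Proof. exact: measurable_cube. Qed.

Lemma measure_cell j x : bl (cell j x) = (mesh j ^+ n)%:E.
Proof. by apply: borel_lebesgue_hbox; rewrite ltW// mesh_gt0. Qed.

Lemma bounded_integrable_cell (f : 'rV[R]_n -> R) (B : R) j x : measurable_fun setT f ->
  (forall x, `|f x| <= B) -> bl.-integrable (cell j x) (EFin \o f).
Proof.
move=> mf fB; apply: measurable_bounded_integrable.
- exact: measurable_cell.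
- by suff: (bl (cell j x) < +oo)%E by []; rewrite measure_cell ltry.
- exact: measurable_funTS.
- exists B; split; first by rewrite num_real.
  by move=> M BM y _; exact: le_trans (fB y) (ltW BM).
Qed.

Definition avg j (f : 'rV[R]_n -> R) x : R := (2 ^+ j) ^+ n * \int[bl]_(y in cell j x) f y.

Lemma avg_anchor j f x y : anchor j x = anchor j y -> avg j f x = avg j f y.
Proof. by move=> h; rewrite /avg /cell h. Qed.

Lemma measurable_avg j f : measurable_fun setT (avg j f).
Proof.
pose F (a : 'rV[R]_n) := (2 ^+ j) ^+ n * \int[bl]_(y in cube a (mesh j)) f y.
exact: (measurable_comp_anchor j F).
Qed.

Lemma cell_normalize j : (2 ^+ j) ^+ n * mesh j ^+ n = 1 :> R.
Proof. by rewrite -exprMn mulrC meshK expr1n. Qed.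

Lemma Rintegral_cell_cst j x (c : R) : \int[bl]_(y in cell j x) c = c * mesh j ^+ n.
Proof.
rewrite Rintegral_cst; last exact: measurable_cell.
by congr (_ * _); exact: (congr1 fine (measure_cell j x)).
Qed.

Lemma avg_local_le j (f : 'rV[R]_n -> R) x (B e : R) : measurable_fun setT f ->
  (forall x, `|f x| <= B) -> (forall y, cell j x y -> `|f y| <= e) -> `|avg j f x| <= e.
Proof.
move=> mf fB fe.
have fi := bounded_integrable_cell j x mf fB.
rewrite normrM ger0_norm ?exprn_ge0//.
have h : `|\int[bl]_(y in cell j x) f y| <= e * mesh j ^+ n.
  apply: (le_trans (le_normr_Rintegral (measurable_cell j x) fi)).
  apply: (@le_trans _ _ (\int[bl]_(y in cell j x) cst e y)).
    apply: le_Rintegral => //; first exact: measurable_cell.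
    - exact: integrable_norm.
    - apply: (bounded_integrable_cell (B := `|e|)) => //; exact: measurable_cst.
  by rewrite Rintegral_cell_cst.
rewrite [leRHS](_ : e = (2 ^+ j) ^+ n * (e * mesh j ^+ n)); last first.
  by rewrite mulrCA cell_normalize mulr1.
by apply: ler_wpM2l => //; rewrite !exprn_ge0.
Qed.

(** Jensen's inequality, by averaging the tangent inequality at [a = avg j g x] over the cell. *)
Lemma avg_jensen j (g : 'rV[R]_n -> R) x (p B : R) : 1 < p -> measurable_fun setT g ->
  (forall x, 0 <= g x <= B) -> avg j g x `^ p <= avg j (fun y => g y `^ p) x.
Proof.
move=> p1 mg gB.
have p0 : 0 <= p by rewrite ltW// (lt_trans _ p1).
have g0 y : 0 <= g y by case/andP: (gB y).
have gi : bl.-integrable (cell j x) (EFin \o g).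
  apply: (bounded_integrable_cell (B := B)) => // y.
  by rewrite ger0_norm//; case/andP: (gB y).
have mgp : measurable_fun setT (fun y => g y `^ p).
  exact: (measurableT_comp (measurable_powR p)).
have gpi : bl.-integrable (cell j x) (EFin \o (fun y => g y `^ p)).
  apply: (bounded_integrable_cell (B := B `^ p)) => // y.
  rewrite ger0_norm ?powR_ge0//; apply: powR_homo => //.
  by case/andP: (gB y).
set N := (2 ^+ j) ^+ n : R.
set A := avg j g x.
have A0 : 0 <= A.
  by rewrite /A /avg mulr_ge0 ?exprn_ge0//; apply: Rintegral_ge0.
have ci (c : R) : bl.-integrable (cell j x) (EFin \o (fun=> c)).
  by apply: (bounded_integrable_cell (B := `|c|)) => //; exact: measurable_cst.
have h : \int[bl]_(y in cell j x) (p * A `^ (p - 1) * g y) <=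
    \int[bl]_(y in cell j x) (g y `^ p + (p - 1) * A `^ p).
  apply: le_Rintegral.
  - exact: measurable_cell.
  - by apply: integrable_cst_mul => //; exact: measurable_cell.
  - by apply: integrable_add => //; exact: measurable_cell.
  - by move=> y _; exact: powR_tangent.
move: h; rewrite RintegralZl//; last exact: measurable_cell.
rewrite RintegralD//; last exact: measurable_cell.
rewrite Rintegral_cell_cst.
have N0 : 0 <= N by rewrite !exprn_ge0.
move=> /(ler_wpM2l N0).
set I1 := \int[bl]_(y in _) g y; set I2 := \int[bl]_(y in _) (g y `^ p).
have NK : N * mesh j ^+ n = 1 := cell_normalize j.
have NA : N * I1 = A by [].
have AA : A `^ (p - 1) * A = A `^ p.
  have [->|An0] := eqVneq A 0; first by rewrite mulr0 powR0// gt_eqF// (lt_trans _ p1).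
  by rewrite -{2}(powRr1 A0) -powRD ?An0 ?implybT// subrK.
have -> : N * (p * A `^ (p - 1) * I1) = p * A `^ p by rewrite -AA -NA; ring.
have -> : N * (I2 + (p - 1) * A `^ p * mesh j ^+ n) = N * I2 + (p - 1) * A `^ p.
  by rewrite mulrDr mulrCA NK mulr1.
by rewrite /avg -/N -/I2; lra.
Qed.

(** Tonelli's theorem for the kernel [N * \1_S], where [S] is the set of pairs in a common cell: the
    kernel is symmetric and has integral 1 in each variable. *)
Lemma integral_avg j (G : 'rV[R]_n -> R) (B : R) : measurable_fun setT G ->
  (forall x, 0 <= G x <= B) ->
  (\int[bl]_x (avg j G x)%:E = \int[bl]_x (G x)%:E)%E.
Proof.
move=> mG GB.
have G0 y : 0 <= G y by case/andP: (GB y).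
have Gi x : bl.-integrable (cell j x) (EFin \o G).
  apply: (bounded_integrable_cell (B := B)) => // y.
  by rewrite ger0_norm//; case/andP: (GB y).
pose N : R := (2 ^+ j) ^+ n.
pose S := [set z : 'rV[R]_n * 'rV[R]_n | anchor j z.1 = anchor j z.2].
pose K (z : 'rV[R]_n * 'rV[R]_n) : \bar R := (N * (G z.2 * \1_S z))%:E.
have mK : measurable_fun setT K.
  apply/measurable_EFinP; apply: measurable_funM => //; apply: measurable_funM.
    by apply: (measurableT_comp mG); exact: measurable_snd.
  by apply: measurable_indic; exact: measurable_same_cell.
have K0 z : (0 <= K z)%E by rewrite lee_fin !mulr_ge0 ?exprn_ge0.
have := @tonelli_restrict _ _ 'rV[R]_n 'rV[R]_n R bl bl setT setT measurableT measurableT K mK K0.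
have -> : (\int[bl]_x \int[bl]_y K (x, y) = \int[bl]_x (avg j G x)%:E)%E.
  apply: eq_integral => x _.
  have -> : (avg j G x)%:E = (N%:E * \int[bl]_(y in cell j x) (G y)%:E)%E.
    by rewrite -(EFin_Rintegral (measurable_cell j x) (Gi x)) -EFinM.
  have mGc : measurable_fun (cell j x) (fun y => (G y)%:E).
    by apply: measurable_funTS; exact/measurable_EFinP.
  have N0 : (0 <= N%:E)%E by rewrite lee_fin !exprn_ge0.
  rewrite -(ge0_integralZl bl (measurable_cell j x) mGc (fun y _ => G0 y) N0) [RHS]integral_mkcond.
  apply: eq_integral => y _; rewrite /K/= patchE indicE.
  have -> : ((x, y) \in S) = (y \in cell j x).
    by apply/idP/idP => /set_mem h; apply/mem_set; [apply/cellP; rewrite -h|apply/esym; exact/cellP].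
  by case: ifP => _; rewrite ?mulr1 ?mulr0// EFinM.
move=> ->; apply: eq_integral => y _.
rewrite (_ : integral _ _ _ = \int[bl]_(x in cell j y) cst (N * G y)%:E x)%E.
  rewrite integral_cst; last exact: measurable_cell.
  by rewrite [X in (_ * X)%E]measure_cell -EFinM mulrAC /N cell_normalize mul1r.
rewrite [RHS]integral_mkcond; apply: eq_integral => x _; rewrite /K/= patchE indicE.
have -> : ((x, y) \in S) = (x \in cell j y).
  by apply/idP/idP => /set_mem h; apply/mem_set; [apply/cellP|exact/cellP].
by case: ifP => _; rewrite ?mulr1 ?mulr0.
Qed.

Section smooth_average.
Variables (f : 'rV[R]_n -> R) (B : R).
Hypotheses (Cf : Ck 1 f) (fB : forall x, `|f x| <= B).

(** The l^1 norm of the gradient, the form in which it appears in [poincare_cube]. *)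
Definition grad1 x : R := \sum_(i < n) `|'D_(ebase i) f x|.

Lemma grad1_ge0 x : 0 <= grad1 x. Proof. by apply: sumr_ge0. Qed.

Lemma continuous_grad1 : continuous grad1.
Proof.
suff : forall s : seq 'I_n, continuous (fun x => \sum_(i <- s) `|'D_(ebase i) f x|) by exact.
elim=> [|i s ih].
  rewrite (_ : (fun x => _) = (fun=> 0)); first exact: cst_continuous.
  by apply/funext => x; rewrite big_nil.
rewrite (_ : (fun x => _) = (fun x => `|'D_(ebase i) f x| + \sum_(i <- s) `|'D_(ebase i) f x|)).
  move=> x; apply: (@continuousD _ _ _ (fun x => `|'D_(ebase i) f x|)
    (fun x => \sum_(i <- s) `|'D_(ebase i) f x|) x); last exact: ih.
  exact: (@continuous_abs_derive _ _ f i Cf x).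
by apply/funext => x; rewrite big_cons.
Qed.

Hypothesis gB : forall x, grad1 x <= B.

Let mf : measurable_fun setT f. Proof. exact: continuous_measurable_rV (Ck_continuous Cf). Qed.
Let mg : measurable_fun setT grad1. Proof. exact: continuous_measurable_rV continuous_grad1. Qed.

(** Passing from the smaller cell to the larger one costs the ratio [2^n] of their volumes. The mean
    oscillation on the larger cell is bounded by [poincare_cube], whose constant divided by the
    squared volume, against the average of the gradient, leaves one factor [mesh j]. *)
Lemma avg_diff j x : `|avg j.+1 f x - avg j f x| <= 2 ^+ n * mesh j * avg j grad1 x.
Proof.
set E := avg j f x.
have C1 := measurable_cell j.+1 x; have C0 := measurable_cell j x.
have fi1 := bounded_integrable_cell j.+1 x mf fB.
have fi0 := bounded_integrable_cell j x mf fB.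
have ci k (c : R) : bl.-integrable (cell k x) (EFin \o (fun=> c)).
  by apply: (bounded_integrable_cell (B := `|c|)) => //; exact: measurable_cst.
have B0 : 0 <= B by apply: le_trans (fB x).
have fc c : forall y, `|f y - c| <= B + `|c|.
  by move=> y; rewrite (le_trans (ler_normB _ _))// lerD2r.
have mfc c : measurable_fun setT (fun y => f y - c) by apply: measurable_funB.
have nfi k c : bl.-integrable (cell k x) (EFin \o (fun y => `|f y - c|)).
  apply: (integrable_norm (f := fun y => f y - c)).
  exact: (bounded_integrable_cell (B := B + `|c|)).
have gi : bl.-integrable (cell j x) (EFin \o grad1).
  by apply: (bounded_integrable_cell (B := B)) => // y; rewrite ger0_norm ?grad1_ge0.
have avgc k c : avg k (fun=> c) x = c.
  by rewrite /avg Rintegral_cell_cst mulrCA cell_normalize mulr1.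
have avgB k c : avg k f x - c = avg k (fun y => f y - c) x.
  rewrite -{1}(avgc k c) /avg -mulrBr.
  by rewrite (RintegralB (measurable_cell k x) (bounded_integrable_cell k x mf fB) (ci k c)).
have avgle k c : `|avg k f x - c| <= avg k (fun y => `|f y - c|) x.
  rewrite avgB /avg normrM ger0_norm ?exprn_ge0//; apply: ler_wpM2l; first by rewrite !exprn_ge0.
  apply: le_normr_Rintegral; first exact: measurable_cell.
  exact: (bounded_integrable_cell (B := B + `|c|)).
apply: (le_trans (avgle j.+1 E)).
have step1 : avg j.+1 (fun y => `|f y - E|) x <= 2 ^+ n * avg j (fun y => `|f y - E|) x.
  rewrite /avg mulrA exprS exprMn; apply: ler_wpM2l; first by rewrite mulr_ge0 ?exprn_ge0.
  by apply: le_Rintegral_subset => //; exact: cellS.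
apply: (le_trans step1); rewrite -mulrA; apply: ler_wpM2l; first by rewrite exprn_ge0.
have PC := poincare_cube (anchor j x) (ltW (mesh_gt0 j)) Cf.
rewrite /avg mulrCA; apply: ler_wpM2l; first by rewrite !exprn_ge0.
rewrite -lee_fin EFinM !EFin_Rintegral//.
have mff y : measurable_fun setT (fun z => (`|f y - f z|)%:E).
  apply/measurable_EFinP; apply: measurableT_comp => //.
  by apply: measurable_funB => //; exact: measurable_cst.
pose N : R := (2 ^+ j) ^+ n.
have N0 : (0 <= N%:E)%E by rewrite lee_fin !exprn_ge0.
apply: (@le_trans _ _ (\int[bl]_(y in cell j x) (N%:E * \int[bl]_(z in cell j x) (`|f y - f z|)%:E))%E).
  have mKi : measurable_fun setT (fun y => \int[bl]_(z in cell j x) (`|f y - f z|)%:E)%E.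
    apply: (@measurable_fun_inner_integral _ _ 'rV[R]_n 'rV[R]_n R bl (cell j x) C0
      (fun z => (`|f z.1 - f z.2|)%:E)) => //.
    apply/measurable_EFinP; apply: measurableT_comp => //; apply: measurable_funB.
      by apply: (measurableT_comp mf); exact: measurable_fst.
    by apply: (measurableT_comp mf); exact: measurable_snd.
  apply: ge0_le_integral => //.
  - apply/measurable_EFinP; apply: measurableT_comp => //; exact: measurable_funTS.
  - by apply: measurable_funTS; exact: measurable_funeM.
  - move=> y _; rewrite distrC.
    have := avgle j (f y); rewrite -/E /avg -lee_fin EFinM EFin_Rintegral//.
    by under eq_integral do rewrite distrC.
rewrite ge0_integralZl//; last 2 first.
- apply: measurable_funTS.
  apply: (@measurable_fun_inner_integral _ _ 'rV[R]_n 'rV[R]_n R bl (cell j x) C0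
      (fun z => (`|f z.1 - f z.2|)%:E)) => //.
  apply/measurable_EFinP; apply: measurableT_comp => //; apply: measurable_funB.
    by apply: (measurableT_comp mf); exact: measurable_fst.
  by apply: (measurableT_comp mf); exact: measurable_snd.
- by move=> y _; apply: integral_ge0 => z _; rewrite lee_fin.
apply: (le_trans (lee_wpmul2l N0 PC)).
rewrite muleA -EFinM exprS mulrCA /N cell_normalize mulr1.
rewrite le_eqVlt; apply/orP; left; apply/eqP; congr (_ * _)%E.
rewrite -ge0_integral_sum//.
  by apply: eq_integral => y _; rewrite sumEFin.
move=> i; apply: measurable_funTS.
exact: (measurable_continuousE (@continuous_abs_derive _ _ f i Cf)).
Qed.

End smooth_average.
End dyadic_cells.

Section power_continuity.
Context {R : realType}.

Lemma continuous_norm_powR (r : R) : 0 < r -> continuous (fun t : R => `|t| `^ r).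
Proof.
move=> r0 t; have [->|t0] := eqVneq t 0.
  apply/cvgrPdist_lt => e e0; rewrite normr0 powR0 ?gt_eqF//.
  have h : 0 < e `^ r^-1 by rewrite powR_gt0.
  exists (e `^ r^-1) => //= s; rewrite /= !sub0r !normrN => sh.
  rewrite ger0_norm ?powR_ge0//.
  rewrite (_ : e = (e `^ r^-1) `^ r); first by rewrite gt0_ltr_powR ?nnegrE// ltW.
  by rewrite -powRrM mulVf ?gt_eqF// powRr1// ltW.
have H : {for `|t|, continuous (fun s : R => s `^ r)}.
  apply: differentiable_continuous; apply/derivable1_diffP.
  by apply: derivable_powR; rewrite in_itv/= andbT normr_gt0.
exact: (cvg_comp (fun s : R => `|s|) (fun s => s `^ r) (@norm_continuous _ _ t) H).
Qed.

Lemma cvg_norm_powR (u : nat -> R) (l r : R) : 0 < r -> u k @[k --> \oo] --> l ->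
  `|u k| `^ r @[k --> \oo] --> `|l| `^ r.
Proof. by move=> r0 ul; exact: (continuous_cvg _ (@continuous_norm_powR r r0 l) ul). Qed.

Lemma powR_gt1 (a r : R) : 1 < a -> 0 < r -> 1 < a `^ r.
Proof.
move=> a1 r0; rewrite /powR gt_eqF ?(lt_trans ltr01)//.
by rewrite expR_gt1 mulr_gt0// ln_gt0.
Qed.

End power_continuity.

(** * Rate of approximation by dyadic averages *)

Section dyadic_sobolev.
Context {R : realType} {n : nat}.
Local Notation bl := (@borel_lebesgue R n).
Variables (Omega : set 'rV[R]_n) (L : R).
Hypotheses (mO : measurable Omega) (L0 : 0 < L) (OL : Omega `<=` cube (const_mx (- L)) (2 * L)).

Lemma measure_bounded_fin : (bl Omega < +oo)%E.
Proof.
apply: (@le_lt_trans _ _ (((2 * L) ^+ n)%:E)); last by rewrite ltry.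
rewrite -(@borel_lebesgue_hbox R n (const_mx (- L))) ?mulr_ge0 ?(ltW L0)//.
by apply: le_measure => //; rewrite inE//; exact: measurable_hbox.
Qed.

Lemma bounded_integrable (f : 'rV[R]_n -> R) (B : R) : measurable_fun setT f ->
  (forall x, `|f x| <= B) -> bl.-integrable Omega (EFin \o f).
Proof.
move=> mf fB; apply: measurable_bounded_integrable => //.
- exact: measure_bounded_fin.
- exact: measurable_funTS.
- exists B; split; first by rewrite num_real.
  by move=> M BM y _; exact: le_trans (fB y) (ltW BM).
Qed.

Lemma vanish_patch (f : 'rV[R]_n -> R) : (forall x, ~ Omega x -> f x = 0) ->
  (EFin \o f) \_ Omega = EFin \o f.
Proof.
move=> f0; apply/funext => x; rewrite patchE; case: ifPn => //.
by rewrite notin_setE => /f0 /= ->.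
Qed.

Lemma vanish_integrable (f : 'rV[R]_n -> R) (B : R) : measurable_fun setT f ->
  (forall x, `|f x| <= B) -> (forall x, ~ Omega x -> f x = 0) ->
  bl.-integrable setT (EFin \o f).
Proof.
move=> mf fB f0; rewrite -(vanish_patch f0); apply/(integrable_mkcond (EFin \o f) mO).
exact: bounded_integrable fB.
Qed.

Lemma vanish_integral (f : 'rV[R]_n -> R) : (forall x, ~ Omega x -> f x = 0) ->
  (\int[bl]_x (f x)%:E = \int[bl]_(x in Omega) (f x)%:E)%E.
Proof. by move=> f0; rewrite [RHS]integral_mkcond (vanish_patch f0). Qed.

(** The functions live on the whole space and vanish with their gradient off [Omega], so that cells
    sticking out of [Omega] can be treated like the others. *)
Definition smooth_in (f : 'rV[R]_n -> R) := [/\ Ck 1 f,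
  exists B, (forall x, `|f x| <= B) /\ (forall x, grad1 f x <= B),
  forall x, ~ Omega x -> f x = 0 & forall x, ~ Omega x -> grad1 f x = 0].

Variables (p d : R).
Hypotheses (p1 : 1 < p) (pd : p <= d).

Let p0 : 0 < p. Proof. exact: lt_trans p1. Qed.
Let d0 : 0 < d. Proof. exact: lt_le_trans p0 pd. Qed.

Definition energy (f : 'rV[R]_n -> R) : R := \int[bl]_(x in Omega) (grad1 f x `^ p).

Lemma energy_ge0 f : 0 <= energy f.
Proof. by apply: Rintegral_ge0 => x _; rewrite powR_ge0. Qed.

(** The d-th power of the difference of averages at scales [j] and [j + 1] has an integral of order
    2^(-decay j): [d] comes from the mesh, and n - n d / p from bounding all but one factor of an
    average by the total energy. *)
Definition decay : R := d + n%:R - n%:R * d / p.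

(** Half of the decay, so that [ratio^d * ratio^d = 2^(-decay)]. One factor is spent on weights in
    the summation over the scales, the other makes the resulting series converge. *)
Definition ratio : R := 2 `^ (- (decay / (2 * d))).

Definition approx_cst : R :=
  ((1 - ratio)^-1) `^ d * ((2 ^+ n) `^ d * (1 - ratio `^ d)^-1).

Lemma ratio_bounds : 0 < decay -> [/\ 0 < ratio, ratio < 1, 0 < ratio `^ d & ratio `^ d < 1].
Proof.
move=> dec0; have s0 : 0 < ratio by rewrite powR_gt0.
have s1 : ratio < 1.
  rewrite /ratio powRN invf_lt1 ?powR_gt0// powR_gt1// ?ltr1n//.
  by rewrite divr_gt0// mulr_gt0.
split => //; first by rewrite powR_gt0.
have : ratio `^ d < 1 `^ d by apply: gt0_ltr_powR => //; rewrite nnegrE// ltW.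
by rewrite powR1.
Qed.

Section one_function.
Variables (f : 'rV[R]_n -> R) (B : R).
Hypotheses (Cf : Ck 1 f) (fB : forall x, `|f x| <= B) (gB : forall x, grad1 f x <= B).
Hypotheses (f0 : forall x, ~ Omega x -> f x = 0) (g0 : forall x, ~ Omega x -> grad1 f x = 0).

Let mf : measurable_fun setT f. Proof. exact: continuous_measurable_rV (Ck_continuous Cf). Qed.
Let mg : measurable_fun setT (grad1 f).
Proof. exact: continuous_measurable_rV (@continuous_grad1 _ _ f Cf). Qed.
Let gp x := grad1 f x `^ p.
Let mgp : measurable_fun setT gp. Proof. exact: (measurableT_comp (measurable_powR p)). Qed.
Let gp0 x : 0 <= gp x. Proof. exact: powR_ge0. Qed.
Let gpB x : gp x <= B `^ p.
Proof. by apply: powR_homo; [exact: ltW|exact: grad1_ge0|exact: gB]. Qed.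
Let gpv x : ~ Omega x -> gp x = 0.
Proof. by move=> /g0; rewrite /gp => ->; rewrite powR0// gt_eqF. Qed.
Let gpn x : `|gp x| <= B `^ p. Proof. by rewrite ger0_norm. Qed.
Let M := energy f.

Lemma energyE : (\int[bl]_x (gp x)%:E = M%:E)%E.
Proof.
rewrite (vanish_integral gpv) /M /energy EFin_Rintegral//.
exact: (bounded_integrable mgp gpn).
Qed.

Lemma cell_energy_le j x : avg j gp x <= (2 ^+ j) ^+ n * M.
Proof.
apply: ler_wpM2l; first by rewrite !exprn_ge0.
have Ti := vanish_integrable mgp gpn gpv.
rewrite -lee_fin -energyE -EFin_Rintegral// lee_fin.
by apply: le_Rintegral_subset => //; exact: measurable_cell.
Qed.

(** Jensen's inequality brings in the average of the p-th powers to the power d/p. All of this power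
    except one factor is bounded by the energy of the whole function; the last factor is kept
    linear, to be integrated. *)
Lemma avg_diff_powR j x : `|avg j.+1 f x - avg j f x| `^ d <=
  (2 ^+ n * mesh j) `^ d * ((2 ^+ j) ^+ n * M) `^ (d / p - 1) * avg j gp x.
Proof.
have ag0 : 0 <= avg j (grad1 f) x.
  by rewrite mulr_ge0 ?exprn_ge0//; apply: Rintegral_ge0 => y _; exact: grad1_ge0.
have agp0 : 0 <= avg j gp x.
  by rewrite mulr_ge0 ?exprn_ge0//; apply: Rintegral_ge0.
have c0 : 0 <= (2 ^+ n * mesh j : R) by rewrite mulr_ge0 ?exprn_ge0// ltW// mesh_gt0.
apply: (@le_trans _ _ ((2 ^+ n * mesh j * avg j (grad1 f) x) `^ d)).
  apply: powR_homo => //; first exact: ltW.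
  exact: (avg_diff Cf fB gB).
rewrite powRM// -mulrA; apply: ler_wpM2l; first exact: powR_ge0.
have dp1 : 0 <= d / p - 1 by rewrite subr_ge0 ler_pdivlMr// mul1r.
have -> : avg j (grad1 f) x `^ d = (avg j (grad1 f) x `^ p) `^ (d / p).
  by rewrite -powRrM mulrCA divff ?mulr1// gt_eqF.
apply: (@le_trans _ _ (avg j gp x `^ (d / p))).
  apply: powR_homo; [by rewrite ltW// divr_gt0|exact: powR_ge0|].
  apply: (@avg_jensen _ _ j (grad1 f) x p B) => // y.
  by rewrite grad1_ge0 gB.
have -> : avg j gp x `^ (d / p) = avg j gp x `^ (d / p - 1) * avg j gp x.
  have [->|An0] := eqVneq (avg j gp x) 0.
    by rewrite mulr0 powR0// gt_eqF// divr_gt0.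
  by rewrite -{3}(powRr1 agp0) -powRD ?An0 ?implybT// subrK.
apply: ler_wpM2r; first exact: agp0.
by apply: powR_homo; [exact: dp1|exact: agp0|exact: cell_energy_le].
Qed.


Lemma avg_bound j x : `|avg j f x| <= B.
Proof. by apply: (avg_local_le mf fB) => y _. Qed.

Lemma integrable_avg_diff j k (F : 'rV[R]_n -> R) : F = avg k f \/ F = f ->
  bl.-integrable Omega (EFin \o (fun x => `|F x - avg j f x| `^ d)).
Proof.
move=> HF.
have B0 : 0 <= B by apply: le_trans (fB 0).
have mF : measurable_fun setT F by case: HF => -> //; exact: measurable_avg.
apply: (bounded_integrable (B := (B + B) `^ d)).
  apply: (measurableT_comp (measurable_powR d)); apply: measurableT_comp => //.
  by apply: measurable_funB => //; exact: measurable_avg.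
move=> x; rewrite ger0_norm ?powR_ge0//; apply: powR_homo => //; first exact: ltW.
rewrite (le_trans (ler_normB _ _))// lerD ?avg_bound//.
by case: HF => -> //; exact: avg_bound.
Qed.

(** The remaining average integrates to at most [M] by [integral_avg], and the powers of 2 collect
    to the exponent [decay]. *)
Lemma integral_avg_diff j : \int[bl]_(x in Omega) (`|avg j.+1 f x - avg j f x| `^ d) <=
  (2 ^+ n) `^ d * (2 `^ (- decay)) ^+ j * M `^ (d / p).
Proof.
have M0 : 0 <= M by exact: energy_ge0.
set c := (2 ^+ n * mesh j) `^ d * ((2 ^+ j) ^+ n * M) `^ (d / p - 1).
have c0 : 0 <= c by rewrite mulr_ge0 ?powR_ge0.
have ai : bl.-integrable Omega (EFin \o avg j gp).
  apply: (bounded_integrable (B := B `^ p)); first exact: measurable_avg.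
  by move=> x; apply: (avg_local_le mgp gpn) => y _.
have aM : \int[bl]_(x in Omega) avg j gp x <= M.
  rewrite -lee_fin EFin_Rintegral// -energyE.
  rewrite -(@integral_avg _ _ j gp (B `^ p))//; last by move=> x; rewrite gp0 gpB.
  apply: ge0_subset_integral => //.
  - by apply/measurable_EFinP; exact: measurable_avg.
  - by move=> x _; rewrite lee_fin mulr_ge0 ?exprn_ge0//; apply: Rintegral_ge0.
apply: (@le_trans _ _ (\int[bl]_(x in Omega) (c * avg j gp x))).
  apply: le_Rintegral => //.
  - exact: (@integrable_avg_diff j j.+1 _ (or_introl erefl)).
  - exact: integrable_cst_mul.
  - by move=> x _; exact: avg_diff_powR.
rewrite RintegralZl//; apply: (le_trans (ler_wpM2l c0 aM)).
rewrite /c powRM ?exprn_ge0 ?(ltW (mesh_gt0 _))// powRM ?exprn_ge0//.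
rewrite -!mulrA; apply: ler_wpM2l; first exact: powR_ge0.
have MM : M `^ (d / p - 1) * M = M `^ (d / p).
  have [->|Mn0] := eqVneq M 0; first by rewrite mulr0 powR0// gt_eqF// divr_gt0.
  by rewrite -{2}(powRr1 M0) -powRD ?Mn0 ?implybT// subrK.
rewrite MM mulrA le_eqVlt; apply/orP; left; apply/eqP; congr (_ * _).
have t0 : 0 <= 2 :> R by [].
have mE : (mesh j : R) = 2 `^ (- j%:R) by rewrite powRN powR_mulrn// /mesh exprVn.
have NE : (2 ^+ j) ^+ n = 2 `^ (j%:R * n%:R) :> R by rewrite powRrM !powR_mulrn ?exprn_ge0.
rewrite mE NE -!powRrM -powRD ?pnatr_eq0 ?implybT//.
rewrite -powR_mulrn ?powR_ge0// -powRrM; congr (_ `^ _); rewrite /decay.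
by field; rewrite gt_eqF.
Qed.

Lemma cvg_avg x : avg j f x @[j --> \oo] --> f x.
Proof.
apply/cvgrPdist_le => e e0.
have /cvgrPdist_le/(_ e e0) : f y @[y --> x] --> f x by exact: (Ck_continuous Cf).
move=> /nbhs_ballP[r /= r0 rf].
have h2 : `|2^-1 : R| < 1 by rewrite ger0_norm ?invr_ge0// invf_lt1 ?ltr1n.
have /cvgrPdist_lt/(_ r r0) := @cvg_expr R 2^-1 h2; apply: filterS => j.
rewrite sub0r normrN ger0_norm// => jr.
have -> : f x - avg j f x = - avg j (fun y => f y - f x) x.
  rewrite -opprB; congr (- _); rewrite /avg RintegralB.
  - by rewrite Rintegral_cell_cst mulrBr mulrCA cell_normalize mulr1.
  - exact: measurable_cell.
  - exact: (bounded_integrable_cell _ _ mf fB).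
  - by apply: (bounded_integrable_cell (B := `|f x|)) => //; exact: measurable_cst.
rewrite normrN; apply: (@avg_local_le _ _ j _ x (B + B)).
- by apply: measurable_funB => //; exact: measurable_cst.
- by move=> y; rewrite (le_trans (ler_normB _ _))// lerD.
- move=> y xy; rewrite distrC; apply: rf; split => // i k; rewrite (ord1 i).
  have := xy k; have := cell_self j x k; rewrite !mxE /= => /andP[x1 x2] /andP[y1 y2].
  by rewrite /ball/= ltr_distl -/(mesh j) in jr *; apply/andP; split; lra.
Qed.

(** A substitute for Minkowski's inequality. With [W] the sum of the (s^-j D_j)^d, each D_j is at
    most [s^j W^(1/d)]; then both the sum of the [s^j] and the integral of [W] are controlled by
    geometric series. *)
Lemma avg_tail_le (J K : nat) : 0 < decay -> (J <= K)%N ->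
  \int[bl]_(x in Omega) (`|avg K f x - avg J f x| `^ d) <=
  approx_cst * (ratio `^ d) ^+ J * M `^ (d / p).
Proof.
move=> dec0 JK; have [] := ratio_bounds dec0; rewrite /approx_cst; set s := ratio.
move=> s0 s1 sd0 sd1.
have sd : s `^ d * s `^ d = 2 `^ (- decay).
  rewrite -powRD; last by rewrite (gt_eqF s0) implybT.
  by rewrite /s -powRrM; congr (_ `^ _); field; rewrite gt_eqF.
have M0 : 0 <= M by exact: energy_ge0.
pose D j x := `|avg j.+1 f x - avg j f x|.
pose w j x := (s ^- j * D j x) `^ d.
pose W x := \sum_(J <= j < K) w j x.
have w0 j x : 0 <= w j x by exact: powR_ge0.
have W0 x : 0 <= W x by apply: sumr_ge0.
have pt x : `|avg K f x - avg J f x| `^ d <= ((1 - s)^-1 * s ^+ J) `^ d * W x.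
  have DW j : (J <= j < K)%N -> D j x <= s ^+ j * W x `^ d^-1.
    move=> jJK.
    have : w j x <= W x.
      rewrite /W (bigD1_seq j) ?mem_index_iota ?iota_uniq//= lerDl.
      exact: sumr_ge0.
    move=> /(powR_homo (r := d^-1)) -/(_ _ (w0 j x)) h.
    have {}h := h (ltW _); rewrite invr_gt0 in h; have {h} := h d0.
    rewrite /w -powRrM divff ?gt_eqF// powRr1 ?mulr_ge0 ?invr_ge0 ?exprn_ge0 ?(ltW s0) ?normr_ge0//.
    by rewrite ler_pdivrMl ?exprn_gt0.
  have W1 : W x = (W x `^ d^-1) `^ d by rewrite -powRrM mulVf ?gt_eqF// powRr1.
  rewrite W1 -powRM ?powR_ge0//; last first.
    by rewrite mulr_ge0 ?invr_ge0 ?subr_ge0 ?exprn_ge0 ?ltW.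
  apply: powR_homo => //; first exact: ltW.
  rewrite -(telescope_sumr (fun j => avg j f x) JK) (le_trans (ler_norm_sum _ _ _))//.
  apply: (@le_trans _ _ (\sum_(J <= j < K) s ^+ j * W x `^ d^-1)).
    by rewrite big_nat [leRHS]big_nat; apply: ler_sum => j; exact: DW.
  rewrite -mulr_suml; apply: ler_wpM2r; first exact: powR_ge0.
  rewrite mulrC ler_pdivlMr ?subr_gt0// mulr_suml.
  rewrite (eq_bigr (fun j => - (s ^+ j.+1 - s ^+ j))); last first.
    by move=> j _; rewrite exprS; ring.
  by rewrite sumrN telescope_sumr// opprB lerBlDr lerDl exprn_ge0// ltW.
have Di j : bl.-integrable Omega (EFin \o (fun x => D j x `^ d)).
  exact: (@integrable_avg_diff j j.+1 _ (or_introl erefl)).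
have wE j x : w j x = (s ^- j) `^ d * D j x `^ d.
  by rewrite /w powRM ?normr_ge0// invr_ge0 exprn_ge0// ltW.
have wi j : bl.-integrable Omega (EFin \o w j).
  rewrite (_ : w j = fun x => (s ^- j) `^ d * D j x `^ d); first exact: integrable_cst_mul.
  by apply/funext => x; rewrite wE.
have c0 : 0 <= ((1 - s)^-1 * s ^+ J) `^ d by exact: powR_ge0.
apply: (@le_trans _ _ (\int[bl]_(x in Omega) (((1 - s)^-1 * s ^+ J) `^ d * W x))).
  apply: le_Rintegral => //.
  - exact: (@integrable_avg_diff J K _ (or_introl erefl)).
  - by apply: integrable_cst_mul => //; exact: integrable_sum_fun.
rewrite RintegralZl//; last exact: integrable_sum_fun.
rewrite Rintegral_sum// powRM ?invr_ge0 ?subr_ge0 ?exprn_ge0 ?(ltW s1) ?(ltW s0)//.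
rewrite powRXn ?(ltW s0)// -!mulrA; apply: ler_wpM2l; first exact: powR_ge0.
rewrite mulrC ![X in _ <= X]mulrA [X in _ <= X]mulrAC.
apply: ler_wpM2r; first by rewrite exprn_ge0// ltW.
apply: (@le_trans _ _ (\sum_(J <= j < K) ((2 ^+ n) `^ d * M `^ (d / p)) * (s `^ d) ^+ j)).
  apply: ler_sum => j _.
  rewrite (_ : \int[bl]_(x in Omega) w j x =
    \int[bl]_(x in Omega) ((s ^- j) `^ d * D j x `^ d)); last first.
    by apply: eq_Rintegral => x _; rewrite wE.
  rewrite RintegralZl//.
  have q0 : 0 <= (s ^- j) `^ d by exact: powR_ge0.
  apply: (le_trans (ler_wpM2l q0 (integral_avg_diff j))).
  rewrite -sd exprMn -exprVn (@powRXn _ s^-1 d j) ?invr_ge0 ?(ltW s0)//.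
  have sv : s^-1 `^ d * s `^ d = 1.
    by rewrite -powRM ?invr_ge0 ?(ltW s0)// mulVf ?gt_eqF// powR1.
  rewrite le_eqVlt; apply/orP; left; apply/eqP.
  transitivity (((s^-1 `^ d * s `^ d) ^+ j) * ((2 ^+ n) `^ d * M `^ (d / p)) * (s `^ d) ^+ j).
    by rewrite exprMn; ring.
  by rewrite sv expr1n mul1r.
rewrite -mulr_sumr.
have -> : (2 ^+ n) `^ d / (1 - s `^ d) * M `^ (d / p) = ((2 ^+ n) `^ d * M `^ (d / p)) * (1 - s `^ d)^-1.
  by rewrite mulrAC.
apply: ler_wpM2l; first by rewrite mulr_ge0 ?powR_ge0.
rewrite -[leRHS]mul1r ler_pdivlMr ?subr_gt0// mulr_suml.
rewrite (eq_bigr (fun j => - ((s `^ d) ^+ j.+1 - (s `^ d) ^+ j))); last first.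
  by move=> j _; rewrite exprS; ring.
rewrite sumrN telescope_sumr// opprB lerBlDr (@le_trans _ _ 1)//.
  by rewrite exprn_ile1// ltW.
by rewrite lerDl exprn_ge0// ltW.
Qed.

(* The differences of consecutive dyadic averages decay geometrically exactly when [d < n p / (n - p)]. *)
Lemma approx_avg_le (J : nat) : 0 < decay ->
  \int[bl]_(x in Omega) (`|f x - avg J f x| `^ d) <=
  approx_cst * (ratio `^ d) ^+ J * M `^ (d / p).
Proof.
move=> dec0.
pose F k x := `|avg (J + k)%N f x - avg J f x| `^ d.
have Ai k : bl.-integrable Omega (EFin \o F k).
  exact: (@integrable_avg_diff J (J + k)%N _ (or_introl erefl)).
have fi : bl.-integrable Omega (EFin \o (fun x => `|f x - avg J f x| `^ d)).
  exact: (@integrable_avg_diff J 0%N _ (or_intror erefl)).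
have [//|//] := @fatou_Rintegral _ _ _ bl Omega mO F (fun x => `|f x - avg J f x| `^ d)
  _ Ai (integrable_fun_measurable fi) (fun k x _ => powR_ge0 _ _) (fun x _ => powR_ge0 _ _) _
  (fun k => @avg_tail_le J (J + k)%N dec0 (leq_addr _ _)).
apply: aeW => x _.
have hJ : avg (J + k)%N f x @[k --> \oo] --> f x.
  exact: (cvg_comp (addn J) (avg ^~ f ^~ x) (@cvg_addnl J) (@cvg_avg x)).
by apply: cvg_norm_powR => //; apply: cvgB => //; exact: cvg_cst.
Qed.

End one_function.
End dyadic_sobolev.

(** * Compact embedding *)

Lemma dist_same_floor (R : realFieldType) (u v B c dl : R) : c * dl <= u + B ->
  u + B < c * dl + dl -> c * dl <= v + B -> v + B < c * dl + dl -> `|u - v| <= dl.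
Proof. by move=> *; rewrite ler_distl; apply/andP; split; lra. Qed.

(** * Total boundedness and diagonal extraction *)

Section extraction.

(* Total boundedness of a sequence, with [r k l] expressing that its k-th and l-th terms are close. *)
Definition finitely_coloured (r : nat -> nat -> Prop) := exists (N : nat) (col : nat -> nat),
  (forall k, (col k < N)%N) /\ forall k l, col k = col l -> r k l.

Definition unbounded (X : set nat) := forall m, exists k, (m < k)%N /\ X k.

(** Pigeonhole principle by induction on the number of colours: either the last colour occurs
    infinitely often, or it does not occur beyond some [b]. *)
Lemma unbounded_colour (X : set nat) N (col : nat -> nat) : unbounded X ->
  (forall k, X k -> (col k < N)%N) -> exists c, unbounded (X `&` [set k | col k = c]).
Proof.
elim: N X => [|N IH] X uX colN; first by have [k [_ /colN]] := uX 0%N.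
have [uc|/existsNP[b hb]] := pselect (unbounded (X `&` [set k | col k = N])); first by exists N.
have hb' k : (b < k)%N -> X k -> (col k < N)%N.
  move=> bk Xk; have := colN k Xk; rewrite ltnS leq_eqVlt => /orP[/eqP kN|//].
  by exfalso; apply: hb; exists k.
have [|k [bk Xk]|c uc] := IH (X `&` [set k | (b < k)%N]).
- move=> m; have [k [+ Xk]] := uX (maxn m b); rewrite gtn_max => /andP[mk bk].
  by exists k.
- exact: hb'.
by exists c => m; have [k [mk [[Xk _] kc]]] := uc m; exists k.
Qed.

(** Nested infinite sets [Xs e] are chosen on which [r e] holds throughout; the i-th term is taken
    in [Xs i], so that [r i] holds from the index [i] on. *)
Lemma diagonal_extraction (r : nat -> nat -> nat -> Prop) :
  (forall e, finitely_coloured (r e)) ->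
  exists s : nat -> nat, (forall i, (s i < s i.+1)%N) /\
    forall i j, (i <= j)%N -> r i (s i) (s j).
Proof.
move=> rc.
(* The property is conditional on [X] being infinite so that [choice] gives a total function of
   [X]. *)
have step e X : exists X', unbounded X -> [/\ unbounded X', X' `<=` X &
    forall k l, X' k -> X' l -> r e k l].
  have [uX|nX] := pselect (unbounded X); last by exists X.
  have [N [col [colN colr]]] := rc e.
  have [c uc] := unbounded_colour uX (fun k _ => colN k).
  exists (X `&` [set k | col k = c]) => _; split; [exact: uc|by move=> k []|].
  by move=> k l [_ kc] [_ lc]; apply: colr; rewrite kc lc.
have [F FP] := choice (fun eX : nat * set nat => step eX.1 eX.2).
pose Xs := fix Xs i := if i is j.+1 then F (i, Xs j) else F (0%N, setT).
have uT : unbounded setT by move=> m; exists m.+1.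
have uX i : unbounded (Xs i).
  by elim: i => [|i IH]; [have [] := FP (0%N, setT) uT|have [] := FP (i.+1, Xs i) IH].
have XS i : Xs i.+1 `<=` Xs i by have [] := FP (i.+1, Xs i) (uX i).
have Xle i j : (i <= j)%N -> Xs j `<=` Xs i.
  elim: j => [|j IH]; first by rewrite leqn0 => /eqP ->.
  rewrite leq_eqVlt => /orP[/eqP -> //|/IH]; exact: subset_trans (XS j).
have Xr i k l : Xs i k -> Xs i l -> r i k l.
  case: i => [|i]; first by have [_ _] := FP (0%N, setT) uT; apply.
  by have [_ _] := FP (i.+1, Xs i) (uX i); apply.
have [f fP] := choice (fun im : nat * nat => uX im.1 im.2).
pose s := fix s i := if i is j.+1 then f (i, s j) else f (0%N, 0%N).
have sX i : Xs i (s i) by case: i => [|i]; apply: (fP (_, _)).2.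
exists s; split => [i|i j ij]; first exact: (fP (i.+1, s i)).1.
by apply: Xr => //; exact: Xle ij _ (sX j).
Qed.

Lemma extraction_ge (s : nat -> nat) : (forall i, (s i < s i.+1)%N) -> forall i, (i <= s i)%N.
Proof. by move=> h; elim=> [//|i IH]; exact: leq_ltn_trans (h i). Qed.

Lemma finitely_colouredW (r r' : nat -> nat -> Prop) : (forall k l, r k l -> r' k l) ->
  finitely_coloured r -> finitely_coloured r'.
Proof. by move=> rr [N [col [h1 h2]]]; exists N, col; split => // k l /h2/rr. Qed.

Lemma finite_colouring (C : finType) (col : nat -> C) (r : nat -> nat -> Prop) :
  (forall k l, col k = col l -> r k l) -> finitely_coloured r.
Proof.
move=> h; exists #|C|, (fun k => nat_of_ord (enum_rank (col k))); split; first by move=> k; exact: ltn_ord.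
by move=> k l /val_inj/enum_rank_inj/h.
Qed.

Lemma finitely_coloured_and (r r' : nat -> nat -> Prop) :
  finitely_coloured r -> finitely_coloured r' ->
  finitely_coloured (fun k l => r k l /\ r' k l).
Proof.
move=> [N [col [c1 c2]]] [N' [col' [c1' c2']]].
apply: (@finite_colouring ('I_N * 'I_N')%type (fun k => (Ordinal (c1 k), Ordinal (c1' k)))).
by move=> k l [] /c2 ? /c2'.
Qed.

Lemma finitely_coloured_forall m (r : 'I_m -> nat -> nat -> Prop) :
  (forall i, finitely_coloured (r i)) -> finitely_coloured (fun k l => forall i, r i k l).
Proof.
move=> h; have [N NP] := choice h; have [col cP] := choice NP.
pose M := \max_(i < m) N i.
have lt i k : (col i k < M)%N by apply: leq_trans (leq_bigmax i); exact: (cP i).1.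
apply: (@finite_colouring {ffun 'I_m -> 'I_M} (fun k => [ffun i => Ordinal (lt i k)])).
move=> k l /ffunP kl i; apply: (cP i).2.
by have := kl i; rewrite !ffunE => -[].
Qed.

Lemma bounded_finitely_coloured (R : realType) (u : nat -> R) (M e : R) : 0 < e ->
  (forall k, `|u k| <= M) -> finitely_coloured (fun k l => `|u k - u l| <= e).
Proof.
move=> e0 uM.
have M0 : 0 <= M by apply: le_trans (uM 0%N).
pose code k := Num.floor ((u k + M) / e).
have c0 k : 0 <= code k.
  by rewrite floor_ge0 divr_ge0 ?(ltW e0)// -lerBlDr sub0r; have := uM k; rewrite ler_norml => /andP[].
exists (absz (Num.floor (2 * M / e))).+1, (fun k => absz (code k)); split=> [k|k l].
  rewrite ltnS -lez_nat !gez0_abs//; last by rewrite floor_ge0 divr_ge0 ?(ltW e0)// mulr_ge0.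
  apply: le_floor; rewrite ler_pM2r ?invr_gt0// mulr2n mulrDl mul1r lerD2r.
  by apply: le_trans (uM k); exact: ler_norm.
move=> /(congr1 Posz); rewrite !gez0_abs// => cc.
have /andP[a1 a2] := floor_itv ((u k + M) / e).
have /andP[b1 b2] := floor_itv ((u l + M) / e).
move: a1 a2 b1 b2; rewrite -/(code _) -/(code _) cc !intrD.
rewrite !ler_pdivlMr// !ltr_pdivrMr// mulrDl mul1r.
exact: dist_same_floor.
Qed.

Lemma cvg_subseq (R : realType) (u : nat -> R) (s : nat -> nat) (l : R) :
  (forall i, (s i < s i.+1)%N) -> u k @[k --> \oo] --> l -> u (s k) @[k --> \oo] --> l.
Proof.
move=> sS ul; apply: cvg_comp ul => A [N _ NA]; exists N => // k /= Nk.
by apply: NA => /=; exact: leq_trans Nk (extraction_ge sS k).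
Qed.

End extraction.

(** * The power mean inequality *)

Section power_mean.
Context d (T : measurableType d) (R : realType).
Variables (mu : {measure set T -> \bar R}) (D : set T).
Hypotheses (mD : measurable D) (Doo : (mu D < +oo)%E).

Lemma integrable_cst_fin (c : R) : mu.-integrable D (EFin \o (fun=> c)).
Proof.
apply: measurable_bounded_integrable => //.
exists `|c|; split; first by rewrite num_real.
by move=> M cM x _ /=; exact: ltW.
Qed.

(** The tangent inequality at 1 reads [p t <= t^p + p - 1], and the constant is integrable on a set
    of finite measure. *)
Lemma integrable_powR_le (g : T -> R) (p : R) : 1 < p -> measurable_fun D g ->
  (forall x, D x -> 0 <= g x) -> mu.-integrable D (EFin \o (fun x => g x `^ p)) ->
  mu.-integrable D (EFin \o g).
Proof.
move=> p1 mg g0 gpi.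
apply: (integrable_dominated mD mg (integrable_add mD gpi (integrable_cst_fin (p - 1)))) => x Dx.
rewrite ger0_norm ?g0//; have := powR_tangent p1 ler01 (g0 x Dx).
rewrite !powR1 !mulr1; apply: le_trans.
by rewrite ler_peMl ?g0// ltW.
Qed.

(* The tangent inequality [p A^(p-1) t <= t^p + (p-1) A^p] is integrated at [A = (\int g^p)^(1/p) + e]. *)
Lemma Rintegral_le_power_mean (g : T -> R) (p : R) : 1 < p -> measurable_fun D g ->
  (forall x, D x -> 0 <= g x) -> mu.-integrable D (EFin \o (fun x => g x `^ p)) ->
  \int[mu]_(x in D) g x <= (1 + (p - 1) * fine (mu D)) * (\int[mu]_(x in D) (g x `^ p)) `^ p^-1.
Proof.
move=> p1 mg g0 gpi.
have p0 : 0 < p by apply: lt_trans p1.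
have gi := integrable_powR_le p1 mg g0 gpi.
set V := fine (mu D); set M := \int[mu]_(x in D) (g x `^ p).
have V0 : 0 <= V by apply: fine_ge0.
have M0 : 0 <= M by apply: Rintegral_ge0 => x _; exact: powR_ge0.
set c := 1 + (p - 1) * V.
have c0 : 0 < c by rewrite ltr_wpDr// mulr_ge0// subr_ge0 ltW.
apply/ler_addgt0Pr => e e0.
(* The added term keeps [A] positive when the integral [M] vanishes, so that a power of [A] can be
   cancelled. *)
pose A := M `^ p^-1 + e / c.
have A0 : 0 < A by rewrite ltr_wpDl ?powR_ge0// divr_gt0.
have MA : M <= A `^ p.
  rewrite [leLHS](_ : M = (M `^ p^-1) `^ p); last by rewrite -powRrM mulVf ?gt_eqF// powRr1.
  apply: powR_homo; rewrite ?powR_ge0 ?(ltW p0)// lerDl divr_ge0 ?(ltW e0) ?(ltW c0)//.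
suff : \int[mu]_(x in D) g x <= c * A.
  by rewrite /A mulrDr mulrCA divff ?gt_eqF// mulr1.
have h : \int[mu]_(x in D) (p * A `^ (p - 1) * g x) <=
    \int[mu]_(x in D) (g x `^ p + (p - 1) * A `^ p).
  apply: le_Rintegral => //.
  - exact: integrable_cst_mul.
  - by apply: integrable_add => //; exact: integrable_cst_fin.
  - by move=> x Dx; apply: powR_tangent => //; [exact: ltW|exact: g0].
move: h; rewrite RintegralZl// RintegralD//; last exact: integrable_cst_fin.
rewrite Rintegral_cst// -/M -/V.
set I := \int[mu]_(x in D) g x => h.
have I0 : 0 <= I by exact: Rintegral_ge0.
have AA : A `^ p = A `^ (p - 1) * A.
  by rewrite -{3}(powRr1 (ltW A0)) -powRD ?(gt_eqF A0) ?implybT// subrK.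
have Ap0 : 0 < A `^ (p - 1) by rewrite powR_gt0.
have h2 : p * A `^ (p - 1) * I <= c * A `^ p by rewrite /c mulrDl mul1r mulrAC; lra.
rewrite -(ler_pM2l Ap0); apply: (@le_trans _ _ (p * A `^ (p - 1) * I)).
  by rewrite -mulrA ler_peMl ?(ltW p1)// mulr_ge0// ltW.
by apply: (le_trans h2); rewrite AA mulrCA.
Qed.

End power_mean.

Lemma le_half_quarters (R : realFieldType) (e a b c : R) :
  c <= e / 2 -> a <= e / 4 -> b <= e / 4 -> b + a + c <= e.
Proof. lra. Qed.

(** * Sobolev inequality and total boundedness for smooth functions *)

Section sobolev.
Context {R : realType} {n : nat}.
Local Notation bl := (@borel_lebesgue R n).
Variables (Omega : set 'rV[R]_n) (L : R).
Hypotheses (n0 : (0 < n)%N) (mO : measurable Omega) (L0 : 0 < L).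
Hypothesis OL : Omega `<=` cube (const_mx (- L)) (2 * L).
Variables (p d : R).
Hypotheses (p1 : 1 < p) (pd : p <= d) (dec0 : 0 < @decay R n p d).

Let p0 : 0 < p. Proof. exact: lt_trans p1. Qed.
Let d0 : 0 < d. Proof. exact: lt_le_trans p0 pd. Qed.
Let Ofin : (bl Omega < +oo)%E. Proof. exact: measure_bounded_fin OL. Qed.
Local Notation V := (fine (bl Omega)).
Local Notation energy := (energy Omega p).

Definition L1_cst : R := (L ^+ n)^-1 * (3 * L) ^+ n.+1 * (1 + (p - 1) * V).

Let V0 : 0 <= V. Proof. exact: fine_ge0. Qed.

Lemma L1_cst_ge0 : 0 <= L1_cst.
Proof.
rewrite !mulr_ge0 ?invr_ge0 ?exprn_ge0 ?mulr_ge0 ?(ltW L0)//.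
by rewrite addr_ge0// mulr_ge0// subr_ge0 ltW.
Qed.

(** The cube [Q] of side 3 L contains both [Omega] and a cube [Q'] of side [L] disjoint from it,
    where [f] vanishes. Restricting one variable to [Q'] in the Poincare inequality on [Q] bounds
    [L^n] times the L^1 norm of [f]; the power mean inequality then brings in the energy. *)
Lemma smooth_L1_le f : smooth_in Omega f ->
  \int[bl]_(x in Omega) `|f x| <= L1_cst * energy f `^ p^-1.
Proof.
move=> [Cf [B [fB gB]] f0 g0].
have mf : measurable_fun setT f by exact: continuous_measurable_rV (Ck_continuous Cf).
have mg : measurable_fun setT (grad1 f) by exact: continuous_measurable_rV (@continuous_grad1 _ _ f Cf).
pose Q := cube (const_mx (- L) : 'rV[R]_n) (3 * L).
pose Q' := cube (const_mx L : 'rV[R]_n) L.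
have mQ : measurable Q by exact: measurable_cube.
have mQ' : measurable Q' by exact: measurable_cube.
have OQ : Omega `<=` Q.
  move=> x /OL h i; have := h i; rewrite !mxE => /andP[h1 h2]; rewrite h1 (lt_le_trans h2)//.
  by rewrite lerD2l ler_wpM2r ?(ltW L0)// ler_nat.
have Q'Q : Q' `<=` Q.
  move=> x h i; have := h i; rewrite !mxE => /andP[h1 h2]; apply/andP; split; move: L0 h1 h2; lra.
have Q'O x : Q' x -> ~ Omega x.
  move=> h /OL h'; have := h (Ordinal n0); have := h' (Ordinal n0); rewrite !mxE => /andP[_ a] /andP[b _].
  by move: a b; lra.
have muQ' : bl Q' = (L ^+ n)%:E by apply: borel_lebesgue_hbox; exact: ltW.
have PC := poincare_cube (const_mx (- L)) (mulr_ge0 (ler0n R 3) (ltW L0)) Cf.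
have absf : bl.-integrable Omega (EFin \o (fun x => `|f x|)).
  apply: integrable_norm; exact: (bounded_integrable mO L0 OL mf fB).
have gn x : `|grad1 f x| <= B by rewrite ger0_norm ?grad1_ge0.
have gi : bl.-integrable Omega (EFin \o grad1 f) by exact: (bounded_integrable mO L0 OL mg gn).
have Ln : 0 < L ^+ n by rewrite exprn_gt0.
have main : ((L ^+ n)%:E * (\int[bl]_(x in Omega) `|f x|)%R%:E <=
    ((3 * L) ^+ n.+1)%:E * (\int[bl]_(x in Omega) grad1 f x)%R%:E)%E.
  apply: le_trans (le_trans _ PC) _.
    apply: (@le_trans _ _ (\int[bl]_(y in Q) ((L ^+ n)%:E * (`|f y|)%:E))%E).
      rewrite EFin_Rintegral// -ge0_integralZl//; last 2 first.
      - by apply/measurable_EFinP; apply: measurableT_comp => //; exact: measurable_funTS.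
      - by rewrite lee_fin ltW.
      apply: ge0_subset_integral => //.
      - apply: measurable_funeM; apply/measurable_EFinP; apply: measurableT_comp => //.
        exact: measurable_funTS.
      - by move=> x _; rewrite mule_ge0// lee_fin// ltW.
    apply: ge0_le_integral => //.
    - by move=> x _; rewrite mule_ge0// lee_fin// ltW.
    - apply: measurable_funeM; apply/measurable_EFinP; apply: measurableT_comp => //.
      exact: measurable_funTS.
    - apply: measurable_funTS.
      apply: (@measurable_fun_inner_integral _ _ 'rV[R]_n 'rV[R]_n R bl Q mQ
        (fun z => (`|f z.1 - f z.2|)%:E)) => //.
      apply/measurable_EFinP; apply: measurableT_comp => //; apply: measurable_funB.
        by apply: (measurableT_comp mf); exact: measurable_fst.
      by apply: (measurableT_comp mf); exact: measurable_snd.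
    - move=> y _.
      apply: (@le_trans _ _ (\int[bl]_(z in Q') cst (`|f y|)%:E z)%E).
        rewrite integral_cst// -muQ' muleC; exact: lexx.
      apply: (@le_trans _ _ (\int[bl]_(z in Q') (`|f y - f z|)%:E)%E).
        rewrite le_eqVlt; apply/orP; left; apply/eqP; apply: eq_integral => z /set_mem zQ'.
        by rewrite /= (f0 z) ?subr0//; exact: Q'O.
      apply: ge0_subset_integral => //.
      apply/measurable_EFinP; apply: measurableT_comp => //; apply: measurable_funTS.
      by apply: measurable_funB => //; exact: measurable_cst.
  apply: lee_wpmul2l; first by rewrite lee_fin exprn_ge0// mulr_ge0// ltW.
  rewrite EFin_Rintegral// -ge0_integral_sum//; last first.
    move=> i; apply: measurable_funTS.
    exact: (measurable_continuousE (@continuous_abs_derive _ _ f i Cf)).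
  rewrite -(vanish_integral g0).
  under eq_integral do rewrite sumEFin.
  apply: ge0_subset_integral => //; first exact/measurable_EFinP.
  by move=> x _; rewrite lee_fin grad1_ge0.
have gpi : bl.-integrable Omega (EFin \o (fun x => grad1 f x `^ p)).
  apply: (bounded_integrable mO L0 OL (B := B `^ p)).
    exact: (measurableT_comp (measurable_powR p)).
  move=> x; rewrite ger0_norm ?powR_ge0//.
  by apply: powR_homo; [exact: ltW|exact: grad1_ge0|exact: gB].
have PM := Rintegral_le_power_mean mO Ofin p1 (measurable_funTS mg) (fun x _ => grad1_ge0 f x) gpi.
move: main; rewrite -!EFinM lee_fin /L1_cst -!mulrA => main.
by rewrite ler_pdivlMl// (le_trans main)// ler_wpM2l ?exprn_ge0 ?mulr_ge0 ?ler0n ?(ltW L0).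
Qed.

Lemma smooth_avg_le f J x : smooth_in Omega f ->
  `|avg J f x| <= (2 ^+ J) ^+ n * (L1_cst * energy f `^ p^-1).
Proof.
move=> sf; have [Cf [B [fB gB]] f0 g0] := sf.
have mf : measurable_fun setT f by exact: continuous_measurable_rV (Ck_continuous Cf).
rewrite normrM ger0_norm ?exprn_ge0//; apply: ler_wpM2l; first by rewrite !exprn_ge0.
apply: le_trans (smooth_L1_le sf).
have fi := bounded_integrable_cell J x mf fB.
apply: (le_trans (le_normr_Rintegral (measurable_cell J x) fi)).
have mn : measurable_fun setT (fun x => `|f x|) by exact: measurableT_comp.
have v0 y : ~ Omega y -> `|f y| = 0 by move=> /f0 ->; rewrite normr0.
have nB y : `| `|f y| | <= B by rewrite normr_id.
have Ti := vanish_integrable mO L0 OL mn nB v0.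
rewrite -lee_fin !EFin_Rintegral//; last 3 first.
- exact: (bounded_integrable mO L0 OL mn nB).
- exact: measurable_cell.
- exact: (bounded_integrable_cell _ _ mn nB).
rewrite -(vanish_integral v0); apply: ge0_subset_integral => //.
- exact: measurable_cell.
- exact/measurable_EFinP.
Qed.

Lemma powR_add3_le (a b c : R) : 0 <= a -> 0 <= b -> 0 <= c ->
  (a + b + c) `^ d <= (2 `^ d * 2 `^ d) * (a `^ d + b `^ d + c `^ d).
Proof.
move=> a0 b0 c0.
have t1 : 1 <= 2 `^ d :> R by rewrite ltW// powR_gt1// ltr1n.
apply: (le_trans (powR_addr_le (addr_ge0 a0 b0) c0 (ltW d0))).
rewrite -mulrA; apply: ler_wpM2l; first exact: powR_ge0.
rewrite mulrDr; apply: lerD; first exact: powR_addr_le (ltW d0).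
by rewrite ler_peMl// powR_ge0.
Qed.

Lemma smooth_diff_integrable f g : smooth_in Omega f -> smooth_in Omega g ->
  bl.-integrable Omega (EFin \o (fun x => `|f x - g x| `^ d)).
Proof.
move=> [Cf [B [fB gB]] f0 g0] [Cg [B' [fB' gB']] f0' g0'].
apply: (bounded_integrable mO L0 OL (B := (B + B') `^ d)).
  apply: (measurableT_comp (measurable_powR d)); apply: measurableT_comp => //.
  by apply: measurable_funB; [exact: continuous_measurable_rV (Ck_continuous Cf)|exact: continuous_measurable_rV (Ck_continuous Cg)].
move=> x; rewrite ger0_norm ?powR_ge0//; apply: powR_homo => //; first exact: ltW.
by rewrite (le_trans (ler_normB _ _))// lerD.
Qed.

Lemma smooth_approx_integrable f J : smooth_in Omega f ->
  bl.-integrable Omega (EFin \o (fun x => `|f x - avg J f x| `^ d)).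
Proof.
by move=> [Cf [B [fB gB]] f0 g0]; apply: (integrable_avg_diff mO L0 OL p1 pd Cf fB J (k := 0%N)); right.
Qed.

Lemma smooth_approx_le f J : smooth_in Omega f ->
  \int[bl]_(x in Omega) (`|f x - avg J f x| `^ d) <=
    @approx_cst R n p d * (@ratio R n p d `^ d) ^+ J * energy f `^ (d / p).
Proof.
by move=> [Cf [B [fB gB]] f0 g0]; exact: (approx_avg_le mO L0 OL p1 pd Cf fB gB g0 J dec0).
Qed.

Definition sobolev_cst : R := 2 `^ d * (@approx_cst R n p d + L1_cst `^ d * V).

(** [f] is compared with its averages at scale 1: the difference is bounded by [approx_avg_le] and
    the averages by the L^1 norm. *)
Lemma smooth_sobolev f : smooth_in Omega f ->
  bl.-integrable Omega (EFin \o (fun x => `|f x| `^ d)) /\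
  \int[bl]_(x in Omega) (`|f x| `^ d) <= sobolev_cst * energy f `^ (d / p).
Proof.
move=> sf; have [Cf [B [fB gB]] f0 g0] := sf.
have mf : measurable_fun setT f by exact: continuous_measurable_rV (Ck_continuous Cf).
have fi : bl.-integrable Omega (EFin \o (fun x => `|f x| `^ d)).
  apply: (bounded_integrable mO L0 OL (B := B `^ d)).
    by apply: (measurableT_comp (measurable_powR d)); exact: measurableT_comp.
  by move=> x; rewrite ger0_norm ?powR_ge0//; apply: powR_homo => //; exact: ltW.
split => //.
have Ai := smooth_approx_integrable 0 sf.
set c := L1_cst * energy f `^ p^-1.
have c0 : 0 <= c by rewrite mulr_ge0 ?L1_cst_ge0 ?powR_ge0.
have ci := integrable_cst_fin mO Ofin (c `^ d).
apply: (@le_trans _ _ (\int[bl]_(x in Omega) (2 `^ d * (`|f x - avg 0 f x| `^ d + c `^ d)))).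
  apply: le_Rintegral => //.
    by apply: integrable_cst_mul => //; exact: integrable_add.
  move=> x _; apply: le_trans (powR_addr_le _ c0 (ltW d0)) => //.
  apply: powR_homo => //; first exact: ltW.
  rewrite -{1}(subrK (avg 0 f x) (f x)) (le_trans (ler_normD _ _))// lerD2l.
  by have := smooth_avg_le 0 x sf; rewrite expr0 expr1n mul1r.
rewrite RintegralZl//; last exact: integrable_add.
rewrite RintegralD// Rintegral_cst// /sobolev_cst -mulrA; apply: ler_wpM2l; first exact: powR_ge0.
rewrite mulrDl; apply: lerD.
  by have := smooth_approx_le 0 sf; rewrite expr0 mulr1.
rewrite /c powRM ?powR_ge0 ?L1_cst_ge0// -powRrM (mulrC p^-1).
by rewrite le_eqVlt mulrAC eqxx.
Qed.

Lemma anchor_lattice_id J (c : 'rV[int]_n) : anchor J (lattice_point J c) = lattice_point J c :> 'rV[R]_n.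
Proof.
apply/rowP => i; rewrite !mxE mulrA (mulrC (2 ^+ J)) meshK mul1r.
by rewrite (floor_def (m := c ord0 i)) ?lexx ?ltr_int ?ltrDl.
Qed.

(** In units of the mesh the coordinates of the anchors are integers from -N to N - 1; they are
    shifted by [N] to be indexed by a finite type. *)
Lemma finite_cells J : exists N : nat, forall x, Omega x ->
  exists i : {ffun 'I_n -> 'I_N.*2.+1},
    anchor J x = lattice_point J (\row_k ((i k)%:Z - N%:Z)).
Proof.
have [N hN] : exists N : nat, 2 ^+ J * L <= N%:R.
  exists (Num.bound (2 ^+ J * L)); rewrite ltW//.
  by rewrite archi_boundP// mulr_ge0 ?exprn_ge0// ltW.
exists N => x /OL xQ.
pose z k := Num.floor (2 ^+ J * x ord0 k).
have zN k : - N%:Z <= z k < N%:Z.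
  have := xQ k; rewrite !mxE => /andP[x1 x2].
  have J0 : 0 < 2 ^+ J :> R by rewrite exprn_gt0.
  apply/andP; split.
    rewrite /z floor_ge_int intrN.
    apply: (@le_trans _ _ (2 ^+ J * (- L))); first by rewrite mulrN lerN2.
    by rewrite ler_pM2l.
  rewrite /z -(ltr_int R) (le_lt_trans (floor_le _))//.
  apply: lt_le_trans hN; rewrite ltr_pM2l//.
  by apply: lt_le_trans x2 _; rewrite (_ : - L + 2 * L = L)//; ring.
exists [ffun k => inord (absz (z k + N%:Z))].
rewrite anchor_lattice; congr lattice_point; apply/rowP => k; rewrite !mxE ffunE.
have /andP[z1 z2] := zN k.
have zp : 0 <= z k + N%:Z by rewrite -lerBlDr sub0r.
rewrite inordK; first by rewrite gez0_abs// addrK.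
by rewrite -ltz_nat gez0_abs// -addnn -addn1 !PoszD; move: z2 zp; move: (z k) (Posz N) => a b; lra.
Qed.

(** Up to an error uniform in [k], [F k] is its average at a fine scale [J], which has finitely many
    values on [Omega], all in a fixed interval. Rounding these values to multiples of [dl] leaves
    finitely many codes. *)
Lemma smooth_totally_bounded (F : nat -> 'rV[R]_n -> R) (M e : R) : 0 < e ->
  (forall k, smooth_in Omega (F k)) -> (forall k, energy (F k) <= M) ->
  finitely_coloured (fun k l => \int[bl]_(x in Omega) (`|F k x - F l x| `^ d) <= e).
Proof.
move=> e0 sF FM.
have M0 : 0 <= M by apply: le_trans (FM 0%N); exact: energy_ge0.
have [r0 r1 rd0 rd1] := @ratio_bounds R n p d p1 pd dec0.
set K := 2 `^ d * 2 `^ d.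
have K0 : 0 < K by rewrite mulr_gt0// powR_gt0.
set A := @approx_cst R n p d * M `^ (d / p).
(* [K] is the constant of [powR_add3_le], so each of the two approximation errors contributes at
   most e / 4. *)
have [J hJ] : exists J, A * (@ratio R n p d `^ d) ^+ J <= e / (4 * K).
  have rn : `|@ratio R n p d `^ d| < 1 by rewrite ger0_norm// ltW.
  have h : A * (@ratio R n p d `^ d) ^+ J @[J --> \oo] --> A * 0.
    by apply: cvgMr; exact: (cvg_expr rn).
  have e1 : 0 < e / (4 * K) by rewrite divr_gt0// mulr_gt0.
  have /cvgrPdist_lt/(_ _ e1)[N _ /(_ N (leqnn N))] := h.
  rewrite mulr0 sub0r normrN => hN; exists N.
  by rewrite (le_trans (ler_norm _))// ltW.
have [N cellN] := finite_cells J.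
pose B := (2 ^+ J) ^+ n * (L1_cst * M `^ p^-1).
have B0 : 0 <= B by rewrite /B mulr_ge0 ?exprn_ge0// mulr_ge0 ?L1_cst_ge0 ?powR_ge0.
have avB k x : `|avg J (F k) x| <= B.
  apply: (le_trans (smooth_avg_le J x (sF k))); rewrite /B.
  apply: ler_wpM2l; first by rewrite !exprn_ge0.
  apply: ler_wpM2l; first exact: L1_cst_ge0.
  by apply: powR_homo; [rewrite invr_ge0 ltW|exact: energy_ge0|exact: FM].
(* A difference of averages of at most [dl] on [Omega] contributes at most e / 2; [V + 1] avoids a
   division by zero. *)
pose dl := (e / (2 * K * (V + 1))) `^ d^-1.
have V1 : 0 < V + 1 by rewrite ltr_wpDl.
have dl0 : 0 < dl by rewrite powR_gt0// divr_gt0// !mulr_gt0.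
have dld : K * (dl `^ d * V) <= e / 2.
  rewrite /dl -powRrM mulVf ?gt_eqF// powRr1; last by rewrite divr_ge0 ?(ltW e0)// !mulr_ge0// ltW.
  rewrite (_ : K * _ = (e / 2) * (V / (V + 1))); last by field; rewrite !gt_eqF.
  by rewrite ler_piMr ?divr_ge0 ?(ltW e0)// ler_pdivrMr// mul1r lerDl.
pose code (v : R) := Num.floor ((v + B) / dl).
pose W := absz (Num.floor (2 * B / dl)).
have codeW k x : 0 <= code (avg J (F k) x) <= W%:Z.
  have := avB k x; rewrite ler_norml => /andP[v1 v2].
  have h0 : 0 <= (avg J (F k) x + B) / dl by rewrite divr_ge0 ?(ltW dl0)// -lerBlDr sub0r.
  apply/andP; split; first by rewrite floor_ge0.
  rewrite /W gez0_abs; first by apply: le_floor; rewrite ler_pM2r ?invr_gt0// mulr2n mulrDl mul1r lerD2r.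
  by rewrite floor_ge0 divr_ge0 ?(ltW dl0)// mulr_ge0.
pose pt (i : {ffun 'I_n -> 'I_N.*2.+1}) : 'rV[R]_n := lattice_point J (\row_k ((i k)%:Z - N%:Z)).
apply: (@finite_colouring {ffun {ffun 'I_n -> 'I_N.*2.+1} -> 'I_W.+1}
  (fun k => [ffun i => inord (absz (code (avg J (F k) (pt i))))])) => k l /ffunP kl.
have close x : Omega x -> `|avg J (F k) x - avg J (F l) x| <= dl.
  move=> /cellN[i xi]; have := kl i; rewrite !ffunE => /(congr1 val) /=.
  have /andP[k0 kW] := codeW k (pt i); have /andP[l0 lW] := codeW l (pt i).
  rewrite !inordK; last 2 first.
  - by rewrite ltnS -lez_nat gez0_abs.
  - by rewrite ltnS -lez_nat gez0_abs.
  move=> /(congr1 Posz); rewrite !gez0_abs// => cc.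
  have xp : anchor J x = anchor J (pt i) by rewrite xi anchor_lattice_id.
  rewrite (avg_anchor _ xp) (avg_anchor (F l) xp).
  have /andP[a1 a2] := floor_itv ((avg J (F k) (pt i) + B) / dl).
  have /andP[b1 b2] := floor_itv ((avg J (F l) (pt i) + B) / dl).
  move: a1 a2 b1 b2; rewrite -/(code _) -/(code _) cc !intrD.
  set c := (code _)%:~R; rewrite !ler_pdivlMr// !ltr_pdivrMr// mulrDl mul1r => a1 a2 b1 b2.
  exact: dist_same_floor a1 a2 b1 b2.
clear kl pt codeW code W avB B0 cellN N.
have ik := smooth_approx_integrable J (sF k); have il := smooth_approx_integrable J (sF l).
have ci := integrable_cst_fin mO Ofin (dl `^ d).
have s2 := integrable_add mO ik il; have s3 := integrable_add mO s2 ci.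
have tle j : \int[bl]_(x in Omega) (`|F j x - avg J (F j) x| `^ d) <= e / (4 * K).
  apply: le_trans hJ; apply: (le_trans (smooth_approx_le J (sF j))); rewrite /A.
  have ac0 : 0 <= @approx_cst R n p d.
    by rewrite !mulr_ge0 ?powR_ge0// invr_ge0 subr_ge0 ltW.
  move: (@approx_cst R n p d) ac0 => ac ac0; rewrite -!mulrA.
  apply: ler_wpM2l => //; rewrite mulrC; apply: ler_wpM2r; first by rewrite exprn_ge0// ltW.
  by apply: powR_homo; [rewrite divr_ge0 ?ltW|exact: energy_ge0|exact: FM].
apply: (@le_trans _ _ (\int[bl]_(x in Omega) (K * (`|F k x - avg J (F k) x| `^ d +
   `|F l x - avg J (F l) x| `^ d + dl `^ d)))).
  apply: le_Rintegral => //; first exact: smooth_diff_integrable.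
    exact: (integrable_cst_mul mO K s3).
  move=> x Ox; apply: le_trans (powR_add3_le _ _ (ltW dl0)) => //.
  apply: powR_homo => //; first exact: ltW.
  have -> : F k x - F l x = (F k x - avg J (F k) x) - (F l x - avg J (F l) x) +
    (avg J (F k) x - avg J (F l) x) by ring.
  rewrite (le_trans (ler_normD _ _))// lerD ?close//.
  exact: ler_normB.
rewrite (RintegralZl K mO s3) (RintegralD mO s2 ci) (RintegralD mO ik il) (Rintegral_cst _ mO).
have hk := tle k; have hl := tle l.
have : K * (e / (4 * K)) = e / 4 by field; rewrite gt_eqF.
move: (\int[bl]_(x in Omega) _) (\int[bl]_(x in Omega) _) hk hl => u v hu hv hK.
rewrite !mulrDr.
have := ler_wpM2l (ltW K0) hu; have := ler_wpM2l (ltW K0) hv; rewrite hK.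
move: dld; rewrite (mulrC (dl `^ d)); exact: le_half_quarters.
Qed.

End sobolev.

(** * Test functions and weak gradients *)

Section divergence.
Context {R : realType}.
Local Notation bl := (@borel_lebesgue R).
Local Notation leb := (@lebesgue_measure R).

Lemma continuous_derive n (f : 'rV[R]_n -> R) i : Ck 1 f -> continuous (fun x => 'D_(ebase i) f x).
Proof. by move=> [_ /(_ i)[_ []]]. Qed.

Lemma Ck1_is_derive n (f : 'rV[R]_n -> R) i x : Ck 1 f ->
  is_derive x (ebase i) f ('D_(ebase i) f x).
Proof. by move=> [_ /(_ i)[df _]]; apply: DeriveDef. Qed.

(* Adding a constant [C] that makes the derivative nonnegative allows the use of Tonelli's theorem. *)
Lemma integral_derive_cube n (f : 'rV[R]_n -> R) (a : 'rV[R]_n) (h C : R) (i : 'I_n) :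
  0 < h -> Ck 1 f ->
  (forall x : 'rV[R]_n, (exists j, ~ (a ord0 j < x ord0 j < a ord0 j + h)) -> f x = 0) ->
  (forall x, 0 <= 'D_(ebase i) f x + C) ->
  (\int[bl n]_(x in cube a h) ('D_(ebase i) f x + C)%:E = (C * h ^+ n)%:E)%E.
Proof.
elim: n f a i => [|n IH] f a i h0 Cf f0 DC; first by case: i {DC}.
have mD : measurable_fun setT (fun x => ('D_(ebase i) f x + C)%:E).
  apply/measurable_EFinP; apply: measurable_funD => //.
  exact: continuous_measurable_rV (@continuous_derive _ f i Cf).
have D0 x : (0 <= ('D_(ebase i) f x + C)%:E)%E by rewrite lee_fin.
move: mD D0 DC; case: (unliftP ord0 i) => [j ->|->] mD D0 DC.
- rewrite integral_cubeS//.
  have inner s : (\int[bl n]_(x in cube (row_tail a) h) ('D_(ebase (lift ord0 j)) f (rV_cons (s, x)) + C)%:E =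
      (C * h ^+ n)%:E)%E.
    have E x : 'D_(ebase j) (fun x => f (rV_cons (s, x))) x = 'D_(ebase (lift ord0 j)) f (rV_cons (s, x)).
      by have /(congr1 (fun F : 'rV[R]_n -> R => F x)) := derive_sliceS (s : R) (j : 'I_n) Cf.
    rewrite -(IH (fun x => f (rV_cons (s, x))) (row_tail a) j h0 (Ck1_slice s Cf)).
    + by apply: eq_integral => x _; rewrite E.
    + move=> x [k hk]; apply: f0; exists (lift ord0 k).
      by move: hk; rewrite /row_tail /rV_cons !mxE liftK.
    + by move=> x; rewrite E.
  under eq_integral do rewrite inner.
  by rewrite integral_cst//= lebesgue_measure_co ?(ltW h0)// -EFinM -mulrA -exprSr.
- rewrite integral_cubeS_swap//.
  have inner x : (\int[leb]_(s in `[a ord0 ord0, (a ord0 ord0 + h)%R[)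
      ('D_(ebase ord0) f (rV_cons (s, x)) + C)%:E = (C * h)%:E)%E.
    have cD : continuous (fun s : R => 'D_(ebase ord0) f (rV_cons (s, x)) + C).
      move=> s; apply: cvgD; last exact: cvg_cst.
      apply: (@continuous_comp _ _ _ (fun s : R => rV_cons (s, x)) ('D_(ebase ord0) f) s).
        exact: (@continuous_rV_cons_l R n x s).
      exact: (@continuous_derive _ f _ Cf).
    rewrite integral_itv_bndo_bndc; last first.
      by apply/measurable_EFinP; apply: measurable_funTS; exact: continuous_measurable_fun.
    have dD (s : R) : is_derive s (1 : R) (fun s : R => f (rV_cons (s, x)) + C * s)
        ('D_(ebase ord0) f (rV_cons (s, x)) + C).
      apply: is_deriveD; first by apply: is_derive_slice0; exact: Ck1_is_derive.
      by apply: is_derive_eq; rewrite /GRing.scale/= ?mulr1.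
    have a_lt : a ord0 ord0 < a ord0 ord0 + h by rewrite ltrDl.
    rewrite (FTC_derive a_lt dD cD).
    have fe t : ~ (a ord0 ord0 < t < a ord0 ord0 + h) -> f (rV_cons (t, x)) = 0.
      by move=> th; apply: f0; exists ord0; rewrite /rV_cons mxE unlift_none.
    by rewrite !fe ?ltxx ?andbF// !add0r -EFinB mulrDr addrAC subrr add0r.
  under eq_integral do rewrite inner.
  rewrite integral_cst//=; last exact: measurable_cube.
  by rewrite borel_lebesgue_hbox ?(ltW h0)// -EFinM -mulrA -exprS.
Qed.

End divergence.

(** * Test functions and integration by parts *)

Section test_functions.
Context {R : realType} {n : nat}.
Local Notation bl := (@borel_lebesgue R n).
Local Notation mu := (@lebesgue_rV R n).
Variable Omega : set 'rV[R]_n.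

Definition grad (f : 'rV[R]_n -> R) (x : 'rV[R]_n) : 'rV[R]_n := \row_i 'D_(ebase i) f x.

Lemma compact_continuous_bounded (K : set 'rV[R]_n) (f : 'rV[R]_n -> R) : compact K -> continuous f ->
  exists2 B : R, 0 <= B & forall x, K x -> `|f x| <= B.
Proof.
move=> cK cf.
have cfK : compact (f @` K).
  by apply: continuous_compact => //; exact: continuous_subspaceT.
have /compact_bounded[M [_ hM]] := cfK.
exists (`|M| + 1) => [|x Kx]; first by rewrite addr_ge0.
apply: (hM (`|M| + 1)) => /=; last by exists x.
by rewrite (le_lt_trans (ler_norm M))// ltrDl.
Qed.

Lemma vanish_derive (phi : 'rV[R]_n -> R) x v : ~ closure [set x | phi x != 0] x -> 'D_v phi x = 0.
Proof.
move=> nx; rewrite -(derive_cst (0 : R) x v); apply: near_eq_derive.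
have : nbhs x (~` closure [set x | phi x != 0]).
  by apply: open_nbhs_nbhs; split => //; apply: closed_openC; exact: closed_closure.
apply: filterS => y ny; apply/eqP; rewrite -[_ == _]negbK; apply/negP => h.
by apply: ny; exact: subset_closure.
Qed.

Lemma test_function_derive0 phi x v : test_function Omega phi -> ~ Omega x -> 'D_v phi x = 0.
Proof. by move=> [_ _ sO] nx; apply: vanish_derive => /sO. Qed.

Lemma test_function0 phi x : test_function Omega phi -> ~ Omega x -> phi x = 0.
Proof.
move=> [_ _ sO] nx; apply/eqP; rewrite -[_ == _]negbK; apply/negP => h.
by apply: nx; apply: sO; exact: subset_closure.
Qed.

Lemma test_function_smooth_in phi : test_function Omega phi -> smooth_in Omega phi.
Proof.
move=> tphi; have [Cphi cK sO] := tphi; have C1 := Cphi 1%N.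
split => //; last 2 first.
- by move=> x /(test_function0 tphi).
- move=> x nx; rewrite /grad1 big1// => i _.
  by rewrite (test_function_derive0 _ tphi nx) normr0.
have [B B0 hB] := compact_continuous_bounded cK (Ck_continuous C1).
have [B' B0' hB'] := compact_continuous_bounded cK (@continuous_grad1 _ _ phi C1).
exists (B + B'); split => x.
- have [/hB h|h] := pselect (closure [set x | phi x != 0] x).
    by rewrite (le_trans h)// lerDl.
  rewrite (_ : phi x = 0) ?normr0 ?addr_ge0//; apply/eqP; rewrite -[_ == _]negbK; apply/negP => h'.
  by apply: h; exact: subset_closure.
- have [/hB' h|h] := pselect (closure [set x | phi x != 0] x).
    by rewrite (le_trans (ler_norm _))// (le_trans h)// lerDr.
  by rewrite /grad1 big1 ?addr_ge0// => i _; rewrite vanish_derive// normr0.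
Qed.

(** The support of [h] lies in the union of the two supports. Linear combinations, products and
    smoothed absolute values of test functions are all instances. *)
Lemma test_function_closed (phi psi h : 'rV[R]_n -> R) : test_function Omega phi ->
  test_function Omega psi -> (forall k, Ck k h) ->
  (forall x, phi x = 0 -> psi x = 0 -> h x = 0) -> test_function Omega h.
Proof.
move=> [_ c1 s1] [_ c2 s2] Ch h0.
have sub : closure [set x | h x != 0] `<=`
    closure [set x | phi x != 0] `|` closure [set x | psi x != 0].
  rewrite -closureU; apply: closure_subset => x /= hx.
  have [px|] := eqVneq (phi x) 0; last by left.
  have [qx|] := eqVneq (psi x) 0; last by right.
  by move: hx; rewrite h0 ?eqxx.
split => //; last by move=> x /sub[/s1|/s2].
apply: (subclosed_compact _ _ sub); first exact: closed_closure.
exact: compactU.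
Qed.

Lemma test_function_cst0 : test_function Omega (fun=> 0).
Proof.
have e : closure [set _ : 'rV[R]_n | (0 : R) != 0] = set0.
  by rewrite (_ : [set _ | _] = set0) ?closure0//; apply/seteqP; split => x //=; rewrite eqxx.
by split => [k||]; rewrite ?e//; [exact: Ck_cst|exact: compact0].
Qed.

Lemma test_functionDZ c phi psi : test_function Omega phi -> test_function Omega psi ->
  test_function Omega (fun x => phi x + c * psi x).
Proof.
move=> t1 t2; apply: (test_function_closed t1 t2) => [k|x -> ->]; last by rewrite mulr0 addr0.
by apply: CkD; [have [] := t1|apply: CkZ; have [] := t2].
Qed.

Lemma test_function_abs e phi : 0 < e -> test_function Omega phi ->
  test_function Omega (fun x => smooth_abs e (phi x)).
Proof.
move=> e0 t; apply: (test_function_closed t t) => [k|x -> _].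
  by apply: Ck_smooth_abs => //; have [] := t.
by rewrite /smooth_abs expr0n/= add0r sqrtr_sqr gtr0_norm// subrr.
Qed.

Lemma grad_linear c phi psi x : test_function Omega phi -> test_function Omega psi ->
  grad (fun x => phi x + c * psi x) x = grad phi x + c *: grad psi x.
Proof.
move=> [C1 _ _] [C2 _ _]; apply/rowP => i; rewrite !mxE.
have d1 := Ck1_is_derive i x (C1 1%N); have d2 := Ck1_is_derive i x (C2 1%N).
by have [_ ->] := is_deriveD d1 (is_deriveZ c d2).
Qed.

Variable L : R.
Hypotheses (oO : open Omega) (L0 : 0 < L) (OL : Omega `<=` cube (const_mx (- L)) (2 * L)).

Let mO : measurable Omega. Proof. exact: open_measurable_rV. Qed.

Lemma integral_derive_test phi i : test_function Omega phi ->
  \int[mu]_(x in Omega) 'D_(ebase i) phi x = 0.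
Proof.
move=> tphi; have [C1 [B [phiB gB]] phi0 g0] := test_function_smooth_in tphi.
have mD : measurable_fun setT (fun x => 'D_(ebase i) phi x).
  exact: continuous_measurable_rV (@continuous_derive _ _ phi i C1).
rewrite Rintegral_lebesgue_rV//; last exact: measurable_funTS.
have DB x : `|'D_(ebase i) phi x| <= B.
  apply: le_trans (gB x); rewrite /grad1 (bigD1 i)//= lerDl.
  by apply: sumr_ge0.
have D0 x : ~ Omega x -> 'D_(ebase i) phi x = 0 by exact: test_function_derive0.
(* The cube is enlarged so that [Omega] lies in its interior, since [integral_derive_cube] asks
   [phi] to vanish off the open cube. *)
pose L' := L + 1; have L'0 : 0 < L' by rewrite addr_gt0.
pose Q := cube (const_mx (- L') : 'rV[R]_n) (2 * L').
have mQ : measurable Q by exact: measurable_cube.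
have OQ : Omega `<=` Q.
  move=> x /OL h j; have := h j; rewrite !mxE /L' => /andP[h1 h2].
  by apply/andP; split; move: h1 h2; lra.
have D0Q x : ~ Q x -> 'D_(ebase i) phi x = 0 by move=> nQ; apply: D0 => /OQ.
have bQ : Q `<=` cube (const_mx (- L')) (2 * L') by [].
have iQ := bounded_integrable mQ L'0 bQ mD DB.
have iO := bounded_integrable mO L0 OL mD DB.
apply: EFin_inj; rewrite EFin_Rintegral// -(vanish_integral D0) (vanish_integral D0Q).
have DB0 x : 0 <= 'D_(ebase i) phi x + B.
  by have := DB x; rewrite ler_norml -lerBlDr sub0r => /andP[].
have cQ : (bl Q < +oo)%E by exact: (measure_bounded_fin mQ L'0 bQ).
have ci : bl.-integrable Q (EFin \o (fun=> B)) by exact: integrable_cst_fin.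
have out (x : 'rV[R]_n) : (exists j, ~ ((const_mx (- L') : 'rV[R]_n) ord0 j < x ord0 j < (const_mx (- L') : 'rV[R]_n) ord0 j + 2 * L')) ->
    phi x = 0.
  move=> [j hj]; apply: (test_function0 tphi) => /OL/(_ j); rewrite !mxE /L' => /andP[h1 h2].
  by apply: hj; rewrite !mxE /L'; apply/andP; split; move: h1 h2; lra.
have := integral_derive_cube (mulr_gt0 (ltr0n _ 2) L'0) C1 out DB0.
rewrite -/Q -EFin_Rintegral//; last exact: integrable_add.
rewrite RintegralD// Rintegral_cst//.
have -> : fine (bl Q) = (2 * L') ^+ n.
  by rewrite [bl Q]borel_lebesgue_hbox// mulr_ge0// ltW.
rewrite -(EFin_Rintegral mQ iQ) => -[] /(congr1 (fun t => t - B * (2 * L') ^+ n)).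
by rewrite addrK subrr => ->.
Qed.

Lemma measurable_compact_rV (K : set 'rV[R]_n) : compact K -> measurable K.
Proof.
move=> cK; rewrite -(setCK K); apply: measurableC; apply: open_measurable_rV.
by apply: closed_openC; apply: compact_closed => //; exact: norm_hausdorff.
Qed.

Lemma continuous_L1loc (f : 'rV[R]_n -> R) : continuous f -> L1loc Omega f.
Proof.
move=> cf; have mf := continuous_measurable_rV cf.
split; first by apply: borel_measurable_cara => //; exact: measurable_funTS.
move=> K KO cK; have mK := measurable_compact_rV cK.
apply: integrable_lebesgue_rV => //.
have [B B0 hB] := compact_continuous_bounded cK cf.
have Kfin : (bl K < +oo)%E.
  have := measure_bounded_fin mO L0 OL; apply: (@le_lt_trans _ _ (bl Omega)).
  by apply: le_measure; rewrite ?inE.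
apply: (measurable_bounded_integrable mK Kfin); first exact: measurable_funTS.
exists B; split; first by rewrite num_real.
by move=> M BM x Kx /=; exact: le_trans (hB x Kx) (ltW BM).
Qed.

Lemma bounded_integrable_mu (f : 'rV[R]_n -> R) (B : R) : measurable_fun setT f ->
  (forall x, `|f x| <= B) -> mu.-integrable Omega (EFin \o f).
Proof.
move=> mf fB; apply: integrable_lebesgue_rV => //.
exact: (bounded_integrable mO L0 OL mf fB).
Qed.

Lemma test_bounded phi : test_function Omega phi -> exists B,
  (forall x, `|phi x| <= B) /\ forall x i, `|'D_(ebase i) phi x| <= B.
Proof.
move=> /test_function_smooth_in[_ [B [pB gB]] _ _]; exists B; split => // x i.
by apply: le_trans (gB x); rewrite /grad1 (bigD1 i)//= lerDl; apply: sumr_ge0.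
Qed.

(** Integration by parts: the integral of the derivative of the test function [phi * psi]
    vanishes. *)
Lemma test_weak_gradient phi : test_function Omega phi ->
  is_weak_gradient Omega phi (grad phi).
Proof.
move=> tphi; have [C1 _ _] := tphi; split.
- exact: continuous_L1loc (Ck_continuous (C1 0%N)).
- move=> i; rewrite (_ : (fun z => _) = 'D_(ebase i) phi); last by apply/funext => z; rewrite mxE.
  exact: continuous_L1loc (@continuous_derive _ _ phi i (C1 1%N)).
- move=> psi tpsi i; have [C2 _ _] := tpsi.
  have t : test_function Omega (fun x => phi x * psi x).
    apply: (test_function_closed tphi tpsi) => [k|x -> _]; last by rewrite mul0r.
    exact: CkM.
  have := integral_derive_test i t.
  have -> : 'D_(ebase i) (fun x => phi x * psi x) =
      (fun x => phi x * 'D_(ebase i) psi x + grad phi x ord0 i * psi x).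
    apply/funext => x.
    have d1 := Ck1_is_derive i x (C1 1%N); have d2 := Ck1_is_derive i x (C2 1%N).
    have [_ ->] := is_deriveM d1 d2.
    by rewrite mxE; congr (_ + _); exact: mulrC.
  have [B1 [p1 g1]] := test_bounded tphi; have [B2 [p2 g2]] := test_bounded tpsi.
  have m1 := continuous_measurable_rV (Ck_continuous (C1 1%N)).
  have m2 := continuous_measurable_rV (Ck_continuous (C2 1%N)).
  have m1' := continuous_measurable_rV (@continuous_derive _ _ phi i (C1 1%N)).
  have m2' := continuous_measurable_rV (@continuous_derive _ _ psi i (C2 1%N)).
  rewrite RintegralD; last 3 first.
  + exact: borel_cara.
  + apply: (@bounded_integrable_mu _ (B1 * B2)); first exact: measurable_funM.
    by move=> x; rewrite normrM ler_pM.
  + apply: (@bounded_integrable_mu _ (B1 * B2)).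
      by apply: measurable_funM => //; under eq_fun do rewrite mxE.
    by move=> x; rewrite normrM mxE ler_pM.
  by move=> /eqP; rewrite addr_eq0 => /eqP.
Qed.

End test_functions.

(** * Bump functions over boxes *)

Section bumps.
Context {R : realType} {n : nat}.
Variable Omega : set 'rV[R]_n.

(** Positive exactly on the open box, and tending to its indicator as [k] grows: the factor k + 1
    steepens the flat functions at the faces. *)
Definition bump (a b : 'rV[R]_n) (k : nat) (x : 'rV[R]_n) : R :=
  \prod_(i < n) (flat 0 (k.+1%:R * (x ord0 i - a ord0 i)) * flat 0 (k.+1%:R * (b ord0 i - x ord0 i))).

Lemma flat0_le1 (t : R) : flat 0 t <= 1.
Proof.
rewrite /flat; case: ifP => // t0; rewrite expr0 mul1r -expR0 ler_expR oppr_le0 invr_ge0.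
exact: ltW.
Qed.

Lemma bump_bounds a b k x : 0 <= bump a b k x <= 1.
Proof.
apply/andP; split; first by apply: prodr_ge0 => i _; rewrite mulr_ge0 ?flat_ge0.
apply: prodr_ile1 => i _; rewrite mulr_ge0 ?flat_ge0//=.
by rewrite mulr_ile1 ?flat_ge0 ?flat0_le1.
Qed.

Lemma flat_gt0 m (t : R) : 0 < t -> 0 < flat m t.
Proof. by move=> t0; rewrite /flat t0 mulr_gt0 ?expR_gt0// exprn_gt0// invr_gt0. Qed.

Lemma flat_le0 m (t : R) : t <= 0 -> flat m t = 0.
Proof. by move=> t0; rewrite /flat ltNge t0. Qed.

Lemma bump_gt0 a b k x : obox a b x -> 0 < bump a b k x.
Proof.
move=> h; apply: prodr_gt0 => i _; have /andP[h1 h2] := h i.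
by rewrite mulr_gt0// flat_gt0// mulr_gt0// subr_gt0.
Qed.

Lemma bump_eq0 a b k x : ~ obox a b x -> bump a b k x = 0.
Proof.
move=> /existsNP[i] /negP; rewrite negb_and -!leNgt => h.
rewrite /bump (bigD1 i)//=.
have k0 : 0 < k.+1%:R :> R by [].
by case/orP: h => h; [rewrite (@flat_le0 0)|rewrite [flat 0 (_ * (b _ _ - _))]flat_le0];
  rewrite ?mul0r ?mulr0 ?mul0r// pmulr_rle0// subr_le0.
Qed.

Lemma cvg_flat0 (t : R) : 0 < t -> flat 0 (k.+1%:R * t) @[k --> \oo] --> (1 : R).
Proof.
move=> t0.
have -> : (fun k => flat 0 (k.+1%:R * t)) = (fun k => expR (- ((k.+1%:R)^-1 * t^-1))).
  by apply/funext => k; rewrite /flat mulr_gt0// expr0 mul1r invfM.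
have h : expR (- (k.+1%:R^-1 * t^-1)) @[k --> \oo] --> expR (- (0 * t^-1)).
  apply: continuous_cvg; first exact: continuous_expR.
  apply: cvgN; apply: cvgMl; exact: cvg_harmonic.
by move: h; rewrite mul0r oppr0 expR0.
Qed.

Lemma cvg_bump a b x : obox a b x -> bump a b k x @[k --> \oo] --> (1 : R).
Proof.
move=> h; rewrite -[X in _ --> X](_ : \prod_(i < n) (1 * 1 : R) = 1); last first.
  by rewrite mulr1 big1.
apply: cvg_big => //; first by move=> z; apply: cvgM; [exact: cvg_fst|exact: cvg_snd].
move=> i _; have /andP[h1 h2] := h i.
by apply: cvgM; apply: cvg_flat0; rewrite subr_gt0.
Qed.

Lemma bump_test (a b : 'rV[R]_n) k :
  (forall x : 'rV[R]_n, (forall i, a ord0 i <= x ord0 i <= b ord0 i) -> Omega x) ->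
  test_function Omega (bump a b k).
Proof.
move=> abO; pose K := [set x : 'rV[R]_n | forall i, `[a ord0 i, b ord0 i]%classic (x ord0 i)].
have cK : compact K.
  by apply: (@rV_compact R n (fun i => `[a ord0 i, b ord0 i]%classic)) => i; exact: segment_compact.
have sub : closure [set x | bump a b k x != 0] `<=` K.
  rewrite -[K](_ : closure K = K); last first.
    apply/esym/closure_id; apply: compact_closed => //; exact: norm_hausdorff.
  apply: closure_subset => x /= hx i.
  have [/(_ i)/andP[h1 h2]|nb] := pselect (obox a b x); last by rewrite bump_eq0 ?eqxx in hx.
  by rewrite /= in_itv/= !ltW.
split.
- move=> m; apply: Ck_prod => i; apply: CkM; apply: Ck_flat => l; apply: CkZ; apply: CkB;
    by [exact: Ck_coord|exact: Ck_cst].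
- by apply: (subclosed_compact _ cK sub); exact: closed_closure.
- by move=> x /sub h; apply: abO => i; have := h i; rewrite /= in_itv.
Qed.

End bumps.

Section almost_everywhere.
Context d (T : measurableType d) (R : realType) (mu : {measure set T -> \bar R}).
Implicit Types P Q S : T -> Prop.

Lemma ae_mono P Q : (forall x, P x -> Q x) -> {ae mu, forall x, P x} -> {ae mu, forall x, Q x}.
Proof. by move=> PQ; apply: filterS. Qed.

Lemma ae_mono2 P Q S : (forall x, P x -> Q x -> S x) ->
  {ae mu, forall x, P x} -> {ae mu, forall x, Q x} -> {ae mu, forall x, S x}.
Proof. by move=> PQ; apply: filterS2. Qed.

End almost_everywhere.

(** * Borel hulls and functions with zero integrals over boxes *)

Section borel_regularity.
Context {R : realType} {n : nat}.
Local Notation bl := (@borel_lebesgue R n).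
Local Notation mu := (@lebesgue_rV R n).
Local Notation cT := (caratheodory_type (bl^*)%mu).

(** The completed measure is an outer measure defined by countable Borel covers. The intersection of
    covers that are optimal up to 1/(k + 1) is a Borel set of the same measure. *)
Lemma borel_hull (A : set 'rV[R]_n) : measurable (A : set cT) -> (mu A < +oo)%E ->
  exists B : set 'rV[R]_n, [/\ measurable B, A `<=` B & mu (B `\` A) = 0%E].
Proof.
move=> mA Aoo.
have muA : mu A = ereal_inf [set (\sum_(0 <= i <oo) bl (F i))%E | F in measurable_cover A] by [].
have Afin : mu A \is a fin_num by rewrite ge0_fin_numE.
have /choice[B hB] (k : nat) : exists B, [/\ measurable B, A `<=` B &
    (bl B <= mu A + (k.+1%:R^-1)%:E)%E].
  have k0 : 0 < k.+1%:R^-1 :> R by rewrite invr_gt0.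
  have [_ [F [mF AF] <-] lF] : exists2 y, [set (\sum_(0 <= i <oo) bl (F i))%E | F in measurable_cover A] y &
      (y < mu A + (k.+1%:R^-1)%:E)%E.
    by rewrite muA; apply: lb_ereal_inf_adherent => //; rewrite -muA.
  exists (\bigcup_i F i); split => //; first exact: bigcup_measurable.
  apply: (@le_trans _ _ (\sum_(0 <= i <oo) bl (F i))%E); last exact: ltW.
  apply: measure_sigma_subadditive => //.
  exact: bigcup_measurable.
have mB : measurable (\bigcap_k B k) by apply: bigcap_measurable => // k _; have [] := hB k.
have AB : A `<=` \bigcap_k B k by move=> x Ax k _; have [_ + _] := hB k; apply.
exists (\bigcap_k B k); split => //.
have mB' : measurable ((\bigcap_k B k) : set cT) by exact: borel_cara.
have BA : (mu (\bigcap_k B k) <= mu A)%E.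
  apply/lee_addgt0Pr => e e0; rewrite lebesgue_rV_borel//.
  pose k := Num.bound e^-1.
  have ke : (k.+1%:R^-1 : R) <= e.
    rewrite -[leRHS]invrK lef_pV2 ?posrE ?invr_gt0//.
    apply: (@le_trans _ _ k%:R); last by rewrite ler_nat.
    by apply: ltW; apply: archi_boundP; rewrite invr_ge0 ltW.
  have [mBk _ lBk] := hB k.
  apply: (@le_trans _ _ (bl (B k))).
    by apply: le_measure; rewrite ?inE//; move=> x; apply.
  by apply: (le_trans lBk); rewrite leeD2l// lee_fin.
have -> : mu ((\bigcap_k B k) `\` A) = (mu (\bigcap_k B k) - mu ((\bigcap_k B k) `&` A))%E.
  by apply: measureD => //; apply: le_lt_trans BA _.
rewrite (_ : _ `&` A = A); last by apply/setIidPr.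
apply/eqP; rewrite eq_le sube_le0 BA/=.
by rewrite sube_ge0 ?Afin// le_measure ?inE.
Qed.

Definition oboxes : set (set 'rV[R]_n) := [set A | exists a b, A = obox a b].

Lemma obox_setI (a b a' b' : 'rV[R]_n) : obox a b `&` obox a' b' =
  obox (\row_i Num.max (a ord0 i) (a' ord0 i)) (\row_i Num.min (b ord0 i) (b' ord0 i)).
Proof.
apply/seteqP; split => [x [h h'] i|x h].
  by rewrite !mxE gt_max lt_min; have /andP[-> ->] := h i; have /andP[-> ->] := h' i.
by split => i; have := h i; rewrite !mxE gt_max lt_min => /andP[/andP[? ?] /andP[? ?]]; apply/andP.
Qed.

Lemma oboxesI : setI_closed oboxes.
Proof. by move=> _ _ [a [b ->]] [a' [b' ->]]; rewrite obox_setI; do 2 eexists. Qed.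

Lemma oboxes_generate : @measurable _ 'rV[R]_n = <<s oboxes >>.
Proof.
apply/seteqP; split; last first.
  apply: smallest_sub; first exact: sigma_algebra_measurable.
  by move=> _ [a [b ->]]; exact: measurable_obox.
apply: smallest_sub; first exact: smallest_sigma_algebra.
move=> B /=; rewrite -bigcup_seq/= => -[i _ [C mC <-]].
have mf : measurable_fun setT (fun x : g_sigma_algebraType oboxes => (x : 'rV[R]_n) ord0 i : measurableTypeR R).
  apply: (measurability (@RGenOInfty.G R)); first exact: RGenOInfty.measurableE.
  move=> _ [_ [r ->] <-]; rewrite setTI.
  (* The half-space where the i-th coordinate exceeds [r] is the union of boxes with lower face [r]
     in that direction, growing with [N] in all others. *)
  pose a (N : nat) : 'rV[R]_n := \row_j (if j == i then r else - N%:R).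
  pose b (N : nat) : 'rV[R]_n := \row_j N%:R.
  rewrite (_ : _ @^-1` _ = \bigcup_N obox (a N) (b N)).
    apply: bigcup_measurable => N _; apply: sub_sigma_algebra; by exists (a N), (b N).
  apply/seteqP; split => [x /=|x [N _ /(_ i)]].
    rewrite in_itv/= andbT => rx.
    exists (Num.bound (\sum_j `|x ord0 j|)) => //= j.
    have lt : `|x ord0 j| < (Num.bound (\sum_j `|x ord0 j|))%:R.
      apply: le_lt_trans (archi_boundP _); last exact: sumr_ge0.
      by rewrite (bigD1 j)//= lerDl sumr_ge0.
    move: lt; rewrite !mxE ltr_norml; case: eqP => [->|_] /andP[h1 h2]; last by rewrite h1.
    by rewrite rx.
  by rewrite !mxE eqxx /= in_itv/= andbT => /andP[].
by have := mf measurableT C mC.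
Qed.

(** The pi-lambda theorem: the sets over which the integral vanishes form a Dynkin system, and the
    open boxes generate the sigma-algebra and are stable under intersection. *)
Lemma borel_null_integral (Q : set 'rV[R]_n) (f : 'rV[R]_n -> R) :
  measurable Q -> mu.-integrable Q (EFin \o f) -> \int[mu]_(x in Q) f x = 0 ->
  (forall a b, \int[mu]_(x in obox a b `&` Q) f x = 0) ->
  forall A, measurable A -> \int[mu]_(x in A `&` Q) f x = 0.
Proof.
move=> mQ fi fQ fbox A; rewrite oboxes_generate => mA.
have cQ : measurable (Q : set cT) by exact: borel_cara.
apply: (@dynkin_induction _ _ oboxes (fun A => \int[mu]_(x in A `&` Q) f x = 0) oboxes_generate oboxesI _ _ _ _ A mA).
- by rewrite setTI.
- by move=> _ [a [b ->]]; exact: fbox.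
- move=> S mS S0.
  have cS : measurable (S : set cT) by exact: borel_cara.
  have QE : Q = (S `&` Q) `|` (~` S `&` Q) by rewrite -setIUl setUv setTI.
  move: fQ; rewrite {1}QE Rintegral_setU.
  + by rewrite S0 add0r.
  + exact: measurableI.
  + by apply: measurableI => //; exact: measurableC.
  + by rewrite -QE.
  + by apply/disj_setPS => x [[? _] [? _]].
- move=> F mF tF F0.
  have cF k : measurable (F k `&` Q : set cT) by apply: borel_cara; exact: measurableI.
  have sub : \bigcup_k (F k `&` Q) `<=` Q by move=> x [k _ []].
  rewrite setI_bigcupl.
  have ci : mu.-integrable (\bigcup_k (F k `&` Q)) (EFin \o f).
    by apply: (integrableS _ _ _ fi) => //; exact: bigcup_measurable.
  apply: EFin_inj; rewrite EFin_Rintegral//; last exact: bigcup_measurable.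
  rewrite integral_bigcup//; last exact: trivIset_setIr.
  rewrite eseries0// => k _ _; rewrite -EFin_Rintegral ?F0//.
  by apply: (integrableS _ _ _ fi) => //; move=> x [].
Qed.

(** A Lebesgue measurable set is replaced by its Borel hull, from which it differs by a negligible
    set. *)
Lemma null_on_boxes (Q : set 'rV[R]_n) (f : 'rV[R]_n -> R) :
  measurable Q -> (bl Q < +oo)%E -> mu.-integrable Q (EFin \o f) -> \int[mu]_(x in Q) f x = 0 ->
  (forall a b, \int[mu]_(x in obox a b `&` Q) f x = 0) ->
  {ae mu, forall x, Q x -> f x = 0}.
Proof.
move=> mQ Qoo fi fQ fbox.
have cQ : measurable (Q : set cT) by exact: borel_cara.
have nul := borel_null_integral mQ fi fQ fbox.
have : ae_eq mu Q (EFin \o f) (cst 0%E).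
  apply: integral_ae_eq => // E EQ mE; rewrite integral0.
  have Eoo : (mu E < +oo)%E.
    apply: (@le_lt_trans _ _ (mu Q)); last by rewrite lebesgue_rV_borel.
    by apply: le_measure; rewrite ?inE.
  have [B [mB EB BE0]] := borel_hull mE Eoo.
  have cB : measurable (B : set cT) by exact: borel_cara.
  have mBQ : measurable (B `&` Q : set cT) by exact: measurableI.
  have EBQ : E `<=` B `&` Q by move=> x Ex; split; [exact: EB|exact: EQ].
  have fBQ : mu.-integrable (B `&` Q) (EFin \o f) by apply: (integrableS _ _ _ fi) => //; move=> x [].
  have : \int[mu]_(x in B `&` Q) f x = 0 by exact: nul.
  have BQE : B `&` Q = E `|` ((B `&` Q) `\` E) by rewrite setDE setUIr setUv setIT; apply/esym/setUidPr.
  have mN : measurable ((B `&` Q) `\` E : set cT) by exact: measurableD.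
  have N0 : mu ((B `&` Q) `\` E) = 0%E.
    by apply: (subset_measure0 mN _ _ BE0); [exact: measurableD|move=> x [[]]].
  have := negligible_integral mN mBQ fBQ N0.
  rewrite setDD (setIidr EBQ).
  by move=> <- h; rewrite -(EFin_Rintegral mBQ fBQ) h.
by apply: ae_mono => x h Qx; apply: EFin_inj; exact: h.
Qed.

End borel_regularity.

(** * The fundamental lemma of the calculus of variations *)

Section fundamental_lemma.
Context {R : realType} {n : nat}.
Local Notation bl := (@borel_lebesgue R n).
Local Notation mu := (@lebesgue_rV R n).
Local Notation cT := (caratheodory_type (bl^*)%mu).
Variables (Omega : set 'rV[R]_n) (f : 'rV[R]_n -> R).
Hypotheses (oO : open Omega) (fL : L1loc Omega f).
Hypothesis f0 : forall phi, test_function Omega phi -> \int[mu]_(x in Omega) (f x * phi x) = 0.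

Definition closed_box (a b : 'rV[R]_n) : set 'rV[R]_n := [set x | forall i, a ord0 i <= x ord0 i <= b ord0 i].

Lemma obox_closed_box a b : obox a b `<=` closed_box a b.
Proof. by move=> x h i; have /andP[/ltW -> /ltW ->] := h i. Qed.

Lemma compact_closed_box a b : compact (closed_box a b).
Proof.
rewrite (_ : closed_box a b = [set x | forall i, `[a ord0 i, b ord0 i]%classic (x ord0 i)]).
  by apply: (@rV_compact R n (fun i => `[a ord0 i, b ord0 i]%classic)) => i; exact: segment_compact.
by apply/seteqP; split => x h i; have := h i; rewrite /= in_itv.
Qed.

Lemma integrable_obox a b : closed_box a b `<=` Omega -> mu.-integrable (obox a b) (EFin \o f).
Proof.
move=> abO; have [_ /(_ _ abO (@compact_closed_box a b))] := fL.
apply: integrableS => //; last exact: obox_closed_box.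
- by apply: borel_cara; apply: measurable_compact_rV; exact: compact_closed_box.
- by apply: borel_cara; exact: measurable_obox.
Qed.

(** Dominated convergence along the bumps of the box, which are test functions because the closed
    box lies in [Omega]. *)
Lemma null_integral_obox a b : closed_box a b `<=` Omega -> \int[mu]_(x in obox a b) f x = 0.
Proof.
move=> abO; have fi := integrable_obox abO.
have mb : measurable (obox a b : set cT) by apply: borel_cara; exact: measurable_obox.
have mf := integrable_fun_measurable fi.
have tb k : test_function Omega (bump a b k) by apply: bump_test => x h; exact: abO.
have mbk k : measurable_fun (obox a b : set cT) (bump a b k : cT -> R).
  apply: borel_measurable_cara; last exact: measurable_obox.
  apply: measurable_funTS; apply: continuous_measurable_rV.
  by have [/(_ 0%N)/Ck_continuous] := tb k.
have [] := @dominated_Rintegral _ _ _ mu _ mb (fun k x => f x * bump a b k x) f (fun x => `|f x|).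
- by move=> k; exact: measurable_funM.
- exact: mf.
- apply: aeW => x xb; rewrite -[X in _ --> X]mulr1; apply: cvgMr; exact: cvg_bump.
- exact: integrable_norm.
- apply: aeW => x xb k; rewrite normrM ler_piMr// ger0_norm; by have /andP[] := bump_bounds a b k x.
move=> _ _; have -> : (fun k => \int[mu]_(x in obox a b) (f x * bump a b k x)) = fun=> 0.
  apply/funext => k; rewrite -(f0 (tb k)) [LHS]Rintegral_mkcond [RHS]Rintegral_mkcond.
  congr (Rintegral mu setT _); apply/funext => x; rewrite /patch.
  case: ifPn => [/set_mem xb|/negP xb].
    by rewrite mem_set//; apply: abO; exact: obox_closed_box.
  case: ifP => // _; rewrite bump_eq0 ?mulr0// => h; apply: xb; exact: mem_set.
by move=> h; apply/esym; move: h; apply: cvg_unique; [|exact: cvg_cst].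
Qed.

Lemma fundamental_lemma : {ae mu, forall x, Omega x -> f x = 0}.
Proof.
pose lo (jc : nat * 'rV[int]_n) : 'rV[R]_n := \row_i (2^-1 ^+ jc.1 * (jc.2 ord0 i - 1)%:~R).
pose hi (jc : nat * 'rV[int]_n) : 'rV[R]_n := \row_i (2^-1 ^+ jc.1 * (jc.2 ord0 i + 1)%:~R).
have box_null jc : closed_box (lo jc) (hi jc) `<=` Omega ->
    {ae mu, forall x, obox (lo jc) (hi jc) x -> f x = 0}.
  move=> sO; apply: null_on_boxes.
  - exact: measurable_obox.
  - apply: (@le_lt_trans _ _ (bl (hbox (lo jc) (\row_i ((lo jc) ord0 i + 2 * 2^-1 ^+ jc.1))))).
      apply: le_measure; rewrite ?inE; [exact: measurable_obox|exact: measurable_hbox|].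
      move=> x h i; have := h i; rewrite /lo /hi !mxE => /andP[/ltW -> h2] /=.
      by apply: (lt_le_trans h2); rewrite -/(2^-1 ^+ _) !intrD mulrDr mulrDr; lra.
    by rewrite borel_lebesgue_hbox ?ltry// mulr_ge0// exprn_ge0.
  - exact: integrable_obox.
  - exact: null_integral_obox.
  - move=> a b; rewrite obox_setI; apply: null_integral_obox => x h; apply: sO => i.
    by have := h i; rewrite !mxE ge_max le_min => /andP[/andP[_ ->] /andP[_ ->]].
(* Countably many negligible sets are united through the [pickle] codes of the boxes; a code that
   denotes no box carries the trivial statement. *)
have : {ae mu, forall x, forall k : nat, if unpickle k is Some jc then
    closed_box (lo jc) (hi jc) `<=` Omega -> obox (lo jc) (hi jc) x -> f x = 0 else True}.
  apply/ae_foralln => k; case: unpickle => [jc|]; last exact: aeW.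
  have [/box_null h|h] := pselect (closed_box (lo jc) (hi jc) `<=` Omega); last exact: aeW.
  by apply: ae_mono h => x + _; apply.
apply: ae_mono => x h Ox; have [jc [xjc jcO]] := dyadic_box_ball oO Ox.
have := h (pickle jc); rewrite pickleK; apply => // y yh; apply: jcO => i.
by have := yh i; rewrite /lo /hi !mxE.
Qed.

End fundamental_lemma.

(** * Convexity of powers of the Euclidean norm *)

Section euclidean_norm.
Context {R : realType} {n : nat}.
Implicit Types u v w : 'rV[R]_n.

Lemma dotvC u v : dotv u v = dotv v u.
Proof. by apply: eq_bigr => i _; rewrite mulrC. Qed.

Lemma dotvDl u v w : dotv (u + v) w = dotv u w + dotv v w.
Proof. by rewrite -big_split; apply: eq_bigr => i _; rewrite mxE mulrDl. Qed.

Lemma dotvDr u v w : dotv w (u + v) = dotv w u + dotv w v.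
Proof. by rewrite dotvC dotvDl !(dotvC w). Qed.

Lemma dotvZl c u v : dotv (c *: u) v = c * dotv u v.
Proof. by rewrite mulr_sumr; apply: eq_bigr => i _; rewrite mxE mulrA. Qed.

Lemma dotvZr c u v : dotv u (c *: v) = c * dotv u v.
Proof. by rewrite dotvC dotvZl dotvC. Qed.

Lemma dotvNr u v : dotv u (- v) = - dotv u v.
Proof. by rewrite -scaleN1r dotvZr mulN1r. Qed.

Lemma dotv_ge0 u : 0 <= dotv u u.
Proof. by apply: sumr_ge0 => i _; rewrite -expr2 sqr_ge0. Qed.

Lemma enorm_ge0 u : 0 <= enorm u.
Proof. exact: sqrtr_ge0. Qed.

Lemma enorm_sqr u : enorm u ^+ 2 = dotv u u.
Proof. by rewrite sqr_sqrtr ?dotv_ge0. Qed.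

Lemma enormZ c u : enorm (c *: u) = `|c| * enorm u.
Proof.
by rewrite /enorm dotvZl dotvZr mulrA -expr2 sqrtrM ?sqr_ge0// sqrtr_sqr.
Qed.

Lemma enormN u : enorm (- u) = enorm u.
Proof. by rewrite -scaleN1r enormZ normrN normr1 mul1r. Qed.

Lemma enorm0 : enorm (0 : 'rV[R]_n) = 0.
Proof. by rewrite -(scale0r 0) enormZ normr0 mul0r. Qed.

Lemma enormDsqr u v : enorm (u + v) ^+ 2 = enorm u ^+ 2 + 2 * dotv u v + enorm v ^+ 2.
Proof. by rewrite !enorm_sqr !dotvDl !dotvDr (dotvC v u); ring. Qed.

Lemma enorm_eq0 u : enorm u = 0 -> u = 0.
Proof.
move=> u0; have := enorm_sqr u; rewrite u0 expr0n/= => /esym/eqP.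
rewrite psumr_eq0 => [/allP h|i _]; last by rewrite -expr2 sqr_ge0.
apply/rowP => i; have := h i (mem_index_enum i); rewrite /= -expr2 sqrf_eq0 mxE.
by move=> /eqP.
Qed.

Lemma cauchy_schwarz u v : `|dotv u v| <= enorm u * enorm v.
Proof.
have [v0|v0] := eqVneq (enorm v) 0.
  by rewrite v0 (enorm_eq0 v0) /dotv big1 ?normr0 ?mulr0// => i _; rewrite mxE mulr0.
have vp : 0 < enorm v ^+ 2 by rewrite exprn_gt0// lt0r v0 enorm_ge0.
rewrite -(@ler_pXn2r _ 2) ?nnegrE ?mulr_ge0 ?enorm_ge0// real_normK ?num_real//.
(* The squared norm of [|v|^2 u - (u.v) v] is |v|^2 times the difference of the two sides of the
   squared inequality. *)
have := sqr_ge0 (enorm (enorm v ^+ 2 *: u + (- dotv u v) *: v)).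
rewrite enormDsqr !enormZ dotvZl dotvZr !normrN !exprMn !real_normK ?num_real//.
move: vp; move: (enorm v ^+ 2) (enorm u ^+ 2) (dotv u v) => b a c b0.
have -> : b ^+ 2 * a + 2 * (b * (- c * c)) + c ^+ 2 * b = b * (a * b - c ^+ 2) by ring.
by rewrite pmulr_rge0// subr_ge0.
Qed.

Lemma ler_enormD u v : enorm (u + v) <= enorm u + enorm v.
Proof.
rewrite -(@ler_pXn2r _ 2) ?nnegrE ?addr_ge0 ?enorm_ge0// enormDsqr.
have := le_trans (ler_norm _) (cauchy_schwarz u v).
move: (enorm u) (enorm v) (dotv u v) => a b c; nra.
Qed.

Lemma ler_enormB u v : enorm (u - v) <= enorm u + enorm v.
Proof. by rewrite -(enormN v) ler_enormD. Qed.

(** The parallelogram identity. *)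
Lemma enorm_midpoint_sqr u v : enorm (2^-1 *: (u + v)) ^+ 2 =
  (enorm u ^+ 2 + enorm v ^+ 2) / 2 - enorm (u - v) ^+ 2 / 4.
Proof.
rewrite enormZ exprMn (enormDsqr u v) (enormDsqr u (- v)) enormN dotvNr.
by rewrite ger0_norm ?invr_ge0 ?ler0n//; field.
Qed.

Lemma coord_le_enorm u i : `|u ord0 i| <= enorm u.
Proof.
rewrite -(@ler_pXn2r _ 2) ?nnegrE ?enorm_ge0// enorm_sqr real_normK ?num_real//.
rewrite /dotv (bigD1 i)//= -expr2 lerDl; apply: sumr_ge0 => j _; by rewrite -expr2 sqr_ge0.
Qed.

Lemma enorm_le_sum u : enorm u <= \sum_(i < n) `|u ord0 i|.
Proof.
have s0 : 0 <= \sum_(i < n) `|u ord0 i| by exact: sumr_ge0.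
rewrite -(@ler_pXn2r _ 2) ?nnegrE ?enorm_ge0// enorm_sqr /dotv expr2 mulr_suml.
apply: ler_sum => i _; rewrite -expr2 -real_normK ?num_real// expr2.
by apply: ler_wpM2l => //; rewrite (bigD1 i)//= lerDl sumr_ge0.
Qed.

Lemma measurable_enorm d (T : measurableType d) (D : set T) (g : T -> 'rV[R]_n) :
  (forall i, measurable_fun D (fun x => g x ord0 i : measurableTypeR R)) ->
  measurable_fun D (fun x => enorm (g x) : measurableTypeR R).
Proof.
move=> mg; apply: (@measurableT_comp _ _ _ _ _ _ (@Num.sqrt R)).
  by apply: continuous_measurable_fun; exact: sqrt_continuous.
have mm i : measurable_fun D (fun x => g x ord0 i * g x ord0 i) := measurable_funM (mg i) (mg i).
exact: (measurable_sum (index_enum _) mm).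
Qed.

Lemma measurable_dotv d (T : measurableType d) (D : set T) (g h : T -> 'rV[R]_n) :
  (forall i, measurable_fun D (fun x => g x ord0 i : measurableTypeR R)) ->
  (forall i, measurable_fun D (fun x => h x ord0 i : measurableTypeR R)) ->
  measurable_fun D (fun x => dotv (g x) (h x) : measurableTypeR R).
Proof.
move=> mg mh.
have mm i : measurable_fun D (fun x => g x ord0 i * h x ord0 i) := measurable_funM (mg i) (mh i).
exact: (measurable_sum (index_enum _) mm).
Qed.

End euclidean_norm.

(** * Uniform convexity of powers of the norm *)

Section uniform_convexity.
Context {R : realType}.
Implicit Types (s t p e : R).

Lemma lt_ln_sub1 (x : R) : 0 < x -> x != 1 -> ln x < x - 1.
Proof.
move=> x0 x1; rewrite ltrBrDl -{2}(lnK (x := x)) ?posrE// expR_gt1Dx//.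
by rewrite ln_eq0.
Qed.

(** Both estimates come from ln x <= x - 1: at 1/u, where it is strict, it gives [u - 1 < u * ln u],
    and at [u^(p-1)] it bounds [(p - 1) * ln u]. *)
Lemma powR_bernoulli_lt (u p : R) : 1 < p -> 0 <= u -> u != 1 -> 1 + p * (u - 1) < u `^ p.
Proof.
move=> p1 u0 u1; have p0 : 0 < p by exact: lt_trans p1.
have [->|un0] := eqVneq u 0; first by rewrite powR0 ?gt_eqF//; lra.
have up : 0 < u by rewrite lt0r un0.
have h1 : u - 1 < u * ln u.
  have : ln u^-1 < u^-1 - 1 by rewrite lt_ln_sub1 ?invr_gt0// invr_eq1.
  rewrite lnV ?posrE// -(ltr_pM2l up) mulrBr divff// mulr1 mulrN.
  by move: (u * ln u) => L; lra.
have h2 : (p - 1) * ln u <= u `^ (p - 1) - 1.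
  have [e1|e1] := eqVneq (u `^ (p - 1)) 1.
    by rewrite -ln_powR e1 ln1 subrr.
  by rewrite -ln_powR ltW// lt_ln_sub1// powR_gt0.
have -> : u `^ p = u * u `^ (p - 1) by rewrite mulr_powRB1// ltW.
have := ler_wpM2l u0 h2.
have : (p - 1) * (u - 1) < (p - 1) * (u * ln u) by rewrite ltr_pM2l// subr_gt0.
move: (u `^ (p - 1)) (ln u) => A B; lra.
Qed.

(** The tangent inequality at the mean [a], taken at [x] and [y] and combined with the weights [l]
    and [1 - l]. *)
Lemma powR_convex (l x y p : R) : 1 < p -> 0 <= l <= 1 -> 0 <= x -> 0 <= y ->
  (l * x + (1 - l) * y) `^ p <= l * x `^ p + (1 - l) * y `^ p.
Proof.
move=> p1 /andP[l0 l1] x0 y0; set a := l * x + (1 - l) * y.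
have l1' : 0 <= 1 - l by rewrite subr_ge0.
have a0 : 0 <= a by rewrite addr_ge0// mulr_ge0.
have := powR_tangent p1 a0 x0; have := powR_tangent p1 a0 y0.
have -> : a `^ p = a `^ (p - 1) * a.
  have [->|an] := eqVneq a 0; first by rewrite mulr0 powR0// gt_eqF// (lt_trans _ p1).
  by rewrite -{3}(powRr1 a0) -powRD ?an ?implybT// subrK.
rewrite {3 6}/a; move: (a `^ (p - 1)) (x `^ p) (y `^ p) => A X Y h1 h2.
have := ler_wpM2l l0 h2; have := ler_wpM2l l1' h1; rewrite /a.
lra.
Qed.

(** Convexity at the points b / l and c / (1 - l), with [l] chosen so that [l^(1 - p) = 1 + e]. The
    factor close to 1 is what makes modulars continuous along modular convergence. *)
Lemma powR_split (e p : R) : 0 < e -> 1 < p -> exists2 C : R, 0 <= C &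
  forall a b c : R, 0 <= a -> 0 <= b -> 0 <= c -> a <= b + c ->
    a `^ p <= (1 + e) * b `^ p + C * c `^ p.
Proof.
move=> e0 p1; have p0 : 0 < p by exact: lt_trans p1.
pose l := (1 + e) `^ (- (p - 1)^-1).
have pm : 0 < p - 1 by rewrite subr_gt0.
have l0 : 0 < l by rewrite powR_gt0// addr_gt0.
have l1 : l < 1.
  rewrite /l powRN invf_lt1 ?powR_gt0 ?addr_gt0// powR_gt1 ?invr_gt0//.
  by rewrite ltrDl.
have lp : l `^ (1 - p) = 1 + e.
  rewrite /l -powRrM mulNr -mulrN opprB mulVf ?gt_eqF// powRr1 ?addr_ge0 ?ler01 ?(ltW e0)//.
have l1' : 0 < 1 - l by rewrite subr_gt0.
exists ((1 - l) `^ (1 - p)) => [|a b c a0 b0 c0 abc]; first exact: powR_ge0.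
have E x y : 0 < x -> 0 <= y -> x * (y / x) `^ p = x `^ (1 - p) * y `^ p.
  move=> x0 y0; rewrite powRM ?invr_ge0 ?(ltW x0)// -powR_inv1 ?(ltW x0)// -powRrM mulN1r.
  by rewrite powRD ?(gt_eqF x0) ?implybT// powRr1 ?(ltW x0)//; ring.
have := @powR_convex l (b / l) (c / (1 - l)) p p1.
rewrite !E// !lp; move=> /(_ _ _ _)h.
apply: le_trans (h _ _ _); last 3 first.
- by rewrite !ltW.
- by rewrite divr_ge0// ltW.
- by rewrite divr_ge0// ltW.
apply: powR_homo; [exact: ltW|exact: a0|].
by rewrite mulrC divfK ?gt_eqF// (mulrC (1 - l)) divfK ?gt_eqF.
Qed.

(** The strict Bernoulli inequality at 1 / a and t / a, with [a] the mean: the linear terms cancel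
    since the two numbers sum to 2. *)
Lemma powR_mean_lt (t p : R) : 1 < p -> 0 <= t -> t != 1 -> ((1 + t) / 2) `^ p < (1 + t `^ p) / 2.
Proof.
move=> p1 t0 t1; set a := (1 + t) / 2.
have a0 : 0 < a by rewrite divr_gt0// ltr_wpDr.
have a1 : a^-1 != 1.
  rewrite invr_eq1; apply: contra t1 => /eqP a1; apply/eqP; move: a1; rewrite /a; lra.
have ta : t / a != 1.
  apply: contra a1 => /eqP ta; have : t = a by rewrite -[LHS](divfK (lt0r_neq0 a0)) ta mul1r.
  by rewrite /a => h; rewrite invr_eq1; apply/eqP; move: h; rewrite /a; lra.
have h1 := @powR_bernoulli_lt a^-1 p p1 (ltW (etrans (invr_gt0 a) a0)) a1.
have h2 := @powR_bernoulli_lt (t / a) p p1 (divr_ge0 t0 (ltW a0)) ta.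
have ap : 0 < a `^ p by rewrite powR_gt0.
have e1 : a^-1 `^ p = (a `^ p)^-1.
  by rewrite -powR_inv1 ?(ltW a0)// -powRrM mulN1r powRN.
have e2 : (t / a) `^ p = t `^ p / a `^ p by rewrite powRM ?invr_ge0 ?(ltW a0)// e1.
have s2 : a^-1 + t / a = 2.
  by rewrite -{1}(mul1r a^-1) -mulrDl /a; field; rewrite gt_eqF// ltr_wpDr.
have h3 : 2 < (1 + t `^ p) / a `^ p.
  rewrite mulrDl mul1r -e2 -e1.
  have : p * (a^-1 + t / a - 2) = 0 by rewrite s2 subrr mulr0.
  by move: h1 h2; move: (a^-1 `^ p) ((t / a) `^ p) => A B; lra.
by move: h3; rewrite ltr_pdivlMr// mulrC -ltr_pdivlMr.
Qed.

(* By homogeneity the larger norm is [1]; then the midpoint has norm at most [(1 + t) / 2] and, by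
   the parallelogram identity, at most [sqrt ((1 + t^2) / 2 - e^2 / 4)], and one of the two bounds
   is strict at each [t] in [0, 1]. *)
Lemma midpoint_gap (p e : R) : 1 < p -> 0 < e -> exists2 c : R, 0 < c & forall t m : R,
  0 <= t <= 1 -> 0 <= m -> m <= (1 + t) / 2 -> m ^+ 2 <= (1 + t ^+ 2) / 2 - e ^+ 2 / 4 ->
  c <= (1 + t `^ p) / 2 - m `^ p.
Proof.
move=> p1 e0; have p0 : 0 < p by exact: lt_trans p1.
pose b (t : R) := Num.min ((1 + t) / 2) (Num.sqrt ((1 + t ^+ 2) / 2 - e ^+ 2 / 4)).
pose F (t : R) := (1 + `|t| `^ p) / 2 - `|b t| `^ p.
have cb : continuous b.
  have -> : b = (fun t => ((1 + t) / 2 + Num.sqrt ((1 + t ^+ 2) / 2 - e ^+ 2 / 4) -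
      `|(1 + t) / 2 - Num.sqrt ((1 + t ^+ 2) / 2 - e ^+ 2 / 4)|) / 2).
    by apply/funext => t; rewrite /b minr_absE.
  have c1 : continuous (fun t : R => (1 + t) / 2).
    by move=> t; apply: cvgMl; apply: cvgD; [exact: cvg_cst|exact: cvg_id].
  have c2 : continuous (fun t : R => Num.sqrt ((1 + t ^+ 2) / 2 - e ^+ 2 / 4)).
    move=> t; apply: continuous_cvg; first exact: sqrt_continuous.
    apply: cvgB; last exact: cvg_cst.
    by apply: cvgMl; apply: cvgD; [exact: cvg_cst|exact: exprn_continuous].
  move=> t; apply: cvgMl; apply: cvgB; first by apply: cvgD; [exact: c1|exact: c2].
  by apply: cvg_norm; apply: cvgB; [exact: c1|exact: c2].
have cF : continuous F.
  move=> t; apply: cvgB.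
    by apply: cvgMl; apply: cvgD; [exact: cvg_cst|exact: continuous_norm_powR].
  apply: (@continuous_comp _ _ _ b (fun x => `|x| `^ p)); first exact: cb.
  exact: continuous_norm_powR.
have b0 t : 0 <= t -> 0 <= b t.
  by move=> t0; rewrite le_min sqrtr_ge0 divr_ge0// addr_ge0.
(* Compactness of [0, 1] turns the strict inequality at each [t] into one positive constant. *)
have [t0 + tmin] := @EVT_min R F 0 1 ler01 (continuous_subspaceT cF).
rewrite in_itv/= => /andP[t00 t01].
exists (F t0) => [|t m /andP[t0' t1'] m0 m1 m2].
  rewrite /F ger0_norm// (ger0_norm (b0 _ t00)) subr_gt0.
  have [te|te] := eqVneq t0 1; last first.
    apply: le_lt_trans (powR_mean_lt p1 t00 te); apply: powR_homo; [exact: ltW|exact: b0|].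
    by rewrite /b ge_min lexx.
  rewrite te powR1 (_ : (1 + 1) / 2 = 1) ?divff//.
  have b1 : b 1 < 1.
    rewrite /b gt_min; apply/orP; right.
    rewrite [ltRHS](_ : 1 = Num.sqrt 1); last by rewrite sqrtr1.
    rewrite ltr_sqrt// expr1n.
    have : 0 < e ^+ 2 by rewrite exprn_gt0.
    lra.
  have : b 1 `^ p < 1 `^ p by apply: gt0_ltr_powR; rewrite ?nnegrE ?b0.
  by rewrite powR1.
apply: (le_trans (tmin t _)); first by rewrite in_itv/= t0'.
rewrite /F ger0_norm// (ger0_norm (b0 _ t0')) lerD2l lerN2; apply: powR_homo; [exact: ltW|exact: m0|].
rewrite /b le_min m1/=.
rewrite -(@ger0_norm _ m)// -sqrtr_sqr ler_sqrt// (le_trans _ m2)//.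
exact: sqr_ge0.
Qed.

(** Let [u] be the longer vector. If |u - v|^p exceeds the first term, then |u - v| >= dl |u|, and
    after division by |u| [midpoint_gap] bounds the convexity defect below by c |u|^p. As |u - v| <=
    2 |u|, a multiple of the defect dominates |u - v|^p. *)
Lemma enorm_uniform_convexity (p e : R) : 1 < p -> 0 < e -> exists2 C : R, 0 <= C &
  forall n (u v : 'rV[R]_n), enorm (u - v) `^ p <= e * (enorm u `^ p + enorm v `^ p) +
    C * ((enorm u `^ p + enorm v `^ p) / 2 - enorm (2^-1 *: (u + v)) `^ p).
Proof.
move=> p1 e0; have p0 : 0 < p by exact: lt_trans p1.
pose dl := e `^ p^-1; have dl0 : 0 < dl by rewrite powR_gt0.
have [c c0 hc] := midpoint_gap p1 dl0.
have C0 : 0 <= 2 `^ p / c by rewrite divr_ge0 ?powR_ge0// ltW.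
exists (2 `^ p / c) => // n u v.
wlog uv : u v / enorm v <= enorm u.
  move=> h; case: (leP (enorm v) (enorm u)) => [/h//|/ltW/h].
  by rewrite -enormN opprB (addrC v) (addrC (enorm v `^ p)).
have h0 := (enorm_ge0, powR_ge0).
set s := enorm u; set t := enorm v; set D := enorm (u - v); set m := enorm _.
have s0 : 0 <= s by exact: enorm_ge0.
have t0 : 0 <= t by exact: enorm_ge0.
have m0 : 0 <= m by exact: enorm_ge0.
have D0 : 0 <= D by exact: enorm_ge0.
have Dst : D <= s + t by exact: ler_enormB.
have mst : m <= (s + t) / 2.
  rewrite /m enormZ ger0_norm ?invr_ge0// mulrC ler_pM2r ?invr_gt0//; exact: ler_enormD.
have m2 : m ^+ 2 = (s ^+ 2 + t ^+ 2) / 2 - D ^+ 2 / 4 by exact: enorm_midpoint_sqr.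
have mean : m `^ p <= (s `^ p + t `^ p) / 2.
  apply: (@le_trans _ _ (((s + t) / 2) `^ p)); first exact: (powR_homo (ltW p0)).
  rewrite (_ : (s + t) / 2 = 2^-1 * s + (1 - 2^-1) * t); last by field.
  apply: (le_trans (powR_convex p1 _ s0 t0)); first by rewrite invr_ge0 ler0n/= invf_le1// ler1n.
  by rewrite le_eqVlt; apply/orP; left; apply/eqP; field.
have gap0 : 0 <= (s `^ p + t `^ p) / 2 - m `^ p by rewrite subr_ge0.
have [small|big] := leP (D `^ p) (e * (s `^ p + t `^ p)).
  by rewrite (le_trans small)// lerDl mulr_ge0.
have sp : 0 < s.
  rewrite lt0r s0 andbT; apply: contraTN big => /eqP s00.
  have t00 : t = 0 by apply/eqP; rewrite eq_le t0 andbT -s00.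
  have D00 : D = 0 by apply/eqP; rewrite eq_le D0 andbT (le_trans Dst)// s00 t00 addr0.
  by rewrite D00 powR0 ?gt_eqF// -leNgt mulr_ge0 ?(ltW e0)// addr_ge0 ?powR_ge0.
have Ds : dl * s <= D.
  have h : (dl * s) `^ p <= D `^ p.
    apply: le_trans (ltW big); rewrite powRM ?(ltW dl0)// /dl -powRrM mulVf ?gt_eqF// powRr1 ?(ltW e0)//.
    by rewrite ler_pM2l// lerDl powR_ge0.
  rewrite leNgt; apply/negP => lt; move: h; rewrite leNgt; apply/negP; rewrite negbK.
  by apply: gt0_ltr_powR; rewrite ?nnegrE// mulr_ge0// ltW.
have g := hc (t / s) (m / s) _ _ _ _.
have {g} : c <= (1 + (t / s) `^ p) / 2 - (m / s) `^ p.
  apply: hc.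
  - by rewrite divr_ge0//= ler_pdivrMr// mul1r.
  - by rewrite divr_ge0.
  - by rewrite ler_pdivrMr// mulrAC mulrDl mul1r divfK ?gt_eqF.
  - rewrite !expr_div_n m2.
    have -> : ((s ^+ 2 + t ^+ 2) / 2 - D ^+ 2 / 4) / s ^+ 2 =
      (1 + t ^+ 2 / s ^+ 2) / 2 - (D ^+ 2 / s ^+ 2) / 4 by field; rewrite gt_eqF.
    rewrite lerD2l lerN2 ler_pM2r ?invr_gt0// ler_pdivlMr ?exprn_gt0// -exprMn.
    by rewrite ler_pXn2r ?nnegrE// mulr_ge0// ltW.
have spp : 0 < s `^ p by rewrite powR_gt0.
rewrite !powRM ?invr_ge0// (_ : s^-1 `^ p = (s `^ p)^-1); last first.
  by rewrite -powR_inv1// -powRrM mulN1r powRN.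
rewrite -(ler_pM2r spp) mulrBl mulrAC mulrDl mul1r !divfK ?gt_eqF// => gap.
have : D `^ p <= 2 `^ p * s `^ p.
  rewrite -powRM//; apply: powR_homo; [exact: ltW|exact: D0|].
  by rewrite (le_trans Dst)// mulr2n mulrDl mul1r lerD2l.
move=> /le_trans; apply; apply: (@le_trans _ _ (2 `^ p / c * (c * s `^ p))).
  by rewrite mulrA divfK ?gt_eqF.
apply: (@le_trans _ _ (2 `^ p / c * ((s `^ p + t `^ p) / 2 - m `^ p))).
  by apply: ler_wpM2l.
by rewrite lerDr mulr_ge0 ?(ltW e0)// addr_ge0 ?powR_ge0.
Qed.

End uniform_convexity.

(** * Modular spaces of vector fields *)

Lemma ae_forall_fin dd (T : measurableType dd) (R : realType) (mu : {measure set T -> \bar R})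
    (I : finType) (P : I -> T -> Prop) :
  (forall i, {ae mu, forall x, P i x}) -> {ae mu, forall x, forall i, P i x}.
Proof. exact: filter_forall. Qed.

Lemma dist_of_split (R : realFieldType) (s e F P c : R) : 0 < e -> 0 < s -> 0 <= F -> 0 <= P ->
  s * (F + 1 + e) = e / 2 -> c <= e / 2 -> P <= (1 + s) * F + c -> F <= (1 + s) * P + c ->
  `|P - F| <= e.
Proof.
move=> e0 s0 F0 P0 sE ce h1 h2.
have se : 0 <= s * (1 + e) by rewrite mulr_ge0 ?addr_ge0 ?ler01 ?(ltW e0) ?(ltW s0).
have h3 : P <= F + e by lra.
have : s * P <= s * (F + 1 + e) by rewrite ler_pM2l// (le_trans h3)// -addrA lerD2l lerDr.
by rewrite ler_distl; lra.
Qed.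

Lemma mul_add_le_double (R : realFieldType) (P Q a b c e : R) : 0 <= P -> 0 <= Q ->
  0 <= a -> 0 <= b -> 0 <= c -> 0 <= e ->
  P * (a + c) + Q * (b + e) <= (P + Q) * (a + b + (c + e)).
Proof.
move=> P0 Q0 a0 b0 c0 e0; rewrite -subr_ge0.
have -> : (P + Q) * (a + b + (c + e)) - (P * (a + c) + Q * (b + e)) = P * (b + e) + Q * (a + c) by ring.
by rewrite addr_ge0// mulr_ge0// addr_ge0.
Qed.

Section vector_fields.
Context dd (T : measurableType dd) {R : realType} {n : nat}.
Variables (mu : {measure set T -> \bar R}) (D : set T).
Hypothesis mD : measurable D.
Implicit Types g h : T -> 'rV[R]_n.

Definition vmeasurable g := forall i, measurable_fun D (fun x => g x ord0 i).

Lemma vmeasurableD g h : vmeasurable g -> vmeasurable h -> vmeasurable (fun x => g x + h x).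
Proof. by move=> mg mh i; under eq_fun do rewrite mxE; apply: measurable_funD. Qed.

Lemma vmeasurableZ c g : vmeasurable g -> vmeasurable (fun x => c *: g x).
Proof. by move=> mg i; under eq_fun do rewrite mxE; apply: measurable_funM. Qed.

Lemma vmeasurableB g h : vmeasurable g -> vmeasurable h -> vmeasurable (fun x => g x - h x).
Proof. by move=> mg mh i; under eq_fun do rewrite !mxE; apply: measurable_funB. Qed.

Variables (w : T -> R) (r : R).
Hypotheses (mw : measurable_fun D w) (w0 : forall x, D x -> 0 <= w x) (r1 : 1 < r).

Let r0 : 0 < r. Proof. exact: lt_trans r1. Qed.

(** The weight [w] and the exponent [r] are free so that one theory covers the p-energy, the
    weighted q-energy, L^r powers of scalar functions, and the coupling term as a function of a
    single component. *)
Definition wpow g x : R := w x * enorm (g x) `^ r.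

Definition wint g := vmeasurable g /\ mu.-integrable D (EFin \o wpow g).

Definition pen g : R := \int[mu]_(x in D) wpow g x.

Lemma wpow_ge0 g x : D x -> 0 <= wpow g x.
Proof. by move=> Dx; rewrite mulr_ge0 ?w0 ?powR_ge0. Qed.

Lemma pen_ge0 g : 0 <= pen g.
Proof. by apply: Rintegral_ge0 => x Dx; exact: wpow_ge0. Qed.

Lemma measurable_wpow g : vmeasurable g -> measurable_fun D (wpow g).
Proof.
move=> mg; apply: measurable_funM => //.
apply: (measurableT_comp (measurable_powR r)); exact: measurable_enorm.
Qed.

Lemma wpow_powR_le g h h' (C : R) x : D x -> 0 <= C ->
  enorm (g x) <= C * (enorm (h x) + enorm (h' x)) ->
  wpow g x <= C `^ r * 2 `^ r * (wpow h x + wpow h' x).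
Proof.
move=> Dx C0 gh; rewrite /wpow -mulrDr mulrCA; apply: ler_wpM2l; first exact: w0.
apply: (@le_trans _ _ ((C * (enorm (h x) + enorm (h' x))) `^ r)).
  by apply: powR_homo => //; [exact: ltW|exact: enorm_ge0].
rewrite powRM ?addr_ge0 ?enorm_ge0// -mulrA; apply: ler_wpM2l; first exact: powR_ge0.
by apply: powR_addr_le; rewrite ?enorm_ge0// ltW.
Qed.

Lemma wint_le g h h' (C : R) : 0 <= C -> vmeasurable g -> wint h -> wint h' ->
  (forall x, D x -> enorm (g x) <= C * (enorm (h x) + enorm (h' x))) -> wint g.
Proof.
move=> C0 mg [mh ih] [mh' ih'] gh; split; first exact: mg.
apply: (integrable_dominated mD (measurable_wpow mg)
  (integrable_cst_mul mD (C `^ r * 2 `^ r) (integrable_add mD ih ih'))) => x Dx.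
by rewrite ger0_norm ?wpow_ge0// wpow_powR_le// gh.
Qed.

Lemma wintD g h : wint g -> wint h -> wint (fun x => g x + h x).
Proof.
move=> ig ih; apply: (wint_le ler01 (vmeasurableD ig.1 ih.1) ig ih) => x _.
by rewrite mul1r ler_enormD.
Qed.

Lemma wintB g h : wint g -> wint h -> wint (fun x => g x - h x).
Proof.
move=> ig ih; apply: (wint_le ler01 (vmeasurableB ig.1 ih.1) ig ih) => x _.
by rewrite mul1r ler_enormB.
Qed.

Lemma wpowZ c g x : wpow (fun x => c *: g x) x = `|c| `^ r * wpow g x.
Proof. by rewrite /wpow enormZ powRM ?enorm_ge0// mulrCA. Qed.

Lemma wintZ c g : wint g -> wint (fun x => c *: g x).
Proof.
move=> [mg ig]; split; first exact: vmeasurableZ.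
rewrite (_ : wpow _ = (fun x => `|c| `^ r * wpow g x)); last by apply/funext => x; rewrite wpowZ.
exact: integrable_cst_mul.
Qed.

Lemma penZ c g : wint g -> pen (fun x => c *: g x) = `|c| `^ r * pen g.
Proof.
move=> [mg ig]; rewrite -(RintegralZl _ mD ig); apply: eq_Rintegral => x _; exact: wpowZ.
Qed.

Lemma pen_split (e : R) : 0 < e -> exists2 C : R, 0 <= C & forall g h, wint g -> wint h ->
  pen g <= (1 + e) * pen h + C * pen (fun x => g x - h x).
Proof.
move=> e0; have [C C0 hC] := powR_split e0 r1; exists C => // g h ig ih.
have igh := wintB ig ih.
have i1 := integrable_cst_mul mD (1 + e) ih.2; have i2 := integrable_cst_mul mD C igh.2.
rewrite /pen -(RintegralZl _ mD ih.2) -(RintegralZl _ mD igh.2) -(RintegralD mD i1 i2).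
apply: (le_Rintegral mD ig.2 (integrable_add mD i1 i2)) => x Dx.
rewrite /wpow (mulrCA (1 + e)) (mulrCA C) -mulrDr; apply: ler_wpM2l; first exact: w0.
apply: hC; rewrite ?enorm_ge0// -{1}(subrK (h x) (g x)) addrC; exact: ler_enormD.
Qed.

Lemma pen_uniform_convexity (e : R) : 0 < e -> exists2 C : R, 0 <= C & forall g h, wint g -> wint h ->
  pen (fun x => g x - h x) <= e * (pen g + pen h) +
    C * ((pen g + pen h) / 2 - pen (fun x => 2^-1 *: (g x + h x))).
Proof.
move=> e0; have [C C0 hC] := enorm_uniform_convexity r1 e0; exists C => // g h ig ih.
have igh := wintB ig ih; have im := wintZ 2^-1 (wintD ig ih).
have isum := integrable_add mD ig.2 ih.2.
have i1 := integrable_cst_mul mD e isum; have i2 := integrable_cst_mul mD 2^-1 isum.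
have i3 := integrable_sub mD i2 im.2; have i4 := integrable_cst_mul mD C i3.
rewrite /pen (mulrC _ 2^-1) -(RintegralD mD ig.2 ih.2) -!(RintegralZl _ mD isum) -(RintegralB mD i2 im.2).
rewrite -(RintegralZl _ mD i3) -(RintegralD mD i1 i4).
apply: (le_Rintegral mD igh.2 (integrable_add mD i1 i4)) => x Dx.
have := ler_wpM2l (w0 Dx) (hC n (g x) (h x)).
rewrite /wpow; move: (enorm _ `^ _) (enorm _ `^ _) (enorm _ `^ _) (enorm _ `^ _) => a b c c'.
by move=> /le_trans; apply; rewrite le_eqVlt; apply/orP; left; apply/eqP; field.
Qed.

Lemma pen_midpoint g h : wint g -> wint h ->
  pen (fun x => 2^-1 *: (g x + h x)) <= (pen g + pen h) / 2.
Proof.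
move=> ig ih; have im := wintZ 2^-1 (wintD ig ih).
have isum := integrable_add mD ig.2 ih.2.
rewrite /pen (mulrC _ 2^-1) -(RintegralD mD ig.2 ih.2) -(RintegralZl _ mD isum).
apply: (le_Rintegral mD im.2 (integrable_cst_mul mD 2^-1 isum)) => x Dx.
rewrite /wpow -mulrDr mulrCA; apply: ler_wpM2l; first exact: w0.
have h0 := enorm_ge0 (g x); have h0' := enorm_ge0 (h x).
apply: (@le_trans _ _ ((2^-1 * enorm (g x) + (1 - 2^-1) * enorm (h x)) `^ r)).
  apply: powR_homo; [exact: ltW|exact: enorm_ge0|].
  rewrite enormZ ger0_norm ?invr_ge0// (_ : 1 - 2^-1 = 2^-1); last by field.
  by rewrite -mulrDr ler_pM2l ?invr_gt0// ler_enormD.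
apply: (le_trans (powR_convex r1 _ h0 h0')); first by rewrite invr_ge0 ler0n/= invf_le1// ler1n.
by rewrite le_eqVlt; apply/orP; left; apply/eqP; field.
Qed.

Definition vcvg (g : nat -> T -> 'rV[R]_n) (f : T -> 'rV[R]_n) :=
  {ae mu, forall x, D x -> forall i, g k x ord0 i @[k --> \oo] --> f x ord0 i}.

Lemma cvg_enorm (u : nat -> 'rV[R]_n) (v : 'rV[R]_n) :
  (forall i, u k ord0 i @[k --> \oo] --> v ord0 i) -> enorm (u k) @[k --> \oo] --> enorm v.
Proof.
move=> uv; suff h : dotv (u k) (u k) @[k --> \oo] --> dotv v v.
  by apply: (cvg_comp _ _ h); exact: sqrt_continuous.
rewrite /dotv; apply: cvg_big => //; first by move=> z; apply: cvgD; [exact: cvg_fst|exact: cvg_snd].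
by move=> i _; apply: cvgM.
Qed.

Lemma pen_fatou (g : nat -> T -> 'rV[R]_n) f (C : R) : (forall k, wint (g k)) -> vmeasurable f ->
  vcvg g f -> (forall k, pen (g k) <= C) -> wint f /\ pen f <= C.
Proof.
move=> ig mf gf gC.
have [|if' fC] := fatou_Rintegral mD (fun k => (ig k).2) (measurable_wpow mf) (fun k x => @wpow_ge0 (g k) x)
  (fun x => @wpow_ge0 f x) _ gC; last by [].
apply: ae_mono gf => x h /h{}h; rewrite /wpow; apply: cvgMr.
have e0 (u : 'rV[R]_n) : enorm u = `|enorm u| by rewrite ger0_norm// enorm_ge0.
under eq_fun do rewrite e0; rewrite e0.
by apply: cvg_norm_powR => //; exact: cvg_enorm.
Qed.

(** [pen_split] is used in both directions: [s] is fixed first, so that it costs at most e / 2, and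
    the distance is then taken small against the constant that belongs to [s]. *)
Lemma pen_cvg (g : nat -> T -> 'rV[R]_n) f : (forall k, wint (g k)) -> wint f ->
  pen (fun x => g k x - f x) @[k --> \oo] --> 0 -> pen (g k) @[k --> \oo] --> pen f.
Proof.
move=> ig if' h.
have sym k : pen (fun x => f x - g k x) = pen (fun x => g k x - f x).
  by apply: eq_Rintegral => x _; rewrite /wpow -enormN opprB.
apply/cvgrPdist_le => e e0.
pose s := e / (2 * (pen f + 1 + e)).
have pf1 : 0 < pen f + 1 + e by rewrite addr_gt0// ltr_wpDl ?pen_ge0.
have s0 : 0 < s by rewrite divr_gt0// mulr_gt0.
have sE : s * (pen f + 1 + e) = e / 2.
  by rewrite /s; field; rewrite gt_eqF.
have [C C0 hC] := pen_split s0.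
have d0 : 0 < e / (2 * (C + 1)) by rewrite divr_gt0// mulr_gt0// ltr_wpDl.
move/cvgrPdist_lt : h => /(_ _ d0); apply: filterS => k; rewrite sub0r normrN.
rewrite ger0_norm ?pen_ge0// => small.
have Cs : C * pen (fun x => g k x - f x) <= e / 2.
  apply: (@le_trans _ _ ((C + 1) * (e / (2 * (C + 1))))).
    by rewrite ler_pM ?pen_ge0 ?(ltW small)// lerDl.
  by rewrite le_eqVlt; apply/orP; left; apply/eqP; field; rewrite gt_eqF// ltr_wpDl.
have h1 := hC _ _ (ig k) if'; have h2 := hC _ _ if' (ig k); rewrite sym in h2.
rewrite distrC; exact: (dist_of_split e0 s0 (pen_ge0 f) (pen_ge0 (g k)) sE Cs h1 h2).
Qed.

Lemma eq_wpow g h : (forall x, enorm (g x) = enorm (h x)) -> pen g = pen h.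
Proof. by move=> gh; apply: eq_Rintegral => x _; rewrite /wpow gh. Qed.

End vector_fields.

(** * Completeness for modular convergence *)

Section cauchy_sequences.

Lemma fast_extraction (R : realType) (dist : nat -> nat -> R) (t : nat -> R) :
  (forall k, 0 < t k) ->
  (forall e, 0 < e -> exists N, forall k l, (N <= k)%N -> (N <= l)%N -> dist k l <= e) ->
  exists s : nat -> nat, (forall i, (s i < s i.+1)%N) /\
    forall i k l, (s i <= k)%N -> (s i <= l)%N -> dist k l <= t i.
Proof.
move=> t0 h; have /choice[N hN] (i : nat) := h _ (t0 i).
pose s := fix s i := if i is j.+1 then maxn (s j).+1 (N i) else N 0%N.
have Ns i : (N i <= s i)%N by case: i => [//|i]; rewrite /= leq_maxr.
exists s; split => [i|i k l sk sl]; first by rewrite /= leq_maxl.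
by apply: hN; [exact: leq_trans sk|exact: leq_trans sl].
Qed.

Context dd (T : measurableType dd) {R : realType} {n : nat}.
Variables (mu : {measure set T -> \bar R}) (D : set T).
Hypothesis mD : measurable D.
Variables (p q : R) (w : T -> R).
Hypotheses (p1 : 1 < p) (q1 : 1 < q) (mw : measurable_fun D w) (w0 : forall x, D x -> 0 <= w x).

Implicit Types g h : T -> 'rV[R]_n.

Let one : T -> R := fun=> 1.
Let m1 : measurable_fun D one. Proof. exact: measurable_cst. Qed.
Let one0 x : D x -> 0 <= one x. Proof. by []. Qed.
Let p0 : 0 < p. Proof. exact: lt_trans p1. Qed.

Definition double_phase (g : T -> 'rV[R]_n) := wint mu D one p g /\ wint mu D w q g.
Definition modular (g : T -> 'rV[R]_n) := pen mu D one p g + pen mu D w q g.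

Lemma modular_ge0 g : 0 <= modular g.
Proof. by rewrite addr_ge0// pen_ge0. Qed.

Lemma double_phaseB g h : double_phase g -> double_phase h -> double_phase (fun x => g x - h x).
Proof. by move=> [? ?] [? ?]; split; exact: wintB. Qed.

Lemma double_phaseD g h : double_phase g -> double_phase h -> double_phase (fun x => g x + h x).
Proof. by move=> [? ?] [? ?]; split; exact: wintD. Qed.

Lemma double_phaseZ c g : double_phase g -> double_phase (fun x => c *: g x).
Proof. by move=> [? ?]; split; exact: wintZ. Qed.

Lemma modularC g h : modular (fun x => g x - h x) = modular (fun x => h x - g x).
Proof.
have e x : enorm (g x - h x) = enorm (h x - g x) by rewrite -enormN opprB.
by rewrite /modular (eq_wpow mu D one p e) (eq_wpow mu D w q e).
Qed.

Lemma modularD g h : double_phase g -> double_phase h ->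
  modular (fun x => g x + h x) <= (2 `^ p + 2 `^ q) * (modular g + modular h).
Proof.
move=> [g1 g2] [h1 h2].
have aux (v : T -> R) (r : R) : measurable_fun D v -> (forall x, D x -> 0 <= v x) -> 1 < r -> wint mu D v r g ->
    wint mu D v r h -> pen mu D v r (fun x => g x + h x) <= 2 `^ r * (pen mu D v r g + pen mu D v r h).
  move=> mv v0 r1 ig ih; have isum := integrable_add mD ig.2 ih.2.
  rewrite /pen -(RintegralD mD ig.2 ih.2) -(RintegralZl _ mD isum).
  apply: (le_Rintegral mD (wintD mD mv v0 r1 ig ih).2 (integrable_cst_mul mD _ isum)) => x Dx.
  have -> : 2 `^ r = 1 `^ r * 2 `^ r by rewrite powR1 mul1r.
  apply: (wpow_powR_le v0 r1 Dx ler01).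
  by rewrite mul1r ler_enormD.
have := aux _ _ m1 one0 p1 g1 h1; have := aux _ _ mw w0 q1 g2 h2.
rewrite /modular => a1 a2; apply: (le_trans (lerD a2 a1)).
have A0 f : 0 <= pen mu D one p f by exact: pen_ge0.
have B0 f : 0 <= pen mu D w q f by exact: pen_ge0.
by apply: mul_add_le_double; rewrite ?A0 ?B0 ?powR_ge0.
Qed.

Definition mcauchy (g : nat -> T -> 'rV[R]_n) := forall e, 0 < e ->
  exists N, forall k l, (N <= k)%N -> (N <= l)%N -> modular (fun x => g k x - g l x) <= e.

(** The unweighted p-part makes the coordinates of a fast subsequence converge a.e. Fatou's lemma
    along this subsequence then bounds both parts of the modular of [g k - F], for every large
    [k]. *)
Lemma modular_complete (g : nat -> T -> 'rV[R]_n) : (forall k, double_phase (g k)) -> mcauchy g ->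
  exists f, double_phase f /\ modular (fun x => g k x - f x) @[k --> \oo] --> 0.
Proof.
move=> ig cg.
pose t k : R := 2^-1 ^+ k / (2 ^+ k) `^ p.
have t0 k : 0 < t k by rewrite divr_gt0 ?exprn_gt0 ?powR_gt0 ?invr_gt0 ?exprn_gt0.
have [s [sS st]] := fast_extraction t0 cg.
have int i k : mu.-integrable D (EFin \o (fun x => `|g k x ord0 i| `^ p)).
  have [[mg ig'] _] := ig k.
  apply: (integrable_dominated mD _ ig') => [|x Dx].
    by apply: (measurableT_comp (measurable_powR p)); apply: measurableT_comp.
  rewrite ger0_norm ?powR_ge0// /wpow mul1r; apply: powR_homo => //; [exact: ltW|exact: coord_le_enorm].
have dint i k l : mu.-integrable D (EFin \o (fun x => `|g k x ord0 i - g l x ord0 i| `^ p)) /\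
    \int[mu]_(x in D) (`|g k x ord0 i - g l x ord0 i| `^ p) <= modular (fun x => g k x - g l x).
  have [[mg ig'] b2] := double_phaseB (ig k) (ig l).
  have mf : measurable_fun D (fun x => `|g k x ord0 i - g l x ord0 i| `^ p).
    apply: (measurableT_comp (measurable_powR p)); apply: measurableT_comp => //.
    by apply: measurable_funB; [exact: (ig k).1.1|exact: (ig l).1.1].
  have le x : D x -> `|g k x ord0 i - g l x ord0 i| `^ p <= wpow one p (fun x => g k x - g l x) x.
    move=> Dx; rewrite /wpow mul1r; apply: powR_homo => //; first exact: ltW.
    by have := coord_le_enorm (g k x - g l x) i; rewrite !mxE.
  have fi : mu.-integrable D (EFin \o (fun x => `|g k x ord0 i - g l x ord0 i| `^ p)).
    by apply: (integrable_dominated mD mf ig') => x Dx; rewrite ger0_norm ?powR_ge0// le.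
  split => //; apply: le_trans (le_Rintegral mD fi ig' le) _.
  by rewrite /modular lerDl pen_ge0.
have lim i : exists f : T -> R, measurable_fun D f /\
    {ae mu, forall x, D x -> g (s k) x ord0 i @[k --> \oo] --> f x}.
  have h1 k : measurable_fun D (fun x => g (s k) x ord0 i) by exact: (ig (s k)).1.1.
  have h3 k : mu.-integrable D (EFin \o (fun x => `|g (s k.+1) x ord0 i - g (s k) x ord0 i| `^ p)).
    by have [] := dint i (s k.+1) (s k).
  have h4 k : (2 ^+ k) `^ p * \int[mu]_(x in D) (`|g (s k.+1) x ord0 i - g (s k) x ord0 i| `^ p) <= 2^-1 ^+ k.
    rewrite -ler_pdivlMl ?powR_gt0 ?exprn_gt0// mulrC.
    have [_ h] := dint i (s k.+1) (s k); apply: (le_trans h); apply: st => //.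
    exact: ltnW.
  have [f [G [mf _ _ _ h]]] := fast_cauchy_ae mD p0 h1 (int i (s 0%N)) h3 h4.
  exists f; split => //; by apply: ae_mono h => x h /h [].
have /choice[f hf] := lim.
pose F x : 'rV[R]_n := \row_i f i x.
have mF : vmeasurable D F by move=> i; under eq_fun do rewrite mxE; exact: (hf i).1.
have cF : vcvg mu D (fun k => g (s k)) F.
  have : {ae mu, forall x, forall i, D x -> g (s k) x ord0 i @[k --> \oo] --> f i x}.
    by apply/ae_forall_fin => i; exact: (hf i).2.
  by apply: ae_mono => x h Dx i; rewrite mxE; exact: h.
have tail e : 0 < e -> exists N, forall k, (N <= k)%N ->
    double_phase (fun x => g k x - F x) /\ modular (fun x => g k x - F x) <= 2 * e.
  move=> e0; have [N hN] := cg e e0; exists N => k Nk.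
  pose s' j := s (j + N)%N.
  have s'S j : (N <= s' j)%N.
    by apply: leq_trans (extraction_ge sS _); exact: leq_addl.
  have cB : vcvg mu D (fun j x => g k x - g (s' j) x) (fun x => g k x - F x).
    apply: ae_mono cF => x h Dx i; rewrite !mxE; under eq_fun do rewrite !mxE.
    apply: cvgB; first exact: cvg_cst.
    have := h Dx i; rewrite -(cvg_shiftn N); rewrite mxE.
    exact.
  have mB : vmeasurable D (fun x => g k x - F x) by apply: vmeasurableB => //; exact: (ig k).1.1.
  have le j : modular (fun x => g k x - g (s' j) x) <= e by apply: hN.
  have [|i1 l1] := pen_fatou mD m1 one0 p1 (fun j => (double_phaseB (ig k) (ig (s' j))).1) mB cB (C := e).
    by move=> j; apply: le_trans (le j); rewrite /modular lerDl pen_ge0.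
  have [|i2 l2] := pen_fatou mD mw w0 q1 (fun j => (double_phaseB (ig k) (ig (s' j))).2) mB cB (C := e).
    by move=> j; apply: le_trans (le j); rewrite /modular lerDr pen_ge0.
  by split => //; rewrite /modular mulr2n mulrDl mul1r lerD.
exists F; split.
  have [N /(_ N (leqnn N))[iF _]] := tail 1 ltr01.
  have := double_phaseB (ig N) iF.
  by rewrite (_ : (fun x => _) = F)//; apply/funext => x; rewrite opprB addrCA subrr addr0.
apply/cvgrPdist_le => e e0; have [|N hN] := tail (e / 2); first by rewrite divr_gt0.
exists N => // k /= Nk; have [_] := hN k Nk.
rewrite sub0r normrN ger0_norm ?modular_ge0// => /le_trans; apply.
by rewrite mulrCA divff// mulr1.
Qed.

End cauchy_sequences.

(** * Scalar functions and L^r convergence *)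

Section scalar_functions.
Context dd (T : measurableType dd) {R : realType}.
Variables (mu : {measure set T -> \bar R}) (D : set T).
Hypothesis mD : measurable D.
Implicit Types (u v : T -> R).

(** Scalar functions are viewed as fields of row vectors of length 1, so that the results on [pen]
    apply to them. *)
Definition lift1 u (x : T) : 'rV[R]_1 := const_mx (u x).

Lemma enorm_const_mx (a : R) : enorm (const_mx a : 'rV[R]_1) = `|a|.
Proof. by rewrite /enorm /dotv big_ord1 mxE -expr2 sqrtr_sqr. Qed.

Definition unit_weight (x : T) : R := 1.

Definition Lr (r : R) u := wint mu D unit_weight r (lift1 u).

Definition normr_pow (r : R) u := \int[mu]_(x in D) (`|u x| `^ r).

Lemma LrP r u : Lr r u <-> measurable_fun D u /\ mu.-integrable D (EFin \o (fun x => `|u x| `^ r)).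
Proof.
have e : wpow unit_weight r (lift1 u) = (fun x => `|u x| `^ r).
  by apply/funext => x; rewrite /wpow mul1r enorm_const_mx.
split=> [[mu' iu]|[mu' iu]]; split; rewrite ?e// -?e//.
- have := mu' ord0; rewrite /lift1; under eq_fun do rewrite mxE; exact.
- by move=> i; rewrite /lift1; under eq_fun do rewrite mxE.
Qed.

Lemma normr_powE r u : normr_pow r u = pen mu D unit_weight r (lift1 u).
Proof. by apply: eq_Rintegral => x _; rewrite /wpow mul1r enorm_const_mx. Qed.

Lemma measurable_unit_weight : measurable_fun D unit_weight.
Proof. exact: measurable_cst. Qed.

Lemma unit_weight_ge0 x : D x -> 0 <= unit_weight x.
Proof. by []. Qed.

Lemma lift1B u v : (fun x => lift1 u x - lift1 v x) = lift1 (fun x => u x - v x).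
Proof. by apply/funext => x; apply/rowP => i; rewrite !mxE. Qed.

Lemma lift1D u v : (fun x => lift1 u x + lift1 v x) = lift1 (fun x => u x + v x).
Proof. by apply/funext => x; apply/rowP => i; rewrite !mxE. Qed.

Lemma lift1Z c u : (fun x => c *: lift1 u x) = lift1 (fun x => c * u x).
Proof. by apply/funext => x; apply/rowP => i; rewrite !mxE. Qed.

Variable r : R.
Hypothesis r1 : 1 < r.
Let r0 : 0 < r. Proof. exact: lt_trans r1. Qed.

Lemma normr_pow_ge0 u : 0 <= normr_pow r u.
Proof. by apply: Rintegral_ge0 => x _; exact: powR_ge0. Qed.

Lemma LrB u v : Lr r u -> Lr r v -> Lr r (fun x => u x - v x).
Proof. by move=> hu hv; rewrite /Lr -lift1B; exact: (wintB mD measurable_unit_weight unit_weight_ge0 r1 hu hv). Qed.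

Lemma LrD u v : Lr r u -> Lr r v -> Lr r (fun x => u x + v x).
Proof. by move=> hu hv; rewrite /Lr -lift1D; exact: (wintD mD measurable_unit_weight unit_weight_ge0 r1 hu hv). Qed.

Lemma LrZ c u : Lr r u -> Lr r (fun x => c * u x).
Proof. by move=> hu; rewrite /Lr -lift1Z; apply: wintZ => //; exact: measurable_cst. Qed.

Lemma normr_powC u v : normr_pow r (fun x => u x - v x) = normr_pow r (fun x => v x - u x).
Proof. by apply: eq_Rintegral => x _; rewrite distrC. Qed.

Lemma normr_powZ c u : Lr r u -> normr_pow r (fun x => c * u x) = `|c| `^ r * normr_pow r u.
Proof.
move=> hu; rewrite !normr_powE -lift1Z penZ//; exact: measurable_cst.
Qed.

Lemma normr_powD u v : Lr r u -> Lr r v ->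
  normr_pow r (fun x => u x + v x) <= 2 `^ r * (normr_pow r u + normr_pow r v).
Proof.
move=> hu hv; have [_ iu] := (LrP r u).1 hu; have [_ iv] := (LrP r v).1 hv.
have [_ iuv] := (LrP r _).1 (LrD hu hv).
have isum := integrable_add mD iu iv.
rewrite /normr_pow -(RintegralD mD iu iv) -(RintegralZl _ mD isum).
apply: (le_Rintegral mD iuv (integrable_cst_mul mD _ isum)) => x Dx.
apply: le_trans (powR_addr_le _ _ (ltW r0)); rewrite ?normr_ge0//.
apply: powR_homo; [exact: ltW|exact: normr_ge0|exact: ler_normD].
Qed.

Lemma normr_pow_fatou (f : nat -> T -> R) u (C : R) : (forall k, Lr r (f k)) -> measurable_fun D u ->
  {ae mu, forall x, D x -> f k x @[k --> \oo] --> u x} -> (forall k, normr_pow r (f k) <= C) ->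
  Lr r u /\ normr_pow r u <= C.
Proof.
move=> hf hu fu fC; rewrite normr_powE; apply: (pen_fatou mD measurable_unit_weight unit_weight_ge0 r1 hf).
- by move=> i; rewrite /lift1; under eq_fun do rewrite mxE.
- by apply: ae_mono fu => x h /h; rewrite /lift1 => {}h i; rewrite mxE; under eq_fun do rewrite mxE.
- by move=> k; rewrite -normr_powE.
Qed.

(* The sequence [f (s 0), u, f (s 2), u, ...] is fast Cauchy, so its a.e. limit can only be [u]. *)
Lemma Lr_cvg_ae (f : nat -> T -> R) u : (forall k, Lr r (f k)) -> Lr r u ->
  normr_pow r (fun x => f k x - u x) @[k --> \oo] --> 0 ->
  exists (s : nat -> nat) (G : T -> R), [/\ (forall i, (s i < s i.+1)%N),
    (forall x, D x -> 0 <= G x), measurable_fun D G, mu.-integrable D (EFin \o (fun x => G x `^ r)) &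
    {ae mu, forall x, D x -> f (s k) x @[k --> \oo] --> u x /\ forall k, `|f (s k) x| <= G x}].
Proof.
move=> hf hu h.
pose t k : R := 2^-1 ^+ k / (2 ^+ k) `^ r.
have t0 k : 0 < t k by rewrite divr_gt0 ?exprn_gt0 ?powR_gt0 ?invr_gt0 ?exprn_gt0.
pose dist k (l : nat) := normr_pow r (fun x => f k x - u x).
have [|s [sS st]] := @fast_extraction R dist t t0.
  move=> e e0; move/cvgrPdist_le : h => /(_ _ e0)[N _ hN]; exists N => k l Nk _.
  by have := hN k Nk; rewrite sub0r normrN ger0_norm ?normr_pow_ge0.
pose F k := if odd k then u else f (s k).
have hF k : Lr r (F k) by rewrite /F; case: (odd k); [exact: hu|exact: hf].
have step k : normr_pow r (fun x => F k.+1 x - F k x) <= t k.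
  rewrite /F /=; case: (odd k) => /=.
    exact: (st k _ (s k.+1) (ltnW (sS k)) (ltnW (sS k))).
  rewrite normr_powC; exact: (st k _ (s k) (leqnn _) (leqnn _)).
have h1 k : measurable_fun D (F k) by exact: ((LrP r _).1 (hF k)).1.
have h2 := ((LrP r _).1 (hF 0%N)).2.
have h3 k := ((LrP r _).1 (LrB (hF k.+1) (hF k))).2.
have h4 k : (2 ^+ k) `^ r * \int[mu]_(x in D) (`|F k.+1 x - F k x| `^ r) <= 2^-1 ^+ k.
  by rewrite -ler_pdivlMl ?powR_gt0 ?exprn_gt0// mulrC; exact: step.
have [g [G [mg mG G0 iG hG]]] := fast_cauchy_ae mD r0 h1 h2 h3 h4.
exists (fun k => s (k.*2)), G; split => //.
  move=> i; rewrite doubleS; exact: ltn_trans (sS _) (sS _).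
apply: ae_mono hG => x hx /hx[cg bG]; split; last first.
  by move=> k; have := bG k.*2; rewrite /F odd_double.
have c1 : F k.*2 x @[k --> \oo] --> g x.
  by apply: (@cvg_subseq _ (fun k => F k x) (fun k => k.*2)) => // i; rewrite doubleS ltnS leqnSn.
have c2 : F k.*2.+1 x @[k --> \oo] --> g x.
  by apply: (@cvg_subseq _ (fun k => F k x) (fun k => k.*2.+1)) => // i; rewrite doubleS !ltnS leqnSn.
have gu : g x = u x.
  have : (fun k => F k.*2.+1 x) = (fun=> u x) by apply/funext => k; rewrite /F /= odd_double.
  move=> e; move: c2; rewrite e => c2.
  by apply: (cvg_unique _ c2); [|exact: cvg_cst].
by move: c1; rewrite gu; under eq_fun do rewrite /F odd_double.
Qed.

Hypothesis Doo : (mu D < +oo)%E.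

(** The embedding of L^r into L^s on a set of finite measure: the power mean inequality for |u|^s
    with exponent r / s. *)
Lemma normr_pow_le (s : R) : 0 < s < r -> exists2 C : R, 0 <= C & forall u, Lr r u ->
  mu.-integrable D (EFin \o (fun x => `|u x| `^ s)) /\
  normr_pow s u <= C * normr_pow r u `^ (s / r).
Proof.
move=> /andP[s0 sr].
have rs1 : 1 < r / s by rewrite ltr_pdivlMr// mul1r.
exists (1 + (r / s - 1) * fine (mu D)) => [|u /LrP[hu iu]].
  by rewrite addr_ge0// mulr_ge0 ?fine_ge0// subr_ge0 ltW.
have mus : measurable_fun D (fun x => `|u x| `^ s).
  by apply: (measurableT_comp (measurable_powR s)); apply: measurableT_comp.
have e x : (`|u x| `^ s) `^ (r / s) = `|u x| `^ r by rewrite -powRrM mulrCA divff ?mulr1 ?gt_eqF.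
have e' : (fun x => (`|u x| `^ s) `^ (r / s)) = (fun x => `|u x| `^ r) by apply/funext.
have i' : mu.-integrable D (EFin \o (fun x => (`|u x| `^ s) `^ (r / s))) by rewrite e'.
have g0 x : D x -> 0 <= `|u x| `^ s by move=> _; exact: powR_ge0.
split; first exact: (integrable_powR_le mD Doo rs1 mus g0 i').
by have := Rintegral_le_power_mean mD Doo rs1 mus g0 i'; rewrite e' invf_div.
Qed.

Lemma Lr_integrable u : Lr r u -> mu.-integrable D (EFin \o u).
Proof.
move=> /LrP[hu iu]; have mu1 : measurable_fun D (fun x => `|u x|) by exact: measurableT_comp.
apply: (integrable_dominated mD hu (integrable_powR_le mD Doo r1 mu1 (fun x _ => normr_ge0 (u x)) iu)).
by [].
Qed.

Lemma bounded_mul_integrable (f b : T -> R) (B : R) : mu.-integrable D (EFin \o f) ->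
  measurable_fun D b -> (forall x, D x -> `|b x| <= B) -> mu.-integrable D (EFin \o (fun x => f x * b x)).
Proof.
move=> fi mb bB; have mf := integrable_fun_measurable fi.
apply: (integrable_dominated mD (measurable_funM mf mb) (integrable_cst_mul mD B (integrable_norm fi))) => x Dx.
by rewrite normrM mulrC ler_wpM2r// bB.
Qed.

Lemma Lr_cvg_integral (f : nat -> T -> R) u (b : T -> R) (B : R) : (forall k, Lr r (f k)) -> Lr r u ->
  normr_pow r (fun x => f k x - u x) @[k --> \oo] --> 0 ->
  measurable_fun D b -> (forall x, D x -> `|b x| <= B) ->
  \int[mu]_(x in D) (f k x * b x) @[k --> \oo] --> \int[mu]_(x in D) (u x * b x).
Proof.
move=> hf hu h mb bB.
pose c := 1 + (r - 1) * fine (mu D).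
have c0 : 0 <= c by rewrite addr_ge0// mulr_ge0 ?fine_ge0// subr_ge0 ltW.
pose nu k := normr_pow r (fun x => f k x - u x).
have key k : `|\int[mu]_(x in D) (u x * b x) - \int[mu]_(x in D) (f k x * b x)| <= `|B| * (c * nu k `^ r^-1).
  have hd := LrB hu (hf k).
  have iu := bounded_mul_integrable (Lr_integrable hu) mb bB.
  have iF := bounded_mul_integrable (Lr_integrable (hf k)) mb bB.
  have id := bounded_mul_integrable (Lr_integrable hd) mb bB.
  have ia := integrable_norm (Lr_integrable hd).
  rewrite -(RintegralB mD iu iF).
  under eq_Rintegral do rewrite -mulrBl.
  apply: (le_trans (le_normr_Rintegral mD id)).
  apply: (@le_trans _ _ (\int[mu]_(x in D) (`|B| * `|u x - f k x|))).
    apply: (le_Rintegral mD (integrable_norm id) (integrable_cst_mul mD _ ia)) => x Dx.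
    by rewrite /= normrM mulrC ler_wpM2r// (le_trans (bB x Dx))// ler_norm.
  rewrite (RintegralZl _ mD ia); apply: ler_wpM2l; first exact: normr_ge0.
  have /LrP[md id'] := hd.
  have m1 : measurable_fun D (fun x => `|u x - f k x|) by exact: measurableT_comp.
  have := Rintegral_le_power_mean mD Doo r1 m1 (fun x _ => normr_ge0 _) id'.
  by rewrite -/c -/(normr_pow r (fun x => u x - f k x)) normr_powC.
apply/cvgrPdist_le => e e0.
have lim : `|B| * (c * nu k `^ r^-1) @[k --> \oo] --> 0.
  have := cvg_norm_powR (r := r^-1) _ h; rewrite invr_gt0 => /(_ r0).
  rewrite normr0 powR0 ?invr_eq0 ?gt_eqF// => h'.
  rewrite -(mulr0 `|B|); apply: cvgMr; rewrite -(mulr0 c); apply: cvgMr.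
  by apply: cvg_trans h'; apply: near_eq_cvg; near=> k; rewrite /nu ger0_norm// normr_pow_ge0.
move/cvgrPdist_le : lim => /(_ _ e0); apply: filterS => k.
rewrite sub0r normrN => hk; apply: (le_trans (key k)); apply: le_trans hk; exact: ler_norm.
Unshelve. all: by end_near.
Qed.

End scalar_functions.

(** * The energy space *)

Lemma squeeze0 (R : realType) (u v : nat -> R) : (forall k, 0 <= u k <= v k) ->
  v k @[k --> \oo] --> 0 -> u k @[k --> \oo] --> 0.
Proof.
move=> uv v0; apply: (squeeze_cvgr _ (cvg_cst 0) v0); exact: nearW.
Qed.

Lemma cvg0_comb (R : realType) (a b : nat -> R) (c1 c2 : R) : a k @[k --> \oo] --> 0 ->
  b k @[k --> \oo] --> 0 -> c1 * (a k + c2 * b k) @[k --> \oo] --> 0.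
Proof.
move=> a0 b0; rewrite -[X in _ --> X](mulr0 c1) -[X in _ --> c1 * X](addr0 0) -{2}(mulr0 c2).
by apply: cvgMr; apply: cvgD => //; apply: cvgMr.
Qed.

Lemma cvg_powR (R : realType) (u : nat -> R) (l r : R) : 0 < r -> (forall k, 0 <= u k) ->
  u k @[k --> \oo] --> l -> u k `^ r @[k --> \oo] --> l `^ r.
Proof.
move=> r0 u0 ul; have l0 : 0 <= l by apply: (cvgr_to_ge ul); exact: nearW.
have := cvg_norm_powR r0 ul; rewrite ger0_norm//.
by under eq_fun do rewrite ger0_norm//.
Qed.

Section test_function_spaces.
Context {R : realType} {n : nat}.
Local Notation bl := (@borel_lebesgue R n).
Local Notation mu := (@lebesgue_rV R n).
Local Notation cT := (caratheodory_type (bl^*)%mu).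
Variables (Omega : set 'rV[R]_n) (eta : 'rV[R]_n -> R) (L p q d M : R).
Hypotheses (n0 : (0 < n)%N) (oO : open Omega) (L0 : 0 < L).
Hypothesis OL : Omega `<=` cube (const_mx (- L)) (2 * L).
Hypotheses (p1 : 1 < p) (pq : p < q) (qd : q < d) (dec0 : 0 < @decay R n p d).
Hypotheses (meta : lebesgue_measurable Omega eta) (eta0 : forall x, Omega x -> 0 <= eta x).
Hypothesis etaM : {ae mu, forall z, Omega z -> `|eta z| <= M}.

Let bO : measurable Omega. Proof. exact: open_measurable_rV. Qed.
Let mO : measurable (Omega : set cT). Proof. exact: borel_cara. Qed.
Let Ofin : (mu Omega < +oo)%E.
Proof. by rewrite lebesgue_rV_borel//; exact: (measure_bounded_fin bO L0 OL). Qed.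
Let q1 : 1 < q. Proof. exact: lt_trans pq. Qed.
Let d1 : 1 < d. Proof. exact: lt_trans qd. Qed.
Let pd : p <= d. Proof. by apply: ltW; exact: lt_trans qd. Qed.
Let p0 : 0 < p. Proof. exact: lt_trans p1. Qed.
Let d0 : 0 < d. Proof. exact: lt_trans d1. Qed.

Local Notation one := (@unit_weight _ cT R).
Let m1 : measurable_fun (Omega : set cT) one. Proof. exact: measurable_cst. Qed.
Let one0 x : Omega x -> 0 <= one x. Proof. by []. Qed.
Local Notation dp := (@double_phase _ cT R n mu Omega p q eta).
Local Notation md := (@modular _ cT R n mu Omega p q eta).
Local Notation peng := (@pen _ cT R n mu Omega one p).
Local Notation Ld := (@Lr _ cT R mu Omega d).
Local Notation nd := (@normr_pow _ cT R mu Omega d).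
Local Notation test := (test_function Omega).

Lemma bounded_ae_integrable (f : cT -> R) (B : R) : measurable_fun (Omega : set cT) f ->
  {ae mu, forall z, Omega z -> `|f z| <= B} -> mu.-integrable (Omega : set cT) (EFin \o f).
Proof.
move=> mf fB; exact: (integrable_dominated_ae mO mf (integrable_cst_fin mO Ofin B) fB).
Qed.

Lemma continuous_cara (f : 'rV[R]_n -> R) : continuous f -> measurable_fun (Omega : set cT) (f : cT -> R).
Proof.
move=> cf; apply: borel_measurable_cara => //; apply: measurable_funTS.
exact: continuous_measurable_rV.
Qed.

Lemma test_continuous phi : test phi -> continuous phi.
Proof. by move=> [/(_ 0%N)/Ck_continuous]. Qed.

Lemma test_measurable phi : test phi -> measurable_fun (Omega : set cT) (phi : cT -> R).
Proof. by move=> t; apply: continuous_cara; exact: test_continuous. Qed.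

Lemma test_derive_measurable phi i : test phi ->
  measurable_fun (Omega : set cT) ('D_(ebase i) phi : cT -> R).
Proof.
move=> [C1 _ _]; apply: continuous_cara; exact: (@continuous_derive _ _ phi i (C1 1%N)).
Qed.

Lemma test_grad_measurable phi : test phi -> @vmeasurable _ cT R n Omega (grad phi).
Proof.
move=> t i; rewrite /grad; under eq_fun do rewrite mxE; exact: test_derive_measurable.
Qed.

Lemma test_Ld phi : test phi -> Ld phi.
Proof.
move=> t; have [B [pB _]] := test_bounded t.
apply/LrP; split; first exact: test_measurable.
apply: (@bounded_ae_integrable _ (B `^ d)).
  apply: (measurableT_comp (measurable_powR d)); apply: measurableT_comp => //.
  exact: test_measurable.
apply: aeW => x _; rewrite ger0_norm ?powR_ge0//.
by apply: powR_homo; [exact: ltW|exact: normr_ge0|exact: pB].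
Qed.

Lemma test_enorm_grad phi : test phi -> exists B, forall x, enorm (grad phi x) <= B.
Proof.
move=> t; have [B [_ gB]] := test_bounded t; exists (\sum_(i < n) B) => x.
apply: (le_trans (enorm_le_sum _)); apply: ler_sum => i _; rewrite mxE; exact: gB.
Qed.

Lemma test_dp phi : test phi -> dp (grad phi).
Proof.
move=> t; have [B gB] := test_enorm_grad t; have mg := test_grad_measurable t.
have pB r x : 1 < r -> enorm (grad phi x) `^ r <= B `^ r.
  by move=> r1; apply: powR_homo; [rewrite ltW// (lt_trans _ r1)|exact: enorm_ge0|exact: gB].
split; split => //.
- apply: (@bounded_ae_integrable _ (B `^ p)); first by apply: measurable_wpow; [exact: measurable_cst|exact: mg].
  by apply: aeW => x _; rewrite /wpow mul1r ger0_norm ?powR_ge0// pB.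
- apply: (@bounded_ae_integrable _ (M * B `^ q)); first by apply: measurable_wpow; [exact: meta|exact: mg].
  apply: ae_mono etaM => x h Ox; rewrite /wpow normrM (ger0_norm (powR_ge0 _ _)).
  by apply: ler_pM; rewrite ?powR_ge0 ?pB ?h.
Qed.

Lemma energy_le_pen phi : test phi -> energy Omega p phi <= n%:R `^ p * peng (grad phi).
Proof.
move=> t; have [C1 [B [pB gB]] _ _] := test_function_smooth_in t.
have cg := @continuous_grad1 _ _ phi C1.
have mg : measurable_fun setT (fun x => grad1 phi x `^ p).
  by apply: (measurableT_comp (measurable_powR p)); exact: continuous_measurable_rV.
rewrite /energy -Rintegral_lebesgue_rV//; last exact: measurable_funTS.
have ig : mu.-integrable (Omega : set cT) (EFin \o (fun x => grad1 phi x `^ p)).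
  apply: (@bounded_integrable_mu R n Omega L oO L0 OL _ (B `^ p)) => // x.
  rewrite ger0_norm ?powR_ge0//.
  by apply: powR_homo; [exact: ltW|exact: grad1_ge0|exact: gB].
have [[_ ip] _] := test_dp t.
rewrite /pen -(RintegralZl _ mO ip).
apply: (le_Rintegral mO ig (integrable_cst_mul mO _ ip)) => x _.
rewrite /wpow mul1r -powRM ?enorm_ge0//; apply: powR_homo; [exact: ltW|exact: grad1_ge0|].
have -> : n%:R * enorm (grad phi x) = \sum_(i < n) enorm (grad phi x).
  by rewrite sumr_const card_ord mulr_natl.
apply: ler_sum => i _.
by have := coord_le_enorm (grad phi x) i; rewrite mxE.
Qed.

Lemma sobolev_cst_ge0 : 0 <= @sobolev_cst R n Omega L p d.
Proof.
have [r0 r1 rd0 rd1] := @ratio_bounds R n p d p1 pd dec0.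
rewrite /sobolev_cst /approx_cst mulr_ge0 ?powR_ge0// addr_ge0//.
  by rewrite !mulr_ge0 ?powR_ge0// invr_ge0 subr_ge0 ltW.
by rewrite mulr_ge0 ?powR_ge0 ?fine_ge0.
Qed.

Lemma test_sobolev : exists2 C, 0 <= C & forall phi, test phi ->
  nd phi <= C * peng (grad phi) `^ (d / p).
Proof.
have dp0 : 0 <= d / p by rewrite divr_ge0// ltW.
exists (@sobolev_cst R n Omega L p d * (n%:R `^ p) `^ (d / p)) => [|phi t].
  by rewrite mulr_ge0 ?powR_ge0// sobolev_cst_ge0.
have [_ h] := smooth_sobolev n0 bO L0 OL p1 pd dec0 (test_function_smooth_in t).
have mp : measurable_fun Omega (fun x => `|phi x| `^ d).
  apply: (measurableT_comp (measurable_powR d)); apply: measurableT_comp => //.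
  by apply: measurable_funTS; apply: continuous_measurable_rV; exact: test_continuous.
rewrite /normr_pow Rintegral_lebesgue_rV//; apply: (le_trans h).
have pg : 0 <= peng (grad phi) by apply: pen_ge0 => x _; exact: ler01.
apply: (@le_trans _ _ (@sobolev_cst R n Omega L p d * (n%:R `^ p * peng (grad phi)) `^ (d / p))).
  apply: ler_wpM2l; first exact: sobolev_cst_ge0.
  by apply: powR_homo; [exact: dp0|exact: energy_ge0|exact: energy_le_pen].
by rewrite (powRM _ (powR_ge0 _ _) pg) mulrA.
Qed.

Lemma test_totally_bounded (F : nat -> 'rV[R]_n -> R) (K e : R) : 0 < e ->
  (forall k, test (F k)) -> (forall k, peng (grad (F k)) <= K) ->
  finitely_coloured (fun k l => nd (fun x => F k x - F l x) <= e).
Proof.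
move=> e0 tF FK.
have sF k := test_function_smooth_in (tF k).
have eF k : energy Omega p (F k) <= n%:R `^ p * K.
  by apply: (le_trans (energy_le_pen (tF k))); rewrite ler_wpM2l ?powR_ge0.
have := smooth_totally_bounded n0 bO L0 OL p1 pd dec0 e0 sF eF.
apply: finitely_colouredW => k l; rewrite /normr_pow Rintegral_lebesgue_rV//.
apply: (measurableT_comp (measurable_powR d)); apply: measurableT_comp => //.
by apply: measurable_funTS; apply: measurable_funB; apply: continuous_measurable_rV; exact: test_continuous.
Qed.


(** The gradient is part of the data rather than derived from [u], and convergence is measured in
    L^d and in the modular. These pairs turn out to be the elements of [W01H] with their weak
    gradients, up to null sets. *)
Definition approximable (u : 'rV[R]_n -> R) (g : 'rV[R]_n -> 'rV[R]_n) := [/\ Ld u, dp g &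
  exists phi : nat -> 'rV[R]_n -> R, [/\ forall k, test (phi k),
    nd (fun x => phi k x - u x) @[k --> \oo] --> 0 &
    md (fun x => grad (phi k) x - g x) @[k --> \oo] --> 0]].

Lemma modular_pens g : 0 <= peng g <= md g /\ 0 <= @pen _ cT R n mu Omega eta q g <= md g.
Proof.
have a0 : 0 <= peng g by apply: pen_ge0 => x _; exact: ler01.
have b0 : 0 <= @pen _ cT R n mu Omega eta q g by exact: pen_ge0.
by rewrite a0 b0 /= /modular lerDl lerDr.
Qed.

Lemma modular_cvg_pens (f : nat -> 'rV[R]_n -> 'rV[R]_n) : md (f k) @[k --> \oo] --> 0 ->
  peng (f k) @[k --> \oo] --> 0 /\ @pen _ cT R n mu Omega eta q (f k) @[k --> \oo] --> 0.
Proof.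
by move=> h; split; apply: squeeze0 h => k; have [] := modular_pens (f k).
Qed.

Lemma nd_cvg (f : nat -> 'rV[R]_n -> R) u : (forall k, Ld (f k)) -> Ld u ->
  nd (fun x => f k x - u x) @[k --> \oo] --> 0 -> nd (f k) @[k --> \oo] --> nd u.
Proof.
move=> hf hu h; rewrite normr_powE; under eq_fun do rewrite normr_powE.
have h' : @pen _ cT R 1 mu Omega one d (fun x => lift1 (f k) x - lift1 u x) @[k --> \oo] --> 0.
  by move: h; under eq_fun do rewrite normr_powE -lift1B.
exact: (pen_cvg mO m1 one0 d1 hf hu h').
Qed.

Lemma approximable_sobolev : exists2 C, 0 <= C & forall u g, approximable u g ->
  nd u <= C * peng g `^ (d / p).
Proof.
have [C C0 hC] := test_sobolev; exists C => // u g [hu hg [phi [tphi uphi gphi]]].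
have c1 := nd_cvg (fun k => test_Ld (tphi k)) hu uphi.
have [c2 _] := modular_cvg_pens gphi.
have c3 := pen_cvg mO m1 one0 p1
  (fun k => (test_dp (tphi k)).1) hg.1 c2.
have pos f : 0 <= peng f by have [/andP[]] := modular_pens f.
have c4 : C * peng (grad (phi k)) `^ (d / p) @[k --> \oo] --> C * peng g `^ (d / p).
  by apply: cvgMr; exact: (cvg_powR (divr_gt0 d0 p0) (fun k => pos _) c3).
by apply: (ler_cvg_to c1 c4); apply: nearW => k; exact: hC.
Qed.

Lemma test_approximable phi : test phi -> approximable phi (grad phi).
Proof.
move=> t; split; [exact: test_Ld|exact: test_dp|exists (fun=> phi); split => //].
- rewrite (_ : (fun _ => _) = fun=> 0); first exact: cvg_cst.
  apply/funext => k; rewrite /normr_pow; under eq_Rintegral do rewrite subrr normr0 powR0 ?gt_eqF//.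
  by rewrite Rintegral_cst// mul0r.
- have e x : enorm (grad phi x - grad phi x) = 0 by rewrite subrr enorm0.
  rewrite (_ : (fun _ => _) = fun=> 0); first exact: cvg_cst.
  apply/funext => k; rewrite /modular /pen /wpow.
  under eq_Rintegral do rewrite e powR0 ?gt_eqF// mulr0.
  rewrite Rintegral_cst// mul0r add0r.
  under eq_Rintegral do rewrite e powR0 ?gt_eqF ?(lt_trans _ pq)// mulr0.
  by rewrite Rintegral_cst// mul0r.
Qed.

Lemma modularZ_le c g : dp g -> md (fun x => c *: g x) <= (`|c| `^ p + `|c| `^ q) * md g.
Proof.
move=> [g1 g2]; rewrite /modular !penZ//.
have := powR_ge0 `|c| p; have := powR_ge0 `|c| q.
have : 0 <= peng g by apply: pen_ge0 => x _; exact: ler01.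
have : 0 <= @pen _ cT R n mu Omega eta q g by exact: pen_ge0.
rewrite !mulrDl !mulrDr => a b c' d'; apply: lerD.
  by rewrite lerDl mulr_ge0.
by rewrite lerDr mulr_ge0.
Qed.

Lemma approximable_linear c u g v h : approximable u g -> approximable v h ->
  approximable (fun x => u x + c * v x) (fun x => g x + c *: h x).
Proof.
move=> [hu hg [phi [t1 u1 g1]]] [hv hh [psi [t2 u2 g2]]].
split; [exact: (LrD mO d1 hu (LrZ mO c hv))| |].
  exact: (double_phaseD mO p1 q1 meta eta0 hg (double_phaseZ mO c hh)).
exists (fun k x => phi k x + c * psi k x); split.
- by move=> k; exact: test_functionDZ.
- pose a k := nd (fun x => phi k x - u x); pose b k := nd (fun x => psi k x - v x).
  apply: (@squeeze0 _ _ (fun k => 2 `^ d * (a k + `|c| `^ d * b k))) => [k|].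
    rewrite normr_pow_ge0/=.
    have l1 := LrB mO d1 (test_Ld (t1 k)) hu; have l2 := LrB mO d1 (test_Ld (t2 k)) hv.
    have := normr_powD mO d1 l1 (LrZ mO c l2); rewrite (normr_powZ mO c l2).
    apply: le_trans; rewrite le_eqVlt; apply/orP; left; apply/eqP.
    by apply: eq_Rintegral => x _; congr (`|_| `^ _); ring.
  exact: (@cvg0_comb _ a b _ _ u1 u2).
- pose a k := md (fun x => grad (phi k) x - g x); pose b k := md (fun x => grad (psi k) x - h x).
  apply: (@squeeze0 _ _ (fun k => (2 `^ p + 2 `^ q) * (a k + (`|c| `^ p + `|c| `^ q) * b k))) => [k|].
    rewrite modular_ge0//=.
    have l1 := double_phaseB mO p1 q1 meta eta0 (test_dp (t1 k)) hg.
    have l2 := double_phaseB mO p1 q1 meta eta0 (test_dp (t2 k)) hh.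
    have l3 := double_phaseZ mO c l2.
    have := modularD mO p1 q1 meta eta0 l1 l3.
    have -> : (fun x => grad (phi k) x - g x + c *: (grad (psi k) x - h x)) =
        (fun x => grad (fun x => phi k x + c * psi k x) x - (g x + c *: h x)).
      by apply/funext => x; rewrite (grad_linear c x (t1 k) (t2 k)) scalerBr opprD addrACA.
    move=> /le_trans; apply; apply: ler_wpM2l; first by rewrite addr_ge0 ?powR_ge0.
    apply: lerD; [exact: lexx|exact: (modularZ_le c l2)].
  exact: (@cvg0_comb _ a b _ _ g1 g2).
Qed.

End test_function_spaces.

(** * Linearity and uniqueness of weak gradients *)

Section weak_gradients.
Context {R : realType} {n : nat}.
Local Notation bl := (@borel_lebesgue R n).
Local Notation mu := (@lebesgue_rV R n).
Local Notation cT := (caratheodory_type (bl^*)%mu).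
Variables (Omega : set 'rV[R]_n).
Hypotheses (oO : open Omega).
Implicit Types (u v f : 'rV[R]_n -> R) (g h : 'rV[R]_n -> 'rV[R]_n).

Let mO : measurable (Omega : set cT). Proof. by apply: borel_cara; exact: open_measurable_rV. Qed.

Lemma L1loc_mul_integrable f b K : L1loc Omega f -> continuous b -> compact K -> K `<=` Omega ->
  (forall x, ~ K x -> b x = 0) -> mu.-integrable (Omega : set cT) (EFin \o (fun x => f x * b x)).
Proof.
move=> [mf fK] cb cK KO b0.
have mK : measurable (K : set cT) by apply: borel_cara; exact: measurable_compact_rV.
have [B B0 hB] := compact_continuous_bounded cK cb.
have mb : measurable_fun (K : set cT) (b : cT -> R).
  apply: borel_measurable_cara; last exact: measurable_compact_rV.
  by apply: measurable_funTS; exact: continuous_measurable_rV.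
have := bounded_mul_integrable mK (fK K KO cK) mb hB.
move=> /(integrable_mkcond _ mK) iK; apply/(integrable_mkcond _ mO).
rewrite (_ : (EFin \o _) \_ Omega = (EFin \o (fun x => f x * b x)) \_ K)//.
apply/funext => x; rewrite /patch; case: ifPn => xO; case: ifPn => xK //=.
- by rewrite b0 ?mulr0//; move/negP: xK => xK ?; apply: xK; exact: mem_set.
- by move/negP: xO; case; apply: mem_set; apply: KO; exact: set_mem.
Qed.

Lemma L1loc_test_integrable f phi : L1loc Omega f -> test_function Omega phi ->
  mu.-integrable (Omega : set cT) (EFin \o (fun x => f x * phi x)) /\
  forall i, mu.-integrable (Omega : set cT) (EFin \o (fun x => f x * 'D_(ebase i) phi x)).
Proof.
move=> fL t; have [C1 cK KO] := t; split => [|i].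
  apply: (L1loc_mul_integrable fL (Ck_continuous (C1 0%N)) cK KO) => x nx.
  by apply/eqP; rewrite -[_ == _]negbK; apply/negP => h; apply: nx; exact: subset_closure.
apply: (L1loc_mul_integrable fL (@continuous_derive _ _ phi i (C1 1%N)) cK KO) => x nx.
exact: vanish_derive.
Qed.

Lemma L1locD c u v : L1loc Omega u -> L1loc Omega v -> L1loc Omega (fun x => u x + c * v x).
Proof.
move=> [mu1 iu] [mv iv]; split.
  exact: (measurable_funD mu1 (measurable_funM (measurable_cst c) mv)).
move=> K KO cK; have mK : measurable (K : set cT) by apply: borel_cara; exact: measurable_compact_rV.
exact: (integrable_add mK (iu K KO cK) (integrable_cst_mul mK c (iv K KO cK))).
Qed.

Lemma weak_gradient_linear c u v g h : is_weak_gradient Omega u g -> is_weak_gradient Omega v h ->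
  is_weak_gradient Omega (fun x => u x + c * v x) (fun x => g x + c *: h x).
Proof.
move=> [uL gL ug] [vL hL vh]; split; first exact: L1locD.
  move=> i; rewrite (_ : (fun z => _) = (fun z => g z ord0 i + c * h z ord0 i)); first exact: L1locD.
  by apply/funext => z; rewrite !mxE.
move=> phi t i.
have [_ /(_ i) u1] := L1loc_test_integrable uL t; have [_ /(_ i) v1] := L1loc_test_integrable vL t.
have [g1 _] := L1loc_test_integrable (gL i) t; have [h1 _] := L1loc_test_integrable (hL i) t.
have -> : (fun z => (u z + c * v z) * 'D_(ebase i) phi z) =
    (fun z => u z * 'D_(ebase i) phi z + c * (v z * 'D_(ebase i) phi z)).
  by apply/funext => z; rewrite mulrDl mulrA.
have -> : (fun z => (g z + c *: h z) ord0 i * phi z) =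
    (fun z => g z ord0 i * phi z + c * (h z ord0 i * phi z)).
  by apply/funext => z; rewrite !mxE mulrDl mulrA.
rewrite (RintegralD mO u1 (integrable_cst_mul mO c v1)) (RintegralD mO g1 (integrable_cst_mul mO c h1)).
by rewrite (RintegralZl _ mO v1) (RintegralZl _ mO h1) ug// vh// opprD mulrN.
Qed.

Lemma weak_gradient_unique u g h : is_weak_gradient Omega u g -> is_weak_gradient Omega u h ->
  {ae mu, forall z, Omega z -> g z = h z}.
Proof.
move=> [uL gL ug] [_ hL uh].
have co i : {ae mu, forall z, Omega z -> g z ord0 i + (- 1) * h z ord0 i = 0}.
  apply: (fundamental_lemma oO); first exact: L1locD.
  move=> phi t; have [g1 _] := L1loc_test_integrable (gL i) t; have [h1 _] := L1loc_test_integrable (hL i) t.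
  have -> : (fun z => (g z ord0 i + -1 * h z ord0 i) * phi z) =
      (fun z => g z ord0 i * phi z + -1 * (h z ord0 i * phi z)).
    by apply/funext => z; rewrite mulrDl mulrA.
  rewrite (RintegralD mO g1 (integrable_cst_mul mO _ h1)) (RintegralZl _ mO h1) mulN1r.
  by rewrite -[X in X - _]opprK -(ug _ t) (uh _ t) opprK subrr.
have := ae_forall_fin co; apply: ae_mono => z hz Oz; apply/rowP => i.
by have := hz i Oz; rewrite mulN1r => /eqP; rewrite subr_eq0 => /eqP.
Qed.

Lemma weak_gradientP u g : is_weak_gradient Omega u g -> is_weak_gradient Omega u (weak_gradient Omega u).
Proof. by move=> ug; rewrite /weak_gradient; apply: xgetPex; exists g. Qed.

Lemma weak_gradientE u g : is_weak_gradient Omega u g ->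
  {ae mu, forall z, Omega z -> weak_gradient Omega u z = g z}.
Proof. by move=> ug; exact: (weak_gradient_unique (weak_gradientP ug) ug). Qed.

Lemma integrable_L1loc f : lebesgue_measurable Omega f ->
  mu.-integrable (Omega : set cT) (EFin \o f) -> L1loc Omega f.
Proof.
move=> mf fi; split => // K KO cK.
have mK : measurable (K : set cT) by apply: borel_cara; exact: measurable_compact_rV.
exact: (integrableS mO mK KO fi).
Qed.

End weak_gradients.

Section approximable_gradients.
Context {R : realType} {n : nat}.
Local Notation bl := (@borel_lebesgue R n).
Local Notation mu := (@lebesgue_rV R n).
Local Notation cT := (caratheodory_type (bl^*)%mu).
Variables (Omega : set 'rV[R]_n) (eta : 'rV[R]_n -> R) (L p q d M : R).
Hypotheses (n0 : (0 < n)%N) (oO : open Omega) (L0 : 0 < L).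
Hypothesis OL : Omega `<=` cube (const_mx (- L)) (2 * L).
Hypotheses (p1 : 1 < p) (pq : p < q) (qd : q < d) (dec0 : 0 < @decay R n p d).
Hypotheses (meta : lebesgue_measurable Omega eta) (eta0 : forall x, Omega x -> 0 <= eta x).
Hypothesis etaM : {ae mu, forall z, Omega z -> `|eta z| <= M}.

Let bO : measurable Omega. Proof. exact: open_measurable_rV. Qed.
Let mO : measurable (Omega : set cT). Proof. exact: borel_cara. Qed.
Let Ofin : (mu Omega < +oo)%E.
Proof. by rewrite lebesgue_rV_borel//; exact: (measure_bounded_fin bO L0 OL). Qed.
Let q1 : 1 < q. Proof. exact: lt_trans pq. Qed.
Let d1 : 1 < d. Proof. exact: lt_trans qd. Qed.
Let p0 : 0 < p. Proof. exact: lt_trans p1. Qed.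

Local Notation one := (@unit_weight _ cT R).
Local Notation dp := (@double_phase _ cT R n mu Omega p q eta).
Local Notation md := (@modular _ cT R n mu Omega p q eta).
Local Notation peng := (@pen _ cT R n mu Omega one p).
Local Notation approx := (@approximable R n Omega eta p q d).

Lemma double_phase_coord (g : 'rV[R]_n -> 'rV[R]_n) i : dp g ->
  @Lr _ cT R mu Omega p (fun x => g x ord0 i) /\
  @normr_pow _ cT R mu Omega p (fun x => g x ord0 i) <= peng g.
Proof.
move=> [[mg ig] _].
have mi : measurable_fun (Omega : set cT) (fun x : cT => `|g x ord0 i| `^ p).
  by apply: (measurableT_comp (measurable_powR p)); apply: measurableT_comp => //; exact: mg.
have le (x : cT) : Omega x -> `|g x ord0 i| `^ p <= wpow one p (g : cT -> _) x.
  move=> _; rewrite /wpow mul1r; apply: powR_homo; [exact: ltW|exact: normr_ge0|exact: coord_le_enorm].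
have ii : mu.-integrable (Omega : set cT) (EFin \o (fun x : cT => `|g x ord0 i| `^ p)).
  by apply: (integrable_dominated mO mi ig) => x Ox; rewrite ger0_norm ?powR_ge0// le.
by split; [apply/LrP; split => //; exact: mg|exact: (le_Rintegral mO ii ig le)].
Qed.

(** The formula for the test functions [phi k] passes to the limit against the bounded functions
    [psi] and its derivatives: L^d convergence serves the left side, L^p convergence of the
    coordinates of the gradients the right side. *)
Lemma approximable_weak_gradient u g : approx u g -> is_weak_gradient Omega u g.
Proof.
move=> [hu hg [phi [tphi uphi gphi]]]; split.
- by apply: integrable_L1loc => //; [exact: ((LrP _ _ _ _).1 hu).1|exact: (Lr_integrable mO d1 Ofin hu)].
- move=> i; have [hi _] := double_phase_coord i hg; apply: integrable_L1loc => //.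
    exact: ((LrP _ _ _ _).1 hi).1.
  exact: (Lr_integrable mO p1 Ofin hi).
- move=> psi tpsi i.
  have [B [pB gB]] := test_bounded tpsi.
  have m1 := test_measurable oO tpsi; have m2 := test_derive_measurable oO i tpsi.
  have c1 := Lr_cvg_integral mO d1 Ofin (fun k => test_Ld oO L0 OL p1 pq qd (tphi k)) hu uphi m2 (fun x _ => gB x i).
  have dphi k := test_dp oO L0 OL p1 pq meta etaM (tphi k).
  have g2 : @normr_pow _ cT R mu Omega p (fun x => grad (phi k) x ord0 i - g x ord0 i) @[k --> \oo] --> 0.
    have [h _] := modular_cvg_pens eta0 gphi.
    apply: squeeze0 h => k; rewrite normr_pow_ge0/=.
    have [_] := double_phase_coord i (double_phaseB mO p1 q1 meta eta0 (dphi k) hg).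
    apply: le_trans; rewrite le_eqVlt; apply/orP; left; apply/eqP.
    by apply: eq_Rintegral => x _; rewrite !mxE.
  have c2 := Lr_cvg_integral mO p1 Ofin (fun k => (double_phase_coord i (dphi k)).1)
    (double_phase_coord i hg).1 g2 m1 (fun x _ => pB x).
  have e k : \int[mu]_(x in Omega) (phi k x * 'D_(ebase i) psi x) =
      - \int[mu]_(x in Omega) (grad (phi k) x ord0 i * psi x).
    by have [_ _] := test_weak_gradient oO L0 OL (tphi k); apply.
  have E : (fun k => - \int[mu]_(x in Omega) (grad (phi k) x ord0 i * psi x)) =
      (fun k => \int[mu]_(x in Omega) (phi k x * 'D_(ebase i) psi x)) by apply/funext.
  have c3 : (- \int[mu]_(x in Omega) (grad (phi k) x ord0 i * psi x)) @[k --> \oo] -->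
      \int[mu]_(x in Omega) (u x * 'D_(ebase i) psi x) by rewrite E; exact: c1.
  exact: (cvg_unique _ c3 (cvgN c2)).
Qed.

End approximable_gradients.

Lemma cvg0_small (R : realType) (u : nat -> R) : (forall k, 0 <= u k) -> u k @[k --> \oo] --> 0 ->
  forall e, 0 < e -> exists N, forall k, (N <= k)%N -> u k <= e.
Proof.
move=> u0 ucv e e0; move/cvgrPdist_le : ucv => /(_ _ e0)[N _ hN]; exists N => k /hN.
by rewrite sub0r normrN ger0_norm.
Qed.

Lemma small_cvg0 (R : realType) (u : nat -> R) : (forall k, 0 <= u k) ->
  (forall e, 0 < e -> exists N, forall k, (N <= k)%N -> u k <= e) -> u k @[k --> \oo] --> 0.
Proof.
move=> u0 h; apply/cvgrPdist_le => e /h[N hN]; exists N => // k /= Nk.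
by rewrite sub0r normrN ger0_norm// hN.
Qed.

Lemma le_mul_half_half (R : realFieldType) (K b x y : R) : 0 <= K -> 0 <= b -> 0 <= x -> 0 <= y ->
  x <= b / (2 * (K + 1)) -> y <= b / (2 * (K + 1)) -> K * (x + y) <= b.
Proof.
move=> K0 b0 x0 y0 hx hy; have K1 : 0 < K + 1 by rewrite ltr_wpDl.
apply: (@le_trans _ _ ((K + 1) * (b / (2 * (K + 1)) + b / (2 * (K + 1))))).
  by apply: ler_pM; rewrite ?addr_ge0// ?lerDl// lerD.
by rewrite le_eqVlt; apply/orP; left; apply/eqP; field; rewrite gt_eqF.
Qed.

Lemma small_powR (R : realType) (e r : R) : 0 < e -> 0 < r ->
  exists2 t : R, 0 < t <= 1 & t `^ r <= e.
Proof.
move=> e0 r0; exists (Num.min 1 (e `^ r^-1)).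
  by rewrite lt_min ltr01 powR_gt0//= ge_min lexx.
apply: (@le_trans _ _ ((e `^ r^-1) `^ r)).
  apply: powR_homo; [exact: ltW|by rewrite le_min ler01 powR_ge0|by rewrite ge_min lexx orbT].
by rewrite -powRrM mulVf ?gt_eqF// powRr1// ltW.
Qed.

Lemma cvge0P (R : realType) (u : nat -> \bar R) : (forall k, (0 <= u k)%E) ->
  (u k @[k --> \oo] --> 0%E <-> forall e : R, 0 < e -> \forall k \near \oo, (u k <= e%:E)%E).
Proof.
move=> u0; split=> [/fine_cvgP[uf ucv] e e0|h].
  move/cvgrPdist_le : ucv => /(_ _ e0) ucv; near=> k.
  have fk : u k \is a fin_num by near: k.
  have : `|0 - fine (u k)| <= e by near: k.
  rewrite sub0r normrN ger0_norm ?fine_ge0// => le.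
  by rewrite -(fineK fk) lee_fin.
apply/fine_cvgP; split.
  apply: filterS (h 1 ltr01) => k le; rewrite ge0_fin_numE//.
  by apply: le_lt_trans le _; rewrite ltry.
apply/cvgrPdist_le => e e0; apply: filterS (h e e0) => k le /=.
rewrite sub0r normrN ger0_norm ?fine_ge0//.
have fk : u k \is a fin_num by rewrite ge0_fin_numE//; apply: le_lt_trans le _; rewrite ltry.
by rewrite -lee_fin fineK.
Unshelve. all: by end_near.
Qed.

(** * Modular and Luxemburg norm *)

Section modular_and_norm.
Context {R : realType} {n : nat}.
Local Notation bl := (@borel_lebesgue R n).
Local Notation mu := (@lebesgue_rV R n).
Local Notation cT := (caratheodory_type (bl^*)%mu).
Variables (Omega : set 'rV[R]_n) (eta : 'rV[R]_n -> R) (p q : R).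
Hypotheses (p1 : 1 < p) (pq : p < q) (mO : measurable (Omega : set cT)).
Hypotheses (meta : lebesgue_measurable Omega eta) (eta0 : forall x, Omega x -> 0 <= eta x).
Implicit Types f h : 'rV[R]_n -> R.

Let p0 : 0 < p. Proof. exact: lt_trans p1. Qed.
Let q1 : 1 < q. Proof. exact: lt_trans pq. Qed.
Let q0 : 0 < q. Proof. exact: lt_trans q1. Qed.

Local Notation rho := (@rhoH R n Omega eta p q).
Local Notation nH := (@normH R n Omega eta p q).

Definition phase f (z : 'rV[R]_n) : R := `|f z| `^ p + eta z * `|f z| `^ q.

Lemma phase_ge0 f z : Omega z -> 0 <= phase f z.
Proof. by move=> Oz; rewrite addr_ge0 ?mulr_ge0 ?powR_ge0 ?eta0. Qed.

Lemma measurable_phase f : lebesgue_measurable Omega f ->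
  measurable_fun (Omega : set cT) (phase f : cT -> R).
Proof.
move=> mf.
have mr r : measurable_fun (Omega : set cT) (fun z : cT => `|f z| `^ r).
  by apply: (measurableT_comp (measurable_powR r)); exact: (measurableT_comp _ mf).
exact: (measurable_funD (mr p) (measurable_funM meta (mr q))).
Qed.

Lemma le_rhoH c f h : 0 <= c -> lebesgue_measurable Omega f -> lebesgue_measurable Omega h ->
  (forall z, Omega z -> phase f z <= c * phase h z) -> (rho f <= c%:E * rho h)%E.
Proof.
move=> c0 mf mh fh; have mpf := measurable_phase mf; have mph := measurable_phase mh.
have mE : measurable_fun (Omega : set cT) (fun z : cT => (phase h z)%:E) by apply/measurable_EFinP.
have mE' : measurable_fun (Omega : set cT) (fun z : cT => (phase f z)%:E) by apply/measurable_EFinP.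
have hE (z : cT) : Omega z -> (0 <= (phase h z)%:E)%E by move=> Oz; rewrite lee_fin phase_ge0.
have fE (z : cT) : Omega z -> (0 <= (phase f z)%:E)%E by move=> Oz; rewrite lee_fin phase_ge0.
have c0E : (0 <= c%:E)%E by rewrite lee_fin.
rewrite -(ge0_integralZl mu mO mE hE c0E).
have le (z : cT) : Omega z -> ((phase f z)%:E <= c%:E * (phase h z)%:E)%E.
  by move=> Oz; rewrite -EFinM lee_fin; exact: fh.
have mE2 : measurable_fun (Omega : set cT) (fun z : cT => c%:E * (phase h z)%:E)%E.
  exact: measurable_funeM.
exact: (@ge0_le_integral _ cT R mu _ mO _ _ fE mE' mE2 le).
Qed.

Lemma measurable_scale f (t : R) : lebesgue_measurable Omega f -> lebesgue_measurable Omega (fun z => f z / t).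
Proof. by move=> mf; exact: (measurable_funM mf (measurable_cst _)). Qed.

(** As [t <= 1] and p < q, [t^q <= t^p]: division by [t] multiplies the integrand by a factor
    between [t^-p] and [t^-q]. This compares small norms with small modulars. *)
Lemma phase_scale f (t : R) z : 0 < t <= 1 -> Omega z ->
  phase f z <= t `^ p * phase (fun z => f z / t) z /\
  phase (fun z => f z / t) z <= (t `^ q)^-1 * phase f z.
Proof.
move=> /andP[t0 t1] Oz; rewrite /phase normrM (ger0_norm (ltW (etrans (invr_gt0 t) t0))).
have E r : (`|f z| / t) `^ r = `|f z| `^ r / t `^ r.
  rewrite powRM ?invr_ge0 ?(ltW t0)//; congr (_ * _).
  by rewrite -powR_inv1 ?(ltW t0)// -powRrM mulN1r powRN.
have tq : t `^ q <= t `^ p.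
  have -> : t `^ q = t `^ p * t `^ (q - p) by rewrite -powRD ?(gt_eqF t0) ?implybT// addrC subrK.
  rewrite ler_piMr ?powR_ge0//.
  have := @powR_homo R (q - p) t 1; rewrite powR1; apply; rewrite ?subr_ge0 ?(ltW pq) ?(ltW t0)//.
have tp0 : 0 < t `^ p by rewrite powR_gt0.
have tq0 : 0 < t `^ q by rewrite powR_gt0.
have a0 : 0 <= `|f z| `^ p by exact: powR_ge0.
have b0 : 0 <= eta z * `|f z| `^ q by rewrite mulr_ge0 ?powR_ge0 ?eta0.
rewrite !E; move: tq tp0 tq0 a0 b0; rewrite mulrA.
move: (t `^ q) (t `^ p) (`|f z| `^ p) (eta z * _) => B A a b BA A0 B0 a0 b0; split.
  have -> : A * (a / A + b / B) = a + b * (A / B) by field; rewrite !gt_eqF.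
  by rewrite lerD2l ler_peMr// ler_pdivlMr// mul1r.
have -> : B^-1 * (a + b) = a * B^-1 + b / B by ring.
by rewrite lerD2r ler_wpM2l// lef_pV2 ?posrE.
Qed.

Lemma normH_ge0 f : (0 <= nH f)%E.
Proof. by apply: le_ereal_inf_tmp => _ [t [t0 _] <-]; rewrite lee_fin ltW. Qed.

Lemma rhoH_le_of_normH f (t : R) : lebesgue_measurable Omega f -> 0 < t <= 1 ->
  (nH f < t%:E)%E -> (rho f <= (t `^ p)%:E)%E.
Proof.
move=> mf /andP[t0 t1] /ereal_inf_lt[_ [s [s0 rs] <-]]; rewrite lte_fin => st.
have s1 : 0 < s <= 1 by rewrite s0 (le_trans (ltW st) t1).
have := @le_rhoH (s `^ p) f (fun z => f z / s) (powR_ge0 _ _) mf (measurable_scale s mf)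
  (fun z Oz => (phase_scale f s1 Oz).1).
move=> /le_trans; apply; apply: (@le_trans _ _ ((s `^ p)%:E * 1)%E).
  by apply: lee_wpmul2l rs; rewrite lee_fin powR_ge0.
rewrite mule1 lee_fin; apply: powR_homo; [exact: ltW|exact: ltW|exact: ltW].
Qed.

Lemma normH_le_of_rhoH f (t : R) : lebesgue_measurable Omega f -> 0 < t <= 1 ->
  (rho f <= (t `^ q)%:E)%E -> (nH f <= t%:E)%E.
Proof.
move=> mf t01 h; have /andP[t0 t1] := t01.
apply: ereal_inf_lbound; exists t => //; split => //.
have tq : 0 < t `^ q by rewrite powR_gt0.
have tq' : 0 <= (t `^ q)^-1 by rewrite invr_ge0 ltW.
have := @le_rhoH _ (fun z => f z / t) f tq' (measurable_scale t mf) mf (fun z Oz => (phase_scale f t01 Oz).2).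
move=> /le_trans; apply; apply: (@le_trans _ _ (((t `^ q)^-1)%:E * (t `^ q)%:E)%E).
  by apply: lee_wpmul2l h; rewrite lee_fin.
by rewrite -EFinM mulVf// gt_eqF.
Qed.

Lemma eq_rhoH f h : lebesgue_measurable Omega f -> lebesgue_measurable Omega h ->
  {ae mu, forall z, Omega z -> f z = h z} -> rho f = rho h.
Proof.
move=> mf mh fh; have mpf := measurable_phase mf; have mph := measurable_phase mh.
have mE : measurable_fun (Omega : set cT) (fun z : cT => (phase h z)%:E) by apply/measurable_EFinP.
have mE' : measurable_fun (Omega : set cT) (fun z : cT => (phase f z)%:E) by apply/measurable_EFinP.
apply: (ae_eq_integral _ _ mO mE' mE).
by apply: ae_mono fh => z e Oz; rewrite /phase (e Oz).
Qed.

Lemma rhoH_fin f : lebesgue_measurable Omega f -> (rho f < +oo)%E ->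
  mu.-integrable (Omega : set cT) (EFin \o (phase f : cT -> R)).
Proof.
move=> mf foo; have f0 (z : cT) : Omega z -> 0 <= phase f z by exact: phase_ge0.
exact: (integrable_ge0P (measurable_phase mf) f0 foo).
Qed.

Lemma rhoH_parts f : lebesgue_measurable Omega f -> (rho f < +oo)%E ->
  mu.-integrable (Omega : set cT) (EFin \o (fun z : cT => `|f z| `^ p)) /\
  mu.-integrable (Omega : set cT) (EFin \o (fun z : cT => eta z * `|f z| `^ q)).
Proof.
move=> mf foo; have ip := rhoH_fin mf foo.
have mr r : measurable_fun (Omega : set cT) (fun z : cT => `|f z| `^ r).
  by apply: (measurableT_comp (measurable_powR r)); exact: (measurableT_comp _ mf).
split.
  apply: (integrable_dominated mO (mr p) ip) => z Oz.
  by rewrite ger0_norm ?powR_ge0// lerDl mulr_ge0 ?powR_ge0 ?eta0.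
apply: (integrable_dominated mO (measurable_funM meta (mr q)) ip) => z Oz.
by rewrite ger0_norm ?mulr_ge0 ?powR_ge0 ?eta0// lerDr powR_ge0.
Qed.

Lemma normr_pow_le_rhoH f (c : R) : lebesgue_measurable Omega f -> (rho f <= c%:E)%E ->
  @normr_pow _ cT R mu Omega p f <= c.
Proof.
move=> mf fc; have foo : (rho f < +oo)%E by apply: le_lt_trans fc _; rewrite ltry.
have ip := rhoH_fin mf foo; have [i1 _] := rhoH_parts mf foo.
have fE : (\int[mu]_(z in Omega) phase f z)%:E = rho f by rewrite (EFin_Rintegral mO ip).
rewrite -lee_fin; apply: le_trans fc; rewrite -fE lee_fin.
apply: (le_Rintegral mO i1 ip) => z Oz.
by rewrite lerDl mulr_ge0 ?powR_ge0 ?eta0.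
Qed.

Lemma rhoH_modular (g : 'rV[R]_n -> 'rV[R]_n) : @double_phase _ cT R n mu Omega p q eta g ->
  rho (fun z => enorm (g z)) = (@modular _ cT R n mu Omega p q eta g)%:E.
Proof.
move=> [[mg i1] [_ i2]]; rewrite /modular /pen EFinD (EFin_Rintegral mO i1) (EFin_Rintegral mO i2).
rewrite -(integralD mO i1 i2); apply: eq_integral => z _.
by rewrite /wpow /= mul1r !(ger0_norm (enorm_ge0 _)).
Qed.

Lemma double_phase_rhoH (g : 'rV[R]_n -> 'rV[R]_n) : @vmeasurable _ cT R n Omega g ->
  (rho (fun z => enorm (g z)) < +oo)%E -> @double_phase _ cT R n mu Omega p q eta g.
Proof.
move=> mg foo; have mf : lebesgue_measurable Omega (fun z => enorm (g z)) by exact: measurable_enorm.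
have [i1 i2] := rhoH_parts mf foo; split; split; [exact: mg| |exact: mg|].
  move: i1; congr (mu.-integrable Omega _); apply/funext => z.
  by rewrite /wpow /= mul1r (ger0_norm (enorm_ge0 _)).
move: i2; congr (mu.-integrable Omega _); apply/funext => z.
by rewrite /wpow /= (ger0_norm (enorm_ge0 _)).
Qed.

End modular_and_norm.

Lemma le_two_products (R : realFieldType) (A B a b : R) : 0 <= A -> 0 <= B -> 0 <= a -> 0 <= b ->
  A * a + B * b <= (A + B) * (a + b).
Proof.
move=> A0 B0 a0 b0; rewrite -subr_ge0.
have -> : (A + B) * (a + b) - (A * a + B * b) = A * b + B * a by ring.
by rewrite addr_ge0// mulr_ge0.
Qed.

(** * Description of the space by test functions *)

Section space_characterization.
Context {R : realType} {n : nat}.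
Local Notation bl := (@borel_lebesgue R n).
Local Notation mu := (@lebesgue_rV R n).
Local Notation cT := (caratheodory_type (bl^*)%mu).
Variables (Omega : set 'rV[R]_n) (eta : 'rV[R]_n -> R) (L p q d M : R).
Hypotheses (n0 : (0 < n)%N) (oO : open Omega) (L0 : 0 < L).
Hypothesis OL : Omega `<=` cube (const_mx (- L)) (2 * L).
Hypotheses (p1 : 1 < p) (pq : p < q) (qd : q < d) (dec0 : 0 < @decay R n p d).
Hypotheses (meta : lebesgue_measurable Omega eta) (eta0 : forall x, Omega x -> 0 <= eta x).
Hypothesis etaM : {ae mu, forall z, Omega z -> `|eta z| <= M}.

Let bO : measurable Omega. Proof. exact: open_measurable_rV. Qed.
Let mO : measurable (Omega : set cT). Proof. exact: borel_cara. Qed.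
Let Ofin : (mu Omega < +oo)%E.
Proof. by rewrite lebesgue_rV_borel//; exact: (measure_bounded_fin bO L0 OL). Qed.
Let q1 : 1 < q. Proof. exact: lt_trans pq. Qed.
Let d1 : 1 < d. Proof. exact: lt_trans qd. Qed.
Let p0 : 0 < p. Proof. exact: lt_trans p1. Qed.
Let q0 : 0 < q. Proof. exact: lt_trans q1. Qed.
Let d0 : 0 < d. Proof. exact: lt_trans d1. Qed.

Local Notation one := (@unit_weight _ cT R).
Local Notation dp := (@double_phase _ cT R n mu Omega p q eta).
Local Notation md := (@modular _ cT R n mu Omega p q eta).
Local Notation peng := (@pen _ cT R n mu Omega one p).
Local Notation approx := (@approximable R n Omega eta p q d).
Local Notation Ld := (@Lr _ cT R mu Omega d).
Local Notation nd := (@normr_pow _ cT R mu Omega d).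
Local Notation test := (test_function Omega).
Local Notation rho := (@rhoH R n Omega eta p q).
Local Notation nH := (@normH R n Omega eta p q).

(** Convergence in L^d is automatic: the Sobolev inequality for [phi k - phi l] makes the sequence
    Cauchy there, and Fatou's lemma along an a.e. convergent subsequence identifies the limit. *)
Lemma approximable_limit (phi : nat -> 'rV[R]_n -> R) u g (s : nat -> nat) :
  (forall k, test (phi k)) -> dp g -> md (fun x => grad (phi k) x - g x) @[k --> \oo] --> 0 ->
  lebesgue_measurable Omega u -> (forall i, (s i < s i.+1)%N) ->
  {ae mu, forall z, Omega z -> phi (s k) z @[k --> \oo] --> u z} -> approx u g.
Proof.
move=> tphi hg gphi hu sS us.
have dphi k := test_dp oO L0 OL p1 pq meta etaM (tphi k).
have lphi k := test_Ld oO L0 OL p1 pq qd (tphi k).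
have [C C0 hC] := test_sobolev n0 oO L0 OL p1 pq qd dec0 meta etaM.
pose K := 2 `^ p + 2 `^ q.
have K0 : 0 <= K by rewrite addr_ge0 ?powR_ge0.
have cauchy e : 0 < e -> exists N, forall k l, (N <= k)%N -> (N <= l)%N ->
    nd (fun x => phi k x - phi l x) <= e.
  move=> e0; have C1 : 0 < C + 1 by rewrite ltr_wpDl.
  (* Chosen so that [C * b^(d/p)] is at most [e], where [b] bounds the p-energy of the
     difference. *)
  pose b := (e / (C + 1)) `^ (p / d).
  have b0 : 0 < b by rewrite powR_gt0// divr_gt0.
  have b1 : 0 < b / (2 * (K + 1)) by rewrite divr_gt0// mulr_gt0// ltr_wpDl.
  have [N hN] := cvg0_small (fun k => modular_ge0 mu p q eta0 _) gphi b1; exists N => k l Nk Nl.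
  have hk := hN k Nk; have hl := hN l Nl.
  have tkl : test (fun x => phi k x + (- 1) * phi l x) by exact: test_functionDZ.
  have e1 : (fun x => phi k x - phi l x) = (fun x => phi k x + (- 1) * phi l x).
    by apply/funext => x; rewrite mulN1r.
  rewrite e1; apply: (le_trans (hC _ tkl)).
  have gle : peng (grad (fun x => phi k x + (- 1) * phi l x)) <= b.
    have [/andP[_ h1] _] := modular_pens p q eta0 (grad (fun x => phi k x + (- 1) * phi l x)).
    apply: (le_trans h1).
    have dk := double_phaseB mO p1 q1 meta eta0 (dphi k) hg.
    have dl := double_phaseB mO p1 q1 meta eta0 hg (dphi l).
    have := modularD mO p1 q1 meta eta0 dk dl.
    rewrite (modularC mu Omega p q eta g (grad (phi l))).
    have -> : (fun x => grad (phi k) x - g x + (g x - grad (phi l) x)) =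
        grad (fun x => phi k x + (- 1) * phi l x).
      by apply/funext => x; rewrite (grad_linear _ x (tphi k) (tphi l)) scaleN1r addrA subrK.
    move=> /le_trans; apply; rewrite -/K.
    by apply: (le_mul_half_half K0 (ltW b0) _ _ hk hl); exact: modular_ge0.
  apply: (@le_trans _ _ (C * b `^ (d / p))).
    apply: ler_wpM2l => //; apply: powR_homo; [by rewrite divr_ge0// ltW| |exact: gle].
    by apply: pen_ge0 => x _; exact: ler01.
  rewrite /b -powRrM mulrA divfK ?gt_eqF// divff ?gt_eqF// powRr1 ?divr_ge0 ?(ltW e0) ?(ltW C1)//.
  by rewrite mulrCA ler_piMr ?(ltW e0)// ler_pdivrMr// mul1r lerDl.
have tail e : 0 < e -> exists N, forall k, (N <= k)%N ->
    Ld (fun x => phi k x - u x) /\ nd (fun x => phi k x - u x) <= e.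
  move=> e0; have [N hN] := cauchy e e0; exists N => k Nk.
  have sN j : (N <= s (j + N)%N)%N by apply: leq_trans (extraction_ge sS _); exact: leq_addl.
  apply: (normr_pow_fatou mO d1 (f := fun j x => phi k x - phi (s (j + N)%N) x)).
  - move=> j; exact: (LrB mO d1 (lphi k) (lphi _)).
  - exact: (measurable_funB (test_measurable oO (tphi k)) hu).
  - apply: ae_mono us => z h Oz; apply: cvgB; first exact: cvg_cst.
    by have := h Oz; rewrite -(cvg_shiftn N); exact.
  - by move=> j; exact: hN.
split => //.
  have [N /(_ N (leqnn N))[hd _]] := tail 1 ltr01.
  have := LrB mO d1 (lphi N) hd.
  by rewrite (_ : (fun x => _) = u)//; apply/funext => x; rewrite opprB addrCA subrr addr0.
exists phi; split => //.
apply: (small_cvg0 (fun k => normr_pow_ge0 _ _ _ _)) => e /tail[N hN].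
by exists N => k /hN[].
Qed.


(** Both exponents are below [d] and [eta] is essentially bounded, so each part of the modular is
    controlled through [normr_pow_le]. *)
Lemma rhoH_Ld : exists2 C, 0 <= C & forall u, Ld u ->
  (rho u <= (C * (nd u `^ (p / d) + nd u `^ (q / d)))%:E)%E.
Proof.
have [Cp Cp0 hCp] := normr_pow_le mO Ofin (s := p) (introT andP (conj p0 (lt_trans pq qd))).
have [Cq Cq0 hCq] := normr_pow_le mO Ofin (s := q) (introT andP (conj q0 qd)).
exists (Cp + `|M| * Cq) => [|u hu]; first by rewrite addr_ge0// mulr_ge0.
have [mu' _] := (LrP _ _ _ _).1 hu.
have [ip lp] := hCp u hu; have [iq lq] := hCq u hu.
have mr r : measurable_fun (Omega : set cT) (fun z : cT => `|u z| `^ r).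
  by apply: (measurableT_comp (measurable_powR r)); exact: (measurableT_comp _ mu').
have le : {ae mu, forall z : cT, Omega z -> `|eta z * `|u z| `^ q| <= `|M| * `|u z| `^ q}.
  apply: ae_mono etaM => z h Oz; rewrite normrM (ger0_norm (powR_ge0 _ _)) ler_wpM2r ?powR_ge0//.
  exact: le_trans (h Oz) (ler_norm M).
have iM := integrable_cst_mul mO `|M| iq.
have ie := integrable_dominated_ae mO (measurable_funM meta (mr q)) iM le.
have -> : rho u = (\int[mu]_(z in Omega) (`|u z| `^ p + eta z * `|u z| `^ q))%:E.
  by rewrite (EFin_Rintegral mO (integrable_add mO ip ie)).
rewrite lee_fin (RintegralD mO ip ie).
have le2 : \int[mu]_(z in Omega) (eta z * `|u z| `^ q) <= `|M| * normr_pow mu Omega q u.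
  rewrite /normr_pow -(RintegralZl _ mO iq).
  apply: (le_Rintegral_ae mO ie iM); apply: ae_mono le => z h Oz.
  exact: le_trans (ler_norm _) (h Oz).
have a0 : 0 <= nd u `^ (p / d) by exact: powR_ge0.
have b0 : 0 <= nd u `^ (q / d) by exact: powR_ge0.
apply: (le_trans (lerD lp (le_trans le2 (ler_wpM2l (normr_ge0 M) lq)))).
by rewrite mulrA; apply: le_two_products => //; rewrite mulr_ge0.
Qed.

(** Convergence in norm gives modular convergence of the gradients and L^p convergence of the
    functions; the latter supplies the a.e. convergent subsequence for [approximable_limit]. *)
Lemma W01H_approximable u : W01H Omega eta p q u -> approx u (weak_gradient Omega u).
Proof.
move=> [[[mu' rfin] [g0 ug0] [mgu gfin]] [phi [tphi uphi]]].
have ug := weak_gradientP ug0; set g := weak_gradient Omega u in ug *.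
have [_ gL _] := ug.
have mg : @vmeasurable _ cT R n Omega g by move=> i; exact: (gL i).1.
have hg : dp g by exact: (double_phase_rhoH mO meta eta0 mg gfin).
have dphi k := test_dp oO L0 OL p1 pq meta etaM (tphi k).
have lphi k := test_Ld oO L0 OL p1 pq qd (tphi k).
have e1 k : (u \- phi k) = (fun x => u x + (- 1) * phi k x).
  by apply/funext => x; rewrite mulN1r.
(* [weak_gradient] is a chosen representative, so it is linear only almost everywhere. *)
have wk k : {ae mu, forall z, Omega z -> weak_gradient Omega (u \- phi k) z = g z - grad (phi k) z}.
  rewrite e1.
  have := weak_gradientE oO (weak_gradient_linear oO (- 1) ug (test_weak_gradient oO L0 OL (tphi k))).
  by apply: ae_mono => z h Oz; rewrite h// scaleN1r.
have wl k : @vmeasurable _ cT R n Omega (weak_gradient Omega (u \- phi k)).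
  have /weak_gradientP[_ h _] := weak_gradient_linear oO (- 1) ug (test_weak_gradient oO L0 OL (tphi k)).
  by rewrite e1 => i; exact: (h i).1.
have mng k : lebesgue_measurable Omega (norm_grad Omega (u \- phi k)) by exact: measurable_enorm (wl k).
have mud k : lebesgue_measurable Omega (u \- phi k).
  exact: (measurable_funB mu' (test_measurable oO (tphi k))).
have dgk k := double_phaseB mO p1 q1 meta eta0 hg (dphi k).
have rg k : rho (norm_grad Omega (u \- phi k)) = (md (fun x => g x - grad (phi k) x))%:E.
  rewrite -(rhoH_modular mO (dgk k)).
  have mgk : lebesgue_measurable Omega (fun z => enorm (g z - grad (phi k) z)).
    exact: measurable_enorm (dgk k).1.1.
  have ek : {ae mu, forall z, Omega z -> norm_grad Omega (u \- phi k) z = enorm (g z - grad (phi k) z)}.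
    by apply: ae_mono (wk k) => z h Oz; rewrite /norm_grad h.
  exact: (eq_rhoH _ _ mO meta (mng k) mgk ek).
have n1 k := @normH_ge0 R n Omega eta p q (norm_grad Omega (u \- phi k)).
have n2 k := @normH_ge0 R n Omega eta p q (u \- phi k).
have n0' k : (0 <= norm1H Omega eta p q (u \- phi k)%R)%E by exact: (adde_ge0 (n1 k) (n2 k)).
have small (t : R) : 0 < t <= 1 -> exists N, forall k, (N <= k)%N ->
    (rho (norm_grad Omega (u \- phi k)%R) <= (t `^ p)%:E)%E /\ (rho (u \- phi k)%R <= (t `^ p)%:E)%E.
  move=> t01; have /andP[t0 t1] := t01.
  have t2 : 0 < t / 2 by rewrite divr_gt0.
  have /(_ _ t2)[N _ hN] := (cvge0P n0').1 uphi.
  exists N => k /hN le.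
  have lt : ((t / 2)%:E < t%:E)%E by rewrite lte_fin ltr_pdivrMr// ltr_pMr// ltr1n.
  have l1 : (nH (norm_grad Omega (u \- phi k)%R) < t%:E)%E.
    by apply: le_lt_trans lt; apply: le_trans le; apply: leeDl; exact: n2.
  have l2 : (nH (u \- phi k)%R < t%:E)%E.
    by apply: le_lt_trans lt; apply: le_trans le; apply: leeDr; exact: n1.
  by split; [exact: (rhoH_le_of_normH p1 pq mO meta eta0 (mng k) t01 l1)|
    exact: (rhoH_le_of_normH p1 pq mO meta eta0 (mud k) t01 l2)].
have gphi : md (fun x => grad (phi k) x - g x) @[k --> \oo] --> 0.
  apply: (small_cvg0 (fun k => modular_ge0 mu p q eta0 _)) => e e0.
  have [t t01 te] := small_powR e0 p0; have [N hN] := small t t01.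
  exists N => k /hN[+ _]; rewrite rg lee_fin modularC => /le_trans; exact.
have Lpk k : @Lr _ cT R mu Omega p (phi k).
  have [Cp _ hCp] := normr_pow_le mO Ofin (s := p) (introT andP (conj p0 (lt_trans pq qd))).
  by apply/LrP; split; [exact: (test_measurable oO (tphi k))|exact: (hCp _ (lphi k)).1].
have Lpu : @Lr _ cT R mu Omega p u.
  by apply/LrP; split; [exact: mu'|exact: (rhoH_parts mO meta eta0 mu' rfin).1].
have uphi' : @normr_pow _ cT R mu Omega p (fun x => phi k x - u x) @[k --> \oo] --> 0.
  apply: (small_cvg0 (fun k => normr_pow_ge0 _ _ _ _)) => e e0.
  have [t t01 te] := small_powR e0 p0; have [N hN] := small t t01.
  exists N => k /hN[_ le]; rewrite normr_powC; apply: le_trans te.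
  exact: (normr_pow_le_rhoH mO meta eta0 (mud k) le).
have [s [G [sS _ _ _ hs]]] := Lr_cvg_ae mO p1 Lpk Lpu uphi'.
apply: (approximable_limit tphi hg gphi mu' sS).
by apply: ae_mono hs => z h /h[].
Qed.

(** The approximating test functions are the same; small modulars give small norms, and for the
    functions themselves the modular is small by [rhoH_Ld]. *)
Lemma approximable_W01H u g : approx u g ->
  W01H Omega eta p q u /\ {ae mu, forall z, Omega z -> weak_gradient Omega u z = g z}.
Proof.
move=> ap; have [hu hg [phi [tphi uphi gphi]]] := ap.
have ug := approximable_weak_gradient oO L0 OL p1 pq qd meta eta0 etaM ap.
have wE := weak_gradientE oO ug; split; last exact: wE.
have [mu' iu] := (LrP _ _ _ _).1 hu.
have dphi k := test_dp oO L0 OL p1 pq meta etaM (tphi k).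
have lphi k := test_Ld oO L0 OL p1 pq qd (tphi k).
have [_ wL _] := weak_gradientP ug.
have mw : @vmeasurable _ cT R n Omega (weak_gradient Omega u) by move=> i; exact: (wL i).1.
have mng : lebesgue_measurable Omega (norm_grad Omega u) by exact: measurable_enorm mw.
have mgn : lebesgue_measurable Omega (fun z => enorm (g z)) by exact: measurable_enorm hg.1.1.
have [C C0 hC] := rhoH_Ld.
split.
  split.
  - split; first exact: mu'.
    by apply: le_lt_trans (hC u hu) _; rewrite ltry.
  - by exists g.
  - split; first exact: mng.
    have eg : {ae mu, forall z, Omega z -> norm_grad Omega u z = enorm (g z)}.
      by apply: ae_mono wE => z h Oz; rewrite /norm_grad h.
    by rewrite (eq_rhoH _ _ mO meta mng mgn eg) (rhoH_modular mO hg) ltry.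
exists phi; split; first exact: tphi.
have e1 k : (u \- phi k) = (fun x => u x + (- 1) * phi k x).
  by apply/funext => x; rewrite mulN1r.
have wgk k := weak_gradient_linear oO (- 1) ug (test_weak_gradient oO L0 OL (tphi k)).
have wk k : {ae mu, forall z, Omega z -> weak_gradient Omega (u \- phi k) z = g z - grad (phi k) z}.
  rewrite e1; have := weak_gradientE oO (wgk k).
  by apply: ae_mono => z h Oz; rewrite h// scaleN1r.
have wl k : @vmeasurable _ cT R n Omega (weak_gradient Omega (u \- phi k)).
  have /weak_gradientP[_ h _] := wgk k.
  by rewrite e1 => i; exact: (h i).1.
have mngk k : lebesgue_measurable Omega (norm_grad Omega (u \- phi k)) by exact: measurable_enorm (wl k).
have mud k : lebesgue_measurable Omega (u \- phi k).
  exact: (measurable_funB mu' (test_measurable oO (tphi k))).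
have dgk k := double_phaseB mO p1 q1 meta eta0 hg (dphi k).
have rg k : rho (norm_grad Omega (u \- phi k)) = (md (fun x => g x - grad (phi k) x))%:E.
  rewrite -(rhoH_modular mO (dgk k)).
  have mgk : lebesgue_measurable Omega (fun z => enorm (g z - grad (phi k) z)).
    exact: measurable_enorm (dgk k).1.1.
  have ek : {ae mu, forall z, Omega z -> norm_grad Omega (u \- phi k) z = enorm (g z - grad (phi k) z)}.
    by apply: ae_mono (wk k) => z h Oz; rewrite /norm_grad h.
  exact: (eq_rhoH _ _ mO meta (mngk k) mgk ek).
have n1 k := @normH_ge0 R n Omega eta p q (norm_grad Omega (u \- phi k)).
have n2 k := @normH_ge0 R n Omega eta p q (u \- phi k).
have n0' k : (0 <= norm1H Omega eta p q (u \- phi k)%R)%E by exact: (adde_ge0 (n1 k) (n2 k)).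
apply/(cvge0P n0') => e e0.
(* Each of the two norms is made at most [t]; the bound by 1 is the range in which
   [normH_le_of_rhoH] applies. *)
pose t := Num.min 1 (e / 2).
have t0 : 0 < t by rewrite lt_min ltr01 divr_gt0.
have t1 : t <= 1 by rewrite ge_min lexx.
have te : t + t <= e by rewrite [leRHS]splitr lerD// ge_min lexx orbT.
have t01 : 0 < t <= 1 by rewrite t0 t1.
have tq0 : 0 < t `^ q by rewrite powR_gt0.
have [N1 hN1] := cvg0_small (fun k => modular_ge0 mu p q eta0 _) gphi tq0.
have ndc : C * (nd (fun x => phi k x - u x) `^ (p / d) + 1 * nd (fun x => phi k x - u x) `^ (q / d)) @[k --> \oo] --> 0.
  have c1 := cvg_powR (divr_gt0 p0 d0) (fun k => normr_pow_ge0 mu Omega d _) uphi.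
  have c2 := cvg_powR (divr_gt0 q0 d0) (fun k => normr_pow_ge0 mu Omega d _) uphi.
  rewrite powR0 in c1; last by rewrite gt_eqF// divr_gt0.
  rewrite powR0 in c2; last by rewrite gt_eqF// divr_gt0.
  exact: (cvg0_comb C 1 c1 c2).
have nd0 k : 0 <= C * (nd (fun x => phi k x - u x) `^ (p / d) + 1 * nd (fun x => phi k x - u x) `^ (q / d)).
  by rewrite mulr_ge0// addr_ge0 ?mulr_ge0 ?powR_ge0.
have [N2 hN2] := cvg0_small nd0 ndc tq0.
exists (maxn N1 N2) => // k /=; rewrite geq_max => /andP[k1 k2].
apply: (@le_trans _ _ (t%:E + t%:E)%E); last by rewrite -EFinD lee_fin.
apply: leeD.
  apply: (normH_le_of_rhoH pq mO meta eta0 (mngk k) t01).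
  by rewrite rg lee_fin modularC; exact: hN1.
apply: (normH_le_of_rhoH pq mO meta eta0 (mud k) t01).
apply: (le_trans (hC _ (LrB mO d1 hu (lphi k)))); rewrite lee_fin normr_powC.
by have := hN2 k k2; rewrite mul1r.
Qed.

End space_characterization.

(** * Weak compactness *)

Lemma three_terms (R : realFieldType) (P x y z w t thr : R) : 1 <= P -> w <= P * (y + z) ->
  x <= t -> y <= t -> z <= t -> t = thr / (3 * (P * P)) -> 0 <= x -> P * (x + w) <= thr.
Proof.
move=> P1 hw xt yt zt tE x0; have P0 : 0 < P by exact: lt_le_trans P1.
have -> : thr = P * (P * (3 * t)) by rewrite tE; field; rewrite gt_eqF.
rewrite ler_pM2l//; apply: (@le_trans _ _ (P * x + P * (y + z))).
  by apply: lerD => //; rewrite ler_peMl.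
by rewrite -mulrDr ler_pM2l//; lra.
Qed.

Lemma two_halves (R : realFieldType) (P a b c : R) : 0 < P -> a <= c / (2 * P) -> b <= c / (2 * P) ->
  P * (a + b) <= c.
Proof.
move=> P0 ha hb; apply: (@le_trans _ _ (P * (c / (2 * P) + c / (2 * P)))); first by rewrite ler_pM2l// lerD.
by rewrite le_eqVlt; apply/orP; left; apply/eqP; field; rewrite gt_eqF.
Qed.

Lemma dominated_diff (R : realType) (d a b G : R) : 0 < d -> `|a| <= G -> `|b| <= G ->
  `| `|a - b| `^ d| <= (2 `^ d * 2 `^ d) * G `^ d.
Proof.
move=> d0 aG bG; have G0 : 0 <= G by exact: le_trans aG.
rewrite ger0_norm ?powR_ge0// -!powRM//; apply: powR_homo; [exact: ltW|exact: normr_ge0|].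
by apply: (le_trans (ler_normB a b)); lra.
Qed.

Lemma fast_le_harmonic (R : realType) (d P : R) (k : nat) : 0 < d -> 1 <= P ->
  2^-1 ^+ k / (2 ^+ k) `^ d / (3 * (P * P)) <= k.+1%:R^-1.
Proof.
move=> d0 P1; have P0 : 0 < P by exact: lt_le_trans P1.
have PP : 1 <= 3 * (P * P).
  by rewrite -[leLHS]mulr1 ler_pM// ?ler1n// -[leLHS]mulr1 ler_pM.
have pk : 1 <= (2 ^+ k) `^ d :> R.
  have := @powR_homo R d 1 (2 ^+ k) (ltW d0) ler01; rewrite powR1; apply.
  by rewrite exprn_ege1// ler1n.
have pk0 : 0 < (2 ^+ k) `^ d :> R by exact: lt_le_trans pk.
apply: (@le_trans _ _ (2^-1 ^+ k)).
  rewrite -mulrA ler_piMr ?exprn_ge0 ?invr_ge0// -invfM invf_le1.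
    by rewrite -[leLHS]mulr1 ler_pM.
  by rewrite !mulr_gt0.
rewrite exprVn lef_pV2 ?posrE ?exprn_gt0//.
by rewrite -natrX ler_nat ltn_expl.
Qed.

Lemma normr_pow_midpoint dd (T : measurableType dd) (R : realType) (mu : {measure set T -> \bar R})
    (D : set T) (r : R) (u v : T -> R) : measurable D -> 1 < r -> Lr mu D r u -> Lr mu D r v ->
  normr_pow mu D r (fun x => 2^-1 * (u x + v x)) <= (normr_pow mu D r u + normr_pow mu D r v) / 2.
Proof.
move=> mD r1 hu hv.
have := pen_midpoint mD (@measurable_unit_weight _ T R D) (@unit_weight_ge0 _ T R D) r1 hu hv.
have -> : (fun x => 2^-1 *: (lift1 u x + lift1 v x)) = lift1 (fun x => 2^-1 * (u x + v x)).
  by apply/funext => x; apply/rowP => i; rewrite !mxE.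
by rewrite -!normr_powE.
Qed.

Lemma le_pen dd (T : measurableType dd) (R : realType) n (mu : {measure set T -> \bar R}) (D : set T)
    (w : T -> R) (r : R) (g h : T -> 'rV[R]_n) : measurable D -> (forall x, D x -> 0 <= w x) -> 1 < r ->
  wint mu D w r g -> wint mu D w r h -> (forall x, D x -> enorm (g x) <= enorm (h x)) ->
  pen mu D w r g <= pen mu D w r h.
Proof.
move=> mD w0 r1 [_ ig] [_ ih] gh; apply: (le_Rintegral mD ig ih) => x Dx.
apply: ler_wpM2l; first exact: w0.
by apply: powR_homo; [rewrite ltW// (lt_trans _ r1)|exact: enorm_ge0|exact: gh].
Qed.

Lemma le_mean (R : realFieldType) (a b c : R) : a <= c -> b <= c -> (a + b) / 2 <= c.
Proof. lra. Qed.

Lemma le_sum_two (R : realFieldType) (a b x y s : R) : x <= a + s -> y <= b + s -> s <= 1 ->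
  x + y <= a + b + 2.
Proof. lra. Qed.

Lemma uc_sum (R : realFieldType) (E C C' x y z x' y' z' a b : R) : 0 <= C -> 0 <= C' ->
  a <= E * (x + y) + C * ((x + y) / 2 - z) -> b <= E * (x' + y') + C' * ((x' + y') / 2 - z') ->
  z <= (x + y) / 2 -> z' <= (x' + y') / 2 ->
  a + b <= E * ((x + x') + (y + y')) + (C + C') * (((x + x') + (y + y')) / 2 - (z + z')).
Proof.
move=> C0 C0' h1 h2 h3 h4.
have : 0 <= C' * ((x + y) / 2 - z) by rewrite mulr_ge0// subr_ge0.
have : 0 <= C * ((x' + y') / 2 - z') by rewrite mulr_ge0// subr_ge0.
nra.
Qed.

Lemma cvg_upper (R : realType) (u : nat -> R) (l e : R) : u k @[k --> \oo] --> l -> 0 < e ->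
  exists N, forall k, (N <= k)%N -> u k <= l + e.
Proof.
move=> ul e0; move/cvgrPdist_le : ul => /(_ _ e0)[N _ hN]; exists N => k /hN.
by rewrite ler_distlC => /andP[].
Qed.

Lemma norm_div_sqrt_le1 (R : realType) (x t : R) : `|x / Num.sqrt (x ^+ 2 + t ^+ 2)| <= 1.
Proof.
rewrite normrM normfV (ger0_norm (sqrtr_ge0 _)) -sqrtr_sqr.
have le : Num.sqrt (x ^+ 2) <= Num.sqrt (x ^+ 2 + t ^+ 2) by rewrite ler_sqrt ?addr_ge0 ?sqr_ge0// lerDl sqr_ge0.
have [->|h] := eqVneq (Num.sqrt (x ^+ 2 + t ^+ 2)) 0; first by rewrite invr0 mulr0.
by rewrite ler_pdivrMr ?mul1r// lt0r h sqrtr_ge0.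
Qed.

Lemma smooth_abs_dist (R : realType) (t a b : R) : 0 < t ->
  `|smooth_abs t a - `|b| | <= `|a - b| + t.
Proof.
move=> t0; rewrite /smooth_abs.
have h1 : `|a| <= Num.sqrt (a ^+ 2 + t ^+ 2).
  by rewrite -sqrtr_sqr ler_sqrt ?addr_ge0 ?sqr_ge0// lerDl sqr_ge0.
have h2 : Num.sqrt (a ^+ 2 + t ^+ 2) <= `|a| + t.
  rewrite -[leRHS]ger0_norm ?addr_ge0 ?(ltW t0)// -sqrtr_sqr ler_sqrt ?sqr_ge0//.
  by rewrite sqrrD real_normK ?num_real// lerD2r lerDl mulrn_wge0// mulr_ge0 ?(ltW t0).
have h3 := ler_dist_dist a b; move: h3; rewrite !ler_distl => /andP[h3 h4].
apply/andP; split; move: h1 h2 h3 h4; move: (Num.sqrt _) (`|a - b|) (`|a|) (`|b|) => *; lra.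
Qed.

Lemma abs_arith (R : realFieldType) (P V x c s t : R) : 0 < P -> 0 <= V -> x <= c / (2 * P) ->
  s = c / (2 * P * (V + 1)) -> t <= s -> 0 < s -> P * (x + t * V) <= c.
Proof.
move=> P0 V0 hx sE ts s0; have V1 : 0 < V + 1 by rewrite ltr_wpDl.
have h1 : t * V <= c / (2 * P).
  apply: (@le_trans _ _ (s * (V + 1))).
    apply: (@le_trans _ _ (s * V)); first exact: ler_wpM2r.
    by rewrite ler_pM2l// lerDl.
  by rewrite sE le_eqVlt; apply/orP; left; apply/eqP; field; rewrite !gt_eqF.
apply: (@le_trans _ _ (P * (c / (2 * P) + c / (2 * P)))); first by rewrite ler_pM2l// lerD.
by rewrite le_eqVlt; apply/orP; left; apply/eqP; field; rewrite gt_eqF.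
Qed.

Lemma uc_arith (R : realFieldType) (e E B C x y z mN ms s : R) : 0 < e -> 0 <= B -> 0 <= C ->
  E = e / (4 * (B + 1)) -> 0 <= x -> x <= B -> 0 <= y -> y <= B -> mN <= z ->
  x <= ms + s -> y <= ms + s -> C * (ms + s - mN) <= e / 2 ->
  E * (x + y) + C * ((x + y) / 2 - z) <= e.
Proof.
move=> e0 B0 C0 EE x0 xB y0 yB mz xs ys h.
have B1 : 0 < B + 1 by rewrite ltr_wpDl.
have E0 : 0 <= E by rewrite EE divr_ge0 ?(ltW e0)// mulr_ge0// ltW.
have h1 : E * (x + y) <= e / 2.
  apply: (@le_trans _ _ (E * (2 * (B + 1)))); first by apply: ler_wpM2l => //; lra.
  by rewrite EE le_eqVlt; apply/orP; left; apply/eqP; field; rewrite gt_eqF.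
have h2 : C * ((x + y) / 2 - z) <= C * (ms + s - mN) by apply: ler_wpM2l => //; lra.
lra.
Qed.

Lemma tail_arith (R : realFieldType) (C ms s a : R) : 0 <= C -> ms - s < a ->
  C * (ms + s - a) <= C * (s + s).
Proof. by move=> C0 h; apply: ler_wpM2l => //; lra. Qed.

Lemma cvg_sub_powR (R : realType) (d : R) (u : nat -> R) (l : R) : 0 < d -> u k @[k --> \oo] --> l ->
  `|u k - l| `^ d @[k --> \oo] --> 0.
Proof.
move=> d0 c; have c' : u k - l @[k --> \oo] --> 0 by rewrite -[X in _ --> X](subrr l); exact: cvgB c (cvg_cst l).
by have := cvg_norm_powR d0 c'; rewrite normr0 powR0// gt_eqF.
Qed.

Lemma monotone_sup_tail (R : realType) (u : nat -> R) (B : R) : (forall k, u k <= u k.+1) ->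
  (forall k, u k <= B) -> exists ms, (forall k, u k <= ms) /\ ms <= B /\
  forall e, 0 < e -> exists N, forall k, (N <= k)%N -> ms - e < u k.
Proof.
move=> uS uB.
have hs : has_sup (range u).
  by split; [exists (u 0%N); exists 0%N|exists B => _ [k _ <-]].
exists (sup (range u)); split.
  by move=> k; apply: ub_le_sup; [case: hs|exists k].
split; first by apply: ge_sup; [case: hs|move=> _ [k _ <-]].
move=> e e0; have [_ [N _ <-] hN] := sup_adherent e0 hs.
exists N => k Nk; apply: (lt_le_trans hN).
have mono j : u N <= u (N + j)%N.
  by elim: j => [|j IH]; rewrite ?addn0// addnS (le_trans IH).
by have := mono (k - N)%N; rewrite subnKC.
Qed.

Lemma geometric_vanish (R : realType) (e : R) : 0 < e -> exists N, forall k, (N <= k)%N -> k.+1%:R^-1 <= e.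
Proof.
move=> e0; apply: (@cvg0_small R (fun k => k.+1%:R^-1)) e0 => [k|]; first by rewrite invr_ge0.
exact: cvg_harmonic.
Qed.

Section weak_limits.
Context {R : realType} {n : nat}.
Local Notation bl := (@borel_lebesgue R n).
Local Notation mu := (@lebesgue_rV R n).
Local Notation cT := (caratheodory_type (bl^*)%mu).
Variables (Omega : set 'rV[R]_n) (eta : 'rV[R]_n -> R) (L p q d M : R).
Hypotheses (n0 : (0 < n)%N) (oO : open Omega) (L0 : 0 < L).
Hypothesis OL : Omega `<=` cube (const_mx (- L)) (2 * L).
Hypotheses (p1 : 1 < p) (pq : p < q) (qd : q < d) (dec0 : 0 < @decay R n p d).
Hypotheses (meta : lebesgue_measurable Omega eta) (eta0 : forall x, Omega x -> 0 <= eta x).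
Hypothesis etaM : {ae mu, forall z, Omega z -> `|eta z| <= M}.

Let bO : measurable Omega. Proof. exact: open_measurable_rV. Qed.
Let mO : measurable (Omega : set cT). Proof. exact: borel_cara. Qed.
Let Ofin : (mu Omega < +oo)%E.
Proof. by rewrite lebesgue_rV_borel//; exact: (measure_bounded_fin bO L0 OL). Qed.
Let q1 : 1 < q. Proof. exact: lt_trans pq. Qed.
Let d1 : 1 < d. Proof. exact: lt_trans qd. Qed.
Let p0 : 0 < p. Proof. exact: lt_trans p1. Qed.
Let q0 : 0 < q. Proof. exact: lt_trans q1. Qed.
Let d0 : 0 < d. Proof. exact: lt_trans d1. Qed.

Local Notation one := (@unit_weight _ cT R).
Local Notation dp := (@double_phase _ cT R n mu Omega p q eta).
Local Notation md := (@modular _ cT R n mu Omega p q eta).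
Local Notation peng := (@pen _ cT R n mu Omega one p).
Local Notation pene := (@pen _ cT R n mu Omega eta q).
Local Notation approx := (@approximable R n Omega eta p q d).
Local Notation Ld := (@Lr _ cT R mu Omega d).
Local Notation nd := (@normr_pow _ cT R mu Omega d).
Local Notation test := (test_function Omega).

Let m1 : measurable_fun (Omega : set cT) one. Proof. exact: measurable_cst. Qed.
Let one0 x : Omega x -> 0 <= one x. Proof. by []. Qed.

Lemma peng_ge0 g : 0 <= peng g. Proof. by apply: pen_ge0 => x _; exact: ler01. Qed.
Lemma pene_ge0 g : 0 <= pene g. Proof. by apply: pen_ge0; exact: eta0. Qed.

(** The midpoint is written with a leading 0 so that two uses of the combination [phi + c * psi]
    produce it. *)
Definition mid (f h : 'rV[R]_n -> R) x := (0 + 2^-1 * f x) + 2^-1 * h x.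

Lemma test_mid f h : test f -> test h -> test (mid f h).
Proof.
move=> tf th; apply: (test_functionDZ _ _ th); exact: (test_functionDZ _ (test_function_cst0 Omega) tf).
Qed.

Lemma grad_mid f h x : test f -> test h -> grad (mid f h) x = 2^-1 *: (grad f x + grad h x).
Proof.
move=> tf th.
rewrite (grad_linear _ _ (test_functionDZ _ (test_function_cst0 Omega) tf) th).
rewrite (grad_linear _ _ (test_function_cst0 Omega) tf) scalerDr; congr (_ + _).
rewrite -[RHS]add0r; congr (_ + _); apply/rowP => i; rewrite !mxE.
exact: derive_cst.
Qed.

(* The sets [K N] of test functions are stable under midpoints, so by uniform convexity almost
   minimizers [w N] of the modular on [K N] form a Cauchy sequence. *)
Lemma weak_closure (u : 'rV[R]_n -> R) (al be : R) : Ld u ->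
  (forall N : nat, exists f, [/\ test f, peng (grad f) <= al + N.+1%:R^-1,
     pene (grad f) <= be + N.+1%:R^-1 & nd (fun x => f x - u x) <= N.+1%:R^-1]) ->
  exists g, [/\ approx u g, peng g <= al & pene g <= be].
Proof.
move=> hu hK.
pose K (N : nat) : set ('rV[R]_n -> R) := [set f | [/\ test f, peng (grad f) <= al + N.+1%:R^-1,
     pene (grad f) <= be + N.+1%:R^-1 & nd (fun x => f x - u x) <= N.+1%:R^-1]].
have KS N l : (N <= l)%N -> K l `<=` K N.
  move=> Nl f [tf f1 f2 f3].
  have le : l.+1%:R^-1 <= N.+1%:R^-1 :> R by rewrite lef_pV2 ?posrE// ler_nat.
  by split; [exact: tf|apply: (le_trans f1); rewrite lerD2l|apply: (le_trans f2); rewrite lerD2l|exact: le_trans le].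
have mdmid f h : test f -> test h -> md (grad (mid f h)) = md (fun x => 2^-1 *: (grad f x + grad h x)).
  by move=> tf th; congr md; apply/funext => x; exact: grad_mid.
have dtest f : test f -> dp (grad f) by move=> tf; exact: (test_dp oO L0 OL p1 pq meta etaM tf).
have ltest f : test f -> Ld f by move=> tf; exact: (test_Ld oO L0 OL p1 pq qd tf).
have Kmid N f h : K N f -> K N h -> K N (mid f h).
  move=> [tf f1 f2 f3] [th h1 h2 h3].
  have E : grad (mid f h) = (fun x => 2^-1 *: (grad f x + grad h x)).
    by apply/funext => x; exact: grad_mid.
  split; first exact: test_mid.
  - rewrite E; apply: (le_trans (pen_midpoint mO m1 one0 p1 (dtest f tf).1 (dtest h th).1)).
    exact: (le_mean f1 h1).
  - rewrite E; apply: (le_trans (pen_midpoint mO meta eta0 q1 (dtest f tf).2 (dtest h th).2)).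
    exact: (le_mean f2 h2).
  - have l1 := LrB mO d1 (ltest f tf) hu; have l2 := LrB mO d1 (ltest h th) hu.
    have := normr_pow_midpoint mO d1 l1 l2.
    have -> : (fun x => 2^-1 * (f x - u x + (h x - u x))) = (fun x => mid f h x - u x).
      by apply/funext => x; rewrite /mid; field.
    by move=> /le_trans; apply; exact: (le_mean f3 h3).
pose A N : set R := [set md (grad f) | f in K N].
have A0 N : A N !=set0 by have [f hf] := hK N; exists (md (grad f)); exists f.
have lbA N : lbound (A N) 0 by move=> _ [f _ <-]; exact: modular_ge0.
have hiA N : has_inf (A N) by split; [exact: A0|exists 0; exact: lbA].
pose m N := inf (A N).
have mle N f : K N f -> m N <= md (grad f).
  by move=> Kf; apply: ge_inf; [exists 0; exact: lbA|exists f].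
have mS N : m N <= m N.+1.
  apply: lb_le_inf; first exact: A0.
  by move=> _ [f Kf <-]; apply: mle; exact: KS (leqnSn N) _ Kf.
have mB N : m N <= al + be + 2.
  have [f hf] := hK N; apply: (le_trans (mle N f hf)); have [_ f1 f2 _] := hf.
  have : N.+1%:R^-1 <= 1 :> R by rewrite invf_le1// ler1n.
  by move: f1 f2; rewrite /modular; exact: le_sum_two.
have [ms [mms [msB mtail]]] := monotone_sup_tail mS mB.
have wex N : exists f, K N f /\ md (grad f) < m N + N.+1%:R^-1.
  have N0 : 0 < N.+1%:R^-1 :> R by rewrite invr_gt0.
  by have [_ [f Kf <-] lt] := inf_adherent N0 (hiA N); exists f.
have [w hw] := choice wex.
have tw N : test (w N) by have [[]] := hw N.
pose B := `|ms| + 1.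
have B0 : 0 <= B by rewrite addr_ge0.
have wB N : md (grad (w N)) <= B.
  have [_ /ltW lt] := hw N; apply: (le_trans lt); rewrite lerD//.
    exact: le_trans (mms N) (ler_norm _).
  by rewrite invf_le1// ler1n.
have cauchy : @mcauchy _ cT R n mu Omega p q eta (fun N => grad (w N)).
  move=> e e0; pose E := e / (4 * (B + 1)).
  have E0 : 0 < E by rewrite divr_gt0// mulr_gt0// ltr_wpDl.
  have [Cp Cp0 hCp] := @pen_uniform_convexity _ cT R n mu _ mO _ _ m1 one0 p1 _ E0.
  have [Cq Cq0 hCq] := @pen_uniform_convexity _ cT R n mu _ mO _ _ meta eta0 q1 _ E0.
  pose C := Cp + Cq; have C0 : 0 <= C by rewrite addr_ge0.
  pose s := e / (4 * (C + 1)).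
  have s0 : 0 < s by rewrite divr_gt0// mulr_gt0// ltr_wpDl.
  have [N1 hN1] := mtail s s0; have [N2 hN2] := geometric_vanish s0.
  exists (maxn N1 N2) => k l; rewrite !geq_max => /andP[k1 k2] /andP[l1 l2].
  pose N := maxn N1 N2.
  have Kk : K N (w k) by have [Kk _] := hw k; apply: KS Kk; rewrite geq_max k1.
  have Kl : K N (w l) by have [Kl _] := hw l; apply: KS Kl; rewrite geq_max l1.
  (* The midpoint lies in [K N], so its modular is at least the infimum [m N], while those of [w k]
     and [w l] barely exceed the supremum [ms] of the infima: the convexity defect is small. *)
  have mz := mle N _ (Kmid N _ _ Kk Kl); rewrite mdmid// in mz.
  have dk := dtest _ (tw k); have dl := dtest _ (tw l).
  have uc : md (fun x => grad (w k) x - grad (w l) x) <= E * (md (grad (w k)) + md (grad (w l))) +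
      C * ((md (grad (w k)) + md (grad (w l))) / 2 - md (fun x => 2^-1 *: (grad (w k) x + grad (w l) x))).
    have a1 := hCp _ _ dk.1 dl.1; have a2 := hCq _ _ dk.2 dl.2.
    have b1 := pen_midpoint mO m1 one0 p1 dk.1 dl.1.
    have b2 := pen_midpoint mO meta eta0 q1 dk.2 dl.2.
    exact: (uc_sum Cp0 Cq0 a1 a2 b1 b2).
  apply: (le_trans uc).
  have up j : (N2 <= j)%N -> md (grad (w j)) <= ms + s.
    move=> /hN2 js; have [_ /ltW lt] := hw j; apply: (le_trans lt); apply: lerD; [exact: mms|exact: js].
  have tail : C * (ms + s - m N) <= e / 2.
    have h := hN1 N (leq_maxl _ _).
    apply: (le_trans (tail_arith C0 h)).
    apply: (@le_trans _ _ ((C + 1) * (s + s))).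
      by apply: ler_wpM2r; [rewrite addr_ge0// ltW|rewrite lerDl].
    by rewrite /s le_eqVlt; apply/orP; left; apply/eqP; field; rewrite gt_eqF// ltr_wpDl.
  have nn j : 0 <= md (grad (w j)) by exact: (modular_ge0 mu p q eta0 (grad (w j))).
  exact: (uc_arith e0 B0 C0 (erefl E) (nn k) (wB k) (nn l) (wB l) mz (up k k2) (up l l2) tail).
have [g [hg wg]] := modular_complete mO p1 q1 meta eta0 (fun N => dtest _ (tw N)) cauchy.
have ap : approx u g.
  split; [exact: hu|exact: hg|exists w; split; [exact: tw| |exact: wg]].
  apply: (small_cvg0 (fun k => normr_pow_ge0 _ _ _ _)) => e /geometric_vanish[N hN].
  exists N => k /hN le; have [[_ _ _ h] _] := hw k; exact: le_trans le.
have [c1 c2] := modular_cvg_pens eta0 wg.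
have c3 := pen_cvg mO m1 one0 p1 (fun N => (dtest _ (tw N)).1) hg.1 c1.
have c4 := pen_cvg mO meta eta0 q1 (fun N => (dtest _ (tw N)).2) hg.2 c2.
have h0 (a : R) : a + k.+1%:R^-1 @[k --> \oo] --> a.
  by rewrite -[X in _ --> X]addr0; apply: cvgD; [exact: cvg_cst|exact: cvg_harmonic].
exists g; split; first exact: ap.
  by apply: (ler_cvg_to c3 (h0 al)); apply: nearW => k; have [[]] := hw k.
by apply: (ler_cvg_to c4 (h0 be)); apply: nearW => k; have [[]] := hw k.
Qed.

(** [smooth_abs t] of a test function has a gradient that is pointwise no longer than the original
    one. For small [t] these functions approximate |u| in L^d, and [weak_closure] returns a gradient
    of |u| with no larger energies. *)
Lemma approximable_abs u g : approx u g -> exists g',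
  [/\ approx (fun x => `|u x|) g', peng g' <= peng g & pene g' <= pene g].
Proof.
move=> [hu hg [phi [tphi uphi gphi]]].
have dphi k := test_dp oO L0 OL p1 pq meta etaM (tphi k).
have lphi k := test_Ld oO L0 OL p1 pq qd (tphi k).
have [mu' iu] := (LrP _ _ _ _).1 hu.
have hau : Ld (fun x => `|u x|).
  apply/LrP; split; first exact: (measurableT_comp _ mu').
  by move: iu; congr (mu.-integrable Omega _); apply/funext => x /=; rewrite normr_id.
apply: (weak_closure hau) => N.
have N0 : 0 < N.+1%:R^-1 :> R by rewrite invr_gt0.
have [c1 c2] := modular_cvg_pens eta0 gphi.
have c3 := pen_cvg mO m1 one0 p1 (fun k => (dphi k).1) hg.1 c1.
have c4 := pen_cvg mO meta eta0 q1 (fun k => (dphi k).2) hg.2 c2.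
have V0 : 0 <= fine (mu Omega) by exact: fine_ge0.
(* With [t^d <= s] the smoothing error [t] on [Omega] contributes at most half of 1/(N + 1). *)
pose s := N.+1%:R^-1 / (2 * 2 `^ d * (fine (mu Omega) + 1)).
have pd0 : 0 < 2 `^ d :> R by rewrite powR_gt0.
have s0 : 0 < s by rewrite divr_gt0// !mulr_gt0// ltr_wpDl.
have [t /andP[t0 t1] ts] := small_powR s0 d0.
have [k [k1 k2 k3]] : exists k, [/\ peng (grad (phi k)) <= peng g + N.+1%:R^-1,
    pene (grad (phi k)) <= pene g + N.+1%:R^-1 & nd (fun x => phi k x - u x) <= N.+1%:R^-1 / (2 * 2 `^ d)].
  have N1 : 0 < N.+1%:R^-1 / (2 * 2 `^ d) :> R by rewrite divr_gt0// mulr_gt0.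
  have [K1 h1] := cvg_upper c3 N0; have [K2 h2] := cvg_upper c4 N0.
  have [K3 h3] := cvg0_small (fun k => normr_pow_ge0 _ _ _ _) uphi N1.
  exists (maxn K1 (maxn K2 K3)); split; [apply: h1|apply: h2|apply: h3]; by rewrite !leq_max leqnn ?orbT.
have tpsi := test_function_abs t0 (tphi k).
have gle x : enorm (grad (fun x => smooth_abs t (phi k x)) x) <= enorm (grad (phi k) x).
  pose c := phi k x / Num.sqrt (phi k x ^+ 2 + t ^+ 2).
  have -> : grad (fun x => smooth_abs t (phi k x)) x = c *: grad (phi k) x.
    apply/rowP => i; rewrite !mxE derive_smooth_abs//.
    by have [C1 _ _] := tphi k; have [_ /(_ i)[]] := C1 1%N.
  rewrite enormZ ler_piMl ?enorm_ge0//; exact: norm_div_sqrt_le1.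
have dpsi := test_dp oO L0 OL p1 pq meta etaM tpsi.
exists (fun x => smooth_abs t (phi k x)); split; first exact: tpsi.
- exact: (le_trans (le_pen mO one0 p1 dpsi.1 (dphi k).1 (fun x _ => gle x)) k1).
- exact: (le_trans (le_pen mO eta0 q1 dpsi.2 (dphi k).2 (fun x _ => gle x)) k2).
- have l1 := LrB mO d1 (lphi k) hu; have [_ i1] := (LrP _ _ _ _).1 l1.
  have [_ i2] := (LrP _ _ _ _).1 (LrB mO d1 (test_Ld oO L0 OL p1 pq qd tpsi) hau).
  have i3 := integrable_add mO i1 (integrable_cst_fin mO Ofin (t `^ d)).
  apply: (@le_trans _ _ (2 `^ d * (nd (fun x => phi k x - u x) + t `^ d * fine (mu Omega)))).
    rewrite /normr_pow -(Rintegral_cst _ mO) -(RintegralD mO i1 (integrable_cst_fin mO Ofin (t `^ d))).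
    rewrite -(RintegralZl _ mO i3).
    apply: (le_Rintegral mO i2 (integrable_cst_mul mO _ i3)) => x _.
    apply: le_trans (powR_addr_le (normr_ge0 _) (ltW t0) (ltW d0)).
    apply: powR_homo; [exact: ltW|exact: normr_ge0|exact: smooth_abs_dist].
  exact: (abs_arith pd0 V0 k3 (erefl s) ts s0).
Qed.


(** Each function is replaced by a nearby test function, to which total boundedness applies; the
    diagonal subsequence is fast Cauchy in L^d and its energies converge. The gradients [h i] come
    from [weak_closure], so only inequalities relate their energies to the limits. *)
Lemma approximable_compact m (u : nat -> 'I_m -> 'rV[R]_n -> R) (g : nat -> 'I_m -> 'rV[R]_n -> 'rV[R]_n) (K : R) :
  (forall k i, approx (u k i) (g k i)) -> (forall k i, peng (g k i) <= K) ->
  (forall k i, pene (g k i) <= K) ->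
  exists (s : nat -> nat) (v : 'I_m -> 'rV[R]_n -> R) (h : 'I_m -> 'rV[R]_n -> 'rV[R]_n)
    (G : 'I_m -> 'rV[R]_n -> R) (al be : 'I_m -> R),
    (forall j, (s j < s j.+1)%N) /\ forall i,
    [/\ approx (v i) (h i),
        {ae mu, forall z, Omega z -> u (s k) i z @[k --> \oo] --> v i z /\ forall k, `|u (s k) i z| <= G i z},
        [/\ lebesgue_measurable Omega (G i), forall z, Omega z -> 0 <= G i z &
          mu.-integrable (Omega : set cT) (EFin \o (fun z : cT => G i z `^ d))],
        peng (g (s k) i) @[k --> \oo] --> al i /\ pene (g (s k) i) @[k --> \oo] --> be i &
        peng (h i) <= al i /\ pene (h i) <= be i].
Proof.
move=> ap gK eK.
pose P := 2 `^ d : R; have P0 : 0 < P by rewrite powR_gt0.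
have P1 : 1 <= P by rewrite ltW// powR_gt1// ltr1n.
pose thr (k : nat) : R := 2^-1 ^+ k / (2 ^+ k) `^ d.
have thr0 k : 0 < thr k by rewrite divr_gt0 ?exprn_gt0 ?powR_gt0 ?invr_gt0 ?exprn_gt0.
(* The difference of two terms is split into three pieces by two uses of [normr_powD], each of which
   costs a factor [P]. *)
pose t (k : nat) : R := thr k / (3 * (P * P)).
have PP : 0 < 3 * (P * P) by rewrite !mulr_gt0.
have t0 k : 0 < t k by rewrite divr_gt0.
have thrS k l : (k <= l)%N -> thr l <= thr k.
  move=> kl; rewrite /thr ler_pM ?invr_ge0 ?powR_ge0 ?exprn_ge0//.
    by rewrite ler_wiXn2l// ?invr_ge0// invf_le1// ler1n.
  rewrite lef_pV2 ?posrE ?powR_gt0 ?exprn_gt0//; apply: powR_homo; [exact: ltW|by rewrite exprn_ge0|].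
  by rewrite ler_eXn2l// ltr1n.
have tS k l : (k <= l)%N -> t l <= t k by move=> kl; rewrite ler_pM2r ?invr_gt0// thrS.
have hu k i : Ld (u k i) by have [] := ap k i.
have dg k i : dp (g k i) by have [] := ap k i.
have near_test k i : exists f, [/\ test f, nd (fun x => f x - u k i x) <= t k,
    peng (grad f) <= peng (g k i) + k.+1%:R^-1 & pene (grad f) <= pene (g k i) + k.+1%:R^-1].
  have [_ _ [phi [tphi uphi gphi]]] := ap k i.
  have dphi l := test_dp oO L0 OL p1 pq meta etaM (tphi l).
  have k0 : 0 < k.+1%:R^-1 :> R by rewrite invr_gt0.
  have [c1 c2] := modular_cvg_pens eta0 gphi.
  have c3 := pen_cvg mO m1 one0 p1 (fun l => (dphi l).1) (dg k i).1 c1.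
  have c4 := pen_cvg mO meta eta0 q1 (fun l => (dphi l).2) (dg k i).2 c2.
  have [K1 h1] := cvg_upper c3 k0; have [K2 h2] := cvg_upper c4 k0.
  have [K3 h3] := cvg0_small (fun l => normr_pow_ge0 _ _ _ _) uphi (t0 k).
  exists (phi (maxn K1 (maxn K2 K3))); split; [exact: tphi|apply: h3|apply: h1|apply: h2];
    by rewrite !leq_max leqnn ?orbT.
have [f0 hf0] := choice (fun ki : nat * 'I_m => near_test ki.1 ki.2).
pose f k i := f0 (k, i).
have hf k i : [/\ test (f k i), nd (fun x => f k i x - u k i x) <= t k,
    peng (grad (f k i)) <= peng (g k i) + k.+1%:R^-1 & pene (grad (f k i)) <= pene (g k i) + k.+1%:R^-1].
  exact: hf0 (k, i).
have fK k i : peng (grad (f k i)) <= K + 1.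
  have [_ _ h _] := hf k i; apply: (le_trans h); apply: lerD; first exact: gK.
  by rewrite invf_le1// ler1n.
have abs_le (x : R) : 0 <= x -> x <= K -> `|x| <= K by move=> x0; rewrite ger0_norm.
have half0 e : 0 < 2^-1 ^+ e :> R by rewrite exprn_gt0// invr_gt0.
pose r (e k l : nat) := forall i : 'I_m, nd (fun x => f k i x - f l i x) <= t e /\
  (`|peng (g k i) - peng (g l i)| <= 2^-1 ^+ e /\ `|pene (g k i) - pene (g l i)| <= 2^-1 ^+ e).
have rc e : finitely_coloured (r e).
  apply: finitely_coloured_forall => i; apply: finitely_coloured_and; last apply: finitely_coloured_and.
  - have tfi k : test (f k i) by have [] := hf k i.
    exact: (test_totally_bounded n0 oO L0 OL p1 pq qd dec0 meta etaM (t0 e) tfi (fun k => fK k i)).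
  - exact: (bounded_finitely_coloured (half0 e) (fun k => abs_le _ (peng_ge0 _) (gK k i))).
  - exact: (bounded_finitely_coloured (half0 e) (fun k => abs_le _ (pene_ge0 _) (eK k i))).
have [s [sS sr]] := diagonal_extraction rc.
have cauchy_cvg (x : nat -> R) : (forall k, `|x k.+1 - x k| <= 2^-1 ^+ k) -> exists l : R, x k @[k --> \oo] --> l.
  move=> h; have [|c _] := @geometric_cauchy R x 1 ler01; first by move=> k; rewrite mul1r.
  by exists (limn x).
(* All limit data of one component are packed in a tuple, so that a single [choice] over the
   components produces them. *)
have lim i : exists vhG : ('rV[R]_n -> R) * ('rV[R]_n -> 'rV[R]_n) * ('rV[R]_n -> R) * R * R,
    let: (v, h, G, al, be) := vhG in
    [/\ approx v h,
        {ae mu, forall z, Omega z -> u (s k) i z @[k --> \oo] --> v z /\ forall k, `|u (s k) i z| <= G z},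
        [/\ lebesgue_measurable Omega G, forall z, Omega z -> 0 <= G z &
          mu.-integrable (Omega : set cT) (EFin \o (fun z : cT => G z `^ d))],
        peng (g (s k) i) @[k --> \oo] --> al /\ pene (g (s k) i) @[k --> \oo] --> be &
        peng h <= al /\ pene h <= be].
  have lf k : Ld (f k i) by have [tf _ _ _] := hf k i; exact: (test_Ld oO L0 OL p1 pq qd tf).
  have step k : nd (fun x => u (s k.+1) i x - u (s k) i x) <= thr k.
    have [_ f1 _ _] := hf (s k) i; have [_ f2 _ _] := hf (s k.+1) i.
    have [f3 _] := sr k k.+1 (leqnSn k) i.
    have sk := extraction_ge sS k; have sk1 := leq_trans (leqnSn k) (extraction_ge sS k.+1).
    have l1 := LrB mO d1 (hu (s k.+1) i) (lf (s k.+1)).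
    have l2 := LrB mO d1 (lf (s k.+1)) (lf (s k)); have l3 := LrB mO d1 (lf (s k)) (hu (s k) i).
    have e : (fun x => u (s k.+1) i x - u (s k) i x) =
        (fun x => (u (s k.+1) i x - f (s k.+1) i x) + ((f (s k.+1) i x - f (s k) i x) + (f (s k) i x - u (s k) i x))).
      by apply/funext => x; ring.
    rewrite e; apply: (le_trans (normr_powD mO d1 l1 (LrD mO d1 l2 l3))).
    have a := normr_powD mO d1 l2 l3.
    rewrite normr_powC in f2; rewrite normr_powC in f3.
    exact: (three_terms P1 a (le_trans f2 (tS _ _ sk1)) f3 (le_trans f1 (tS _ _ sk)) (erefl (t k)) (normr_pow_ge0 _ _ _ _)).
  have h1 k : measurable_fun (Omega : set cT) (u (s k) i : cT -> R) by exact: ((LrP _ _ _ _).1 (hu (s k) i)).1.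
  have h2 := ((LrP _ _ _ _).1 (hu (s 0%N) i)).2.
  have h3 k := ((LrP _ _ _ _).1 (LrB mO d1 (hu (s k.+1) i) (hu (s k) i))).2.
  have h4 k : (2 ^+ k) `^ d * nd (fun x => u (s k.+1) i x - u (s k) i x) <= 2^-1 ^+ k.
    by rewrite -ler_pdivlMl ?powR_gt0 ?exprn_gt0// mulrC; exact: step.
  have [v [G [mv mG G0 iG hG]]] := fast_cauchy_ae mO d0 h1 h2 h3 h4.
  have hvG : {ae mu, forall z, Omega z -> `|v z| <= G z}.
    apply: ae_mono hG => z h Oz; have [c b] := h Oz.
    by apply: (@cvgr_to_le _ _ _ _ _ _ _ (cvg_norm c)); apply: nearW.
  have hv : Ld v.
    have md : measurable_fun (Omega : set cT) (fun z : cT => `|v z| `^ d).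
      by apply: (measurableT_comp (measurable_powR d)); exact: (measurableT_comp _ mv).
    apply/LrP; split; first exact: mv.
    apply: (integrable_dominated_ae mO md iG); apply: ae_mono hvG => z h Oz.
    by rewrite ger0_norm ?powR_ge0//; apply: powR_homo; [exact: ltW|exact: normr_ge0|exact: h].
  have uv : nd (fun x => u (s k) i x - v x) @[k --> \oo] --> 0.
    have mk k : measurable_fun (Omega : set cT) (fun z : cT => `|u (s k) i z - v z| `^ d).
      apply: (measurableT_comp (measurable_powR d)); apply: (measurableT_comp (@normr_measurable _ _)).
      exact: (measurable_funB (h1 k) mv).
    have cz : {ae mu, forall z, Omega z -> `|u (s k) i z - v z| `^ d @[k --> \oo] --> 0}.
      apply: ae_mono hG => z h Oz; have [c _] := h Oz.
      exact: (cvg_sub_powR d0 c).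
    have dom : {ae mu, forall z, Omega z -> forall k, `| `|u (s k) i z - v z| `^ d| <= (P * P) * G z `^ d}.
      apply: ae_mono2 hG hvG => z h hv' Oz k; have [_ b] := h Oz.
      exact: (dominated_diff d0 (b k) (hv' Oz)).
    have [_ _] := dominated_Rintegral mO mk (measurable_cst (0 : R)) cz (integrable_cst_mul mO (P * P) iG) dom.
    by rewrite Rintegral_cst// mul0r.
  have [al ca] : exists l : R, peng (g (s k) i) @[k --> \oo] --> l.
    apply: cauchy_cvg => k; have [_ [h _]] := sr k k.+1 (leqnSn k) i; by rewrite distrC.
  have [be cb] : exists l : R, pene (g (s k) i) @[k --> \oo] --> l.
    apply: cauchy_cvg => k; have [_ [_ h]] := sr k k.+1 (leqnSn k) i; by rewrite distrC.
  have [h [ah h5 h6]] : exists h, [/\ approx v h, peng h <= al & pene h <= be].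
    apply: (weak_closure hv) => N.
    have N0 : 0 < N.+1%:R^-1 / 2 :> R by rewrite divr_gt0.
    have [K1 k1] := cvg_upper ca N0; have [K2 k2] := cvg_upper cb N0.
    have N1 : 0 < N.+1%:R^-1 / (2 * P) :> R by rewrite divr_gt0// mulr_gt0.
    have [K3 k3] := cvg0_small (fun l => normr_pow_ge0 _ _ _ _) uv N1.
    have [K4 k4] := geometric_vanish N0.
    have [K5 k5] : exists K5, forall k, (K5 <= k)%N -> t (s k) <= N.+1%:R^-1 / (2 * P).
      have [K5 h5] := geometric_vanish N1; exists K5 => k /h5 le; apply: le_trans le.
      apply: (le_trans (tS _ _ (extraction_ge sS k))); exact: (fast_le_harmonic _ d0 P1).
    pose k := maxn K1 (maxn K2 (maxn K3 (maxn K4 K5))).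
    have [le1 le2 le3 le4 le5] : [/\ K1 <= k, K2 <= k, K3 <= k, K4 <= k & K5 <= k]%N.
      by split; rewrite !leq_max leqnn ?orbT.
    have [tf f1 f2 f3] := hf (s k) i.
    have sk : (s k).+1%:R^-1 <= N.+1%:R^-1 / 2 :> R.
      by apply: k4; exact: leq_trans le4 (extraction_ge sS k).
    have hN : N.+1%:R^-1 = N.+1%:R^-1 / 2 + N.+1%:R^-1 / 2 :> R by rewrite -splitr.
    exists (f (s k) i); split; first exact: tf.
    - by apply: (le_trans f2); rewrite hN addrA; apply: lerD; [exact: k1|exact: sk].
    - by apply: (le_trans f3); rewrite hN addrA; apply: lerD; [exact: k2|exact: sk].
    - have l1 := LrB mO d1 (lf (s k)) (hu (s k) i); have l2 := LrB mO d1 (hu (s k) i) hv.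
      have := normr_powD mO d1 l1 l2.
      have -> : (fun x => f (s k) i x - u (s k) i x + (u (s k) i x - v x)) = (fun x => f (s k) i x - v x).
        by apply/funext => x; rewrite addrA subrK.
      move=> /le_trans; apply.
      exact: (two_halves P0 (le_trans f1 (k5 k le5)) (k3 k le3)).
  exists (v, h, G, al, be); split; [exact: ah|exact: hG|by split|by split|by split].
have [F hF] := choice lim.
exists s, (fun i => (F i).1.1.1.1), (fun i => (F i).1.1.1.2), (fun i => (F i).1.1.2),
  (fun i => (F i).1.2), (fun i => (F i).2); split; first exact: sS.
by move=> i; have := hF i; case: (F i) => [[[[v h] G] al] be].
Qed.

End weak_limits.

(** * The fibering map *)

(** Beyond the threshold X = (C / th)^(1/(1-s)) the linear term dominates; below it the left side is
    at most its value at [X]. *)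
Lemma sublinear_le (R : realType) (C s th : R) : 0 <= C -> 0 < s < 1 -> 0 < th ->
  exists2 K, 0 <= K & forall x, 0 <= x -> C * x `^ s <= th * x + K.
Proof.
move=> C0 /andP[s0 s1] th0; pose X := (C / th) `^ (1 - s)^-1.
have X0 : 0 <= X by exact: powR_ge0.
have s1' : 0 < 1 - s by rewrite subr_gt0.
exists (C * X `^ s) => [|x x0]; first by rewrite mulr_ge0 ?powR_ge0.
have [xX|Xx] := leP x X.
  have h : C * x `^ s <= C * X `^ s by apply: ler_wpM2l => //; exact: powR_homo (ltW s0) x0 xX.
  by apply: (le_trans h); rewrite lerDr mulr_ge0// ltW.
have x0' : 0 < x by exact: le_lt_trans Xx.
apply: (@le_trans _ _ (th * x)); last by rewrite lerDl mulr_ge0 ?powR_ge0.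
have h1 : C / th <= x `^ (1 - s).
  have := powR_homo (ltW s1') X0 (ltW Xx); rewrite -powRrM mulVf ?gt_eqF// powRr1//.
  by rewrite divr_ge0 ?(ltW th0).
have E : x = x `^ (1 - s) * x `^ s by rewrite -powRD ?subrK ?powRr1 ?(gt_eqF x0') ?implybT// ltW.
rewrite [X in _ <= th * X]E mulrA; apply: ler_wpM2r; first exact: powR_ge0.
by rewrite mulrC -ler_pdivrMr.
Qed.

Section fibering.
Context {R : realType}.
Variables (s p q d lam : R).
Hypotheses (s01 : 0 < s < 1) (p1 : 1 < p) (pq : p < q) (qd : q < d) (lam0 : 0 < lam).

Let s0 : 0 < s. Proof. by case/andP: s01. Qed.
Let s1 : s < 1. Proof. by case/andP: s01. Qed.
Let p0 : 0 < p. Proof. exact: lt_trans p1. Qed.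
Let q0 : 0 < q. Proof. exact: lt_trans pq. Qed.
Let d0 : 0 < d. Proof. exact: lt_trans qd. Qed.

(** [A], [B], [S] and [U] are the p-energy, the weighted q-energy, the singular and the coupling
    terms at t = 1; the exponents are their degrees of homogeneity. *)
Definition fib (A B S U t : R) := t `^ p / p * A + t `^ q / q * B - t `^ s / s * S - lam * (t `^ d * U).

Definition dfib (A B S U t : R) :=
  t `^ (p - 1) * A + t `^ (q - 1) * B - t `^ (s - 1) * S - lam * (d * t `^ (d - 1) * U).

Lemma is_derive_fib (A B S U t : R) : 0 < t -> is_derive t 1 (fib A B S U) (dfib A B S U t).
Proof.
move=> t0.
have D r (c : R) : is_derive t 1 (fun x => x `^ r * c) (r * t `^ (r - 1) * c).
  have h := is_derive1_powR r t0.
  have := @is_deriveZ _ _ _ (fun x : R => x `^ r) c t 1 _ h.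
  rewrite /GRing.scale/= mulrC; congr (is_derive _ _ _ _); apply/funext => x /=; rewrite mulrC//.
pose F := ((fun x => x `^ p * (A / p)) + (fun x => x `^ q * (B / q)) - (fun x => x `^ s * (S / s))
   - (fun x => x `^ d * (lam * U)))%R : R -> R.
have -> : fib A B S U = F.
  by apply/funext => x; rewrite /F /fib !fctE; ring.
have -> : dfib A B S U t = p * t `^ (p - 1) * (A / p) + q * t `^ (q - 1) * (B / q) -
   s * t `^ (s - 1) * (S / s) - d * t `^ (d - 1) * (lam * U).
  by rewrite /dfib; field; rewrite !gt_eqF.
exact: (is_deriveB (is_deriveB (is_deriveD (D p _) (D q _)) (D s _)) (D d _)).
Qed.

Lemma fib_scale (A B S U t x : R) : 0 <= x -> 0 <= t ->
  fib A B S U (x * t) = fib (x `^ p * A) (x `^ q * B) (x `^ s * S) (x `^ d * U) t.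
Proof. by move=> x0 t0; rewrite /fib !powRM//; field; rewrite !gt_eqF. Qed.

Lemma fib1 A B S U : fib A B S U 1 = A / p + B / q - S / s - lam * U.
Proof. by rewrite /fib !powR1; field; rewrite !gt_eqF. Qed.

Lemma cvg_fib (A B S U t : nat -> R) a b c u x : A k @[k --> \oo] --> a -> B k @[k --> \oo] --> b ->
  S k @[k --> \oo] --> c -> U k @[k --> \oo] --> u -> (forall k, 0 <= t k) -> t k @[k --> \oo] --> x ->
  fib (A k) (B k) (S k) (U k) (t k) @[k --> \oo] --> fib a b c u x.
Proof.
move=> cA cB cS cU t0 ct; rewrite /fib.
have P r : 0 < r -> t k `^ r @[k --> \oo] --> x `^ r by move=> r0; exact: cvg_powR.
apply: cvgB; first (apply: cvgB; first apply: cvgD).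
- by apply: cvgM => //; apply: cvgMl; exact: P.
- by apply: cvgM => //; apply: cvgMl; exact: P.
- by apply: cvgM => //; apply: cvgMl; exact: P.
- by apply: cvgMr; apply: cvgM => //; exact: P.
Qed.

Lemma within_continuous_fib (A B S U x y : R) : 0 < x -> {within `[x, y], continuous (fib A B S U)}.
Proof.
move=> x0; apply: derivable_within_continuous => t; rewrite in_itv/= => /andP[xt _].
by have [] := is_derive_fib A B S U (lt_le_trans x0 xt).
Qed.

(** The equation of the Nehari set: the derivative vanishes at the interior maximum t = 1. *)
Lemma fib_critical (A B S U : R) : (forall t : R, 0 < t -> fib A B S U t <= fib A B S U 1) ->
  A + B - S - lam * (d * U) = 0.
Proof.
move=> h; have h1 := is_derive_fib A B S U ltr01.
have pos t : t \in `]0, 2[ -> 0 < t by rewrite in_itv/= => /andP[].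
have h2 : is_derive (1 : R) 1 (fib A B S U) 0.
  apply: (@derive1_at_max _ _ 0 2) => //.
  - by move=> t /pos t0; have [] := is_derive_fib A B S U t0.
  - by rewrite in_itv/= ltr01 ltr1n.
  - by move=> t /pos /h.
have := @derive_val _ _ _ _ _ _ _ h1; rewrite (@derive_val _ _ _ _ _ _ _ h2) => ->.
by rewrite /dfib !powR1; ring.
Qed.

Lemma fib_le_small (A B S U t K : R) : 0 <= S -> 0 <= U -> A <= K -> B <= K -> 0 <= K -> 0 < t -> t <= 1 ->
  fib A B S U t <= t * (2 * K).
Proof.
move=> S0 U0 AK BK K0 t0 t1; rewrite /fib.
have h1 : 0 <= t `^ s / s * S by rewrite !mulr_ge0 ?powR_ge0// invr_ge0 ltW.
have h2 : 0 <= lam * (t `^ d * U) by rewrite !mulr_ge0 ?powR_ge0// ltW.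
have h r X : 1 < r -> X <= K -> t `^ r / r * X <= t * K.
  move=> r1 XK; have r0 : 0 < r by exact: lt_trans r1.
  have tr0 : 0 <= t `^ r / r by rewrite mulr_ge0 ?powR_ge0// invr_ge0 ltW.
  apply: (@le_trans _ _ (t `^ r / r * K)); first exact: ler_wpM2l.
  apply: ler_wpM2r => //; apply: (@le_trans _ _ (t `^ r)).
    by rewrite ler_pdivrMr// ler_peMr ?powR_ge0// ltW.
  rewrite -[leRHS]powRr1 ?(ltW t0)//; apply: ger_powR; last exact: ltW.
  by rewrite t0 t1.
have := h p A p1 AK; have := h q B (lt_trans p1 pq) BK; lra.
Qed.

Lemma fib_le_large (A B S U t K c : R) : 0 <= S -> A <= K -> B <= K -> 0 <= K -> c <= U -> 1 <= t ->
  fib A B S U t <= t `^ q * (2 * K - lam * t `^ (d - q) * c).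
Proof.
move=> S0 AK BK K0 cU t1; have t0 : 0 < t by exact: lt_le_trans t1.
have h1 : 0 <= t `^ s / s * S by rewrite !mulr_ge0 ?powR_ge0// invr_ge0 ltW.
have h2 : lam * (t `^ d * c) <= lam * (t `^ d * U).
  by rewrite ler_pM2l//; apply: ler_wpM2l => //; exact: powR_ge0.
have h r X : 1 < r -> r <= q -> X <= K -> t `^ r / r * X <= t `^ q * K.
  move=> r1 rq XK; have r0 : 0 < r by exact: lt_trans r1.
  have tr0 : 0 <= t `^ r / r by rewrite mulr_ge0 ?powR_ge0// invr_ge0 ltW.
  apply: (@le_trans _ _ (t `^ r / r * K)); first exact: ler_wpM2l.
  apply: ler_wpM2r => //; apply: (@le_trans _ _ (t `^ r)).
    by rewrite ler_pdivrMr// ler_peMr ?powR_ge0// ltW.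
  exact: ler_powR.
have -> : t `^ q * (2 * K - lam * t `^ (d - q) * c) = t `^ q * K + t `^ q * K - lam * (t `^ d * c).
  have -> : t `^ d = t `^ q * t `^ (d - q) by rewrite -powRD ?(gt_eqF t0) ?implybT// addrC subrK.
  by ring.
rewrite /fib; have := h p A p1 (ltW pq) AK; have := h q B (lt_trans p1 pq) (lexx q) BK; lra.
Qed.

(** The interval depends only on upper bounds for [A] and [B] and on a lower bound for [U]: for
    small [t] the map is at most [t * (2 * K)], and for large [t] the coupling term wins because q <
    d. *)
Lemma fib_bounds (K c : R) : 0 <= K -> 0 < c -> exists t1 t2 : R, [/\ 0 < t1, t1 <= t2 &
  forall A B S U t : R, A <= K -> B <= K -> 0 <= S -> c <= U -> 0 < t -> 1 <= fib A B S U t -> t1 <= t <= t2].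
Proof.
move=> K0 c0; have dq : 0 < d - q by rewrite subr_gt0.
(* Below [t1] the bound of [fib_le_small] is less than 1; beyond [t2] the bracket in [fib_le_large]
   is nonpositive. *)
pose t1 := (2 * K + 1)^-1; pose t2 := Num.max 1 ((2 * K / (lam * c)) `^ (d - q)^-1).
have K1 : 1 <= 2 * K + 1 by rewrite lerDr mulr_ge0.
have K1' : 0 < 2 * K + 1 by exact: lt_le_trans K1.
have t10 : 0 < t1 by rewrite invr_gt0.
have t11 : t1 <= 1 by rewrite invf_le1.
exists t1, t2; split => //; first by rewrite le_max t11.
move=> A B S U t AK BK S0 cU t0 h1; have U0 : 0 <= U by exact: le_trans (ltW c0) cU.
apply/andP; split; rewrite leNgt; apply/negP => tt.
  have := fib_le_small S0 U0 AK BK K0 t0 (ltW (lt_le_trans tt t11)).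
  apply/negP; rewrite -ltNge; apply: lt_le_trans h1.
  apply: (@le_lt_trans _ _ (t1 * (2 * K))); first by apply: ler_wpM2r; [rewrite mulr_ge0|exact: ltW].
  by rewrite /t1 mulrC ltr_pdivrMr// mul1r ltrDl.
move: tt; rewrite gt_max => /andP[t1' tt].
have := fib_le_large S0 AK BK K0 cU (ltW t1').
apply/negP; rewrite -ltNge; apply: lt_le_trans h1.
apply: (@le_lt_trans _ _ 0); last exact: ltr01.
rewrite pmulr_rle0 ?powR_gt0// subr_le0.
have lc : 0 < lam * c by rewrite mulr_gt0.
have := powR_homo (ltW dq) (powR_ge0 _ _) (ltW tt); rewrite -powRrM mulVf ?gt_eqF// powRr1; last by rewrite divr_ge0 ?(ltW lc)// mulr_ge0.
by rewrite ler_pdivrMr// => h; rewrite mulrAC (mulrC (lam * c)).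
Qed.

(** All points where the map is at least 1 lie in [t1, t2], and [tau] is one of them; so the maximum
    over this interval is global. *)
Lemma fib_max (A B S U tau : R) : 0 <= A -> 0 <= B -> 0 <= S -> 0 < U -> 0 < tau -> 1 <= fib A B S U tau ->
  exists2 t : R, 0 < t & forall x : R, 0 < x -> fib A B S U x <= fib A B S U t.
Proof.
move=> A0 B0 S0 U0 tau0 h1; pose K := A + B.
have K0 : 0 <= K by rewrite addr_ge0.
have AK : A <= K by rewrite lerDl.
have BK : B <= K by rewrite lerDr.
have [t1 [t2 [t10 t12 hb]]] := fib_bounds K0 U0.
have [t] := EVT_max t12 (@within_continuous_fib A B S U t1 t2 t10).
rewrite in_itv/= => /andP[t1t tt2] tmax.
have tau12 : tau \in `[t1, t2] by rewrite in_itv/=; exact: (hb _ _ _ _ _ AK BK S0 (lexx U) tau0 h1).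
exists t => [|x x0]; first exact: lt_le_trans t1t.
have [lt1|le1] := ltP (fib A B S U x) 1.
  by apply: (le_trans (ltW lt1)); apply: (le_trans h1); exact: tmax.
by apply: tmax; rewrite in_itv/=; exact: (hb _ _ _ _ _ AK BK S0 (lexx U) x0 le1).
Qed.

(* In the variable [z = x^(p - d)] the function [x^(1 - d) dfib x] is strictly concave; it is compared
   with its tangent at [z = 1]. *)
Lemma dfib_concave (A B S U x : R) : 0 <= B -> 0 < S -> A + B - S - lam * (d * U) = 0 -> 0 < x -> x != 1 ->
  dfib A B S U x <
  x `^ (d - 1) * ((A + (d - q) / (d - p) * B - (d - s) / (d - p) * S) * (x `^ (p - d) - 1)).
Proof.
move=> B0 S0 crit x0 x1; set al := (d - q) / (d - p); set be := (d - s) / (d - p).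
have dp : 0 < d - p by rewrite subr_gt0 (lt_trans pq).
have dq : 0 < d - q by rewrite subr_gt0.
pose z := x `^ (p - d); have z0 : 0 < z by exact: powR_gt0.
have z1 : z != 1.
  apply/eqP => /(congr1 (fun u => u `^ (p - d)^-1)); rewrite -powRrM mulfV; last by rewrite subr_eq0 lt_eqF// (lt_trans pq).
  by rewrite powR1 powRr1 ?(ltW x0)// => /eqP; exact/negP.
have al1 : 1 < al^-1 by rewrite invf_div ltr_pdivlMr// mul1r ltrD2l ltrN2.
have be1 : 1 < be by rewrite ltr_pdivlMr// mul1r ltrD2l ltrN2 (lt_trans s1).
have al0 : 0 < al by rewrite divr_gt0.
have hbe : 1 + be * (z - 1) < z `^ be by exact: powR_bernoulli_lt (ltW z0) z1.
have hal : z `^ al <= 1 + al * (z - 1).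
  have y1 : z `^ al != 1.
    apply/eqP => /(congr1 (fun u => u `^ al^-1)); rewrite -powRrM mulfV ?gt_eqF//.
    by rewrite powR1 powRr1 ?(ltW z0)// => /eqP; exact/negP.
  have := powR_bernoulli_lt al1 (powR_ge0 z al) y1.
  rewrite -powRrM mulfV ?gt_eqF// powRr1 ?(ltW z0)// => h.
  by rewrite -lerBlDl -ler_pdivrMl// lerBrDl ltW.
have E r : x `^ (r - 1) = x `^ (d - 1) * x `^ (r - d).
  by rewrite -powRD ?(gt_eqF x0) ?implybT//; congr powR; ring.
have Eq : x `^ (q - d) = z `^ al.
  by rewrite -powRrM; congr powR; rewrite /al; field; rewrite subr_eq0 gt_eqF// (lt_trans pq).
have Es : x `^ (s - d) = z `^ be.
  by rewrite -powRrM; congr powR; rewrite /be; field; rewrite subr_eq0 gt_eqF// (lt_trans pq).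
have -> : dfib A B S U x = x `^ (d - 1) * (z * A + z `^ al * B - z `^ be * S - lam * (d * U)).
  by rewrite /dfib (E p) (E q) (E s) Eq Es -/z; ring.
rewrite ltr_pM2l ?powR_gt0// -/z.
have h1 : B * z `^ al <= B * (1 + al * (z - 1)) by exact: ler_wpM2l.
have h2 : S * (1 + be * (z - 1)) < S * z `^ be by rewrite ltr_pM2l.
move: crit h1 h2; move: (z `^ al) (z `^ be) (lam * (d * U)) => X Y Z; nra.
Qed.

(** [sl] is the slope of the tangent in [dfib_concave], and z = x^(p - d) decreases in x. If
    [sl >= 0], the derivative is negative for all x > 1. If [sl < 0], it would be negative on (1/2,
    1), and the value at 1/2 would exceed the maximum at 1. *)
Lemma fib_decr (A B S U : R) : 0 <= B -> 0 < S -> (forall t : R, 0 < t -> fib A B S U t <= fib A B S U 1) ->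
  forall t : R, 1 < t -> fib A B S U t < fib A B S U 1.
Proof.
move=> B0 S0 h t t1; have crit := fib_critical h.
pose sl := A + (d - q) / (d - p) * B - (d - s) / (d - p) * S.
have dp : d - p > 0 by rewrite subr_gt0 (lt_trans pq).
have dfib_lt x : 0 < x -> x != 1 -> sl * (x `^ (p - d) - 1) <= 0 -> dfib A B S U x < 0.
  move=> x0 x1 le; apply: (lt_le_trans (dfib_concave B0 S0 crit x0 x1)).
  by rewrite pmulr_rle0 ?powR_gt0.
have decr x y : 0 < x -> x < y -> (forall z, z \in `]x, y[ -> dfib A B S U z < 0) ->
    fib A B S U y < fib A B S U x.
  move=> x0 xy neg.
  have dd z : z \in `]x, y[ -> is_derive z 1 (fib A B S U) (dfib A B S U z).
    by rewrite in_itv/= => /andP[xz _]; apply: is_derive_fib; exact: lt_trans xz.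
  have [c /neg c0 E] := MVT xy dd (@within_continuous_fib A B S U x y x0).
  by rewrite -subr_lt0 E nmulr_rlt0// subr_gt0.
have xpd x : 0 < x -> x `^ (p - d) = (x `^ (d - p))^-1 by move=> x0; rewrite -powRN opprB.
have [sl0|sl0] := leP 0 sl.
  apply: decr => // z; rewrite in_itv/= => /andP[z1 _]; have z0 : 0 < z by exact: lt_trans z1.
  apply: dfib_lt => //; first by rewrite gt_eqF.
  by rewrite mulr_ge0_le0// subr_le0 xpd// invf_le1 ?powR_gt0// ltW// powR_gt1.
suff : fib A B S U 1 < fib A B S U 2^-1 by rewrite ltNge h// invr_gt0.
apply: decr; [by rewrite invr_gt0|by rewrite invf_lt1 ?ltr1n|move=> z].
rewrite in_itv/= => /andP[z2 z1]; have z0 : 0 < z by apply: lt_trans z2; rewrite invr_gt0.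
apply: dfib_lt => //; first by rewrite lt_eqF.
rewrite mulr_le0_ge0 ?(ltW sl0)// subr_ge0.
rewrite xpd// invf_ge1 ?powR_gt0//.
by have := powR_homo (ltW dp) (ltW z0) (ltW z1); rewrite powR1.
Qed.

(** A second maximizer t > 1 is excluded by [fib_decr]. For t < 1 the ray is rescaled so that [t]
    becomes the parameter 1; the old maximizer then sits at 1/t > 1, and the same lemma applies. *)
Lemma fib_unique (A B S U : R) : 0 <= B -> 0 < S -> (forall t : R, 0 < t -> fib A B S U t <= fib A B S U 1) ->
  forall t : R, 0 < t -> fib A B S U 1 <= fib A B S U t -> t = 1.
Proof.
move=> B0 S0 h t t0 ht; apply/eqP; rewrite eq_le; apply/andP; split; rewrite leNgt; apply/negP => lt.
  by have := fib_decr B0 S0 h lt; rewrite ltNge ht.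
have E x : 0 <= x -> fib (t `^ p * A) (t `^ q * B) (t `^ s * S) (t `^ d * U) x = fib A B S U (t * x).
  by move=> x0; rewrite fib_scale// ltW.
have B0' : 0 <= t `^ q * B by rewrite mulr_ge0 ?powR_ge0.
have S0' : 0 < t `^ s * S by rewrite mulr_gt0 ?powR_gt0.
have h' x : 0 < x -> fib (t `^ p * A) (t `^ q * B) (t `^ s * S) (t `^ d * U) x <=
    fib (t `^ p * A) (t `^ q * B) (t `^ s * S) (t `^ d * U) 1.
  by move=> x0; rewrite !E ?ler01 ?(ltW x0)// mulr1 (le_trans _ ht)// h// mulr_gt0.
have ti : 1 < t^-1 by rewrite invf_gt1.
have := fib_decr B0' S0' h' ti; rewrite !E ?ler01 ?invr_ge0 ?(ltW t0)// mulr1 divff ?gt_eqF//.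
by rewrite ltNge h.
Qed.

(** The critical identity expresses [A + B] by [S] and [U]. Replacing 1/q and 1/s by 1/p can only
    increase the energy, and then the terms in [S] cancel. Along a minimizing sequence this keeps
    the coupling term away from 0. *)
Lemma fib_max_large (A B S U c : R) : 0 <= B -> 0 <= S -> 0 <= U -> (forall t : R, 0 < t -> fib A B S U t <= fib A B S U 1) ->
  c <= fib A B S U 1 -> c <= lam * (d / p) * U.
Proof.
move=> B0 S0 U0 h; rewrite fib1 => h1; have crit := fib_critical h.
have e1 : B / q <= B / p by rewrite ler_wpM2l// lef_pV2 ?posrE// ltW.
have e2 : S / p <= S / s.
  by rewrite ler_wpM2l// lef_pV2 ?posrE// ltW// (lt_trans s1).
have e3 : (A + B) / p = S / p + lam * (d / p) * U.
  by rewrite (_ : A + B = S + lam * (d * U)); [field; rewrite gt_eqF|lra].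
have e4 : (A + B) / p = A / p + B / p by rewrite mulrDl.
have e5 : 0 <= lam * U by rewrite mulr_ge0 ?(ltW lam0).
lra.
Qed.

End fibering.

(** * Inequalities for powers and products *)

Lemma powR_dist_le (R : realType) (r a b : R) : 1 < r -> 0 <= a -> 0 <= b ->
  b `^ r - a `^ r <= r * b `^ (r - 1) * (b - a).
Proof.
move=> r1 a0 b0; have := powR_tangent r1 b0 a0.
have r0 : 0 < r by exact: lt_trans r1.
by have := mulr_powRB1 b0 r0; nra.
Qed.

Lemma powR_dist (R : realType) (r a b M : R) : 1 < r -> 0 <= a -> 0 <= b -> a <= M -> b <= M ->
  `|b `^ r - a `^ r| <= r * M `^ (r - 1) * `|b - a|.
Proof.
move=> r1; have r0 : 0 < r by exact: lt_trans r1.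
have r10 : 0 <= r - 1 by rewrite subr_ge0 ltW.
have half u v : 0 <= u -> 0 <= v -> u <= M -> v <= M -> v `^ r - u `^ r <= r * M `^ (r - 1) * `|v - u|.
  move=> u0 v0 uM vM; apply: (le_trans (powR_dist_le r1 u0 v0)).
  apply: (@le_trans _ _ (r * v `^ (r - 1) * `|v - u|)).
    by apply: ler_wpM2l (ler_norm _); rewrite mulr_ge0 ?powR_ge0// ltW.
  apply: ler_wpM2r => //; apply: ler_wpM2l; first exact: ltW.
  exact: powR_homo.
move=> a0 b0 aM bM; rewrite ler_norml; apply/andP; split; last exact: half.
by have := half b a b0 a0 bM aM; rewrite distrC; lra.
Qed.

(** Scaling to a = 1 leaves |x^s - 1| <= |x - 1| for x >= 0. The bound supplies the dominating
    function of the singular difference quotients. *)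
Lemma normr_powR_sub_le (R : realType) (s a b : R) : 0 < s < 1 -> 0 < a ->
  `| `|b| `^ s - a `^ s| <= a `^ (s - 1) * `|b - a|.
Proof.
move=> /andP[s0 s1] a0; pose x := `|b| / a.
have x0 : 0 <= x by rewrite divr_ge0// ltW.
have bE : `|b| = a * x by rewrite mulrC divfK ?gt_eqF.
have aE : a `^ s = a `^ (s - 1) * a.
  by rewrite mulrC; have := @powRD _ a 1 (s - 1); rewrite addrC subrK powRr1 ?(ltW a0)// => <-; rewrite ?(gt_eqF a0) ?implybT.
have -> : `|b| `^ s - a `^ s = a `^ (s - 1) * (a * (x `^ s - 1)).
  by rewrite bE powRM ?(ltW a0)// aE; ring.
rewrite normrM (ger0_norm (powR_ge0 _ _)); apply: ler_wpM2l; first exact: powR_ge0.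
apply: (@le_trans _ _ (`| `|b| - a|)); last first.
  by have := ler_dist_dist b a; rewrite (ger0_norm (ltW a0)).
have -> : `|b| - a = a * (x - 1) by rewrite bE; ring.
rewrite !normrM; apply: ler_wpM2l => //.
have [x1|/ltW x1] := leP x 1.
  have h1 : x `^ s <= 1 by have := powR_homo (ltW s0) x0 x1; rewrite powR1.
  have h2 : x <= x `^ s.
    have [->|xn0] := eqVneq x 0; first exact: powR_ge0.
    rewrite -[leLHS]powRr1//; apply: ger_powR; last exact: ltW.
    by rewrite lt_neqAle eq_sym xn0 x0.
  by rewrite !ler0_norm ?subr_le0//; lra.
have h1 : 1 <= x `^ s by have := powR_homo (ltW s0) ler01 x1; rewrite powR1.
have h2 : x `^ s <= x by rewrite -[leRHS]powRr1//; apply: ler_powR; [exact: x1|exact: ltW].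
by rewrite !ger0_norm ?subr_ge0//; lra.
Qed.

Lemma powR_le_affine (R : realType) (x s d : R) : 0 <= x -> 0 <= s -> s <= d -> x `^ s <= 1 + x `^ d.
Proof.
move=> x0 s0 sd; have [x1|/ltW x1] := leP x 1.
  by have := powR_homo s0 x0 x1; rewrite powR1 => h; rewrite (le_trans h)// lerDl powR_ge0.
by apply: (le_trans (ler_powR x1 sd)); rewrite lerDr.
Qed.

Lemma prod_powR (R : realType) (I : finType) (k : I -> R) (M : R) : 0 < M ->
  \prod_i M `^ (k i) = M `^ (\sum_i k i).
Proof.
move=> M0; elim/big_ind2 : _ => //; first by rewrite powRr0.
by move=> x1 x2 y1 y2 -> ->; rewrite powRD// (gt_eqF M0) implybT.
Qed.

(** Every factor is bounded through the largest [x j], whose power of total exponent is one of the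
    terms of the sum. *)
Lemma prod_powR_le_sum (R : realType) (I : finType) (i0 : I) (k : I -> R) (x : I -> R) :
  (forall i, 0 < k i) -> (forall i, 0 <= x i) ->
  \prod_i x i `^ k i <= \sum_i x i `^ (\sum_j k j).
Proof.
move=> k0 x0; have [j _ jmax] := @arg_maxP _ _ _ i0 predT x isT.
apply: (@le_trans _ _ (x j `^ (\sum_j k j))); last first.
  rewrite [leRHS](bigD1 j)//=; rewrite lerDl sumr_ge0// => i _; exact: powR_ge0.
have [xj0|xj0] := eqVneq (x j) 0.
  rewrite (bigD1 j)//= xj0 powR0 ?gt_eqF// mul0r; exact: powR_ge0.
rewrite -prod_powR; last by rewrite lt_neqAle eq_sym xj0 x0.
apply: ler_prod => i _; rewrite powR_ge0/=; apply: powR_homo; [exact: ltW|exact: x0|exact: jmax].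
Qed.

Lemma quotient_sandwich (R : realFieldType) (A B P Q c e : R) :
  A - B <= P * (e * c) -> B - A <= Q * - (e * c) -> Q * c * e <= A - B <= P * c * e.
Proof. by move=> h1 h2; apply/andP; split; lra. Qed.

(** * Directional derivatives of powers of the norm *)

Section enorm_derivative.
Context {R : realType} {n : nat}.
Implicit Types u v : 'rV[R]_n.

Lemma enormD_dist u v (e : R) : 0 <= e -> `|enorm (u + e *: v) - enorm u| <= e * enorm v.
Proof.
move=> e0; have h1 := ler_enormD u (e *: v); rewrite enormZ (ger0_norm e0) in h1.
have h2 := ler_enormB (u + e *: v) (e *: v); rewrite addrK enormZ (ger0_norm e0) in h2.
by rewrite ler_distl; apply/andP; split; lra.
Qed.

Lemma enorm_quotient_le u v (e r : R) : 1 < r -> 0 < e -> e <= 1 ->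
  `|(enorm (u + e *: v) `^ r - enorm u `^ r) / e| <= r * (enorm u + enorm v) `^ r.
Proof.
move=> r1 e0 e1; have r0 : 0 < r by exact: lt_trans r1.
have ev : e * enorm v <= enorm v by rewrite ler_piMl ?enorm_ge0.
have M0 : 0 <= enorm u + enorm v by rewrite addr_ge0 ?enorm_ge0.
have uM : enorm u <= enorm u + enorm v by rewrite lerDl enorm_ge0.
have wM : enorm (u + e *: v) <= enorm u + enorm v.
  have h1 := ler_enormD u (e *: v); rewrite enormZ (ger0_norm (ltW e0)) in h1.
  by apply: (le_trans h1); rewrite lerD2l.
have h := powR_dist r1 (enorm_ge0 u) (enorm_ge0 (u + e *: v)) uM wM.
rewrite normrM normfV (gtr0_norm e0) ler_pdivrMr//; apply: (le_trans h).
have h2 := enormD_dist u v (ltW e0).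
apply: (@le_trans _ _ (r * (enorm u + enorm v) `^ (r - 1) * (e * (enorm u + enorm v)))).
  apply: ler_wpM2l; first by rewrite mulr_ge0 ?powR_ge0// ltW.
  apply: (le_trans h2); apply: ler_wpM2l; [exact: ltW|by rewrite lerDr enorm_ge0].
by rewrite -(mulr_powRB1 M0 r0) le_eqVlt; apply/orP; left; apply/eqP; ring.
Qed.

(** At u = 0 the quotient is [e^(r-1) |v|^r], which tends to 0 as r > 1. Elsewhere the tangents at
    both endpoints squeeze it, and the increment of the norm is computed by rationalizing a
    difference of squares, which gives [c k]. *)
Lemma cvg_enorm_quotient u v (e : nat -> R) (r : R) : 1 < r -> (forall k, 0 < e k) ->
  e k @[k --> \oo] --> 0 ->
  (enorm (u + e k *: v) `^ r - enorm u `^ r) / e k @[k --> \oo] --> r * (enorm u `^ (r - 2) * dotv u v).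
Proof.
move=> r1 e0 ce; have r0 : 0 < r by exact: lt_trans r1.
have r10 : 0 < r - 1 by rewrite subr_gt0.
have cw : enorm (u + e k *: v) @[k --> \oo] --> enorm u.
  suff h (i : 'I_n) : (u + e k *: v) ord0 i @[k --> \oo] --> u ord0 i by exact: cvg_enorm.
  have -> : (fun k => (u + e k *: v) ord0 i) = (fun k => u ord0 i + e k * v ord0 i).
    by apply/funext => k; rewrite !mxE.
  rewrite -[X in _ --> X]addr0 -[X in _ --> _ + X](mul0r (v ord0 i)).
  by apply: cvgD; [exact: cvg_cst|exact: cvgMl].
have [u0|un0] := eqVneq (enorm u) 0.
  have -> : u = 0 by exact: enorm_eq0.
  have -> : r * (enorm (0 : 'rV[R]_n) `^ (r - 2) * dotv 0 v) = 0.
    by rewrite -(scale0r (0 : 'rV[R]_n)) dotvZl !mul0r !mulr0.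
  have -> : (fun k => (enorm (0 + e k *: v) `^ r - enorm (0 : 'rV[R]_n) `^ r) / e k) =
      (fun k => e k `^ (r - 1) * enorm v `^ r).
    apply/funext => k; rewrite add0r enorm0 powR0 ?gt_eqF// subr0 enormZ (gtr0_norm (e0 k)).
    rewrite powRM ?enorm_ge0 ?(ltW (e0 k))// -(mulr_powRB1 (ltW (e0 k)) r0).
    by field; rewrite gt_eqF.
  rewrite -(mul0r (enorm v `^ r)); apply: cvgMl.
  by have := cvg_powR r10 (fun k => ltW (e0 k)) ce; rewrite powR0 ?gt_eqF.
have a0 : 0 < enorm u by rewrite lt_neqAle eq_sym un0 enorm_ge0.
pose b k := enorm (u + e k *: v); pose c k := (2 * dotv u v + e k * enorm v ^+ 2) / (b k + enorm u).
have b0 k : 0 <= b k by exact: enorm_ge0.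
have ba k : 0 < b k + enorm u by rewrite ltr_wpDl.
have cE k : b k - enorm u = e k * c k.
  have E := enormDsqr u (e k *: v); rewrite dotvZr enormZ (gtr0_norm (e0 k)) in E.
  rewrite /c mulrA; apply: (mulIf (lt0r_neq0 (ba k))); rewrite divfK ?gt_eqF//.
  by rewrite -subr_sqr -/(b k) in E *; rewrite /b E; ring.
have cc : c k @[k --> \oo] --> dotv u v / enorm u.
  have -> : dotv u v / enorm u = (2 * dotv u v + 0 * enorm v ^+ 2) / (enorm u + enorm u).
    by field; rewrite -mulr2n mulrn_eq0/= gt_eqF.
  apply: cvgM; last by apply: cvgV; [rewrite gt_eqF// addr_gt0|apply: cvgD => //; exact: cvg_cst].
  by apply: cvgD; [exact: cvg_cst|apply: cvgMl].
have lE : r * (enorm u `^ (r - 2) * dotv u v) = r * enorm u `^ (r - 1) * (dotv u v / enorm u).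
  have -> : enorm u `^ (r - 1) = enorm u `^ (r - 2) * enorm u.
    rewrite -{3}(powRr1 (ltW a0)) -powRD; last by rewrite (gt_eqF a0) implybT.
    by congr powR; ring.
  by field; rewrite gt_eqF.
rewrite lE; apply: (@squeeze_cvgr _ _ _ _ (fun k => r * enorm u `^ (r - 1) * c k) (fun k => r * b k `^ (r - 1) * c k)).
- apply: nearW => k; rewrite ler_pdivrMr// ler_pdivlMr//; rewrite -/(b k).
  have h1 := powR_dist_le r1 (enorm_ge0 u) (b0 k); have h2 := powR_dist_le r1 (b0 k) (enorm_ge0 u).
  have E := cE k; rewrite E in h1; rewrite -(opprB (b k)) E in h2.
  exact: quotient_sandwich h1 h2.
- by apply: cvgMr.
- apply: cvgM => //; apply: cvgMr; exact: cvg_powR.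
Qed.

End enorm_derivative.

(** Dominated convergence, with the bound of [enorm_quotient_le]. It is applied to the two gradient
    terms and, with weight [rest y i] and exponent [k i], to the coupling term. *)
Lemma pen_derivative dd (T : measurableType dd) (R : realType) n (mu : {measure set T -> \bar R})
    (D : set T) (w : T -> R) (r : R) (g h : T -> 'rV[R]_n) (e : nat -> R) :
  measurable D -> measurable_fun D w -> (forall x, D x -> 0 <= w x) -> 1 < r ->
  wint mu D w r g -> wint mu D w r h -> (forall k, 0 < e k) -> (forall k, e k <= 1) ->
  e k @[k --> \oo] --> 0 ->
  mu.-integrable D (EFin \o (fun x => w x * (enorm (g x) `^ (r - 2) * dotv (g x) (h x)))) /\
  (pen mu D w r (fun x => g x + e k *: h x) - pen mu D w r g) / e k @[k --> \oo] -->
    r * \int[mu]_(x in D) (w x * (enorm (g x) `^ (r - 2) * dotv (g x) (h x))).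
Proof.
move=> mD mw w0 r1 ig ih e0 e1 ce; have r0 : 0 < r by exact: lt_trans r1.
pose f x := w x * (enorm (g x) `^ (r - 2) * dotv (g x) (h x)).
have ik k : wint mu D w r (fun x => g x + e k *: h x) by exact: (wintD mD mw w0 r1 ig (wintZ mD (e k) ih)).
pose F k x := (wpow w r (fun x => g x + e k *: h x) x - wpow w r g x) / e k.
pose G x := r * 2 `^ r * (wpow w r g x + wpow w r h x).
have mf : measurable_fun D f.
  apply: measurable_funM => //; apply: measurable_funM; last exact: (measurable_dotv ig.1 ih.1).
  exact: (measurableT_comp (measurable_powR _) (measurable_enorm ig.1)).
have mF k : measurable_fun D (F k).
  apply: measurable_funM; last exact: measurable_cst.
  by apply: measurable_funB; apply: measurable_wpow => //; [exact: (ik k).1|exact: ig.1].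
have iG : mu.-integrable D (EFin \o G).
  exact: (integrable_cst_mul mD (r * 2 `^ r) (integrable_add mD ig.2 ih.2)).
have mrf : measurable_fun D (fun x => r * f x) by exact: measurable_funM.
have FE k x : F k x = w x * ((enorm (g x + e k *: h x) `^ r - enorm (g x) `^ r) / e k).
  by rewrite /F /wpow; ring.
have cF : {ae mu, forall x, D x -> F k x @[k --> \oo] --> r * f x}.
  apply: aeW => x Dx; under eq_fun do rewrite FE.
  rewrite /f mulrCA; apply: cvgMr; exact: cvg_enorm_quotient.
have dF : {ae mu, forall x, D x -> forall k, `|F k x| <= G x}.
  apply: aeW => x Dx k; rewrite FE normrM (ger0_norm (w0 x Dx)).
  rewrite /G /wpow -mulrDr mulrCA; apply: ler_wpM2l; first exact: w0.
  apply: (le_trans (enorm_quotient_le (g x) (h x) r1 (e0 k) (e1 k))).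
  rewrite -mulrA; apply: ler_wpM2l; first exact: ltW.
  by apply: powR_addr_le; [exact: enorm_ge0|exact: enorm_ge0|exact: ltW].
have [_ irf cv] := dominated_Rintegral mD mF mrf cF iG dF.
have if' : mu.-integrable D (EFin \o f).
  have := integrable_cst_mul mD r^-1 irf; congr (integrable _ _ _).
  by apply/funext => x /=; rewrite mulKf ?gt_eqF.
split; first exact: if'.
move: cv; rewrite RintegralZl// => cv.
have E k : (pen mu D w r (fun x => g x + e k *: h x) - pen mu D w r g) / e k = \int[mu]_(x in D) F k x.
  rewrite /pen -(RintegralB mD (ik k).2 ig.2) mulrC -RintegralZl//.
    by apply: eq_Rintegral => x _; rewrite /F mulrC.
  exact: (integrable_sub mD (ik k).2 ig.2).
by under eq_fun do rewrite E.
Qed.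

(** * The energy functional *)

Lemma bolzano_weierstrass (R : realType) (u : nat -> R) (M : R) : (forall k, `|u k| <= M) ->
  exists (s : nat -> nat) (l : R), (forall i, (s i < s i.+1)%N) /\ u (s k) @[k --> \oo] --> l.
Proof.
move=> uM; have half0 e : 0 < 2^-1 ^+ e :> R by rewrite exprn_gt0// invr_gt0.
have [s [sS sr]] := diagonal_extraction (fun e => bounded_finitely_coloured (half0 e) uM).
exists s; have [|c _] := @geometric_cauchy R (fun k => u (s k)) 1 ler01.
  by move=> k; rewrite mul1r distrC; exact: sr.
by exists (limn (fun k => u (s k))).
Qed.

Lemma cvg_finsum (R : realType) (I : finType) (u : nat -> I -> R) (l : I -> R) :
  (forall i, u j i @[j --> \oo] --> l i) -> \sum_i u j i @[j --> \oo] --> \sum_i l i.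
Proof.
move=> h; apply: cvg_big => [z|i _]; last exact: h.
by apply: cvgD; [exact: cvg_fst|exact: cvg_snd].
Qed.

Section ae_nonnegative.
Context dd (T : measurableType dd) {R : realType}.
Variables (mu : {measure set T -> \bar R}) (D : set T).
Hypothesis mD : measurable D.

Lemma fatou_Rintegral_ae (F : nat -> T -> R) (f : T -> R) (C : R) :
  (forall k, mu.-integrable D (EFin \o F k)) -> measurable_fun D f ->
  {ae mu, forall x, D x -> forall k, 0 <= F k x} ->
  {ae mu, forall x, D x -> F k x @[k --> \oo] --> f x} ->
  (forall k, \int[mu]_(x in D) F k x <= C) ->
  mu.-integrable D (EFin \o f) /\ \int[mu]_(x in D) f x <= C.
Proof.
move=> iF mf F0 cF FC.
have f0 : {ae mu, forall x, D x -> `|f x| = f x}.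
  apply: ae_mono2 F0 cF => x h c Dx; apply: ger0_norm.
  by apply: (cvgr_to_ge (c Dx)); apply: nearW => k; exact: h.
have EF k : \int[mu]_(x in D) `|F k x| = \int[mu]_(x in D) F k x.
  apply: (eq_Rintegral_ae mD).
  - exact: (measurableT_comp (@normr_measurable _ _) (integrable_fun_measurable (iF k))).
  - exact: (integrable_fun_measurable (iF k)).
  - by apply: ae_mono F0 => x h Dx; rewrite ger0_norm// h.
have mnf : measurable_fun D (fun x => `|f x|) by exact: (measurableT_comp (@normr_measurable _ _) mf).
have inn k : mu.-integrable D (EFin \o (fun x => `|F k x|)) by exact: (integrable_norm (iF k)).
have cn : {ae mu, forall x, D x -> `|F k x| @[k --> \oo] --> `|f x|}.
  by apply: ae_mono cF => x h Dx; apply: cvg_norm; exact: h.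
have nC k : \int[mu]_(x in D) `|F k x| <= C by rewrite EF.
have [inf le] := fatou_Rintegral mD inn mnf (fun k x _ => normr_ge0 _) (fun x _ => normr_ge0 _) cn nC.
have inf' : mu.-integrable D (EFin \o f) by exact: (eq_integrable_ae mD mf f0 inf).
by split => //; rewrite -(eq_Rintegral_ae mD mnf mf f0).
Qed.

Lemma Rintegral_ge0_ae (f : T -> R) : mu.-integrable D (EFin \o f) -> {ae mu, forall x, D x -> 0 <= f x} ->
  0 <= \int[mu]_(x in D) f x.
Proof.
move=> if' f0; have -> : 0 = \int[mu]_(x in D) (fun=> 0 : R) x.
  by rewrite /Rintegral integral0.
by apply: le_Rintegral_ae => //; exact: integrable0.
Qed.

Lemma Rintegral_le0_ae (f : T -> R) : mu.-integrable D (EFin \o f) -> {ae mu, forall x, D x -> 0 <= f x} ->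
  \int[mu]_(x in D) f x <= 0 -> {ae mu, forall x, D x -> f x = 0}.
Proof.
move=> if' f0 le0; have mf := integrable_fun_measurable if'.
have mnf : measurable_fun D (fun x => `|f x|) by exact: (measurableT_comp (@normr_measurable _ _) mf).
have inf : mu.-integrable D (EFin \o (fun x => `|f x|)) by exact: (integrable_norm if').
have E : \int[mu]_(x in D) `|f x| = 0.
  apply/eqP; rewrite eq_le; apply/andP; split; last exact: Rintegral_ge0.
  rewrite (eq_Rintegral_ae mD mnf mf)//.
  by apply: ae_mono f0 => x h Dx; rewrite ger0_norm// h.
have E' : (\int[mu]_(x in D) `|(EFin \o f) x|)%E = 0%E.
  by have h := EFin_Rintegral mD inf; rewrite E in h; exact: esym h.
have mef : measurable_fun D (EFin \o f) by exact/measurable_EFinP.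
have [/(_ E') h _] := ae_eq_integral_abs mu mD mef.
by apply: ae_mono h => x h Dx; have [] := h Dx.
Qed.

End ae_nonnegative.

(* [X u g] stands for: u belongs to the energy space and g is its gradient. *)
Record energy_space dd (T : measurableType dd) (R : realType) (n m : nat)
    (mu : {measure set T -> \bar R}) (D : set T) (eta : T -> R) (a : 'I_m -> T -> R) (k : 'I_m -> R)
    (p q s d M : R) (X : (T -> R) -> (T -> 'rV[R]_n) -> Prop) : Prop := EnergySpace {
  es_mD : measurable D; es_Doo : (mu D < +oo)%E; es_m0 : (0 < m)%N;
  es_p1 : 1 < p; es_pq : p < q; es_qk : forall i, q < k i; es_d : d = \sum_i k i; es_qd : q < d;
  es_s : 0 < s < 1;
  es_meta : measurable_fun D eta; es_eta0 : forall x, D x -> 0 <= eta x;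
  es_ma : forall i, measurable_fun D (a i);
  es_aM : {ae mu, forall x, D x -> forall i, `|a i x| <= M};
  es_a0 : {ae mu, forall x, D x -> forall i, 0 < a i x};
  es_Ld : forall u g, X u g -> Lr mu D d u;
  es_dp : forall u g, X u g -> double_phase mu D p q eta g;
  es_lin : forall c u g v h, X u g -> X v h -> X (fun x => u x + c * v x) (fun x => g x + c *: h x);
  es_abs : forall u g, X u g -> exists g', [/\ X (fun x => `|u x|) g',
    pen mu D (@unit_weight _ T R) p g' <= pen mu D (@unit_weight _ T R) p g &
    pen mu D eta q g' <= pen mu D eta q g];
  es_sob : exists2 C, 0 <= C & forall u g, X u g ->
    normr_pow mu D d u <= C * pen mu D (@unit_weight _ T R) p g `^ (d / p);
  es_cpt : forall (u : nat -> 'I_m -> T -> R) (g : nat -> 'I_m -> T -> 'rV[R]_n) (K : R),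
    (forall j i, X (u j i) (g j i)) -> (forall j i, pen mu D (@unit_weight _ T R) p (g j i) <= K) ->
    (forall j i, pen mu D eta q (g j i) <= K) ->
    exists (r : nat -> nat) (v : 'I_m -> T -> R) (h : 'I_m -> T -> 'rV[R]_n)
      (G : 'I_m -> T -> R) (al be : 'I_m -> R),
      (forall j, (r j < r j.+1)%N) /\ forall i,
      [/\ X (v i) (h i),
          {ae mu, forall z, D z -> u (r j) i z @[j --> \oo] --> v i z /\ forall j, `|u (r j) i z| <= G i z},
          [/\ measurable_fun D (G i), forall z, D z -> 0 <= G i z &
            mu.-integrable D (EFin \o (fun z => G i z `^ d))],
          pen mu D (@unit_weight _ T R) p (g (r j) i) @[j --> \oo] --> al i /\
          pen mu D eta q (g (r j) i) @[j --> \oo] --> be i &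
          pen mu D (@unit_weight _ T R) p (h i) <= al i /\ pen mu D eta q (h i) <= be i];
  es_pos : exists h : nat -> T -> R, [/\ forall j, exists g, X (h j) g, forall j x, 0 <= h j x &
    forall x, D x -> exists j, 0 < h j x];
  es_D0 : ~ {ae mu, forall x, ~ D x} }.

(** * The four functionals and their continuity *)

Section functionals.
Context dd (T : measurableType dd) {R : realType} {n m : nat}.
Variables (mu : {measure set T -> \bar R}) (D : set T) (eta : T -> R) (a : 'I_m -> T -> R) (k : 'I_m -> R)
  (p q s d M : R) (X : (T -> R) -> (T -> 'rV[R]_n) -> Prop).
Hypothesis st : energy_space mu D eta a k p q s d M X.
Implicit Types (y : 'I_m -> T -> R) (g : 'I_m -> T -> 'rV[R]_n).

Local Notation one := (@unit_weight _ T R).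

Definition p_energy g := \sum_i pen mu D one p (g i).
Definition q_energy g := \sum_i pen mu D eta q (g i).
Definition singular y := \sum_i \int[mu]_(x in D) (a i x * `|y i x| `^ s).
Definition coupling y := \int[mu]_(x in D) \prod_i `|y i x| `^ k i.

Let mD := es_mD st. Let Doo := es_Doo st.
Let p1 := es_p1 st. Let pq := es_pq st. Let qd := es_qd st.
Let s0 : 0 < s. Proof. by case/andP: (es_s st). Qed.
Let s1 : s < 1. Proof. by case/andP: (es_s st). Qed.
Let q1 : 1 < q. Proof. exact: lt_trans pq. Qed.
Let d1 : 1 < d. Proof. exact: lt_trans qd. Qed.
Let d0 : 0 < d. Proof. exact: lt_trans d1. Qed.
Let p0 : 0 < p. Proof. exact: lt_trans p1. Qed.
Let k0 i : 0 < k i. Proof. by apply: lt_trans (es_qk st i); exact: lt_trans q1. Qed.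
Let sd : s <= d. Proof. by rewrite ltW// (lt_trans s1). Qed.
Let i0 : 'I_m := Ordinal (es_m0 st).
Let one0 (x : T) : D x -> 0 <= one x. Proof. by move=> _; exact: ler01. Qed.
Let m1 : measurable_fun D one. Proof. exact: measurable_cst. Qed.

Lemma M_ge0 : 0 <= M.
Proof.
rewrite leNgt; apply/negP => M0; apply: (es_D0 st); apply: ae_mono (es_aM st) => x h Dx.
by have := h Dx i0; apply/negP; rewrite -ltNge (lt_le_trans M0).
Qed.

Lemma p_energy_ge0 g : 0 <= p_energy g.
Proof. by apply: sumr_ge0 => i _; exact: pen_ge0. Qed.

Lemma q_energy_ge0 g : 0 <= q_energy g.
Proof. by apply: sumr_ge0 => i _; apply: pen_ge0; exact: (es_eta0 st). Qed.

Lemma pen_le_p_energy g i : pen mu D one p (g i) <= p_energy g.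
Proof. by rewrite /p_energy (bigD1 i)//= lerDl sumr_ge0// => j _; exact: pen_ge0. Qed.

Lemma pen_le_q_energy g i : pen mu D eta q (g i) <= q_energy g.
Proof. by rewrite /q_energy (bigD1 i)//= lerDl sumr_ge0// => j _; apply: pen_ge0; exact: (es_eta0 st). Qed.

Lemma coupling_ge0 y : 0 <= coupling y.
Proof. by apply: Rintegral_ge0 => x _; apply: prodr_ge0 => i _; exact: powR_ge0. Qed.

Lemma singular_dominated (G : T -> R) i (u : T -> R) : {ae mu, forall x, D x -> `|u x| <= G x} ->
  {ae mu, forall x, D x -> `|a i x * `|u x| `^ s| <= M * (1 + G x `^ d)}.
Proof.
move=> uG; apply: ae_mono2 uG (es_aM st) => x h aM Dx.
rewrite normrM (ger0_norm (powR_ge0 _ _)); apply: ler_pM; [exact: normr_ge0|exact: powR_ge0|exact: aM|].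
have G0 : 0 <= G x by exact: le_trans (h Dx).
apply: (le_trans (powR_homo (ltW s0) (normr_ge0 _) (h Dx))).
exact: (powR_le_affine G0 (ltW s0) sd).
Qed.

Lemma singular_measurable i (u : T -> R) : measurable_fun D u ->
  measurable_fun D (fun x => a i x * `|u x| `^ s).
Proof.
move=> mu'; apply: measurable_funM; first exact: (es_ma st).
exact: (measurableT_comp (measurable_powR _) (measurableT_comp (@normr_measurable _ _) mu')).
Qed.

Lemma affine_integrable (G : T -> R) : mu.-integrable D (EFin \o (fun x => G x `^ d)) ->
  mu.-integrable D (EFin \o (fun x => M * (1 + G x `^ d))).
Proof. by move=> iG; exact: (integrable_cst_mul mD M (integrable_add mD (integrable_cst_fin mD Doo 1) iG)). Qed.

Lemma singular_integrable i (u : T -> R) : Lr mu D d u ->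
  mu.-integrable D (EFin \o (fun x => a i x * `|u x| `^ s)).
Proof.
move=> /LrP[mu' iu]; apply: (integrable_dominated_ae mD (singular_measurable i mu') (affine_integrable iu)).
by apply: singular_dominated; exact: aeW.
Qed.

Lemma coupling_measurable y : (forall i, measurable_fun D (y i)) ->
  measurable_fun D (fun x => \prod_i `|y i x| `^ k i).
Proof.
move=> my; apply: measurable_prod => i _.
exact: (measurableT_comp (measurable_powR _) (measurableT_comp (@normr_measurable _ _) (my i))).
Qed.

Lemma coupling_le y (G : 'I_m -> T -> R) x : (forall i, `|y i x| <= G i x) ->
  \prod_i `|y i x| `^ k i <= \sum_i G i x `^ d.
Proof.
move=> yG; rewrite (es_d st).
apply: (le_trans (prod_powR_le_sum i0 k0 (fun i => normr_ge0 (y i x)))).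
apply: ler_sum => i _; apply: powR_homo; [by rewrite -(es_d st) ltW|exact: normr_ge0|exact: yG].
Qed.

Lemma coupling_integrable y : (forall i, Lr mu D d (y i)) ->
  mu.-integrable D (EFin \o (fun x => \prod_i `|y i x| `^ k i)).
Proof.
move=> hy; apply: (integrable_dominated mD) (integrable_sum_fun mD (index_enum 'I_m) (fun i => ((LrP _ _ _ _).1 (hy i)).2)) _.
  by apply: coupling_measurable => i; exact: ((LrP _ _ _ _).1 (hy i)).1.
move=> x Dx; rewrite ger0_norm; first exact: (@coupling_le y (fun i x => `|y i x|)).
by apply: prodr_ge0 => i _; exact: powR_ge0.
Qed.

Lemma singular_term_ge0 i (u : T -> R) : Lr mu D d u -> 0 <= \int[mu]_(x in D) (a i x * `|u x| `^ s).
Proof.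
move=> hu; apply: (Rintegral_ge0_ae mD (singular_integrable i hu)).
by apply: ae_mono (es_a0 st) => x h Dx; rewrite mulr_ge0 ?powR_ge0// ltW// h.
Qed.

Lemma singular_ge0 y : (forall i, Lr mu D d (y i)) -> 0 <= singular y.
Proof. by move=> hy; apply: sumr_ge0 => i _; exact: singular_term_ge0. Qed.

Lemma p_energyZ c g : 0 <= c -> (forall i, double_phase mu D p q eta (g i)) ->
  p_energy (fun i x => c *: g i x) = c `^ p * p_energy g.
Proof.
move=> c0 hg; rewrite /p_energy mulr_sumr; apply: eq_bigr => i _.
by rewrite (penZ mD c (hg i).1) ger0_norm.
Qed.

Lemma q_energyZ c g : 0 <= c -> (forall i, double_phase mu D p q eta (g i)) ->
  q_energy (fun i x => c *: g i x) = c `^ q * q_energy g.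
Proof.
move=> c0 hg; rewrite /q_energy mulr_sumr; apply: eq_bigr => i _.
by rewrite (penZ mD c (hg i).2) ger0_norm.
Qed.

Lemma singularZ c y : 0 <= c -> (forall i, Lr mu D d (y i)) ->
  singular (fun i x => c * y i x) = c `^ s * singular y.
Proof.
move=> c0 hy; rewrite /singular mulr_sumr; apply: eq_bigr => i _.
rewrite -(RintegralZl _ mD (singular_integrable i (hy i))).
by apply: eq_Rintegral => x _; rewrite normrM (ger0_norm c0) powRM// mulrCA.
Qed.

Lemma couplingZ c y : 0 < c -> (forall i, Lr mu D d (y i)) ->
  coupling (fun i x => c * y i x) = c `^ d * coupling y.
Proof.
move=> c0 hy; rewrite /coupling -(RintegralZl _ mD (coupling_integrable hy)).
apply: eq_Rintegral => x _; rewrite (es_d st) -prod_powR// -big_split/=.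
by apply: eq_bigr => i _; rewrite normrM (gtr0_norm c0) powRM// ltW.
Qed.

Lemma singular_coupling_cvg (u : nat -> 'I_m -> T -> R) (v : 'I_m -> T -> R) (G : 'I_m -> T -> R) :
  (forall j i, measurable_fun D (u j i)) -> (forall i, measurable_fun D (v i)) ->
  (forall i, {ae mu, forall z, D z -> u j i z @[j --> \oo] --> v i z /\ forall j, `|u j i z| <= G i z}) ->
  (forall i, mu.-integrable D (EFin \o (fun z => G i z `^ d))) ->
  singular (u j) @[j --> \oo] --> singular v /\ coupling (u j) @[j --> \oo] --> coupling v.
Proof.
move=> mu' mv uv iG; split.
  rewrite /singular; apply: cvg_finsum => i.
  have cv : {ae mu, forall z, D z -> a i z * `|u j i z| `^ s @[j --> \oo] --> a i z * `|v i z| `^ s}.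
    apply: ae_mono (uv i) => z h Dz; apply: cvgMr; have [c _] := h Dz; exact: cvg_norm_powR.
  have dom : {ae mu, forall z, D z -> forall j, `|a i z * `|u j i z| `^ s| <= M * (1 + G i z `^ d)}.
    have h j : {ae mu, forall z, D z -> `|u j i z| <= G i z}.
      by apply: ae_mono (uv i) => z h Dz; have [_] := h Dz; exact.
    have := ae_foralln (fun j => singular_dominated i (h j)).
    by apply: ae_mono => z hz Dz j; exact: hz.
  by have [] := dominated_Rintegral mD (fun j => singular_measurable i (mu' j i)) (singular_measurable i (mv i))
    cv (affine_integrable (iG i)) dom.
have all : {ae mu, forall z, forall i, D z -> u j i z @[j --> \oo] --> v i z /\ forall j, `|u j i z| <= G i z}.
  exact: ae_forall_fin uv.
have cv : {ae mu, forall z, D z -> \prod_i `|u j i z| `^ k i @[j --> \oo] --> \prod_i `|v i z| `^ k i}.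
  apply: ae_mono all => z h Dz; apply: cvg_big => //.
    by move=> w; apply: cvgM; [exact: cvg_fst|exact: cvg_snd].
  by move=> i _; have [c _] := h i Dz; exact: cvg_norm_powR.
have dom : {ae mu, forall z, D z -> forall j, `|\prod_i `|u j i z| `^ k i| <= \sum_i G i z `^ d}.
  apply: ae_mono all => z h Dz j; rewrite ger0_norm; last by apply: prodr_ge0 => i _; exact: powR_ge0.
  by apply: coupling_le => i; have [_] := h i Dz; exact.
by have [] := dominated_Rintegral mD (fun j => coupling_measurable (mu' j)) (coupling_measurable mv)
    cv (integrable_sum_fun mD (index_enum 'I_m) iG) dom.
Qed.

Lemma es_measurable u h : X u h -> measurable_fun D u.
Proof. by move=> /(es_Ld st)/LrP[]. Qed.

(** The singular and coupling terms converge along the subsequence because they are dominated by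
    powers of [G]; the energies of the limit are only bounded by the limits of the energies. *)
Lemma energy_compactness (u : nat -> 'I_m -> T -> R) (g : nat -> 'I_m -> T -> 'rV[R]_n) (K : R) :
  (forall j i, X (u j i) (g j i)) -> (forall j, p_energy (g j) <= K) -> (forall j, q_energy (g j) <= K) ->
  exists (r : nat -> nat) v h (al be : R), [/\ (forall j, (r j < r j.+1)%N), (forall i, X (v i) (h i)),
    p_energy (g (r j)) @[j --> \oo] --> al /\ q_energy (g (r j)) @[j --> \oo] --> be,
    singular (u (r j)) @[j --> \oo] --> singular v /\ coupling (u (r j)) @[j --> \oo] --> coupling v &
    p_energy h <= al /\ q_energy h <= be].
Proof.
move=> ug pK qK.
have [r [v [h [G [al [be [rS H]]]]]]] := es_cpt st ug (fun j i => le_trans (pen_le_p_energy (g j) i) (pK j))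
  (fun j i => le_trans (pen_le_q_energy (g j) i) (qK j)).
exists r, v, h, (\sum_i al i), (\sum_i be i); split => //.
- by move=> i; have [] := H i.
- by split; apply: cvg_finsum => i; have [_ _ _ []] := H i.
- apply: (@singular_coupling_cvg _ _ G).
  + by move=> j i; exact: es_measurable (ug _ _).
  + by move=> i; have [/es_measurable] := H i.
  + by move=> i; have [] := H i.
  + by move=> i; have [_ _ []] := H i.
- by split; apply: ler_sum => i _; have [_ _ _ _ []] := H i.
Qed.

Lemma coupling_le_p_energy : exists2 C, 0 <= C & forall y g, (forall i, X (y i) (g i)) ->
  coupling y <= C * p_energy g `^ (d / p).
Proof.
have [C C0 hC] := es_sob st; exists (m%:R * C) => [|y g yg]; first by rewrite mulr_ge0.
have hy i : Lr mu D d (y i) by exact: (es_Ld st (yg i)).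
have id i : mu.-integrable D (EFin \o (fun x => `|y i x| `^ d)) by exact: ((LrP _ _ _ _).1 (hy i)).2.
apply: (@le_trans _ _ (\sum_i normr_pow mu D d (y i))).
  rewrite /normr_pow -(Rintegral_sum mD (index_enum 'I_m) id).
  apply: le_Rintegral => //; [exact: coupling_integrable|exact: integrable_sum_fun|move=> x Dx].
  exact: (@coupling_le y (fun i x => `|y i x|)).
apply: (@le_trans _ _ (\sum_(i < m) C * p_energy g `^ (d / p))); last first.
  by rewrite sumr_const card_ord -mulrA mulr_natl.
apply: ler_sum => i _; apply: (le_trans (hC _ _ (yg i))); apply: ler_wpM2l => //.
apply: powR_homo; [by rewrite divr_ge0 ?ltW|exact: pen_ge0|exact: pen_le_p_energy].
Qed.

(** The Sobolev and power mean inequalities bound the singular term by a multiple of the p-energy to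
    the power s/p < 1, which [sublinear_le] absorbs into an arbitrarily small linear term. *)
Lemma singular_le_p_energy th : 0 < th -> exists2 K, 0 <= K & forall y g, (forall i, X (y i) (g i)) ->
  singular y <= th * p_energy g + K.
Proof.
move=> th0; have [C C0 hC] := es_sob st.
have sd' : 0 < s < d by rewrite s0 (lt_trans s1).
have [C' C'0 hC'] := normr_pow_le mD Doo sd'.
pose E := M * (C' * C `^ (s / d)).
have E0 : 0 <= E by rewrite !mulr_ge0 ?powR_ge0// M_ge0.
have m0 : 0 < m%:R :> R by rewrite ltr0n (es_m0 st).
have sp : 0 < s / p < 1 by rewrite divr_gt0//= ltr_pdivrMr// mul1r (lt_trans s1).
have [K K0 hK] := sublinear_le (mulr_ge0 (ltW m0) E0) sp th0.
exists K => // y g yg; apply: le_trans (hK _ (p_energy_ge0 g)).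
have -> : m%:R * E * p_energy g `^ (s / p) = \sum_(i < m) E * p_energy g `^ (s / p).
  by rewrite sumr_const card_ord -[RHS]mulr_natl mulrA.
apply: ler_sum => i _; have hy := es_Ld st (yg i); have [is' le] := hC' _ hy.
apply: (@le_trans _ _ (M * normr_pow mu D s (y i))).
  rewrite /normr_pow -(RintegralZl _ mD is').
  apply: (le_Rintegral_ae mD (singular_integrable i hy) (integrable_cst_mul mD M is')).
  apply: ae_mono (es_aM st) => x h Dx; apply: ler_wpM2r; first exact: powR_ge0.
  exact: le_trans (ler_norm _) (h Dx i).
rewrite /E -!mulrA; apply: ler_wpM2l; first exact: M_ge0.
apply: (le_trans le); apply: ler_wpM2l => //.
have -> : s / p = d / p * (s / d) by field; rewrite !gt_eqF.
rewrite (powRrM (p_energy g)) -powRM ?powR_ge0//; apply: powR_homo; first by rewrite divr_ge0 ?ltW.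
  exact: normr_pow_ge0.
apply: (le_trans (hC _ _ (yg i))); apply: ler_wpM2l => //.
apply: powR_homo; [by rewrite divr_ge0 ?ltW|exact: pen_ge0|exact: pen_le_p_energy].
Qed.

(** If the singular term vanished, then so would one component a.e., the coefficients being
    positive, and with it the product. *)
Lemma coupling_singular_gt0 y : (forall i, Lr mu D d (y i)) -> 0 < coupling y -> 0 < singular y.
Proof.
move=> hy c0; rewrite lt_neqAle singular_ge0// andbT; apply/negP => /eqP E.
have le : \int[mu]_(x in D) (a i0 x * `|y i0 x| `^ s) <= 0.
  by rewrite E /singular (bigD1 i0)//= lerDl sumr_ge0// => i _; exact: singular_term_ge0.
have h : {ae mu, forall x, D x -> a i0 x * `|y i0 x| `^ s = 0}.
  apply: (Rintegral_le0_ae mD (singular_integrable i0 (hy i0)) _ le).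
  by apply: ae_mono (es_a0 st) => x h Dx; rewrite mulr_ge0 ?powR_ge0// ltW// h.
suff E0 : 0 = coupling y by move: c0; rewrite -E0 ltxx.
rewrite /coupling; have mc := coupling_measurable (fun i => ((LrP _ _ _ _).1 (hy i)).1).
have -> : 0 = \int[mu]_(x in D) (fun=> 0 : R) x by rewrite /Rintegral integral0.
apply: (eq_Rintegral_ae mD (measurable_cst _) mc).
apply: ae_mono2 h (es_a0 st) => x h ha Dx; rewrite (bigD1 i0)//=.
have := h Dx; move/eqP; rewrite mulf_eq0 (gt_eqF (ha Dx i0))/= => /eqP z.
have -> : `|y i0 x| = 0 by move/powR_eq0_eq0 : z.
by rewrite powR0 ?gt_eqF// mul0r.
Qed.

Lemma coupling_p_energy_gt0 y g : (forall i, X (y i) (g i)) -> 0 < coupling y -> 0 < p_energy g.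
Proof.
move=> yg c0; have [C C0 hC] := coupling_le_p_energy.
rewrite lt_neqAle p_energy_ge0 andbT; apply/negP => /eqP E.
have := hC y g yg; rewrite -E powR0 ?mulr0 ?gt_eqF ?divr_gt0//.
by rewrite leNgt c0.
Qed.

(** All components are taken equal to one [h j] that is not a.e. zero; it exists because the [h j]
    have no common zero in [D] and [D] is not negligible. *)
Lemma exists_coupling_gt0 : exists y g, (forall i, X (y i) (g i)) /\ 0 < coupling y.
Proof.
have [h [hX h0 hc]] := es_pos st.
have [j hj] : exists j, ~ {ae mu, forall x, D x -> h j x = 0}.
  apply: contrapT => /forallNP nh; apply: (es_D0 st).
  have all j : {ae mu, forall x, D x -> h j x = 0} by apply: contrapT; exact: nh.
  have := ae_foralln all; apply: ae_mono => x hx Dx; have [j] := hc x Dx.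
  by rewrite hx ?ltxx.
have [g Xg] := hX j; exists (fun=> h j), (fun=> g); split=> //.
have hy (i : 'I_m) : Lr mu D d (h j) by exact: (es_Ld st Xg).
rewrite lt_neqAle coupling_ge0 andbT; apply/negP => /eqP E; apply: hj.
have le : coupling (fun=> h j) <= 0 by rewrite -E.
have ge : {ae mu, forall x, D x -> 0 <= \prod_(i < m) `|h j x| `^ k i}.
  by apply: aeW => x _; apply: prodr_ge0 => i _; exact: powR_ge0.
have := Rintegral_le0_ae mD (coupling_integrable hy) ge le.
apply: ae_mono => x hx Dx; have /eqP/prodf_eq0[i _ /eqP/powR_eq0_eq0 z] := hx Dx.
by apply/eqP; rewrite -normr_eq0 z.
Qed.

End functionals.

(** * Euler-Lagrange equation *)

(** The tangent inequality for the convex power 1/s, read at the points [x^s] and [z^s]. *)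
Lemma powR_concave_tangent (R : realType) (s x z : R) : 0 < s < 1 -> 0 < x -> 0 <= z ->
  z `^ s - x `^ s <= s * x `^ (s - 1) * (z - x).
Proof.
move=> /andP[s0 s1] x0 z0.
have si : 1 < s^-1 by rewrite invf_gt1.
have h := powR_tangent si (powR_ge0 x s) (powR_ge0 z s).
rewrite -!powRrM mulfV ?gt_eqF// !powRr1 ?(ltW x0)// in h.
have E1 : x `^ (s * (s^-1 - 1)) = (x `^ (s - 1))^-1.
  by rewrite -powRN; congr powR; field; rewrite gt_eqF.
have E2 : x `^ s = x `^ (s - 1) * x.
  rewrite -{3}(powRr1 (ltW x0)) -powRD; last by rewrite (gt_eqF x0) implybT.
  by rewrite subrK.
have w0 : 0 < x `^ (s - 1) by exact: powR_gt0.
rewrite E1 in h; rewrite E2; move: (x `^ (s - 1)) w0 h => w w0 h.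
have : w * s * (s^-1 * w^-1 * z `^ s) <= w * s * (z + (s^-1 - 1) * x).
  by rewrite ler_pM2l// mulr_gt0.
have -> : w * s * (s^-1 * w^-1 * z `^ s) = z `^ s by field; rewrite !gt_eqF.
have -> : w * s * (z + (s^-1 - 1) * x) = w * s * z + w * x - w * s * x by field; rewrite gt_eqF.
lra.
Qed.

Lemma cvg_powR_quotient (R : realType) (s y h : R) (e : nat -> R) : 0 < s < 1 -> 0 < y ->
  (forall j, 0 < e j) -> e j @[j --> \oo] --> 0 ->
  (`|y + e j * h| `^ s - y `^ s) / e j @[j --> \oo] --> s * y `^ (s - 1) * h.
Proof.
move=> s01 y0 e0 ce; have [s0 s1] := andP s01.
have cw : y + e j * h @[j --> \oo] --> y.
  rewrite -[X in _ --> X]addr0 -[X in _ --> _ + X](mul0r h).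
  by apply: cvgD; [exact: cvg_cst|exact: cvgMl].
have cn : `|y + e j * h| @[j --> \oo] --> y by rewrite -[X in _ --> X](gtr0_norm y0); exact: cvg_norm.
have s10 : 0 < 1 - s by rewrite subr_gt0.
have cp : `|y + e j * h| `^ (s - 1) @[j --> \oo] --> y `^ (s - 1).
  have E (x : R) : x `^ (s - 1) = (x `^ (1 - s))^-1 by rewrite -powRN opprB.
  under eq_fun do rewrite E; rewrite E.
  by apply: cvgV; [rewrite gt_eqF// powR_gt0|exact: cvg_powR s10 (fun j => normr_ge0 _) cn].
have near_pos : \forall j \near \oo, 0 < y + e j * h by exact: (cvgr_gt y cw).
apply: (@squeeze_cvgr _ _ _ _ (fun j => s * `|y + e j * h| `^ (s - 1) * h) (fun=> s * y `^ (s - 1) * h)).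
- apply: filterS near_pos => j pos; rewrite (gtr0_norm pos) ler_pdivlMr// ler_pdivrMr//.
  have h1 := powR_concave_tangent s01 y0 (ltW pos); have h2 := powR_concave_tangent s01 pos (ltW y0).
  have E : y + e j * h - y = e j * h by ring.
  rewrite E in h1; rewrite -(opprB (y + e j * h)) E in h2.
  by apply/andP; split; [rewrite -lerN2 opprB; apply: (le_trans h2)|apply: (le_trans h1)];
    rewrite le_eqVlt; apply/orP; left; apply/eqP; ring.
- by apply: cvgMl; apply: cvgMr.
- exact: cvg_cst.
Qed.

Lemma powR_sub2_mul (R : realType) (y r : R) : 1 < r -> 0 <= y -> `|y| `^ (r - 2) * y = y `^ (r - 1).
Proof.
move=> r1 y0; rewrite ger0_norm//; have [->|yn0] := eqVneq y 0.
  by rewrite mulr0 powR0// subr_eq0 gt_eqF.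
rewrite -{2}(powRr1 y0) -powRD; last by rewrite yn0 implybT.
by congr powR; ring.
Qed.

Lemma cvg0_mul_powR (R : realType) (C r : R) (e : nat -> R) : 0 < r -> (forall j, 0 <= e j) ->
  e j @[j --> \oo] --> 0 -> C * e j `^ r @[j --> \oo] --> 0.
Proof.
move=> r0 e0 ce; have h := cvg_powR r0 e0 ce; rewrite powR0 ?gt_eqF// in h.
by rewrite -[X in _ --> X](mulr0 C); exact: cvgMr.
Qed.

Lemma cvg_fib_quotient (R : realType) (s p q l A B C : R) (t1 t2 t3 t4 a b c : nat -> R) :
  t1 j @[j --> \oo] --> (1 : R) -> t2 j @[j --> \oo] --> (1 : R) -> t3 j @[j --> \oo] --> (1 : R) ->
  t4 j @[j --> \oo] --> (1 : R) -> a j @[j --> \oo] --> A -> b j @[j --> \oo] --> B ->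
  c j @[j --> \oo] --> C ->
  s / t1 j * (t2 j / p * a j + t3 j / q * b j - l * (t4 j * c j)) @[j --> \oo] -->
  s / 1 * (1 / p * A + 1 / q * B - l * (1 * C)).
Proof.
move=> h1 h2 h3 h4 ha hb hc; apply: cvgM; first by apply: cvgMr; apply: cvgV.
apply: cvgB; first apply: cvgD.
- by apply: cvgM => //; exact: cvgMl.
- by apply: cvgM => //; exact: cvgMl.
- by apply: cvgMr; exact: cvgM.
Qed.

Definition update (I : eqType) V (f : I -> V) (i : I) (v : V) := fun j => if j == i then v else f j.

Lemma sum_update (R : zmodType) (I : finType) V (F : I -> V -> R) (f : I -> V) i v :
  \sum_j F j (update f i v j) - \sum_j F j (f j) = F i v - F i (f i).
Proof.
rewrite (bigD1 i)//= [X in _ - X](bigD1 i)//= /update eqxx.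
rewrite (eq_bigr (fun j => F j (f j))) => [|j /negPf -> //].
by rewrite opprD addrACA subrr addr0.
Qed.

Section euler_lagrange.
Context dd (T : measurableType dd) {R : realType} {n m : nat}.
Variables (mu : {measure set T -> \bar R}) (D : set T) (eta : T -> R) (a : 'I_m -> T -> R) (k : 'I_m -> R)
  (p q s d M lam : R) (X : (T -> R) -> (T -> 'rV[R]_n) -> Prop).
Hypothesis st : energy_space mu D eta a k p q s d M X.

Local Notation one := (@unit_weight _ T R).
Local Notation Ap := (p_energy mu D p).
Local Notation Bq := (q_energy mu D eta q).
Local Notation Ss := (singular mu D a s).
Local Notation Cc := (coupling mu D k).

Definition ray_energy (y : 'I_m -> T -> R) (g : 'I_m -> T -> 'rV[R]_n) (t : R) :=
  fib s p q d lam (Ap g) (Bq g) (Ss y) (Cc y) t.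

(* [(y, g)] is approached along every direction by points of no smaller energy,
   up to rescalings that tend to the identity. *)
Definition path_minimal (y : 'I_m -> T -> R) (g : 'I_m -> T -> 'rV[R]_n) :=
  forall i h gh, X h gh -> exists e t : nat -> R,
  [/\ forall j, 0 < e j <= 1, e j @[j --> \oo] --> (0 : R), forall j, 0 < t j, t j @[j --> \oo] --> (1 : R) &
    forall j, ray_energy y g (t j) <=
      ray_energy (update y i (fun x => y i x + e j * h x)) (update g i (fun x => g i x + e j *: gh x)) (t j)].

Let mD := es_mD st. Let p1 := es_p1 st. Let s01 := es_s st.
Let q1 : 1 < q. Proof. exact: lt_trans (es_pq st). Qed.
Let s0 : 0 < s. Proof. by case/andP: s01. Qed.
Let p0 : 0 < p. Proof. exact: lt_trans p1. Qed.
Let q0 : 0 < q. Proof. exact: lt_trans q1. Qed.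
Let d1 : 1 < d. Proof. exact: lt_trans (es_qd st). Qed.
Let k1 i : 1 < k i. Proof. exact: lt_trans q1 (es_qk st i). Qed.
Let one0 (x : T) : D x -> 0 <= one x. Proof. by move=> _; exact: ler01. Qed.
Let m1 : measurable_fun D one. Proof. exact: measurable_cst. Qed.

(** The weight that the other components give to the i-th one: in that component alone the coupling
    term is a weighted power [pen] with exponent [k i]. *)
Definition rest (y : 'I_m -> T -> R) i x := \prod_(j < m | j != i) `|y j x| `^ k j.

Lemma rest_ge0 y i x : 0 <= rest y i x.
Proof. by apply: prodr_ge0 => j _; exact: powR_ge0. Qed.

Lemma rest_measurable y i : (forall j, measurable_fun D (y j)) -> measurable_fun D (rest y i).
Proof.
move=> my; have -> : rest y i = (fun x => \prod_(j <- [seq j <- index_enum 'I_m | j != i]) `|y j x| `^ k j).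
  by apply/funext => x; rewrite big_filter.
apply: measurable_prod => j _.
exact: (measurableT_comp (measurable_powR _) (measurableT_comp (@normr_measurable _ _) (my j))).
Qed.

Lemma prod_update y i (u : T -> R) x :
  \prod_j `|update y i u j x| `^ k j = wpow (rest y i) (k i) (lift1 u) x.
Proof.
rewrite (bigD1 i)//= /update eqxx mulrC /wpow /rest enorm_const_mx; congr (_ * _).
by apply: eq_bigr => j /negPf ->.
Qed.

Lemma update_id (y : 'I_m -> T -> R) i : update y i (y i) = y.
Proof. by apply/funext => j; rewrite /update; case: eqP => // ->. Qed.

Lemma wint_rest y i u : (forall j, Lr mu D d (y j)) -> Lr mu D d u -> wint mu D (rest y i) (k i) (lift1 u).
Proof.
move=> hy hu; split; first by move=> j; under eq_fun do rewrite mxE; exact: ((LrP _ _ _ _).1 hu).1.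
have hup j : Lr mu D d (update y i u j) by rewrite /update; case: (j == i); [exact: hu|exact: hy].
have := coupling_integrable st hup; congr (integrable _ _ _).
by apply/funext => x /=; rewrite prod_update.
Qed.

Lemma coupling_update y i u : Cc (update y i u) = pen mu D (rest y i) (k i) (lift1 u).
Proof. by apply: eq_Rintegral => x _; rewrite prod_update. Qed.

Variables (y : 'I_m -> T -> R) (g : 'I_m -> T -> 'rV[R]_n).
Hypotheses (yg : forall i, X (y i) (g i)) (y0 : forall i x, 0 <= y i x).

Let hy i : Lr mu D d (y i). Proof. exact: es_Ld st _ _ (yg i). Qed.
Let my i : measurable_fun D (y i). Proof. exact: ((LrP _ _ _ _).1 (hy i)).1. Qed.

Definition p_form i (gh : T -> 'rV[R]_n) :=
  \int[mu]_(x in D) (one x * (enorm (g i x) `^ (p - 2) * dotv (g i x) (gh x))).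
Definition q_form i (gh : T -> 'rV[R]_n) :=
  \int[mu]_(x in D) (eta x * (enorm (g i x) `^ (q - 2) * dotv (g i x) (gh x))).
Definition coupling_form i (h : T -> R) := \int[mu]_(x in D) (y i x `^ (k i - 1) * rest y i x * h x).

(** The derivative, in direction [h] of the i-th component, of the energy without its singular
    term. *)
Definition variation i h gh := p_form i gh + q_form i gh - lam * (k i * coupling_form i h).

Lemma es_perturb i h gh c : X h gh -> X (fun x => y i x + c * h x) (fun x => g i x + c *: gh x).
Proof. by move=> hX; exact: (es_lin st). Qed.

Lemma energy_derivatives i h gh (e : nat -> R) : X h gh -> (forall j, 0 < e j <= 1) ->
  e j @[j --> \oo] --> 0 ->
  [/\ (Ap (update g i (fun x => g i x + e j *: gh x)) - Ap g) / e j @[j --> \oo] --> p * p_form i gh,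
    (Bq (update g i (fun x => g i x + e j *: gh x)) - Bq g) / e j @[j --> \oo] --> q * q_form i gh,
    (Cc (update y i (fun x => y i x + e j * h x)) - Cc y) / e j @[j --> \oo] --> k i * coupling_form i h &
    [/\ mu.-integrable D (EFin \o (fun x => one x * (enorm (g i x) `^ (p - 2) * dotv (g i x) (gh x)))),
      mu.-integrable D (EFin \o (fun x => eta x * (enorm (g i x) `^ (q - 2) * dotv (g i x) (gh x)))) &
      mu.-integrable D (EFin \o (fun x => y i x `^ (k i - 1) * rest y i x * h x))]].
Proof.
move=> hX e01 ce; have e0 j : 0 < e j by case/andP: (e01 j).
have e1 j : e j <= 1 by case/andP: (e01 j).
have [gp gq] := es_dp st (yg i); have [hp hq] := es_dp st hX; have hh := es_Ld st hX.
have [i1 c1] := pen_derivative mD m1 one0 p1 gp hp e0 e1 ce.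
have [i2 c2] := pen_derivative mD (es_meta st) (es_eta0 st) q1 gq hq e0 e1 ce.
have [i3 c3] := pen_derivative mD (rest_measurable i my) (fun x _ => rest_ge0 y i x) (k1 i)
  (wint_rest i hy (hy i)) (wint_rest i hy hh) e0 e1 ce.
have ptE x : rest y i x * (enorm (lift1 (y i) x) `^ (k i - 2) * dotv (lift1 (y i) x) (lift1 h x)) =
    y i x `^ (k i - 1) * rest y i x * h x.
  rewrite enorm_const_mx /dotv big_ord1 !mxE -(powR_sub2_mul (k1 i) (y0 i x)); ring.
have i3' : mu.-integrable D (EFin \o (fun x => y i x `^ (k i - 1) * rest y i x * h x)).
  by move: i3; congr (integrable _ _ _); apply/funext => x /=; rewrite ptE.
split; last by split.
- have F : (fun j => (Ap (update g i (fun x => g i x + e j *: gh x)) - Ap g) / e j) =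
      (fun j => (pen mu D one p (fun x => g i x + e j *: gh x) - pen mu D one p (g i)) / e j).
    by apply/funext => j; congr (_ / _); exact: (sum_update (fun _ v => pen mu D one p v)).
  by rewrite F; exact: c1.
- have F : (fun j => (Bq (update g i (fun x => g i x + e j *: gh x)) - Bq g) / e j) =
      (fun j => (pen mu D eta q (fun x => g i x + e j *: gh x) - pen mu D eta q (g i)) / e j).
    by apply/funext => j; congr (_ / _); exact: (sum_update (fun _ v => pen mu D eta q v)).
  by rewrite F; exact: c2.
- have EC : Cc y = pen mu D (rest y i) (k i) (lift1 (y i)) by rewrite -coupling_update update_id.
  have F : (fun j => (Cc (update y i (fun x => y i x + e j * h x)) - Cc y) / e j) =
      (fun j => (pen mu D (rest y i) (k i) (fun x => lift1 (y i) x + e j *: lift1 h x) -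
        pen mu D (rest y i) (k i) (lift1 (y i))) / e j).
    by apply/funext => j; rewrite coupling_update EC -lift1D -lift1Z.
  rewrite F (_ : coupling_form i h = \int[mu]_(x in D) (rest y i x *
      (enorm (lift1 (y i) x) `^ (k i - 2) * dotv (lift1 (y i) x) (lift1 h x)))); first exact: c3.
  by apply: eq_Rintegral => x _; rewrite ptE.
Qed.

Lemma singular_update i u : Ss (update y i u) - Ss y =
  \int[mu]_(x in D) (a i x * `|u x| `^ s) - \int[mu]_(x in D) (a i x * `|y i x| `^ s).
Proof. exact: (sum_update (fun i v => \int[mu]_(x in D) (a i x * `|v x| `^ s))). Qed.

Definition quotient i (h : T -> R) (e : R) x := a i x * ((`|y i x + e * h x| `^ s - y i x `^ s) / e).

Lemma quotient_integrable i h gh e : X h gh -> mu.-integrable D (EFin \o quotient i h e) /\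
  \int[mu]_(x in D) quotient i h e x = (Ss (update y i (fun x => y i x + e * h x)) - Ss y) / e.
Proof.
move=> hX; have h1 := singular_integrable st i (es_Ld st (es_perturb i e hX)).
have h2 := singular_integrable st i (hy i).
have E : quotient i h e = (fun x => e^-1 * (a i x * `|y i x + e * h x| `^ s - a i x * `|y i x| `^ s)).
  by apply/funext => x; rewrite /quotient (ger0_norm (y0 i x)); ring.
have h12 := integrable_sub mD h1 h2.
rewrite E; split; first exact: integrable_cst_mul.
by rewrite RintegralZl// RintegralB// singular_update mulrC.
Qed.

(** Minimality at the parameter [t j], divided by [e j], bounds the singular quotient by the
    quotients of the differentiable terms. The powers of [t j] tend to 1, so these have the limit
    [s * variation i h gh]. *)
Lemma singular_upper i h gh : path_minimal y g -> X h gh -> exists e Z : nat -> R,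
  [/\ forall j, 0 < e j <= 1, e j @[j --> \oo] --> 0, Z j @[j --> \oo] --> s * variation i h gh &
    forall j, \int[mu]_(x in D) quotient i h (e j) x <= Z j].
Proof.
move=> min hX; have [e [t [e01 ce t0 ct le]]] := min i h gh hX.
have e0 j : 0 < e j by case/andP: (e01 j).
have [cA cB cC _] := energy_derivatives i hX e01 ce.
pose dA j := (Ap (update g i (fun x => g i x + e j *: gh x)) - Ap g) / e j.
pose dB j := (Bq (update g i (fun x => g i x + e j *: gh x)) - Bq g) / e j.
pose dC j := (Cc (update y i (fun x => y i x + e j * h x)) - Cc y) / e j.
pose Z j := s / t j `^ s * (t j `^ p / p * dA j + t j `^ q / q * dB j - lam * (t j `^ d * dC j)).
have tp r : 0 < r -> t j `^ r @[j --> \oo] --> (1 : R).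
  by move=> r0; have := cvg_powR r0 (fun j => ltW (t0 j)) ct; rewrite powR1.
exists e, Z; split => //.
  have -> : s * variation i h gh = s / 1 * (1 / p * (p * p_form i gh) + 1 / q * (q * q_form i gh)
      - lam * (1 * (k i * coupling_form i h))) by rewrite /variation; field; rewrite !gt_eqF.
  exact: cvg_fib_quotient (tp s s0) (tp p p0) (tp q q0) (tp d (lt_trans ltr01 d1)) cA cB cC.
move=> j; have [_ ->] := quotient_integrable i (e j) hX.
have := le j; rewrite /ray_energy /fib /Z /dA /dB /dC.
move: (Ap _) (Bq _) (Ss _) (Cc _) (Ap g) (Bq g) (Ss y) (Cc y) => A' B' S' C' A B S C h'.
have tj : 0 < t j `^ s by rewrite powR_gt0.
have -> : (S' - S) / e j = s / t j `^ s * (t j `^ s / s * S' - t j `^ s / s * S) / e j.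
  by field; rewrite !gt_eqF.
have -> : s / t j `^ s * (t j `^ p / p * ((A' - A) / e j) + t j `^ q / q * ((B' - B) / e j) -
    lam * (t j `^ d * ((C' - C) / e j))) = s / t j `^ s * (t j `^ p / p * (A' - A) +
    t j `^ q / q * (B' - B) - lam * (t j `^ d * (C' - C))) / e j.
  by field; rewrite !gt_eqF.
rewrite ler_pM2r ?invr_gt0// ler_pM2l ?divr_gt0//.
rewrite -subr_ge0 in h'; rewrite -subr_ge0; apply: (le_trans h').
by rewrite le_eqVlt; apply/orP; left; apply/eqP; ring.
Qed.

(* Where [y i] vanishes, the difference quotient is [e^(s - 1) a h^s], which tends to infinity, while
   its integral stays bounded. *)
Lemma positive_where_direction i h gh : path_minimal y g -> X h gh -> (forall x, 0 <= h x) ->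
  {ae mu, forall x, D x -> y i x = 0 -> h x = 0}.
Proof.
move=> min hX h0; have [e [Z [e01 ce cZ le]]] := singular_upper i min hX.
have e0 j : 0 < e j by case/andP: (e01 j).
have [N hN] := cvg_upper cZ ltr01; set C := _ + 1 in hN.
(* Only the part of the quotient over the zeros of [y i] is kept; over the rest it is nonnegative
   because [h] is. *)
pose G x := if 0 < y i x then 0 else a i x * `|h x| `^ s.
have hh := es_Ld st hX; have ih := singular_integrable st i hh.
have mG : measurable_fun D G.
  apply: measurable_fun_if => //.
  - exact: (measurable_fun_ltr (measurable_cst _) (my i)).
  - apply: measurable_funS (integrable_fun_measurable ih) => //; exact: subIsetl.
have G0 : {ae mu, forall x, D x -> 0 <= G x}.
  apply: ae_mono (es_a0 st) => x ha Dx; rewrite /G; case: ifP => // _.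
  by rewrite mulr_ge0 ?powR_ge0// ltW// ha.
have iG : mu.-integrable D (EFin \o G).
  apply: (integrable_dominated_ae mD mG ih); apply: ae_mono (es_a0 st) => x ha Dx.
  have nn : 0 <= a i x * `|h x| `^ s by rewrite mulr_ge0 ?powR_ge0// ltW// ha.
  by rewrite /G; case: ifP => _; rewrite ?normr0// ger0_norm.
have bound j : (N <= j)%N -> \int[mu]_(x in D) G x <= C * e j `^ (1 - s).
  move=> /hN ZC; have [iq _] := quotient_integrable i (e j) hX.
  have pe : 0 < e j `^ (s - 1) by rewrite powR_gt0.
  have -> : e j `^ (1 - s) = (e j `^ (s - 1))^-1 by rewrite -powRN opprB.
  rewrite ler_pdivlMr// mulrC -(RintegralZl _ mD iG); apply: le_trans ZC; apply: le_trans (le j).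
  apply: (le_Rintegral_ae mD (integrable_cst_mul mD _ iG) iq).
  apply: ae_mono (es_a0 st) => x ha Dx; rewrite /G /quotient; have a0 := ha Dx i; case: ifPn => yx.
    rewrite mulr0 mulr_ge0 ?(ltW a0)// divr_ge0 ?(ltW (e0 j))// subr_ge0.
    apply: powR_homo; [exact: ltW|exact: y0|].
    by apply: le_trans (ler_norm _); rewrite lerDl mulr_ge0// ltW.
  have -> : y i x = 0 by apply/eqP; rewrite eq_le y0 andbT leNgt.
  rewrite add0r powR0 ?gt_eqF// subr0 normrM (gtr0_norm (e0 j)) powRM ?(ltW (e0 j))//.
  have -> : e j `^ s = e j * e j `^ (s - 1) by rewrite mulr_powRB1// ltW.
  by rewrite le_eqVlt; apply/orP; left; apply/eqP; field; rewrite gt_eqF.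
have Gle0 : \int[mu]_(x in D) G x <= 0.
  have s10 : 0 < 1 - s by rewrite subr_gt0; case/andP: s01.
  have c0 := cvg0_mul_powR C s10 (fun j => ltW (e0 j)) ce.
  by apply: (cvgr_to_ge c0); exists N.
have := Rintegral_le0_ae mD iG G0 Gle0.
apply: ae_mono2 (es_a0 st) => x ha hG Dx yx; have := hG Dx; rewrite /G yx ltxx => /eqP.
by rewrite mulf_eq0 gt_eqF ?ha//= => /eqP/powR_eq0_eq0/eqP; rewrite normr_eq0 => /eqP.
Qed.

(** Wherever [y i] vanishes, each function of the countable family [h] vanishes up to a null set,
    and these functions have no common zero in [D]. *)
Lemma path_minimal_gt0 i : path_minimal y g -> {ae mu, forall x, D x -> 0 < y i x}.
Proof.
move=> min; have [h [hX h0 hc]] := es_pos st.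
have H j : {ae mu, forall x, D x -> y i x = 0 -> h j x = 0}.
  by have [gh hXj] := hX j; exact: (@positive_where_direction i (h j) gh min hXj (h0 j)).
have := ae_foralln H; apply: ae_mono => x hx Dx; have [j hj] := hc x Dx.
rewrite lt_neqAle y0 andbT; apply/negP => /eqP yx.
by move: hj; rewrite (hx j Dx (esym yx)) ltxx.
Qed.

Lemma measurable_singular_form i h : measurable_fun D h ->
  measurable_fun D (fun x => a i x * y i x `^ (s - 1) * h x).
Proof.
move=> mh; apply: measurable_funM => //; apply: measurable_funM; first exact: es_ma st i.
exact: (measurableT_comp (measurable_powR _) (my i)).
Qed.

Lemma quotient_cvg i h (e : nat -> R) : path_minimal y g -> (forall j, 0 < e j) -> e j @[j --> \oo] --> 0 ->
  {ae mu, forall x, D x -> quotient i h (e j) x @[j --> \oo] --> s * (a i x * y i x `^ (s - 1) * h x)}.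
Proof.
move=> min e0 ce; apply: ae_mono (path_minimal_gt0 i min) => x yx Dx; rewrite /quotient.
have -> : s * (a i x * y i x `^ (s - 1) * h x) = a i x * (s * y i x `^ (s - 1) * h x) by ring.
by apply: cvgMr; exact: cvg_powR_quotient s01 (yx Dx) e0 ce.
Qed.

Lemma singular_form_ge0_integrable i h gh : path_minimal y g -> X h gh -> (forall x, 0 <= h x) ->
  mu.-integrable D (EFin \o (fun x => a i x * y i x `^ (s - 1) * h x)).
Proof.
move=> min hX h0; have [e [Z [e01 ce cZ le]]] := singular_upper i min hX.
have e0 j : 0 < e j by case/andP: (e01 j).
have [N hN] := cvg_upper cZ ltr01.
have mh := es_measurable st hX.
have mf := measurable_singular_form i mh.
have Fpos : {ae mu, forall x, D x -> forall j, 0 <= quotient i h (e (j + N)%N) x}.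
  apply: ae_mono (es_a0 st) => x ha Dx j; rewrite /quotient mulr_ge0 ?(ltW (ha Dx i))//.
  rewrite divr_ge0 ?(ltW (e0 _))// subr_ge0; apply: powR_homo; [exact: ltW|exact: y0|].
  by apply: le_trans (ler_norm _); rewrite lerDl mulr_ge0// ltW.
have cF : {ae mu, forall x, D x -> quotient i h (e (j + N)%N) x @[j --> \oo] -->
    s * (a i x * y i x `^ (s - 1) * h x)}.
  apply: ae_mono (quotient_cvg i h min e0 ce) => x c Dx.
  by have := c Dx; rewrite -(cvg_shiftn N).
have [isf _] := fatou_Rintegral_ae mD (fun j => (quotient_integrable i (e (j + N)%N) hX).1)
  (measurable_funM (measurable_cst s) mf) Fpos cF (fun j => le_trans (le (j + N)%N) (hN _ (leq_addl _ _))).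
have := integrable_cst_mul mD s^-1 isf; congr (integrable _ _ _).
by apply/funext => x /=; rewrite mulKf ?gt_eqF.
Qed.

(** For a direction of any sign the quotients are dominated by the integrand for |h|, which is
    integrable since |h| is again a nonnegative direction of the space. *)
Lemma singular_form_le i h gh : path_minimal y g -> X h gh ->
  mu.-integrable D (EFin \o (fun x => a i x * y i x `^ (s - 1) * h x)) /\
  \int[mu]_(x in D) (a i x * y i x `^ (s - 1) * h x) <= variation i h gh.
Proof.
move=> min hX; have [gh' [hX' _ _]] := es_abs st hX.
have iabs := singular_form_ge0_integrable i min hX' (fun x => normr_ge0 (h x)).
have [e [Z [e01 ce cZ le]]] := singular_upper i min hX.
have e0 j : 0 < e j by case/andP: (e01 j).
have mf := measurable_singular_form i (es_measurable st hX).
have dom : {ae mu, forall x, D x -> forall j, `|quotient i h (e j) x| <= a i x * y i x `^ (s - 1) * `|h x|}.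
  apply: ae_mono2 (path_minimal_gt0 i min) (es_a0 st) => x yx ha Dx j.
  rewrite /quotient normrM (gtr0_norm (ha Dx i)) -mulrA; apply: ler_wpM2l; first exact: ltW (ha Dx i).
  rewrite normrM normfV (gtr0_norm (e0 j)) ler_pdivrMr//.
  apply: (le_trans (normr_powR_sub_le _ s01 (yx Dx))).
  have -> : y i x + e j * h x - y i x = e j * h x by ring.
  by rewrite normrM (gtr0_norm (e0 j)) le_eqVlt; apply/orP; left; apply/eqP; ring.
have mq j : measurable_fun D (quotient i h (e j)).
  exact: (integrable_fun_measurable (quotient_integrable i (e j) hX).1).
have mf' : measurable_fun D (fun x => s * (a i x * y i x `^ (s - 1) * h x)).
  exact: (measurable_funM (measurable_cst s) mf).
have [_ isf cq] := dominated_Rintegral mD mq mf'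
  (quotient_cvg i h min e0 ce) iabs dom.
have if' : mu.-integrable D (EFin \o (fun x => a i x * y i x `^ (s - 1) * h x)).
  have := integrable_cst_mul mD s^-1 isf; congr (integrable _ _ _).
  by apply/funext => x /=; rewrite mulKf ?gt_eqF.
split; first exact: if'.
have nle : \forall j \near \oo, \int[mu]_(x in D) quotient i h (e j) x <= Z j.
  by apply: nearW => j; exact: le.
rewrite -(ler_pM2l s0) -(RintegralZl _ mD if').
exact: (ler_cvg_to cq cZ nle).
Qed.

(** [singular_form_le] in the directions [h] and [- h]; every term is linear in the direction. *)
Lemma euler_lagrange i h gh : path_minimal y g -> X h gh ->
  [/\ mu.-integrable D (EFin \o (fun x => one x * (enorm (g i x) `^ (p - 2) * dotv (g i x) (gh x)))),
    mu.-integrable D (EFin \o (fun x => eta x * (enorm (g i x) `^ (q - 2) * dotv (g i x) (gh x)))),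
    mu.-integrable D (EFin \o (fun x => a i x * y i x `^ (s - 1) * h x)) &
    variation i h gh - \int[mu]_(x in D) (a i x * y i x `^ (s - 1) * h x) = 0].
Proof.
move=> min hX; have [i1 l1] := singular_form_le i min hX.
(* The opposite is written as [h + (-2) h], the form of combination that [es_lin] covers. *)
have E1 : (fun x => - h x) = (fun x => h x + (- 2) * h x) by apply/funext => x; ring.
have E2 : (fun x => - gh x) = (fun x => gh x + (- 2) *: gh x).
  by apply/funext => x; apply/rowP => j; rewrite !mxE; ring.
have hXn : X (fun x => - h x) (fun x => - gh x) by rewrite E1 E2; exact: (es_lin st (- 2) hX hX).
have [_ l2] := singular_form_le i min hXn.
have e01 j : 0 < (j.+1%:R^-1 : R) <= 1 by rewrite invr_gt0 ltr0n invf_le1// ler1n.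
have [_ _ _ [j1 j2 j3]] := energy_derivatives i hX e01 cvg_harmonic.
split => //; apply/eqP; rewrite eq_le; apply/andP; split; last by rewrite subr_ge0.
have N (f f' : T -> R) : mu.-integrable D (EFin \o f') -> (forall x, f x = (- 1) * f' x) ->
    \int[mu]_(x in D) f x = - \int[mu]_(x in D) f' x.
  by move=> if' E; rewrite -mulN1r -(RintegralZl _ mD if'); apply: eq_Rintegral => x _; exact: E.
have V : variation i (fun x => - h x) (fun x => - gh x) = - variation i h gh.
  have E3 : p_form i (fun x => - gh x) = - p_form i gh by apply: (N _ _ j1) => x; rewrite dotvNr; ring.
  have E4 : q_form i (fun x => - gh x) = - q_form i gh by apply: (N _ _ j2) => x; rewrite dotvNr; ring.
  have E5 : coupling_form i (fun x => - h x) = - coupling_form i h by apply: (N _ _ j3) => x; ring.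
  by rewrite /variation E3 E4 E5; ring.
move: l2; rewrite V (N _ _ i1) => [|x]; last by ring.
by rewrite lerN2 subr_le0.
Qed.

End euler_lagrange.

(** * Two critical points *)

Lemma le_max_left (R : realDomainType) (x y : R) : x <= Num.max x y.
Proof. by rewrite le_max lexx. Qed.

Lemma le_max_right (R : realDomainType) (x y : R) : y <= Num.max x y.
Proof. by rewrite le_max lexx orbT. Qed.

Lemma fib_mono (R : realType) (s p q d lam A B A' B' S U t : R) : 0 < p -> 0 < q -> A <= A' -> B <= B' ->
  fib s p q d lam A B S U t <= fib s p q d lam A' B' S U t.
Proof.
move=> p0 q0 AA BB; rewrite /fib !lerD2r; apply: lerD; apply: ler_wpM2l => //;
  by rewrite divr_ge0 ?powR_ge0// ltW.
Qed.

Lemma coercive_arith (R : realFieldType) (B q W e v j : R) : 0 < q -> B / q - W <= e -> e <= v + j ->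
  v < 0 -> j <= 1 -> B <= q * (1 + W).
Proof. by move=> q0 h1 h2 h3 h4; rewrite mulrC -ler_pdivrMr//; lra. Qed.

Lemma half_lt (R : realFieldType) (x : R) : 0 < x -> x / 2 < x.
Proof. by move=> x0; lra. Qed.

(** As s is smaller than both p and q, the negative term in [t^s] dominates for small [t]. *)
Lemma fib_neg (R : realType) (s p q d lam A B S U rho : R) : 0 < s < 1 -> 1 < p -> p < q -> 0 < lam ->
  0 <= A -> 0 <= B -> 0 < S -> 0 <= U -> 0 < rho ->
  exists2 t, 0 < t & fib s p q d lam A B S U t < 0 /\ t `^ p * A <= rho.
Proof.
move=> /andP[s0 s1] p1 pq lam0 A0 B0 S0 U0 rho0.
have p0 : 0 < p by exact: lt_trans p1.
have q1 : 1 < q by exact: lt_trans pq.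
have ps0 : 0 < p - s by rewrite subr_gt0 (lt_trans s1).
have t0 (j : nat) : 0 < j.+1%:R^-1 :> R by rewrite invr_gt0.
have c1 := cvg0_mul_powR A p0 (fun j => ltW (t0 j)) cvg_harmonic.
have c2 := cvg0_mul_powR (A + B) ps0 (fun j => ltW (t0 j)) cvg_harmonic.
have S2 : 0 < S / s / 2 by rewrite !divr_gt0.
have [N1 h1] := cvg0_small (fun j => mulr_ge0 A0 (powR_ge0 _ _)) c1 rho0.
have [N2 h2] := cvg0_small (fun j => mulr_ge0 (addr_ge0 A0 B0) (powR_ge0 _ _)) c2 S2.
pose N := maxn N1 N2; pose t := N.+1%:R^-1 : R.
have {}h1 := h1 N (leq_maxl _ _); have {}h2 := h2 N (leq_maxr _ _); rewrite -/t in h1 h2.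
have t1 : t <= 1 by rewrite invf_le1// ler1n.
have t0' : 0 < t by exact: t0.
exists t => //; split; last by rewrite mulrC.
have le r Z : 1 < r -> p <= r -> 0 <= Z -> t `^ r / r * Z <= t `^ p * Z.
  move=> r1 pr Z0; apply: ler_wpM2r => //; apply: (@le_trans _ _ (t `^ r)).
    by rewrite ler_pdivrMr ?(lt_trans _ r1)// ler_peMr ?powR_ge0// ltW.
  by apply: ger_powR => //; rewrite t0'.
have lA := le p A p1 (lexx p) A0; have lB := le q B q1 (ltW pq) B0.
have E : t `^ p = t `^ s * t `^ (p - s).
  by rewrite -powRD ?(gt_eqF t0') ?implybT// addrC subrK.
have ts : 0 < t `^ s by rewrite powR_gt0.
have lU : 0 <= lam * (t `^ d * U) by rewrite !mulr_ge0 ?powR_ge0// ltW.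
rewrite /fib; apply: (@le_lt_trans _ _ (t `^ s * ((A + B) * t `^ (p - s) - S / s))).
  rewrite -subr_ge0 in lA; rewrite -subr_ge0 in lB; rewrite -subr_ge0.
  apply: le_trans (addr_ge0 (addr_ge0 lA lB) lU) _.
  by rewrite E le_eqVlt; apply/orP; left; apply/eqP; field; rewrite !gt_eqF// (lt_trans _ q1).
rewrite pmulr_rlt0// subr_lt0; apply: (le_lt_trans h2).
by rewrite ltr_pdivrMr// ltr_pMr ?divr_gt0// ltr1n.
Qed.

(** Subtracting 1/d times the critical identity eliminates the coupling term and leaves positive
    multiples of [A] and [B]. The value of [th] lets the singular term take up half of the multiple
    of [A]. *)
Lemma fib_coercive (R : realType) (s p q d lam A B S U th K c : R) : 0 < s < 1 -> 1 < p -> p < q -> q < d ->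
  0 <= A -> 0 <= B -> S <= th * A + K -> 0 <= K -> th = s * (p^-1 - d^-1) / 2 ->
  A + B - S - lam * (d * U) = 0 -> 0 <= S -> fib s p q d lam A B S U 1 <= c ->
  A <= 2 * (c + K / s) / (p^-1 - d^-1) /\ B <= (c + K / s) / (q^-1 - d^-1).
Proof.
move=> /andP[s0 s1] p1 pq qd A0 B0 SA K0 thE crit S0 h.
have p0 : 0 < p by exact: lt_trans p1.
have q0 : 0 < q by exact: lt_trans pq.
have d0 : 0 < d by exact: lt_trans qd.
have pd : 0 < p^-1 - d^-1 by rewrite subr_gt0 ltf_pV2 ?posrE// (lt_trans pq).
have qd' : 0 < q^-1 - d^-1 by rewrite subr_gt0 ltf_pV2 ?posrE.
have E : fib s p q d lam A B S U 1 = A * (p^-1 - d^-1) + B * (q^-1 - d^-1) - S / s + S / d.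
  have -> : fib s p q d lam A B S U 1 = A / p + B / q - S / s - lam * (d * U) / d.
    by rewrite /fib !powR1; field; rewrite !gt_eqF.
  have -> : lam * (d * U) = A + B - S by apply/eqP; rewrite eq_sym -subr_eq0 crit.
  by ring.
have h1 : S / s <= A * (p^-1 - d^-1) / 2 + K / s.
  apply: (@le_trans _ _ ((th * A + K) / s)); first by rewrite ler_pM2r ?invr_gt0.
  by rewrite thE le_eqVlt; apply/orP; left; apply/eqP; field; rewrite !gt_eqF.
have h2 : 0 <= S / d by rewrite divr_ge0// ltW.
have h3 : 0 <= A * (p^-1 - d^-1) by rewrite mulr_ge0// ltW.
have h4 : 0 <= B * (q^-1 - d^-1) by rewrite mulr_ge0// ltW.
rewrite E in h; split; rewrite ler_pdivlMr//; lra.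
Qed.

Section two_solutions.
Context dd (T : measurableType dd) {R : realType} {n m : nat}.
Variables (mu : {measure set T -> \bar R}) (D : set T) (eta : T -> R) (a : 'I_m -> T -> R) (k : 'I_m -> R)
  (p q s d M : R) (X : (T -> R) -> (T -> 'rV[R]_n) -> Prop).
Hypothesis st : energy_space mu D eta a k p q s d M X.
Implicit Types (y v w : 'I_m -> T -> R) (g h : 'I_m -> T -> 'rV[R]_n).

Local Notation one := (@unit_weight _ T R).
Local Notation Ap := (p_energy mu D p).
Local Notation Bq := (q_energy mu D eta q).
Local Notation Ss := (singular mu D a s).
Local Notation Cc := (coupling mu D k).
Local Notation E lam := (ray_energy mu D eta a k p q s d lam).
Local Notation XX y g := (forall i, X (y i) (g i)).

Let mD := es_mD st. Let p1 := es_p1 st. Let pq := es_pq st. Let qd := es_qd st. Let s01 := es_s st.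
Let s0 : 0 < s. Proof. by case/andP: s01. Qed.
Let q1 : 1 < q. Proof. exact: lt_trans pq. Qed.
Let d1 : 1 < d. Proof. exact: lt_trans qd. Qed.
Let p0 : 0 < p. Proof. exact: lt_trans p1. Qed.
Let q0 : 0 < q. Proof. exact: lt_trans q1. Qed.
Let d0 : 0 < d. Proof. exact: lt_trans d1. Qed.

Let Ld y g : XX y g -> forall i, Lr mu D d (y i).
Proof. by move=> yg i; exact: (es_Ld st (yg i)). Qed.

Lemma energy_mono lam y g v h t : Ap g <= Ap h -> Bq g <= Bq h -> Ss y = Ss v -> Cc y = Cc v ->
  E lam y g t <= E lam v h t.
Proof.
move=> Ale Ble Seq Ceq; rewrite /ray_energy Seq Ceq.
exact: (fib_mono s d lam (Ss v) (Cc v) t p0 q0 Ale Ble).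
Qed.

Lemma scale_space y g c : XX y g -> forall i, X (fun x => c * y i x) (fun x => c *: g i x).
Proof.
move=> yg i.
have -> : (fun x => c * y i x) = (fun x => y i x + (c - 1) * y i x) by apply/funext => x; ring.
have -> : (fun x => c *: g i x) = (fun x => g i x + (c - 1) *: g i x).
  by apply/funext => x; rewrite scalerBl scale1r addrC subrK.
exact: (es_lin st).
Qed.

Lemma energy_scale lam y g c t : XX y g -> 0 < c -> 0 <= t ->
  E lam (fun i x => c * y i x) (fun i x => c *: g i x) t = E lam y g (c * t).
Proof.
move=> yg c0 t0; have gd i := es_dp st (yg i); have yL := Ld yg.
rewrite /ray_energy (p_energyZ st (ltW c0) gd) (q_energyZ st (ltW c0) gd) (singularZ st (ltW c0) yL).
by rewrite (couplingZ st c0 yL) (fib_scale d lam s01 p1 pq)// ltW.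
Qed.

Lemma update_space y g i u gu : XX y g -> X u gu -> forall j, X (update y i u j) (update g i gu j).
Proof. by move=> yg ug j; rewrite /update; case: (j == i); [exact: ug|exact: yg]. Qed.

Lemma abs_space y g : XX y g -> exists g', [/\ forall i, X (fun x => `|y i x|) (g' i),
  Ap g' <= Ap g, Bq g' <= Bq g, Ss (fun i x => `|y i x|) = Ss y & Cc (fun i x => `|y i x|) = Cc y].
Proof.
move=> yg; have [g' hg'] := choice (fun i => es_abs st (yg i)).
exists g'; split.
- by move=> i; have [] := hg' i.
- by apply: ler_sum => i _; have [] := hg' i.
- by apply: ler_sum => i _; have [] := hg' i.
- by apply: eq_bigr => i _; apply: eq_Rintegral => x _; rewrite normr_id.
- by apply: eq_Rintegral => x _; apply: eq_bigr => i _; rewrite normr_id.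
Qed.

Lemma energy_sphere : exists rho l0, [/\ 0 < rho, 0 < l0 & forall lam, 0 < lam < l0 -> forall y g,
  XX y g -> Ap g = rho -> 1 <= E lam y g 1].
Proof.
(* With this [th] the growing part of S / s is absorbed by half of A / p. *)
have th0 : 0 < s / (2 * p) by rewrite divr_gt0// mulr_gt0.
have [K K0 hK] := singular_le_p_energy st th0; have [C C0 hC] := coupling_le_p_energy st.
(* On the sphere the gradient terms minus the singular one are at least rho / (2 p) - K / s = 2, and
   [lam < (W + 1)^-1] keeps the coupling term below 1. *)
pose rho := 2 * p * (K / s + 2); pose W := C * rho `^ (d / p).
have W0 : 0 <= W by rewrite mulr_ge0 ?powR_ge0.
have W1 : 0 < W + 1 by rewrite ltr_wpDl.
have Ks : 0 <= K / s by rewrite divr_ge0// ltW.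
have rho0 : 0 < rho by rewrite !mulr_gt0// ltr_wpDl.
exists rho, (W + 1)^-1; split => //; first by rewrite invr_gt0.
move=> lam /andP[lam0 lamW] y g yg Ar; have hS := hK y g yg; have hU := hC y g yg.
rewrite Ar in hS hU; rewrite /ray_energy (fib1 d lam s01 p1 pq) Ar.
have B0 : 0 <= Bq g / q by rewrite divr_ge0 ?(q_energy_ge0 st)// ltW.
have h1 : Ss y / s <= (s / (2 * p) * rho + K) / s by rewrite ler_pM2r ?invr_gt0.
have h2 : (s / (2 * p) * rho + K) / s = rho / (2 * p) + K / s by field; rewrite !gt_eqF.
have h3 : rho / (2 * p) = K / s + 2 by rewrite /rho; field; rewrite !gt_eqF.
have h4 : rho / p = 2 * (rho / (2 * p)) by field; rewrite !gt_eqF.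
have h5 : lam * Cc y <= 1.
  apply: (@le_trans _ _ ((W + 1)^-1 * (W + 1))); last by rewrite mulVf ?gt_eqF.
  apply: ler_pM; [exact: ltW|exact: coupling_ge0|exact: ltW|].
  by apply: (le_trans hU); rewrite lerDl.
rewrite h4 h3; rewrite h2 h3 in h1; lra.
Qed.

(** A positive coupling term forces a positive p-energy, so the ray crosses the sphere of radius
    [rho]. *)
Lemma energy_ray rho lam : 0 < rho -> (forall y g, XX y g -> Ap g = rho -> 1 <= E lam y g 1) ->
  forall y g, XX y g -> 0 < Cc y -> exists2 t, 0 < t & 1 <= E lam y g t.
Proof.
move=> rho0 H y g yg C0; have A0 := coupling_p_energy_gt0 st yg C0.
pose t := (rho / Ap g) `^ p^-1; have t0 : 0 < t by rewrite powR_gt0// divr_gt0.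
exists t => //; rewrite -[t]mulr1 -energy_scale//; apply: H; first exact: scale_space.
rewrite (p_energyZ st (ltW t0) (fun i => es_dp st (yg i))) /t -powRrM mulVf ?gt_eqF// powRr1.
  by rewrite divfK ?gt_eqF.
by rewrite divr_ge0// ltW.
Qed.

Lemma energy_ge lam rho y g K C : 0 <= lam -> 0 <= K -> 0 <= C -> XX y g -> Ap g <= rho ->
  (forall y g, XX y g -> Ss y <= 1 * Ap g + K) ->
  (forall y g, XX y g -> Cc y <= C * Ap g `^ (d / p)) ->
  Bq g / q - ((rho + K) / s + lam * (C * rho `^ (d / p))) <= E lam y g 1.
Proof.
move=> lam0 K0 C0 yg Ar hS hC; rewrite /ray_energy (fib1 d lam s01 p1 pq).
have A0 : 0 <= Ap g / p by rewrite divr_ge0 ?p_energy_ge0// ltW.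
have h1 : Ss y / s <= (rho + K) / s.
  by rewrite ler_pM2r ?invr_gt0//; apply: (le_trans (hS y g yg)); rewrite mul1r lerD2r.
have h2 : lam * Cc y <= lam * (C * rho `^ (d / p)).
  apply: ler_wpM2l => //; apply: (le_trans (hC y g yg)); apply: ler_wpM2l => //.
  by apply: powR_homo; [rewrite divr_ge0// ltW|exact: p_energy_ge0|].
lra.
Qed.

Lemma energy_limit lam (u : nat -> 'I_m -> T -> R) (g : nat -> 'I_m -> T -> 'rV[R]_n) v h (al be t c : R) :
  Ap (g j) @[j --> \oo] --> al -> Bq (g j) @[j --> \oo] --> be ->
  Ss (u j) @[j --> \oo] --> Ss v -> Cc (u j) @[j --> \oo] --> Cc v ->
  Ap h <= al -> Bq h <= be -> 0 <= t ->
  (forall j, E lam (u j) (g j) t <= c + j.+1%:R^-1) -> E lam v h t <= c.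
Proof.
move=> cA cB cS cU hA hB t0 le.
apply: (@le_trans _ _ (fib s p q d lam al be (Ss v) (Cc v) t)).
  exact: (fib_mono s d lam (Ss v) (Cc v) t p0 q0 hA hB).
have c1 : fib s p q d lam (Ap (g j)) (Bq (g j)) (Ss (u j)) (Cc (u j)) t @[j --> \oo] -->
    fib s p q d lam al be (Ss v) (Cc v) t.
  exact: (cvg_fib s01 p1 pq qd cA cB cS cU (fun=> t0) (cvg_cst t)).
have c2 : c + j.+1%:R^-1 @[j --> \oo] --> c + 0 by apply: cvgD; [exact: cvg_cst|exact: cvg_harmonic].
rewrite addr0 in c2; apply: (ler_cvg_to c1 c2); apply: nearW => j; exact: le.
Qed.

Lemma perturbed_cvg y g i (h : T -> R) (gh : T -> 'rV[R]_n) (e : nat -> R) : XX y g -> (forall i x, 0 <= y i x) -> X h gh ->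
  (forall j, 0 < e j <= 1) -> e j @[j --> \oo] --> (0 : R) ->
  [/\ Ap (update g i (fun x => g i x + e j *: gh x)) @[j --> \oo] --> Ap g,
    Bq (update g i (fun x => g i x + e j *: gh x)) @[j --> \oo] --> Bq g,
    Ss (update y i (fun x => y i x + e j * h x)) @[j --> \oo] --> Ss y &
    Cc (update y i (fun x => y i x + e j * h x)) @[j --> \oo] --> Cc y].
Proof.
move=> yg y0 hX e01 ce; have e0 j : 0 < e j by case/andP: (e01 j).
have [cA cB _ _] := energy_derivatives st yg y0 i hX e01 ce.
have fromquot (F : nat -> R) (f l : R) : (F j - f) / e j @[j --> \oo] --> l -> F j @[j --> \oo] --> f.
  move=> c; have c' : (F j - f) / e j * e j + f @[j --> \oo] --> l * 0 + f.
    by apply: cvgD; [exact: cvgM|exact: cvg_cst].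
  rewrite mulr0 add0r in c'.
  have EF : (fun j => (F j - f) / e j * e j + f) = F.
    by apply/funext => j; rewrite divfK ?subrK// gt_eqF.
  by rewrite EF in c'.
have hy := Ld yg; have hh := es_Ld st hX.
have mh := es_measurable st hX; have my l := es_measurable st (yg l).
have iG l : mu.-integrable D (EFin \o (fun x => (`|y l x| + `|h x|) `^ d)).
  apply: (powR_integrable_add mD (ltW d0)).
  - exact: (measurableT_comp (@normr_measurable _ _) (my l)).
  - exact: (measurableT_comp (@normr_measurable _ _) mh).
  - by move=> x _; exact: normr_ge0.
  - by move=> x _; exact: normr_ge0.
  - exact: ((LrP _ _ _ _).1 (hy l)).2.
  - exact: ((LrP _ _ _ _).1 hh).2.
have mu' j l : measurable_fun D (update y i (fun x => y i x + e j * h x) l).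
  by apply: (es_measurable st (update_space i yg (es_perturb st yg i (e j) hX) l)).
have dom l : {ae mu, forall z, D z -> update y i (fun x => y i x + e j * h x) l z @[j --> \oo] --> y l z /\
    forall j, `|update y i (fun x => y i x + e j * h x) l z| <= `|y l z| + `|h z|}.
  apply: aeW => z _; rewrite /update; case: eqP => [->|_]; split.
  - rewrite -[X in _ --> X]addr0 -[X in _ --> _ + X](mul0r (h z)).
    by apply: cvgD; [exact: cvg_cst|exact: cvgMl].
  - move=> j; apply: (le_trans (ler_normD _ _)); rewrite lerD2l normrM (gtr0_norm (e0 j)).
    by rewrite ler_piMl//; case/andP: (e01 j).
  - exact: cvg_cst.
  - by move=> j; rewrite lerDl.
have [cS cC] := singular_coupling_cvg st mu' my dom iG.
split; [exact: (fromquot _ _ _ cA)|exact: (fromquot _ _ _ cB)|exact: cS|exact: cC].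
Qed.

Lemma harmonic_bounds j : 0 < (j.+1%:R^-1 : R) <= 1.
Proof. by rewrite invr_gt0 ltr0n invf_le1// ler1n. Qed.

Lemma first_solution rho lam : 0 < rho -> 0 < lam -> (forall y g, XX y g -> Ap g = rho -> 1 <= E lam y g 1) ->
  exists y g, [/\ XX y g, forall i x, 0 <= y i x, path_minimal mu D eta a k p q s d lam X y g & E lam y g 1 < 0].
Proof.
move=> rho0 lam0 H.
have [K K0 hK] := singular_le_p_energy st ltr01; have [C C0 hC] := coupling_le_p_energy st.
pose W := (rho + K) / s + lam * (C * rho `^ (d / p)).
have lower y g : XX y g -> Ap g <= rho -> Bq g / q - W <= E lam y g 1.
  by move=> yg Ag; exact: (energy_ge (ltW lam0) K0 C0 yg Ag hK hC).
pose V : set R := [set c | exists y g, [/\ XX y g, Ap g <= rho & c = E lam y g 1]].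
have [y1 [g1 [yg1 A1 neg]]] : exists y g, [/\ XX y g, Ap g <= rho & E lam y g 1 < 0].
  have [y [g [yg C0']]] := exists_coupling_gt0 st.
  have [t t0 [neg le]] := fib_neg d s01 p1 pq lam0 (p_energy_ge0 mu D p g) (q_energy_ge0 st g)
    (coupling_singular_gt0 st (Ld yg) C0') (coupling_ge0 mu D k y) rho0.
  exists (fun i x => t * y i x), (fun i x => t *: g i x); split; first exact: scale_space.
    by rewrite (p_energyZ st (ltW t0) (fun i => es_dp st (yg i))).
  by rewrite (energy_scale lam yg t0 ler01) mulr1.
have V0 : V !=set0 by exists (E lam y1 g1 1); exists y1, g1.
have lbV : lbound V (- W).
  move=> _ [y [g [yg Ag ->]]]; apply: le_trans (lower y g yg Ag).
  by rewrite lerDr divr_ge0 ?(q_energy_ge0 st)// ltW.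
have hV : has_inf V by split => //; exists (- W).
have infle y g : XX y g -> Ap g <= rho -> inf V <= E lam y g 1.
  by move=> yg Ag; apply: ge_inf; [exists (- W)|exists y, g].
have inf0 : inf V < 0 by apply: le_lt_trans neg; exact: infle.
have near (j : nat) : exists yg : ('I_m -> T -> R) * ('I_m -> T -> 'rV[R]_n),
    [/\ XX yg.1 yg.2, Ap yg.2 <= rho & E lam yg.1 yg.2 1 <= inf V + j.+1%:R^-1].
  have j0 : 0 < j.+1%:R^-1 :> R by rewrite invr_gt0.
  have [_ [y [g [yg Ag ->]]] lt] := inf_adherent j0 hV.
  by exists (y, g); split => //; exact: ltW.
have [f hf] := choice near.
(* The ball bounds only the p-energy; the q-energy is bounded because the energy is at least
   [B / q - W] and its infimum is negative. *)
have BK j : Bq (f j).2 <= q * (1 + W).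
  have [yg Ag le] := hf j; have l1 := lower _ _ yg Ag.
  have j1 : j.+1%:R^-1 <= 1 :> R by case/andP: (harmonic_bounds j).
  exact: (coercive_arith q0 l1 le inf0 j1).
pose K' := Num.max rho (q * (1 + W)).
have fX j i : X ((f j).1 i) ((f j).2 i) by have [yg _ _] := hf j.
have fA j : Ap (f j).2 <= K' by have [_ Ag _] := hf j; exact: le_trans Ag (le_max_left _ _).
have fB j : Bq (f j).2 <= K' by exact: le_trans (BK j) (le_max_right _ _).
have [r [v [h [al [be [rS vh [cA cB] [cS cC] [hA hB]]]]]]] := energy_compactness st fX fA fB.
have Evh : E lam v h 1 <= inf V.
  apply: (energy_limit cA cB cS cC hA hB ler01) => j; have [_ _ le] := hf (r j).
  by apply: (le_trans le); rewrite lerD2l lef_pV2 ?posrE// ler_nat ltnS; exact: extraction_ge.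
have Ah : Ap h <= rho.
  apply: (le_trans hA); apply: (cvgr_to_le cA); apply: nearW => j; by have [] := hf (r j).
have [w' [ww Aw Bw Sw Cw]] := abs_space vh.
pose w := (fun i x => `|v i x|) : 'I_m -> T -> R.
have Ew : E lam w w' 1 <= inf V.
  by apply: le_trans Evh; exact: (energy_mono lam 1 Aw Bw Sw Cw).
have Arho : Ap w' < rho.
  rewrite lt_neqAle (le_trans Aw Ah) andbT; apply/eqP => Er.
  have := H w w' ww Er; apply/negP; rewrite -ltNge; apply: le_lt_trans Ew _; exact: lt_trans ltr01.
have w0 i x : 0 <= w i x by exact: normr_ge0.
exists w, w'; split; [exact: ww|exact: w0| |exact: (le_lt_trans Ew inf0)].
move=> i h' gh hX; have [cA' _ _ _] := perturbed_cvg i ww w0 hX harmonic_bounds cvg_harmonic.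
have gap : 0 < rho - Ap w' by rewrite subr_gt0.
have [N hN] := cvg_upper cA' gap.
(* No rescaling is made here; the indices are shifted by [N] so that the perturbed points stay in
   the ball. *)
exists (fun j => (j + N).+1%:R^-1), (fun=> 1); split.
- by move=> j; exact: harmonic_bounds.
- by rewrite (cvg_shiftn N (fun j => j.+1%:R^-1 : R)); exact: cvg_harmonic.
- by [].
- exact: cvg_cst.
- move=> j; apply: (le_trans Ew); apply: infle.
    exact: (update_space i ww (es_perturb st ww i _ hX)).
  by have := hN _ (leq_addl j N); rewrite addrC subrK.
Qed.

(** Rays are normalized so that their global maximum is at t = 1: a variational selection of points
    of the Nehari set. *)
Definition ray_maximal lam y g :=
  [/\ XX y g, 0 < Cc y & forall t, 0 < t -> E lam y g t <= E lam y g 1].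

Lemma ray_maximizer lam y g : 0 < lam -> (exists2 t, 0 < t & 1 <= E lam y g t) -> XX y g -> 0 < Cc y ->
  exists2 t, 0 < t & ray_maximal lam (fun i x => t * y i x) (fun i x => t *: g i x) /\
    forall x, 0 < x -> E lam y g x <= E lam y g t.
Proof.
move=> lam0 [tau tau0 h1] yg C0.
have [t t0 tmax] := fib_max s01 p1 pq qd lam0 (p_energy_ge0 mu D p g) (q_energy_ge0 st g)
  (singular_ge0 st (Ld yg)) C0 tau0 h1.
exists t; first exact: t0.
split; last exact: tmax.
split; first exact: scale_space.
  by rewrite (couplingZ st t0 (Ld yg)) mulr_gt0 ?powR_gt0.
move=> x x0; rewrite (energy_scale lam yg t0 (ltW x0)) (energy_scale lam yg t0 ler01) mulr1.
by apply: tmax; exact: mulr_gt0.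
Qed.

(** For a perturbation of [y], [tj] is the maximal parameter of its ray. Minimality of [y] among ray
    maxima and maximality at 1 on its own ray give E y tj <= E y 1 <= the perturbed energy at [tj].
    The [tj] stay in a compact interval, and their limit is a maximizer on the ray of [y], hence
    1. *)
Lemma ray_path_minimal lam y g : 0 < lam ->
  (forall y g, XX y g -> 0 < Cc y -> exists2 t, 0 < t & 1 <= E lam y g t) ->
  ray_maximal lam y g -> (forall i x, 0 <= y i x) ->
  (forall y' g', ray_maximal lam y' g' -> E lam y g 1 <= E lam y' g' 1) ->
  path_minimal mu D eta a k p q s d lam X y g.
Proof.
move=> lam0 H max y0 infle; have [yg C0 mx] := max.
have e1 : 1 <= E lam y g 1.
  by have [t t0 h] := H y g yg C0; apply: (le_trans h); exact: mx.
move=> i h' gh hX.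
have [cA' cB' cS' cC'] := perturbed_cvg i yg y0 hX harmonic_bounds cvg_harmonic.
have half := half_lt C0.
have [N1 h1] := cvg_upper cA' ltr01; have [N2 h2] := cvg_upper cB' ltr01.
have [N3 _ h3] : \forall j \near \oo, Cc y / 2 < Cc (update y i (fun x => y i x + j.+1%:R^-1 * h' x)).
  by apply: (cvgr_gt (Cc y) cC'); exact: half.
(* From [N] on, the perturbed gradient terms are bounded and the coupling term is at least half of
   [Cc y], which are the uniform bounds that [fib_bounds] asks for. *)
pose N := maxn N1 (maxn N2 N3); pose e j := (j + N).+1%:R^-1 : R.
pose yj j := update y i (fun x => y i x + e j * h' x); pose gj j := update g i (fun x => g i x + e j *: gh x).
have ygj j : XX (yj j) (gj j) by exact: (update_space i yg (es_perturb st yg i _ hX)).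
have NN j : [/\ N1 <= j + N, N2 <= j + N & N3 <= j + N]%N.
  by split; apply: leq_trans (leq_addl _ _); rewrite !leq_max leqnn ?orbT.
have A1 j : Ap (gj j) <= Ap g + 1 by apply: h1; have [] := NN j.
have B1 j : Bq (gj j) <= Bq g + 1 by apply: h2; have [] := NN j.
have C1 j : Cc y / 2 <= Cc (yj j) by apply/ltW/h3; have [] := NN j.
have C2 : 0 < Cc y / 2 := divr_gt0 C0 (ltr0Sn R 1).
have Cj j : 0 < Cc (yj j) by exact: lt_le_trans (C1 j).
have tex j : exists tj, 0 < tj /\ E lam y g 1 <= E lam (yj j) (gj j) tj.
  have [tj tj0 [mxj _]] := ray_maximizer lam0 (H _ _ (ygj j) (Cj j)) (ygj j) (Cj j).
  by exists tj; split; [exact: tj0|]; have := infle _ _ mxj; rewrite (energy_scale lam (ygj j) tj0 ler01) mulr1.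
have [tj htj] := choice tex.
pose KK := Num.max (Ap g + 1) (Bq g + 1).
have KK0 : 0 <= KK by rewrite le_max addr_ge0 ?p_energy_ge0.
have [t1 [t2 [t10 t12 tb]]] := fib_bounds s01 p1 pq qd lam0 KK0 C2.
have tjb j : t1 <= tj j <= t2.
  apply: (tb (Ap (gj j)) (Bq (gj j)) (Ss (yj j)) (Cc (yj j))).
  - exact: le_trans (A1 j) (le_max_left _ _).
  - exact: le_trans (B1 j) (le_max_right _ _).
  - exact: (singular_ge0 st (Ld (ygj j))).
  - exact: C1.
  - exact: (htj j).1.
  - exact: le_trans e1 (htj j).2.
have tjn j : `|tj j| <= t2 by rewrite gtr0_norm ?(htj j).1//; case/andP: (tjb j).
have [r' [tl [rS' ctl]]] := bolzano_weierstrass tjn.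
have tl0 : 0 < tl.
  by apply: (lt_le_trans t10); apply: (cvgr_to_ge ctl); apply: nearW => j; case/andP: (tjb (r' j)).
have shift (u : nat -> R) (l : R) : u j @[j --> \oo] --> l -> u (r' j + N)%N @[j --> \oo] --> l.
  move=> ul; have ul' : u (j + N)%N @[j --> \oo] --> l by rewrite (cvg_shiftn N u).
  exact: (@cvg_subseq _ (fun j => u (j + N)%N) r' l rS' ul').
have climit : E lam (yj (r' j)) (gj (r' j)) (tj (r' j)) @[j --> \oo] --> E lam y g tl.
  exact: (cvg_fib s01 p1 pq qd (shift _ _ cA') (shift _ _ cB') (shift _ _ cS') (shift _ _ cC')
    (fun j => ltW (htj (r' j)).1) ctl).
(* In the limit the ray of [y] takes at [tl] a value at least as large as its maximum. *)
have tl1 : tl = 1.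
  apply: (fib_unique s01 p1 pq qd (q_energy_ge0 st g) (coupling_singular_gt0 st (Ld yg) C0) mx tl0).
  apply: (cvgr_to_ge climit); apply: nearW => j; exact: (htj _).2.
exists (fun j => e (r' j)), (fun j => tj (r' j)); split.
- by move=> j; exact: harmonic_bounds.
- exact: (shift (fun j => j.+1%:R^-1) 0 cvg_harmonic).
- by move=> j; exact: (htj _).1.
- by rewrite -tl1.
- by move=> j; apply: le_trans (htj (r' j)).2; apply: mx; exact: (htj _).1.
Qed.

Lemma second_solution lam : 0 < lam -> (forall y g, XX y g -> 0 < Cc y -> exists2 t, 0 < t & 1 <= E lam y g t) ->
  exists y g, [/\ XX y g, forall i x, 0 <= y i x, path_minimal mu D eta a k p q s d lam X y g & 0 < E lam y g 1].
Proof.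
move=> lam0 H.
pose V : set R := [set c | exists y g, ray_maximal lam y g /\ c = E lam y g 1].
have ge1 y g : ray_maximal lam y g -> 1 <= E lam y g 1.
  by move=> [yg C0 max]; have [t t0 h] := H y g yg C0; apply: (le_trans h); exact: max.
have V0 : V !=set0.
  have [y [g [yg C0]]] := exists_coupling_gt0 st.
  have [t _ [max _]] := ray_maximizer lam0 (H y g yg C0) yg C0.
  by eexists; do 2 eexists; split; first exact: max.
have lbV : lbound V 1 by move=> _ [y [g [max ->]]]; exact: ge1.
have hV : has_inf V by split => //; exists 1.
have infle y g : ray_maximal lam y g -> inf V <= E lam y g 1.
  by move=> max; apply: ge_inf; [exists 1|exists y, g].
have inf1 : 1 <= inf V by exact: lb_le_inf.
have near (j : nat) : exists yg : ('I_m -> T -> R) * ('I_m -> T -> 'rV[R]_n),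
    ray_maximal lam yg.1 yg.2 /\ E lam yg.1 yg.2 1 <= inf V + j.+1%:R^-1.
  have j0 : 0 < j.+1%:R^-1 :> R by rewrite invr_gt0.
  have [_ [y [g [max ->]]] lt] := inf_adherent j0 hV.
  by exists (y, g); split => //; exact: ltW.
have [f hf] := choice near.
pose th := s * (p^-1 - d^-1) / 2.
have th0 : 0 < th.
  by rewrite divr_gt0// mulr_gt0// subr_gt0 ltf_pV2 ?posrE// (lt_trans pq).
have [K K0 hK] := singular_le_p_energy st th0.
pose c := inf V + 1.
have bounds j : Ap (f j).2 <= 2 * (c + K / s) / (p^-1 - d^-1) /\ Bq (f j).2 <= (c + K / s) / (q^-1 - d^-1).
  have [[yg C0 max] le] := hf j.
  have j1 : j.+1%:R^-1 <= 1 :> R by case/andP: (harmonic_bounds j).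
  have lec : E lam (f j).1 (f j).2 1 <= c by apply: (le_trans le); rewrite lerD2l.
  have crit : Ap (f j).2 + Bq (f j).2 - Ss (f j).1 - lam * (d * Cc (f j).1) = 0.
    exact: (fib_critical s01 p1 pq max).
  exact: (fib_coercive s01 p1 pq qd (p_energy_ge0 mu D p _) (q_energy_ge0 st _) (hK _ _ yg) K0 (erefl th)
    crit (singular_ge0 st (Ld yg)) lec).
pose K' := Num.max (2 * (c + K / s) / (p^-1 - d^-1)) ((c + K / s) / (q^-1 - d^-1)).
have fX j i : X ((f j).1 i) ((f j).2 i) by have [[yg _ _] _] := hf j.
have fA j : Ap (f j).2 <= K' by exact: le_trans (bounds j).1 (le_max_left _ _).
have fB j : Bq (f j).2 <= K' by exact: le_trans (bounds j).2 (le_max_right _ _).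
have [r [v [h [al [be [rS vh [cA cB] [cS cC] [hA hB]]]]]]] := energy_compactness st fX fA fB.
(* Energies at least 1 bound the coupling terms of the minimizing sequence from below, and the
   coupling term passes to the limit. *)
have Cv : 0 < Cc v.
  have h1 : 1 <= lam * (d / p) * Cc v.
    have cc : lam * (d / p) * Cc (f (r j)).1 @[j --> \oo] --> lam * (d / p) * Cc v by exact: cvgMr.
    apply: (cvgr_to_ge cc); apply: nearW => j; have [max le] := hf (r j); have [yg C0 mx] := max.
    exact: (fib_max_large s01 p1 pq lam0 (q_energy_ge0 st _) (singular_ge0 st (Ld yg)) (ltW C0) mx (ge1 _ _ max)).
  have h2 : 0 < lam * (d / p) * Cc v by exact: lt_le_trans h1.
  by rewrite pmulr_rgt0 in h2; [|rewrite mulr_gt0// divr_gt0].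
(* Along the sequence the energy at any fixed [t] is at most the maximum of the ray. The ray of the
   limit may have its maximum elsewhere than at 1, and is therefore rescaled below. *)
have Ev t : 0 < t -> E lam v h t <= inf V.
  move=> t0; apply: (energy_limit cA cB cS cC hA hB (ltW t0)) => j; have [[_ _ max] le] := hf (r j).
  apply: (le_trans (max t t0)); apply: (le_trans le).
  by rewrite lerD2l lef_pV2 ?posrE// ler_nat ltnS; exact: extraction_ge.
have [w' [ww Aw Bw Sw Cw]] := abs_space vh.
pose w := (fun i x => `|v i x|) : 'I_m -> T -> R.
have Cw0 : 0 < Cc w by rewrite Cw.
have [t t0 [max _]] := ray_maximizer lam0 (H w w' ww Cw0) ww Cw0.
set y := (fun i x => t * w i x) in max; set g := (fun i x => t *: w' i x) in max.
have Ey : E lam y g 1 = inf V.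
  apply/eqP; rewrite eq_le (infle y g max) andbT (energy_scale lam ww t0 ler01) mulr1.
  by apply: le_trans (Ev t t0); exact: (energy_mono lam t Aw Bw Sw Cw).
have [yg C0 mx] := max.
have y0 i x : 0 <= y i x by exact: (mulr_ge0 (ltW t0) (normr_ge0 (v i x))).
exists y, g; split; [exact: yg|exact: y0| |by rewrite Ey; exact: (lt_le_trans ltr01 inf1)].
by apply: (ray_path_minimal lam0 H max y0) => y' g' max'; rewrite Ey; exact: infle.
Qed.

End two_solutions.

(** * The Dirichlet problem *)

Lemma subcritical_decay (R : realType) (n : nat) (p d : R) : 0 < p -> p < n%:R ->
  d < n%:R * p / (n%:R - p) -> 0 < @decay R n p d.
Proof.
move=> p0 pn; have np : 0 < n%:R - p by rewrite subr_gt0.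
rewrite ltr_pdivlMr// => h; rewrite /decay.
have -> : d + n%:R - n%:R * d / p = (n%:R * p - d * (n%:R - p)) / p by field; rewrite gt_eqF.
by rewrite divr_gt0// subr_gt0.
Qed.

Lemma bounded_in_cube (R : realType) (n : nat) (Omega : set 'rV[R]_n) (C : R) :
  (forall x, Omega x -> enorm x <= C) -> exists2 L, 0 < L & Omega `<=` cube (const_mx (- L)) (2 * L).
Proof.
move=> h; exists (`|C| + 1); first by rewrite ltr_wpDl.
move=> x Ox i; rewrite !mxE; have := le_trans (coord_le_enorm x i) (h x Ox).
have := ler_norm C; rewrite ler_norml => h1 /andP[h2 h3].
by apply/andP; split; lra.
Qed.

Lemma weak_form_arith (R : comRingType) (I C P Q S l k c : R) : I = P + Q -> C = c ->
  P + Q - l * (k * c) - S = 0 -> I - S - l * k * C = 0.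
Proof. by move=> -> -> <-; ring. Qed.

Section dirichlet_space.
Context {R : realType} {n m : nat}.
Local Notation mu := (@lebesgue_rV R n).
Local Notation cT := (caratheodory_type ((@borel_lebesgue R n)^*)%mu).
Local Notation one := (@unit_weight _ cT R).
Variables (Omega : set 'rV[R]_n) (eta : 'rV[R]_n -> R) (L p q M : R).
Hypotheses (n0 : (0 < n)%N) (O0 : Omega !=set0) (oO : open Omega) (L0 : 0 < L).
Hypothesis OL : Omega `<=` cube (const_mx (- L)) (2 * L).
Hypotheses (p1 : 1 < p) (pq : p < q).
Hypotheses (meta : lebesgue_measurable Omega eta) (eta0 : forall x, Omega x -> 0 <= eta x).
Hypothesis etaM : {ae mu, forall z, Omega z -> `|eta z| <= M}.

Let bO : measurable Omega. Proof. exact: open_measurable_rV. Qed.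
Let mO : measurable (Omega : set cT). Proof. exact: borel_cara. Qed.
Let Ofin : (mu Omega < +oo)%E.
Proof. by rewrite lebesgue_rV_borel//; exact: (measure_bounded_fin bO L0 OL). Qed.

Lemma open_not_negligible : ~ {ae mu, forall x, ~ Omega x}.
Proof.
move=> [A [mA A0 OA]]; have [x Ox] := O0; have [jc [_ box]] := dyadic_box_ball oO Ox.
pose h : R := 2 * 2^-1 ^+ jc.1; have h0 : 0 < h by rewrite mulr_gt0// exprn_gt0// invr_gt0.
pose lo : 'rV[R]_n := \row_i (2^-1 ^+ jc.1 * (jc.2 ord0 i - 1)%:~R).
pose B := hbox lo (\row_i (lo ord0 i + h)).
have sub : B `<=` A.
  move=> y hy; apply: OA => nOy; apply: nOy; apply: box => i; have /andP[y1 /ltW y2] := hy i.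
  rewrite !mxE in y1 y2; rewrite y1; apply: (le_trans y2).
  by rewrite /h le_eqVlt; apply/orP; left; apply/eqP; rewrite !intrD rmorphN/=; ring.
have mB : measurable B by exact: measurable_hbox.
have le : (mu B <= mu A)%E.
  by apply: (le_measure mu _ _ sub); rewrite inE; [exact: (borel_cara mB)|exact: mA].
move: le; rewrite A0 (lebesgue_rV_borel mB) (borel_lebesgue_hbox lo (ltW h0)) lee_fin.
by apply/negP; rewrite -ltNge exprn_gt0.
Qed.

Variables (a : 'I_m -> 'rV[R]_n -> R) (k : 'I_m -> R) (s d Ma : R).
Hypotheses (m0 : (0 < m)%N) (qk : forall i, q < k i) (dE : d = \sum_i k i) (qd : q < d).
Hypotheses (dec0 : 0 < @decay R n p d) (s01 : 0 < s < 1).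
Hypothesis ma : forall i, lebesgue_measurable Omega (a i).
Hypothesis aM : {ae mu, forall x, Omega x -> forall i, `|a i x| <= Ma}.
Hypothesis a0 : {ae mu, forall x, Omega x -> forall i, 0 < a i x}.

Local Notation approx := (@approximable R n Omega eta p q d).

(** Bumps over the dyadic boxes whose closure lies in [Omega], enumerated by their codes; all other
    codes give the zero function. *)
Lemma countable_bumps : exists h : nat -> 'rV[R]_n -> R,
  [/\ forall j, exists g, approx (h j) g, forall j x, 0 <= h j x &
    forall x, Omega x -> exists j, 0 < h j x].
Proof.
pose lo (jc : nat * 'rV[int]_n) : 'rV[R]_n := \row_i (2^-1 ^+ jc.1 * (jc.2 ord0 i - 1)%:~R).
pose hi (jc : nat * 'rV[int]_n) : 'rV[R]_n := \row_i (2^-1 ^+ jc.1 * (jc.2 ord0 i + 1)%:~R).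
pose h (j : nat) : 'rV[R]_n -> R := if unpickle j is Some jc then
  (if `[< closed_box (lo jc) (hi jc) `<=` Omega >] then bump (lo jc) (hi jc) 0 else fun=> 0) else fun=> 0.
exists h; split.
- move=> j; exists (grad (h j)).
  apply: (test_approximable oO L0 OL p1 pq qd meta etaM); rewrite /h.
  case: unpickle => [jc|]; last exact: test_function_cst0.
  case: asboolP => [sub|_]; last exact: test_function_cst0.
  by apply: bump_test => x hx; exact: sub.
- move=> j x; rewrite /h; case: unpickle => [jc|//]; case: ifP => // _.
  by have /andP[] := bump_bounds (lo jc) (hi jc) 0 x.
- move=> x Ox; have [jc [xjc box]] := dyadic_box_ball oO Ox; exists (pickle jc).
  rewrite /h pickleK asboolT; first exact: bump_gt0.
  by move=> y hy; apply: box => i; have := hy i; rewrite !mxE.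
Qed.

Lemma dirichlet_energy_space : @energy_space _ cT R n m mu Omega eta a k p q s d Ma approx.
Proof.
split.
- exact: mO.
- exact: Ofin.
- exact: m0.
- exact: p1.
- exact: pq.
- exact: qk.
- exact: dE.
- exact: qd.
- exact: s01.
- exact: meta.
- exact: eta0.
- exact: ma.
- exact: aM.
- exact: a0.
- by move=> u g [].
- by move=> u g [].
- move=> c u g v h; exact: (approximable_linear oO L0 OL p1 pq qd meta eta0 etaM c).
- move=> u g; exact: (approximable_abs oO L0 OL p1 pq qd meta eta0 etaM).
- exact: (approximable_sobolev n0 oO L0 OL p1 pq qd dec0 meta eta0 etaM).
- move=> u g K; exact: (approximable_compact n0 oO L0 OL p1 pq qd dec0 meta eta0 etaM).
- exact: countable_bumps.
- exact: open_not_negligible.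
Qed.

Let st := dirichlet_energy_space.

Variables (y : 'I_m -> 'rV[R]_n -> R) (g : 'I_m -> 'rV[R]_n -> 'rV[R]_n).
Hypothesis yg : forall i, approx (y i) (g i).

Let q1 : 1 < q. Proof. exact: lt_trans pq. Qed.
Let WE i := (approximable_W01H oO L0 OL p1 pq qd meta eta0 etaM (yg i)).2.
Let WX i := W01H_approximable n0 oO L0 OL p1 pq qd dec0 meta eta0 etaM
  (approximable_W01H oO L0 OL p1 pq qd meta eta0 etaM (yg i)).1.
Let vW i : @vmeasurable _ cT R n Omega (weak_gradient Omega (y i)).
Proof. by have [_ [[]]] := WX i. Qed.
Let gd i : @double_phase _ cT R n mu Omega p q eta (g i). Proof. by have [] := yg i. Qed.

Let mng i r : measurable_fun (Omega : set cT) (fun z : cT => norm_grad Omega (y i) z `^ r).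
Proof. exact: (measurableT_comp (measurable_powR r) (measurable_enorm (vW i))). Qed.

(** [J] is written with the chosen weak gradients and the ray energy with the fields [g]; the two
    agree almost everywhere. *)
Lemma J_energy lam (nu : R) : s = 1 - nu -> (forall i, k i = k i - 1 + 1) ->
  J Omega eta p q nu lam (fun i => k i - 1) a y =
  @ray_energy _ cT R n m mu Omega eta a k p q s d lam y g 1.
Proof.
move=> sE kE; rewrite /ray_energy (fib1 d lam s01 p1 pq) /J; congr (_ - _ - _).
- have term i : \int[mu]_(z in Omega) (p^-1 * norm_grad Omega (y i) z `^ p + eta z / q * norm_grad Omega (y i) z `^ q)
      = p^-1 * @pen _ cT R n mu Omega one p (g i) + q^-1 * @pen _ cT R n mu Omega eta q (g i).
    have [[_ i1] [_ i2]] := gd i.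
    have j1 := integrable_cst_mul mO p^-1 i1; have j2 := integrable_cst_mul mO q^-1 i2.
    rewrite /pen -(RintegralZl _ mO i1) -(RintegralZl _ mO i2) -(RintegralD mO j1 j2).
    apply: (eq_Rintegral_ae mO).
    + exact: (measurable_funD (measurable_funM (measurable_cst _) (mng i p))
        (measurable_funM (measurable_funM meta (measurable_cst _)) (mng i q))).
    + exact: (integrable_fun_measurable (integrable_add mO j1 j2)).
    + apply: ae_mono (WE i) => z E Oz; rewrite /norm_grad (E Oz) /wpow /unit_weight; ring.
  rewrite (eq_bigr _ (fun i _ => term i)) big_split/= -!mulr_sumr.
  by rewrite /p_energy /q_energy !(mulrC _^-1).
- by rewrite sE mulrC.
- congr (_ * _); apply: eq_Rintegral => z _; apply: eq_bigr => i _; by rewrite -kE.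
Qed.

Hypothesis y0 : forall i x, 0 <= y i x.

Lemma path_minimal_solution lam (nu : R) : s = 1 - nu ->
  @path_minimal _ cT R n m mu Omega eta a k p q s d lam approx y g ->
  positive_weak_solution Omega eta p q nu lam (fun i => k i - 1) a y.
Proof.
move=> sE min; split.
- by move=> i; have [] := approximable_W01H oO L0 OL p1 pq qd meta eta0 etaM (yg i).
- by move=> i; exact: (path_minimal_gt0 st yg y0 i min).
move=> h hY.
have hX i := W01H_approximable n0 oO L0 OL p1 pq qd dec0 meta eta0 etaM (hY i).
have EL i := euler_lagrange st yg y0 i min (hX i).
have nuE : - nu = s - 1 by rewrite sE; ring.
split.
  by move=> i; rewrite nuE; have [_ _ i3 _] := EL i.
apply: big1 => i _; have [i1 i2 i3 eq] := EL i.
have vH : @vmeasurable _ cT R n Omega (weak_gradient Omega (h i)) by have [_ [[]]] := hX i.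
have E1 : \int[mu]_(z in Omega) ((norm_grad Omega (y i) z `^ (p - 2) + eta z * norm_grad Omega (y i) z `^ (q - 2)) *
      dotv (weak_gradient Omega (y i) z) (weak_gradient Omega (h i) z)) =
    @p_form _ cT R n m mu Omega p g i (weak_gradient Omega (h i)) +
    @q_form _ cT R n m mu Omega eta q g i (weak_gradient Omega (h i)).
  rewrite /p_form /q_form -(RintegralD mO i1 i2).
  apply: (eq_Rintegral_ae mO).
  - exact: (measurable_funM (measurable_funD (mng i (p - 2)) (measurable_funM meta (mng i (q - 2))))
      (measurable_dotv (vW i) vH)).
  - exact: (integrable_fun_measurable (integrable_add mO i1 i2)).
  - by apply: ae_mono (WE i) => z E Oz; rewrite /norm_grad (E Oz) /unit_weight; ring.
have E3 : \int[mu]_(z in Omega) (`|y i z| `^ (k i - 1) *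
      (\prod_(j < m | j != i) `|y j z| `^ (k j - 1 + 1)) * h i z) =
    @coupling_form _ cT R m mu Omega k y i (h i).
  apply: eq_Rintegral => z _; rewrite (ger0_norm (y0 i z)) /rest.
  by congr (_ * _ * _); apply: eq_bigr => j _; rewrite subrK.
rewrite nuE subrK; apply: weak_form_arith E1 E3 eq.
Qed.

End dirichlet_space.

Theorem theorem3p3 (R : realType) (m n : nat) (Omega : set 'rV[R]_n)
    (p q nu : R) (kappa : 'I_m -> R)
    (eta : 'rV[R]_n -> R) (a : 'I_m -> 'rV[R]_n -> R) :
  let pstar := n%:R * p / (n%:R - p) in
  (2 < m)%N -> (2 <= n)%N ->
  bounded_domain Omega -> lipschitz_boundary Omega ->
  0 < nu < 1 -> 1 < p < n%:R -> p < q ->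
  (forall i, q < kappa i + 1 < pstar) ->
  \sum_(i < m) kappa i + m%:R < pstar ->
  (forall z, closure Omega z -> 0 <= eta z) -> Linfty Omega eta ->
  (forall i, Linfty Omega (a i)) ->
  (forall i, {ae @lebesgue_rV R n, forall z, Omega z -> 0 < a i z}) ->
  exists lambda_star : R, 0 < lambda_star /\
    forall lambda : R, 0 < lambda < lambda_star ->
    exists y_up y_low : 'I_m -> 'rV[R]_n -> R,
      [/\ positive_weak_solution Omega eta p q nu lambda kappa a y_up,
          positive_weak_solution Omega eta p q nu lambda kappa a y_low,
          J Omega eta p q nu lambda kappa a y_up < 0 &
          0 < J Omega eta p q nu lambda kappa a y_low].
Proof.
move=> pstar m2 n2 bd _ /andP[nu0 nu1] /andP[p1 pn] pq kq sk eta0 [meta [M etaM]] aL apos.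
have [ne oO _ [C hC]] := bd.
have n0 : (0 < n)%N by exact: leq_trans n2.
have m0 : (0 < m)%N by exact: leq_trans m2.
have p0 : 0 < p by exact: lt_trans p1.
have q0 : 0 < q by exact: lt_trans pq.
have [L L0 OL] := bounded_in_cube hC.
pose k i := kappa i + 1; have kE : kappa = (fun i => k i - 1) by apply/funext => i; rewrite addrK.
have qk i : q < k i by case/andP: (kq i).
(* The degree of the coupling term; the hypothesis on the sum of the exponents says that it is
   subcritical, which is positivity of [decay]. *)
pose d := \sum_i k i.
have dE : d = \sum_(i < m) kappa i + m%:R by rewrite /d big_split/= sumr_const card_ord.
have qd : q < d.
  apply: (lt_le_trans (qk (Ordinal m0))); rewrite /d (bigD1 (Ordinal m0))//= lerDl sumr_ge0// => i _.
  by rewrite ltW// (lt_trans q0).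
have dec0 : 0 < @decay R n p d by apply: (subcritical_decay p0 pn); rewrite dE.
have s01 : 0 < 1 - nu < 1 by rewrite subr_gt0 nu1 gtrBl nu0.
have eta0' x : Omega x -> 0 <= eta x by move=> Ox; apply: eta0; exact: subset_closure.
have ma i : lebesgue_measurable Omega (a i) by case: (aL i).
have [Ma hMa] := choice (fun i => (aL i).2).
have aM : {ae @lebesgue_rV R n, forall x, Omega x -> forall i, `|a i x| <= \sum_j `|Ma j|}.
  apply: ae_mono (ae_forall_fin hMa) => x h Ox i; apply: (le_trans (h i Ox)).
  by rewrite (bigD1 i)//= (le_trans (ler_norm _))// lerDl sumr_ge0.
have a0 : {ae @lebesgue_rV R n, forall x, Omega x -> forall i, 0 < a i x}.
  by apply: ae_mono (ae_forall_fin apos) => x h Ox i; exact: h.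
have st := dirichlet_energy_space n0 ne oO L0 OL p1 pq meta eta0' etaM m0 qk (erefl d) qd dec0 s01 ma aM a0.
have [rho [l0 [rho0 l00 H]]] := energy_sphere st.
(* The threshold is the one below which the energy is at least 1 on the sphere; both solutions rest
   on this same barrier. *)
exists l0; split; first exact: l00.
move=> lam lam01; have lam0 : 0 < lam by case/andP: lam01.
have [y [g [yg y0 ymin yneg]]] := first_solution st rho0 lam0 (H lam lam01).
have [z [h [zh z0 zmin zpos]]] := second_solution st lam0 (energy_ray st rho0 (H lam lam01)).
exists y, z; rewrite kE; split.
- exact: (path_minimal_solution n0 ne oO L0 OL p1 pq meta eta0' etaM m0 qk (erefl d) qd dec0 s01 ma aM a0
    yg y0 (erefl (1 - nu)) ymin).
- exact: (path_minimal_solution n0 ne oO L0 OL p1 pq meta eta0' etaM m0 qk (erefl d) qd dec0 s01 ma aM a0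
    zh z0 (erefl (1 - nu)) zmin).
- rewrite (J_energy n0 oO L0 OL p1 pq meta eta0' etaM a qd dec0 s01 yg lam (erefl (1 - nu)))//.
  by move=> i; rewrite subrK.
- rewrite (J_energy n0 oO L0 OL p1 pq meta eta0' etaM a qd dec0 s01 zh lam (erefl (1 - nu)))//.
  by move=> i; rewrite subrK.
Qed.
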